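(* Let $(I,\mathbf\Lambda)$ be a Bruhat–Tits index, let $i_1<\dots<i_s$ be the elements of $I$, and let $1\le j\le s-1$. Let $V_1=\pi\Lambda_0^{i_{j+1}}/\pi^2(\Lambda_1^{i_j})^\vee$ and $V_2=\Lambda_1^{i_j}/\pi(\Lambda_0^{i_{j+1}})^\vee$, and write $t(\Lambda_1^{i_j})=2(l_1-1)+(n-h_{i_j+1})+1$ and $t(\Lambda_0^{i_{j+1}})=2(l_0-1)+h_{i_{j+1}}+1$ with $l_0,l_1\ge1$, so that $d=\dim V_1=\dim V_2=(l_0+l_1-1)+\frac{h_{i_{j+1}}-h_{i_j+1}}2$. Let $X_{\mathbf\Lambda_j}^{\mathbf h_j}=\overline{X_J\{(s_{l_1}s_{l_1+1}\cdots s_{d-1},\,s_{l_0}s_{l_0+1}\cdots s_{d-1})\}}$, where $J=J_1\sqcup J_2$ is the set of simple reflections defined in the context and the closure is taken inside the flag variety of type $J$. Then the variety $X_{\mathbf\Lambda_j}^{\mathbf h_j}$ is projective, smooth and geometrically irreducible of dimension $l_0+l_1+(h_{i_{j+1}}-h_{i_j+1})-2$.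
   Context: Lattices. $p$ is an odd prime, $F/\mathbb Q_p$ a finite extension with uniformizer $\pi$ and residue field of order $q$, $E/F$ the unramified quadratic extension with non-trivial automorphism $x\mapsto x^*$, $n\ge1$, $m\ge1$, and $\mathbf h=(h_1<\dots<h_m)$ are integers in $[0,n]$ of the same parity. Let $\mathbb X$ be a supersingular strict formal $\mathcal O_F$-module over $\mathbb F_{q^2}$ (a formal $p$-divisible group with an $\mathcal O_F$-action inducing the natural one on its Lie algebra) of relative height $2n$, with a compatible $\mathcal O_E$-action such that $x\in\mathcal O_E$ has characteristic polynomial $(T-x)(T-x^* )^{n-1}$ on $\mathrm{Lie}(\mathbb X)$, and an $\mathcal O_E$-linear polarization whose kernel lies in $\mathbb X[\pi]$ and has order $q^{2h_1}$. Let $\mathbb N$ be its rational relative Dieudonné module, with Frobenius $\mathcal F$, Verschiebung $\mathcal V$, alternating form $\langle\cdot,\cdot\rangle$ given by the polarization, and $\mathbb Z/2$-grading $\mathbb N=\mathbb N_0\oplus\mathbb N_1$ given by $\mathcal O_E$. Let $W=W_{\mathcal O_F}(\mathbb F_{q^2})$ (relative Witt vectors), with fraction field $\simeq E$. Over an algebraically closed field $k\supset\overline{\mathbb F}_q$ put $\tau=\pi\mathcal V^{-2}$ and $C=\mathbb N_{k,0}^{\tau}$ (independent of $k$), an $n$-dimensional $\mathrm{Frac}(W)$-vector space with non-degenerate hermitian form $\{v,w\}=\delta\langle v,\mathcal Fw\rangle$, $\delta\in W^\times$ fixed with $\delta^\sigma=-\delta$, where $\sigma$ is the non-trivial automorphism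 of $\mathrm{Frac}(W)/F$. For a $W$-lattice $\Lambda\subset C$, $\Lambda^\vee$ is its dual for $\{\cdot,\cdot\}$. For $i=0,1$, $\mathcal L_i$ is the set of lattices with $\pi^{i+1}\Lambda^\vee\subset\Lambda\subset\pi^i\Lambda^\vee$ (vertex lattices), of type $t(\Lambda)=[\Lambda:\pi^{i+1}\Lambda^\vee]$ (length of the quotient), and $\mathcal L_i^{\ge x}$ is the subset with $t(\Lambda)\ge x$. Bruhat–Tits index. A pair $(I,\mathbf\Lambda)$ where $I\subset\{0,\dots,m\}$ is non-empty, $0\notin I$ if $h_1=0$, $m\notin I$ if $h_m=n$, and $\mathbf\Lambda$ consists of $\Lambda_0^i\in\mathcal L_0^{\ge h_i+1}$ for $i\in I\setminus\{0\}$ and $\Lambda_1^a\in\mathcal L_1^{\ge n-h_{a+1}+1}$ for $a\in I\setminus\{m\}$, such that, $i_1<\dots<i_s$ being the elements of $I$, $\Lambda_0^i\subset\pi\Lambda_1^{i\vee}$ for $i\in I\setminus\{0,m\}$ and $\pi\Lambda_1^{i_a\vee}\subset\Lambda_0^{i_{a+1}}$ for $1\le a\le s-1$. For $1\le j\le s-1$ put $\mathbf\Lambda_j=\{\Lambda_1^{i_j},\Lambda_0^{i_{j+1}}\}$ and $\mathbf h_j=(h_{i_j+1},\dots,h_{i_{j+1}})$. Deligne–Lusztig varieties. For a vector space $V$ over a field $k\supset\mathbb F_q$, $V^{(q)}=V\otimes_{k,x\mapsto x^q}k$, and $f^{(q)}$ is the map induced by $f$. The space $\Lambda_1^{i_j}/\pi^2(\Lambda_1^{i_j})^\vee$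 carries the non-degenerate $\mathbb F_{q^2}/\mathbb F_q$-hermitian form induced by $\pi^{-1}\{\cdot,\cdot\}$; $V_1$ is a subspace and $V_2$ a quotient of it, and the form induces a perfect bilinear pairing $B:V_1\times V_2^{(q)}\to\mathbb F_{q^2}$. $\mathbf G=\mathrm{GL}(V_{1,\overline{\mathbb F}_q})\times\mathrm{GL}(V_{2,\overline{\mathbb F}_q})$ has the Frobenius $\Phi(u,v)=((v^{-1})^{(q),*},(u^{-1})^{*,(q)})$, $*$ being the adjoint for $B$; $\mathbf G^\Phi\simeq\mathrm{GL}(V_1)$. A complete flag $\mathcal F^1$ of $V_1$ and the flag $(\mathcal F^1)^{\perp,(q)}$ of $V_2$ define a $\Phi$-stable Borel subgroup $\mathbf B$ containing a $\Phi$-stable maximal torus. The Weyl group is $\mathbf W=S_d\times S_d$ with simple reflections $(s_i,\mathrm{id}),(\mathrm{id},s_i)$, $s_i=(i\ \ i+1)$, $1\le i\le d-1$, and $\Phi(w_1,w_2)=(w_0w_2w_0,w_0w_1w_0)$, $w_0(i)=d+1-i$. For $J=J_1\sqcup J_2$ a set of simple reflections in the two factors, $\mathbf P_J\supset\mathbf B$ is the standard parabolic subgroup, and $\mathbf G/\mathbf P_J$ (the flag variety of type $J$) parametrizes pairs of partial flags of $V_1$, $V_2$ whose proper non-zero members have dimensions $\{x:s_x\notin J_1\}$, $\{x:s_x\notin J_2\}$; $\mathbf W_J$ is generated by $J$ and ${}^J\mathbf W$ is the set of $w$ with $\ell(vw)=\ell(v)+\ell(w)$ for all $v\in\mathbf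 W_J$. For $w\in{}^J\mathbf W$ the fine Deligne–Lusztig variety is $X_J\{w\}=\{g\mathbf P_J:g^{-1}\Phi(g)\in\mathbf P_J\cdot_\Phi\mathbf Bw\mathbf B\}$, with $x\cdot_\Phi y=xy\Phi(x)^{-1}$; equivalently the image in $\mathbf G/\mathbf P_J$ of $\{g\mathbf B:g^{-1}\Phi(g)\in\mathbf Bw\mathbf B\}$. Empty products are the identity. The set $J$. It corresponds to pairs of flags $W_1\subset\dots\subset W_{i_{j+1}-i_j}\subset V_1$ and $U_{i_{j+1}-i_j}\subset\dots\subset U_1\subset V_2$ with $\dim W_i=l_1+\frac{h_{i_j+i}-h_{i_j+1}}2$ and $\dim U_i=l_0+\frac{h_{i_{j+1}}-h_{i_j+i}}2$ for $1\le i\le i_{j+1}-i_j$; i.e. $J_1$ (resp. $J_2$) is $\{s_1,\dots,s_{d-1}\}$ minus the $s_x$ with $x\le d-1$ equal to one of the numbers $\dim W_i$ (resp. $\dim U_i$). *)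

(* Defs.v *)
From HB Require Import structures.
From mathcomp Require Import all_boot all_order all_algebra all_fingroup all_field.
From mathcomp Require Import mpoly.

Set Implicit Arguments.
Unset Strict Implicit.
Unset Printing Implicit Defensive.

Import Order.TTheory GRing.Theory Num.Theory.
Local Open Scope ring_scope.

(* [v] is a normalized discrete valuation; the value of [v] at 0 is irrelevant. *)
Record discrete_valuation (K : fieldType) (v : K -> int) : Prop := {
  dv_mul : forall x y, x != 0 -> y != 0 -> v (x * y) = v x + v y;
  dv_add : forall x y, x != 0 -> y != 0 -> x + y != 0 ->
    Order.min (v x) (v y) <= v (x + y);
  dv_norm : exists x, x != 0 /\ v x = 1 }.

Definition val_ge (K : fieldType) (v : K -> int) (m : int) (x : K) : bool :=
  (x == 0) || (m <= v x).

Definition integral (K : fieldType) (v : K -> int) (x : K) : bool :=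
  val_ge v 0 x.

Definition val_complete (K : fieldType) (v : K -> int) : Prop :=
  forall u : nat -> K,
    (forall m : int, exists n0, forall i j, (n0 <= i)%N -> (n0 <= j)%N ->
       val_ge v m (u i - u j)) ->
    exists l, forall m : int, exists n0, forall i, (n0 <= i)%N ->
       val_ge v m (u i - l).

(* [k] is the residue field, [r] the reduction map; [r] is only meaningful on
   the valuation ring. *)
Record residue_map (K : fieldType) (v : K -> int) (k : fieldType) (r : K -> k)
    : Prop := {
  rm_one : r 1 = 1;
  rm_add : forall x y, integral v x -> integral v y -> r (x + y) = r x + r y;
  rm_mul : forall x y, integral v x -> integral v y -> r (x * y) = r x * r y;
  rm_surj : forall a, exists2 x, integral v x & r x = a;
  rm_ker : forall x, integral v x -> (r x == 0) = val_ge v 1 x }.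

(* The completion of [rat] for the p-adic valuation. *)
Record is_Qp (p : nat) (Q : fieldType) (v : Q -> int) : Prop := {
  qp_dv : discrete_valuation v;
  qp_p_neq0 : p%:R != 0 :> Q;
  qp_val_p : v p%:R = 1;
  qp_complete : val_complete v;
  qp_dense : forall (x : Q) (m : int), exists r : rat, val_ge v m (x - ratr r) }.

(* A finite extension of Q_p is complete for its (unique) valuation. *)
Record finite_ext_Qp (Q : fieldType) (vQ : Q -> int) (F : fieldExtType Q)
    (vF : F -> int) (kF : finFieldType) (rF : F -> kF) (pi : F) : Prop := {
  fe_dv : discrete_valuation vF;
  fe_over : forall x : Q, integral vQ x -> integral vF (x%:A);
  fe_residue : residue_map vF rF;
  fe_pi_neq0 : pi != 0;
  fe_pi : vF pi = 1 }.

Record unramified_quadratic (F : fieldType) (vF : F -> int)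
    (E : fieldExtType F) (vE : E -> int) (kE : finFieldType) (rE : E -> kE)
    (conj : {rmorphism E -> E}) : Prop := {
  uq_dim : \dim {:E} = 2;
  uq_dv : discrete_valuation vE;
  uq_unramified : forall a : F, a != 0 -> vE a%:A = vF a;
  uq_residue : residue_map vE rE;
  uq_conj_fix : forall a : F, conj a%:A = a%:A;
  uq_conj_neq : exists x, conj x != x }.

(* [K] is the fraction field of the ring of relative Witt vectors of the
   algebraically closed field [k] : the complete discretely valued extension of
   [E] of ramification index 1 with residue field [k], equipped with the lift
   [sigma] of the [q]-power Frobenius. The fraction field of the relative Witt
   vectors of the residue field of [E] is [E] itself, where [sigma] is [conj]. *)
Record witt_field (q : nat) (E : fieldType) (vE : E -> int) (conj : E -> E)
    (K : fieldType) (vK : K -> int) (k : closedFieldType) (rK : K -> k)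
    (emb : {rmorphism E -> K}) (sigma : {rmorphism K -> K}) : Prop := {
  wf_dv : discrete_valuation vK;
  wf_complete : val_complete vK;
  wf_residue : residue_map vK rK;
  wf_iota : forall a, a != 0 -> vK (emb a) = vE a;
  wf_sigma_bij : bijective sigma;
  wf_sigma_val : forall x, x != 0 -> vK (sigma x) = vK x;
  wf_sigma_iota : forall a, sigma (emb a) = emb (conj a);
  wf_sigma_frob : forall x, integral vK x -> rK (sigma x) = rK x ^+ q }.

Section Lattices.
Variables (E : fieldType) (v : E -> int) (C : vectType E).
Implicit Types L M : C -> Prop.

Definition incl L M : Prop := forall x, L x -> M x.

Definition same L M : Prop := forall x, L x <-> M x.

Definition submodule L : Prop :=
  [/\ L 0, (forall x y, L x -> L y -> L (x + y)) &
      (forall a x, integral v a -> L x -> L (a *: x))].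

Definition lattice L : Prop :=
  exists2 b : (\dim {:C}).-tuple C, basis_of fullv b &
    forall x, L x <-> forall i, integral v (coord b i x).

Definition scale (c : E) L : C -> Prop := fun x => exists2 y, L y & x = c *: y.

Definition dual (form : C -> C -> E) L : C -> Prop :=
  fun x => forall y, L y -> integral v (form x y).

(* [L / M] has a composition series of length [t]. *)
Definition quot_length M L (t : nat) : Prop :=
  exists c : nat -> C -> Prop,
    [/\ same (c 0) M, same (c t) L, (forall i, (i <= t)%N -> submodule (c i)) &
        forall i, (i < t)%N ->
          [/\ incl (c i) (c i.+1), ~ incl (c i.+1) (c i) &
              forall P, submodule P -> incl (c i) P -> incl P (c i.+1) ->
                same P (c i) \/ same P (c i.+1)]].

(* [rho], restricted to [L], identifies [L / M] with the coordinate space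
   k^d over the residue field; in particular [L / M] has dimension [d]. *)
Record quot_map (k : fieldType) (r : E -> k) (d : nat) M L
    (rho : C -> 'cV[k]_d) : Prop := {
  qm_incl : incl M L;
  qm_add : forall x y, L x -> L y -> rho (x + y) = rho x + rho y;
  qm_scale : forall a x, integral v a -> L x -> rho (a *: x) = r a *: rho x;
  qm_surj : forall y, exists2 x, L x & rho x = y;
  qm_ker : forall x, L x -> (rho x = 0 <-> M x) }.

Record hermitian_form (conj : E -> E) (form : C -> C -> E) : Prop := {
  hf_linear : forall a x y z, form (a *: x + y) z = a * form x z + form y z;
  hf_conj : forall x y, form y x = conj (form x y);
  hf_nondeg : forall x, (forall y, form x y = 0) -> x = 0 }.

Definition vertex_lattice (form : C -> C -> E) (pi : E) (i : nat) L : Prop :=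
  [/\ lattice L, incl (scale (pi ^+ i.+1) (dual form L)) L &
      incl L (scale (pi ^+ i) (dual form L))].

Definition vertex_type (form : C -> C -> E) (pi : E) (i : nat) L (t : nat) :=
  quot_length (scale (pi ^+ i.+1) (dual form L)) L t.

Definition vertex_lattice_ge (form : C -> C -> E) (pi : E) (i x : nat) L :=
  vertex_lattice form pi i L /\
  exists2 t, vertex_type form pi i L t & (x <= t)%N.

End Lattices.

(* [N] is the rational Dieudonne module (over the fraction field E of the
   relative Witt vectors of the field with q^2 elements), [act] the action of E
   induced by the O_E-action; scalar multiplication of [N] and [act] are
   different structures, which agree on F.  [M] is the Dieudonne module of the
   formal module, covariantly normalized: Lie = M / VM. *)
Record unitary_dieudonne (n h1 : nat) (F : fieldType) (E : fieldExtType F)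
    (vE : E -> int) (kE : finFieldType) (rE : E -> kE)
    (conj : {rmorphism E -> E}) (pi : F)
    (N : vectType E) (Fr Ve : N -> N) (act : E -> N -> N) (pairing : N -> N -> E)
    (M : N -> Prop) : Prop := {
  ud_dim : \dim {:N} = (2 * n)%N;
  ud_Fr : forall a x y, Fr (a *: x + y) = conj a *: Fr x + Fr y;
  ud_Ve : forall a x y, Ve (conj a *: x + y) = a *: Ve x + Ve y;
  ud_FrVe : forall x, Fr (Ve x) = pi%:A *: x;
  ud_VeFr : forall x, Ve (Fr x) = pi%:A *: x;
  ud_act_linear : forall c a x y, act c (a *: x + y) = a *: act c x + act c y;
  ud_actD : forall c c' x, act (c + c') x = act c x + act c' x;
  ud_actM : forall c c' x, act (c * c') x = act c (act c' x);
  ud_actF : forall (c : F) x, act c%:A x = c%:A *: x;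
  ud_actFr : forall c x, act c (Fr x) = Fr (act c x);
  ud_actVe : forall c x, act c (Ve x) = Ve (act c x);
  ud_pairing_linear : forall a x y z,
    pairing (a *: x + y) z = a * pairing x z + pairing y z;
  ud_pairing_alt : forall x, pairing x x = 0;
  ud_pairing_nondeg : forall x, (forall y, pairing x y = 0) -> x = 0;
  ud_pairingFr : forall x y, pairing (Fr x) y = conj (pairing x (Ve y));
  ud_pairing_act : forall c x y, pairing (act c x) y = pairing x (act (conj c) y);
  ud_lattice : lattice vE M;
  ud_stableFr : forall x, M x -> M (Fr x);
  ud_stableVe : forall x, M x -> M (Ve x);
  ud_stable_act : forall c x, integral vE c -> M x -> M (act c x);
  ud_signature : exists2 lie : N -> 'cV[kE]_n,
    quot_map vE rE (fun x => exists2 y, M y & x = Ve y) M lie &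
    forall c, integral vE c -> exists2 A : 'M[kE]_n,
      forall x, M x -> lie (act c x) = A *m lie x &
      char_poly A = ('X - (rE c)%:P) * ('X - (rE (conj c))%:P) ^+ n.-1;
  (* the kernel of the polarization is the quotient of the dual of M by M *)
  ud_kernel_pi : forall x, dual vE pairing M x -> M (pi%:A *: x);
  ud_kernel_order : quot_length vE M (dual vE pairing M) (2 * h1);
  (* isoclinic of slope 1/2 *)
  ud_supersingular : exists2 L, lattice vE L &
    same (fun x => exists2 y, L y & x = Ve (Ve y)) (scale pi%:A L) }.

(* [Nk] is the base change of [N] along [emb]. *)
Record isocrystal_base_change (E : fieldType) (N : vectType E) (Fr Ve : N -> N)
    (pairing : N -> N -> E) (K : fieldType) (emb : {rmorphism E -> K})
    (sigma : {rmorphism K -> K}) (Nk : vectType K) (bc : N -> Nk)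
    (Frk Vek : Nk -> Nk) (pairingk : Nk -> Nk -> K) : Prop := {
  bc_linear : forall a x y, bc (a *: x + y) = emb a *: bc x + bc y;
  bc_basis : basis_of fullv (map bc (vbasis {:N}));
  bc_Fr_semilinear : forall a x y, Frk (a *: x + y) = sigma a *: Frk x + Frk y;
  bc_Ve_semilinear : forall a x y, Vek (sigma a *: x + y) = a *: Vek x + Vek y;
  bc_Fr : forall x, Frk (bc x) = bc (Fr x);
  bc_Ve : forall x, Vek (bc x) = bc (Ve x);
  bc_pairing_linearl : forall a x y z,
    pairingk (a *: x + y) z = a * pairingk x z + pairingk y z;
  bc_pairing_linearr : forall a x y z,
    pairingk z (a *: x + y) = a * pairingk z x + pairingk z y;
  bc_pairing : forall x y, pairingk (bc x) (bc y) = emb (pairing x y) }.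

(* The graded piece of index 0 of the base change: the span of the vectors of
   [N] on which [act] coincides with scalar multiplication. *)
Definition graded0 (E : fieldType) (N : vectType E) (act : E -> N -> N)
    (K : fieldType) (Nk : vectType K) (bc : N -> Nk) (x : Nk) : Prop :=
  exists2 s : seq N, (forall y, y \in s -> forall c, act c y = c *: y) &
    x \in <<map bc s>>%VS.

(* [jC] identifies [C] with the fixed points of tau = pi V^-2 in degree 0;
   x is fixed by tau if and only if V (V x) = pi x. *)
Record tau_invariants (E : fieldType) (pi delta : E)
    (N : vectType E) (act : E -> N -> N) (K : fieldType)
    (emb : {rmorphism E -> K}) (Nk : vectType K) (bc : N -> Nk)
    (Frk Vek : Nk -> Nk) (pairingk : Nk -> Nk -> K)
    (C : vectType E) (jC : C -> Nk) (form : C -> C -> E) : Prop := {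
  ti_linear : forall a x y, jC (a *: x + y) = emb a *: jC x + jC y;
  ti_inj : injective jC;
  ti_image : forall x, (exists y, jC y = x) <->
    graded0 act bc x /\ Vek (Vek x) = emb pi *: x;
  ti_form : forall x y,
    emb (form x y) = emb delta * pairingk (jC x) (Frk (jC y)) }.

(* The sequence of integers h 1 < ... < h m; other values of [h] are irrelevant. *)
Record parahoric_datum (n m : nat) (h : nat -> nat) : Prop := {
  pd_lt : forall a b, (1 <= a)%N -> (a < b)%N -> (b <= m)%N -> (h a < h b)%N;
  pd_le : forall a, (1 <= a <= m)%N -> (h a <= n)%N;
  pd_parity : forall a b, (1 <= a <= m)%N -> (1 <= b <= m)%N ->
    odd (h a) = odd (h b) }.

(* [ith I a] is the a-th element i_a of [I] in increasing order, a >= 1. *)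
Definition ith (m : nat) (I : {set 'I_m.+1}) (a : nat) : nat :=
  nth 0%N [seq val i | i <- enum I] a.-1.

Record bruhat_tits_index (E : fieldType) (v : E -> int) (C : vectType E)
    (form : C -> C -> E) (pi : E) (n m : nat) (h : nat -> nat)
    (I : {set 'I_m.+1}) (L0 L1 : nat -> C -> Prop) : Prop := {
  bt_neq0 : I != set0;
  bt_0 : h 1%N = 0%N -> ord0 \notin I;
  bt_m : h m = n -> ord_max \notin I;
  bt_L0 : forall i : 'I_m.+1, i \in I -> i != 0%N :> nat ->
    vertex_lattice_ge v form pi 0 (h i).+1 (L0 i);
  bt_L1 : forall a : 'I_m.+1, a \in I -> a != m :> nat ->
    vertex_lattice_ge v form pi 1 (n - h a.+1).+1 (L1 a);
  bt_incl01 : forall i : 'I_m.+1, i \in I -> i != 0%N :> nat -> i != m :> nat ->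
    incl (L0 i) (scale pi (dual v form (L1 i)));
  bt_incl10 : forall a, (1 <= a <= #|I|.-1)%N ->
    incl (scale pi (dual v form (L1 (ith I a)))) (L0 (ith I a.+1)) }.

(* A subset of the projective space of dimension N - 1 is given by the set of
   the non-zero vectors of the lines which belong to it; varieties are reduced.
   As [k] is algebraically closed, irreducibility is geometric irreducibility, and a
   variety is projective if it is closed in the projective space. *)
Section Projective.
Variables (k : closedFieldType) (N : nat).
Implicit Types (Z Y A B : 'rV[k]_N -> Prop) (z t : 'rV[k]_N) (f : {mpoly k[N]}).

Definition zero_at f z : Prop := f.@[z ord0] = 0.

Definition homogeneous f : Prop := exists e : nat, f \is e.-homog.

Definition subset Z Y : Prop := forall z, Z z -> Y z.

Definition proj_closed Z : Prop :=
  exists2 S : {mpoly k[N]} -> Prop, (forall f, S f -> homogeneous f) &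
    forall z, Z z <-> z != 0 /\ forall f, S f -> zero_at f z.

Definition vanishes_on Z f : Prop :=
  homogeneous f /\ forall z, Z z -> zero_at f z.

Definition proj_closure Z z : Prop :=
  z != 0 /\ forall f, vanishes_on Z f -> zero_at f z.

Definition proj_irreducible Z : Prop :=
  (exists z, Z z) /\
  forall A B, proj_closed A -> proj_closed B ->
    (forall z, Z z -> A z \/ B z) -> subset Z A \/ subset Z B.

Definition closed_in Z Y : Prop :=
  exists2 A, proj_closed A & forall z, Y z <-> Z z /\ A z.

Definition closed_chain Z (r : nat) (c : nat -> 'rV[k]_N -> Prop) : Prop :=
  (forall i, (i <= r)%N -> closed_in Z (c i) /\ proj_irreducible (c i)) /\
  (forall i, (i < r)%N -> subset (c i) (c i.+1) /\ ~ subset (c i.+1) (c i)).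

Definition krull_dim Z (r : nat) : Prop :=
  (exists c, closed_chain Z r c) /\
  forall r' c, closed_chain Z r' c -> (r' <= r)%N.

Definition local_dim Z z (r : nat) : Prop :=
  (exists2 c, closed_chain Z r c & c 0%N z) /\
  forall r' c, closed_chain Z r' c -> c 0%N z -> (r' <= r)%N.

(* The tangent space at [z] of the affine cone over [Z]; its dimension is one
   more than that of the tangent space of [Z]. *)
Definition cone_tangent Z z t : Prop :=
  forall f, vanishes_on Z f -> \sum_(i < N) t ord0 i * (f^`M(i)).@[z ord0] = 0.

(* Smoothness by the Jacobian criterion. *)
Definition proj_smooth Z : Prop :=
  forall z, Z z -> exists r, local_dim Z z r /\
    exists2 T : 'M[k]_N, \rank T = r.+1 &
      forall t, (t <= T)%MS <-> cone_tangent Z z t.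

End Projective.

(* The simple reflection s_x = (x  x+1) of S_d, 0 < x < d; in 'I_d = {0,..,d-1}
   it exchanges x-1 and x. *)
Definition simple_refl (d : nat) (x : 'I_d) : 'S_d := tperm (ord_pred x) x.

(* s_l s_{l+1} ... s_{d-1}, for l >= 1.  As [perm_mx] is multiplicative, the
   order of the factors is that of the product in the Weyl group of GL_d. *)
Definition coxeter_word (d l : nat) : 'S_d :=
  (\prod_(x < d | (l <= x)%N) simple_refl x)%g.

(* A set J of simple reflections of S_d is given by the set of the x with
   s_x in J. *)
Definition flag_dims (d : nat) (J : {set 'I_d}) : {set 'I_d} :=
  [set x : 'I_d | (0 < x)%N && (x \notin J)].

Section DeligneLusztig.
Variables (k : closedFieldType) (q d : nat).

(* GL(V_1) x GL(V_2) acts on column vectors, in coordinates for which V_1 and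
   V_2 are defined over the field with q^2 elements; so V^(q^2) = V.  The pairing
   B : V_1 x V_2^(q) -> k is (x, y) |-> x^T *m S *m y, and a complete flag is
   given by an invertible matrix, its member of dimension x being the span of
   the first x columns: [b.1] gives F^1, [b.2] the flag of V_2. *)
Variables (S : 'M[k]_d) (b : 'M[k]_d * 'M[k]_d).
Implicit Types (g u : 'M[k]_d * 'M[k]_d) (J w : {set 'I_d} * {set 'I_d}).

Definition inG g : Prop := g.1 \in unitmx /\ g.2 \in unitmx.

Definition frob (A : 'M[k]_d) : 'M[k]_d := map_mx (fun a => a ^+ q) A.

(* The adjoints for B of endomorphisms of V_1 and of V_2^(q). *)
Definition adj1 (A : 'M[k]_d) : 'M[k]_d := invmx S *m A^T *m S.
Definition adj2 (A : 'M[k]_d) : 'M[k]_d := invmx S^T *m A^T *m S^T.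

Definition Phi g : 'M[k]_d * 'M[k]_d :=
  (adj2 (frob (invmx g.2)), frob (adj1 (invmx g.1))).

Definition mulG g u : 'M[k]_d * 'M[k]_d := (g.1 *m u.1, g.2 *m u.2).
Definition invG g : 'M[k]_d * 'M[k]_d := (invmx g.1, invmx g.2).

Definition stab_std_flag (J : {set 'I_d}) (A : 'M[k]_d) : Prop :=
  A \in unitmx /\
  forall (x : 'I_d) (i j : 'I_d), x \in flag_dims J -> (j < x <= i)%N -> A i j = 0.

Definition parabolic J g : Prop :=
  stab_std_flag J.1 (invmx b.1 *m g.1 *m b.1) /\
  stab_std_flag J.2 (invmx b.2 *m g.2 *m b.2).

Definition borel g : Prop := parabolic (set0, set0) g.

Definition weyl_rep (w : 'S_d * 'S_d) : 'M[k]_d * 'M[k]_d :=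
  (b.1 *m perm_mx w.1 *m invmx b.1, b.2 *m perm_mx w.2 *m invmx b.2).

Definition bruhat_cell (w : 'S_d * 'S_d) g : Prop :=
  exists u u', [/\ borel u, borel u' & g = mulG (mulG u (weyl_rep w)) u'].

(* Pluecker coordinates of the member of dimension [x] of the flag of a matrix;
   the rows are chosen by arbitrary maps, so that coordinates occur with
   repetition up to sign. *)
Definition plucker (A : 'M[k]_d) (x : 'I_d) (c : {ffun 'I_x -> 'I_d}) : k :=
  \det (mxsub c (widen_ord (ltnW (ltn_ord x))) A).

Definition plucker_index (J : {set 'I_d}) : finType :=
  {dffun forall x : {x : 'I_d | x \in flag_dims J}, {ffun 'I_(sval x) -> 'I_d}}.

Definition flag_index J : finType :=
  (plucker_index J.1 * plucker_index J.2)%type.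

Definition plucker_prod (J : {set 'I_d}) (A : 'M[k]_d) (c : plucker_index J) : k :=
  \prod_(x : {x : 'I_d | x \in flag_dims J}) plucker A (c x).

(* The image of g P_J by the Pluecker and Segre embeddings. *)
Definition flag_point J g : 'rV[k]_#|flag_index J| :=
  \row_i (plucker_prod (g.1 *m b.1) (enum_val i).1 *
          plucker_prod (g.2 *m b.2) (enum_val i).2).

Definition flag_variety J (z : 'rV[k]_#|flag_index J|) : Prop :=
  exists (c : k) g, [/\ c != 0, inG g & z = c *: flag_point J g].

Definition fine_DL J (w : 'S_d * 'S_d) (z : 'rV[k]_#|flag_index J|) : Prop :=
  exists (c : k) g x y,
    [/\ c != 0, inG g, z = c *: flag_point J g,
        parabolic J x /\ bruhat_cell w y &
        mulG (invG g) (Phi g) = mulG (mulG x y) (invG (Phi x))].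

Definition fine_DL_closure J (w : 'S_d * 'S_d) (z : 'rV[k]_#|flag_index J|)
    : Prop :=
  flag_variety z /\ proj_closure (fine_DL w) z.

End DeligneLusztig.

(* The set of the x with s_x outside of the given dimensions of flag members. *)
Definition refl_avoiding (d : nat) (dims : seq nat) : {set 'I_d} :=
  [set x : 'I_d | (0 < x)%N && (val x \notin dims)].

(* A complete flag of V_1 = k1^d (frame [b1]) and the flag (F^1)^{perp,(q)} of V_2
   (frame [b2]), for k1 the field with q^2 elements.  As y = (y^(q))^(q) for y
   rational over k1, the span of the first c columns of [b2] is ((F^1_{d-c})^perp)^(q)
   if and only if the first d-c columns of [b1] are B-orthogonal to the (q)-twists
   of the first c columns of [b2]. *)
Record adapted_frames (k1 : finFieldType) (q d : nat) (S b1 b2 : 'M[k1]_d)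
    : Prop := {
  af_unit1 : b1 \in unitmx;
  af_unit2 : b2 \in unitmx;
  af_orth : forall a c : 'I_d, (a + c + 2 <= d)%N ->
    (b1^T *m S *m map_mx (fun x => x ^+ q) b2) a c = 0 }.

(* Main.v *)
Require Import Defs.
From HB Require Import structures.
From mathcomp Require Import all_boot all_order all_algebra all_fingroup all_field.
From mathcomp Require Import mpoly boolp.
From mathcomp Require Import zify ring.

Set Implicit Arguments.
Unset Strict Implicit.
Unset Printing Implicit Defensive.

Import Order.TTheory GRing.Theory.
Local Open Scope ring_scope.

(* A pair of flags is given by a pair of frames (h_1, h_2); the form attaches to h_2 a
   frame C(h_2) of the orthogonal of the twisted second flag, and similarly for h_1.
   The points of the closure X of X_J{w} are those for which the matrices
   N_1 = h_1^-1 C(h_2) and N_2 = h_2^-1 C(h_1) send the first x - 1 basis vectors into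
   the span of the first x, for every dimension x of a flag member.  This closed
   condition holds on X_J{w} because the Bruhat cell of w consists of Hessenberg
   matrices.  Conversely, a solution lying in no rational hyperplane is determined by a
   cyclic vector x for the q^2-Frobenius and by non-zero scalars b_i, and all points of
   this kind belong to X_J{w}; any solution deforms over power series to one in general
   position, so polynomials vanishing on X_J{w} vanish at it.

   The parametrization by (x, b) proves irreducibility and bounds the dimension from
   above.  Since Frobenius has derivative zero, linearizing the condition at any
   point asks that nu N_s has the shape of N_s, for nu in the tangent space of the flag
   variety; the dimension of this space of nu does not depend on the point, and
   Newton's method integrates each of its vectors to a formal germ contained in X.
   These germs give a chain of irreducible closed subsets of maximal length.

   The quotients of lattices are compared through their lengths: with t_0, t_1 the types,
   the chain pi L0^v < L1 < pi L1^v < L0 and the duality between its two ends yield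
   2 d = t_0 + t_1 - n. *)

(** * Power series in one variable *)

(** The obstacle is density: no equations of the closure are given beforehand, and the Bruhat cell
    sees only part of the solutions of the closed condition. Schemes are replaced by points with
    coordinates in a domain over [k]: a polynomial that is nonzero at such a point is nonzero at
    some [k]-point satisfying the same relations. Power series rings are iterated one variable at a
    time, so each coordinate of a germ moves independently and has its own derivation. Two kinds of
    germs are used. In one, the entries of [N_s] are free and the frames follow by solving
    [H N = C(H)]; it reaches general position because derivations see [N_s] but not the twisted
    factor. In the other, the frames stay normalized, one for each flag, and exactly the tangent
    coordinates move; it measures dimension. Over a cyclic vector the flag members are Krylov
    spaces, related by twisted polynomials; the scalars [b_i] are the coefficients of linear factors
    of these polynomials. The dimension appears twice: as [(d - 1) + H], from the line of [x] and
    the [H] scalars, [H] being the half difference of the extreme [h], and as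
    [(d - l_1) + (d - l_0)], from the tangent spaces. *)

Definition pser (R : Type) := nat -> R.

Section PowerSeries.
Variable R : idomainType.
Implicit Types f g h : pser R.

HB.instance Definition _ := gen_eqMixin (pser R).
HB.instance Definition _ := gen_choiceMixin (pser R).

Definition ps_trunc m f : {poly R} := \poly_(i < m) f i.
Definition ps_add f g : pser R := fun i => f i + g i.
Definition ps_opp f : pser R := fun i => - f i.
(** The coefficient is read in a product of truncations, so that the ring laws come from
    polynomials. *)
Definition ps_mul f g : pser R := fun n => (ps_trunc n.+1 f * ps_trunc n.+1 g)`_n.
Definition ps_const (a : R) : pser R := fun i => if i == 0%N then a else 0.

Lemma ps_addA : associative ps_add.
Proof. by move=> f g h; apply: funext => i; apply: addrA. Qed.
Lemma ps_addC : commutative ps_add.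
Proof. by move=> f g; apply: funext => i; apply: addrC. Qed.
Lemma ps_add0 : left_id (fun=> 0) ps_add.
Proof. by move=> f; apply: funext => i; apply: add0r. Qed.
Lemma ps_addN : left_inverse (fun=> 0) ps_opp ps_add.
Proof. by move=> f; apply: funext => i; apply: addNr. Qed.
HB.instance Definition _ :=
  GRing.isZmodule.Build (pser R) ps_addA ps_addC ps_add0 ps_addN.

Lemma ps_mulE f g n : ps_mul f g n = \sum_(i < n.+1) f i * g (n - i)%N.
Proof.
rewrite /ps_mul coefM; apply: eq_bigr => i _.
by rewrite !coef_poly ltn_ord ltnS leq_subr.
Qed.

Lemma ps_mul_trunc f g n m : (n < m)%N ->
  ps_mul f g n = (ps_trunc m f * ps_trunc m g)`_n.
Proof.
move=> nm; rewrite ps_mulE coefM; apply: eq_bigr => i _.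
by rewrite !coef_poly (leq_ltn_trans _ nm) ?(leq_ltn_trans (leq_subr _ _) nm) // -ltnS.
Qed.

Lemma ps_mulA : associative ps_mul.
Proof.
move=> f g h; apply: funext => n.
have E a b : (ps_trunc n.+1 (ps_mul a b) = take_poly n.+1 (ps_trunc n.+1 a * ps_trunc n.+1 b))%R.
  apply/polyP => i; rewrite coef_poly coef_take_poly; case: ifP => // iN.
  exact: ps_mul_trunc.
have K (p q : {poly R}) : (p * take_poly n.+1 q)`_n = (p * q)`_n.
  rewrite !coefM; apply: eq_bigr => i _.
  by rewrite coef_take_poly ltnS leq_subr.
rewrite ![ps_mul _ _ n]/ps_mul E K E [in RHS]mulrC K.
by rewrite [in RHS]mulrC mulrA.
Qed.
Lemma ps_mulC : commutative ps_mul.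
Proof. by move=> f g; apply: funext => n; rewrite /ps_mul mulrC. Qed.
Lemma ps_mul1 : left_id (ps_const 1) ps_mul.
Proof.
move=> f; apply: funext => n; rewrite ps_mulE big_ord_recl /= mul1r subn0.
by rewrite big1 ?addr0 // => i _; rewrite mul0r.
Qed.
Lemma ps_mulDl : left_distributive ps_mul ps_add.
Proof.
move=> f g h; apply: funext => n; rewrite /ps_add !ps_mulE -big_split.
by apply: eq_bigr => i _; rewrite mulrDl.
Qed.
Lemma ps_1neq0 : ps_const 1 != 0 :> pser R.
Proof. by apply/eqP => /(congr1 (fun f : pser R => f 0%N))/eqP; apply/negP/oner_neq0. Qed.
HB.instance Definition _ :=
  GRing.Zmodule_isComNzRing.Build (pser R) ps_mulA ps_mulC ps_mul1 ps_mulDl ps_1neq0.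

Lemma psD f g n : (f + g) n = f n + g n. Proof. by []. Qed.
Lemma psN f n : (- f) n = - f n. Proof. by []. Qed.
Lemma psM f g n : (f * g) n = \sum_(i < n.+1) f i * g (n - i)%N.
Proof. exact: ps_mulE. Qed.

Definition ps_eqm m f g : Prop := forall i, (i < m)%N -> f i = g i.

Lemma ps_eqm_refl m f : ps_eqm m f f. Proof. by []. Qed.
Lemma ps_eqmD m f g f' g' : ps_eqm m f f' -> ps_eqm m g g' -> ps_eqm m (f + g) (f' + g').
Proof. by move=> a b i im; rewrite !psD a ?b. Qed.
Lemma ps_eqmN m f f' : ps_eqm m f f' -> ps_eqm m (- f) (- f').
Proof. by move=> a i im; rewrite !psN a. Qed.
Lemma ps_eqmM m f g f' g' : ps_eqm m f f' -> ps_eqm m g g' -> ps_eqm m (f * g) (f' * g').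
Proof.
move=> a b i im; rewrite !psM; apply: eq_bigr => j _.
by rewrite a ?b // (leq_ltn_trans _ im) ?leq_subr // -ltnS.
Qed.
Lemma ps_eqm_mul m n f g : ps_eqm m f 0 -> ps_eqm n g 0 -> ps_eqm (m + n) (f * g) 0.
Proof.
move=> a b i im; rewrite psM big1 // => j _.
have [jm|jm] := ltnP j m; first by rewrite (a _ jm) mul0r.
have ji := ltn_ord j; rewrite [g _](b) ?mulr0 //; lia.
Qed.
Lemma ps_eqm_sym m f g : ps_eqm m f g -> ps_eqm m g f.
Proof. by move=> a i im; rewrite a. Qed.
Lemma ps_eqm_trans m f g h : ps_eqm m f g -> ps_eqm m g h -> ps_eqm m f h.
Proof. by move=> a b i im; rewrite a ?b. Qed.
Lemma ps_eqm_le m n f g : (m <= n)%N -> ps_eqm n f g -> ps_eqm m f g.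
Proof. by move=> mn a i im; rewrite a // (leq_trans im mn). Qed.

(* limit of a sequence in which the [n]-th term is correct modulo X^n *)
Definition ps_lim (s : nat -> pser R) : pser R := fun n => s n.+1 n.
Lemma ps_limP (s : nat -> pser R) : (forall n, ps_eqm n (s n.+1) (s n)) ->
  forall n, ps_eqm n (ps_lim s) (s n).
Proof.
move=> H n i; rewrite /ps_lim; elim: n => // n IH.
by rewrite ltnS leq_eqVlt => /orP[/eqP->//|lt]; rewrite IH // H.
Qed.

Lemma ps_eqP f g : (forall n, ps_eqm n f g) -> f = g.
Proof. by move=> H; apply: funext => i; apply: (H i.+1). Qed.

Lemma ps_const_is_zmod : zmod_morphism ps_const.
Proof.
move=> a b; apply: funext => i; rewrite psD psN /ps_const.
by case: ifP; rewrite ?subr0.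
Qed.
Lemma ps_const_is_monoid : monoid_morphism ps_const.
Proof.
split=> // a b; apply: funext => i; rewrite psM big_ord_recl subn0 /ps_const /=.
rewrite big1 ?addr0 => [|j _]; last by rewrite mul0r.
by case: ifP; rewrite ?mulr0.
Qed.
HB.instance Definition _ := GRing.isZmodMorphism.Build R (pser R) ps_const ps_const_is_zmod.
HB.instance Definition _ := GRing.isMonoidMorphism.Build R (pser R) ps_const ps_const_is_monoid.

Definition ps_coef0 f : R := f 0%N.
Lemma ps_coef0_is_zmod : zmod_morphism ps_coef0. Proof. by []. Qed.
Lemma ps_coef0_is_monoid : monoid_morphism ps_coef0.
Proof. by split=> // f g; rewrite /ps_coef0 psM big_ord1. Qed.
HB.instance Definition _ := GRing.isZmodMorphism.Build (pser R) R ps_coef0 ps_coef0_is_zmod.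
HB.instance Definition _ := GRing.isMonoidMorphism.Build (pser R) R ps_coef0 ps_coef0_is_monoid.

Lemma ps_constK a : ps_coef0 (ps_const a) = a. Proof. by []. Qed.
Lemma ps_constM a f n : (ps_const a * f) n = a * f n.
Proof.
rewrite psM big_ord_recl subn0 /ps_const /= big1 ?addr0 // => j _.
by rewrite mul0r.
Qed.

Definition ps_var : pser R := fun i => (i == 1%N)%:R.

Definition ps_unit_pred : {pred pser R} := fun f => `[< exists g, g * f = 1 >].
Definition ps_inv f : pser R :=
  match pselect (exists g, g * f = 1) with
  | left e => projT1 (cid e) | right _ => f end.
Lemma ps_mulV : {in ps_unit_pred, left_inverse 1 ps_inv *%R}.
Proof.
move=> f /asboolP fu; rewrite /ps_inv; case: pselect => // e.
by case: (cid e).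
Qed.
Lemma ps_unitP f g : g * f = 1 -> f \in ps_unit_pred.
Proof. by move=> e; apply/asboolP; exists g. Qed.
Lemma ps_inv0id : {in [predC ps_unit_pred], ps_inv =1 id}.
Proof.
move=> f; rewrite inE /= => /asboolPn fu; rewrite /ps_inv; by case: pselect.
Qed.
HB.instance Definition _ :=
  GRing.ComNzRing_hasMulInverse.Build (pser R) ps_mulV ps_unitP ps_inv0id.

Lemma ps_mul_eq0 f g : f * g = 0 -> (f == 0) || (g == 0).
Proof.
move=> fg0; apply/orP; case: (pselect (exists n, f n != 0)) => [fn|fn]; last first.
  left; apply/eqP/funext => i; apply/eqP/negPn/negP => ni; by apply: fn; exists i.
case: (pselect (exists n, g n != 0)) => [gn|gn]; last first.
  right; apply/eqP/funext => i; apply/eqP/negPn/negP => ni; by apply: gn; exists i.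
exfalso; case: (ex_minnP fn) => a fa mina; case: (ex_minnP gn) => b gb minb.
have := congr1 (fun f : pser R => f (a + b)%N) fg0; rewrite psM.
have la : (a < (a + b).+1)%N by rewrite ltnS leq_addr.
rewrite (bigD1 (Ordinal la)) //= big1 => [|j /eqP ja]; last have jl := ltn_ord j.
  by rewrite addr0 addKn => /eqP; rewrite mulf_eq0 (negPf fa) (negPf gb).
have [lt|ge] := ltnP j a.
  have -> : f j = 0 by apply/eqP/negPn/negP => /mina; lia.
  by rewrite mul0r.
have {}ge : (a < j)%N by rewrite ltn_neqAle ge andbT; apply/eqP => E; apply: ja; apply: val_inj.
have -> : g (a + b - j)%N = 0 by apply/eqP/negPn/negP => /minb; lia.
by rewrite mulr0.
Qed.
HB.instance Definition _ := GRing.ComUnitRing_isIntegral.Build (pser R) ps_mul_eq0.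

(** Geometric series in [u], the defect of [f] from 1 after normalizing its constant term. *)
Lemma ps_unit f : f 0%N \is a GRing.unit -> f \is a GRing.unit.
Proof.
move=> fu; pose u : pser R := 1 - ps_const (f 0%N)^-1 * f.
have u0 : ps_eqm 1 u 0.
  by case=> // _; rewrite /u psD psN ps_constM mulVr // subrr.
have uX n : ps_eqm n (u ^+ n) 0.
  elim: n => // n IH; rewrite exprS -add1n; exact: ps_eqm_mul.
pose s n := \sum_(i < n) u ^+ i.
have sP n : ps_eqm n (s n.+1) (s n).
  rewrite /s big_ord_recr /= -[X in ps_eqm _ _ X]addr0; exact: ps_eqmD.
have E : (1 - u) * ps_lim s = 1.
  apply: ps_eqP => n; apply: (@ps_eqm_trans _ _ ((1 - u) * s n)).
    apply: ps_eqmM => //; exact: ps_limP.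
  rewrite /s -opprB mulNr -subrX1 opprB -[X in ps_eqm _ _ X]subr0.
  by apply: ps_eqmD => //; apply: ps_eqmN.
apply/unitrP; exists (ps_const (f 0%N)^-1 * ps_lim s).
have E' : ps_const (f 0%N)^-1 * ps_lim s * f = 1.
  by rewrite -[RHS]E /u opprB addrC subrK; ring.
by split=> //; rewrite mulrC.
Qed.

End PowerSeries.

(** A derivation along [phi]. With [phi] a morphism to [k] this is a tangent vector at the point
    [phi]; with [phi] the identity it is a vector field. *)
Definition dlin (A B : nzRingType) (phi D : A -> B) : Prop :=
  (forall x y, D (x + y) = D x + D y) /\ (forall x y, D (x * y) = phi x * D y + D x * phi y).

Section Derivations.
Variable R : idomainType.

(** The derivation of the new variable and, next, the extension of a derivation of the coefficients:
    together they give all partial derivatives over iterated power series. *)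
Definition ps_deriv (f : pser R) : pser R := fun i => f i.+1 *+ i.+1.
Definition ps_map (D : R -> R) (f : pser R) : pser R := fun i => D (f i).

Lemma ps_deriv_dlin : dlin id ps_deriv.
Proof.
split=> f g; apply: funext => n; first by rewrite psD /ps_deriv psD mulrnDl.
rewrite psD !psM /ps_deriv psM.
have -> : \sum_(i < n.+1) f i * (g (n - i).+1 *+ (n - i).+1)
    = \sum_(i < n.+2) (f i * g (n.+1 - i)%N) *+ (n.+1 - i).
  rewrite [RHS]big_ord_recr /= subnn mulr0n addr0; apply: eq_bigr => i _.
  by rewrite subSn -1?ltnS // mulrnAr.
have -> : \sum_(i < n.+1) (f i.+1 *+ i.+1) * g (n - i)%N
    = \sum_(i < n.+2) (f i * g (n.+1 - i)%N) *+ i.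
  rewrite [RHS]big_ord_recl /= mulr0n add0r; apply: eq_bigr => i _.
  by rewrite subSS mulrnAl.
rewrite -big_split -sumrMnl; apply: eq_bigr => i _ /=.
by rewrite -mulrnDr subnK // -ltnS.
Qed.

Lemma ps_map_dlin D : dlin id D -> dlin id (ps_map D).
Proof.
move=> [DD DM]; have D0 : D 0 = 0 by apply: (addrI (D 0)); rewrite -DD !addr0.
split=> f g; apply: funext => n; first by rewrite /ps_map psD DD.
rewrite psD /ps_map !psM (big_morph D DD D0) -big_split.
by apply: eq_bigr => i _; rewrite DM.
Qed.

End Derivations.

(** * Points with values in a domain *)

Section Nullstellensatz.
Variables (k : closedFieldType) (R : idomainType).

Lemma rmorph_mmap (K : nzRingType) n (A B : comNzRingType) (f : K -> A) (phi : {rmorphism A -> B})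
  (h : 'I_n -> A) (F : {mpoly K[n]}) :
  phi (mmap f h F) = mmap (phi \o f) (phi \o h) F.
Proof.
rewrite /mmap rmorph_sum; apply: eq_bigr => m _; rewrite rmorphM /mmap1 rmorph_prod.
by congr (_ * _); apply: eq_bigr => i _; rewrite rmorphXn.
Qed.

Lemma eq_mmap (K A : nzRingType) n (f f' : K -> A) (h h' : 'I_n -> A) (F : {mpoly K[n]}) :
  f =1 f' -> h =1 h' -> mmap f h F = mmap f' h' F.
Proof.
move=> ff hh; rewrite /mmap; apply: eq_bigr => m _.
by rewrite ff (mmap1_eq _ hh).
Qed.

(* every value of [e] which is not zero survives under a [k]-point of [B] that respects
   the kernel of [e] *)
Definition specializes (B : comNzRingType) (iB : k -> B) (e : B -> R) : Prop :=
  forall b, e b != 0 -> exists phi : {rmorphism B -> k},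
    [/\ forall c, phi (iB c) = c, phi b != 0 & forall b', e b' = 0 -> phi b' = 0].

Section Step.
Variables (B : comNzRingType) (iB : k -> B) (e : {rmorphism B -> R}) (x : R).
Hypothesis spec : specializes iB e.

Let ev (p : {poly B}) : R := (map_poly e p).[x].
Let evD p q : ev (p + q) = ev p + ev q. Proof. by rewrite /ev rmorphD hornerD. Qed.
Let evM p q : ev (p * q) = ev p * ev q. Proof. by rewrite /ev rmorphM hornerM. Qed.
Let evC c : ev c%:P = e c. Proof. by rewrite /ev map_polyC hornerC. Qed.

Lemma map_poly_eq0P (S : nzRingType) (f : {rmorphism B -> S}) (p : {poly B}) :
  map_poly f p = 0 <-> forall i, f p`_i = 0.
Proof.
split=> [E i|H]; first by rewrite -coef_map E coef0.
by apply/polyP => i; rewrite coef_map coef0; apply: H.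
Qed.

(** Case of a transcendental [x]: a point of [B] keeps one coefficient of [b] nonzero, and ['X] can
    then go to any non-root of the reduced polynomial. *)
Lemma specializes_poly_trans (b : {poly B}) : ev b != 0 ->
  (forall G, ev G = 0 -> map_poly e G = 0) ->
  exists phi : {rmorphism {poly B} -> k},
    [/\ forall c, phi (iB c)%:P = c, phi b != 0 & forall b', ev b' = 0 -> phi b' = 0].
Proof.
move=> b0 tr.
have /existsNP[i ei] : ~ forall i, e b`_i = 0.
  by move/map_poly_eq0P => E; move: b0; rewrite /ev E horner0 eqxx.
have [phi [phiC phib phi0]] := spec (introN eqP ei).
have nz : map_poly phi b != 0.
  apply/eqP => /map_poly_eq0P/(_ i) E; by rewrite E eqxx in phib.
have [y yr] := closed_nonrootP _ nz.
exists (horner_morph (fun c => mulrC y (phi c))); split=> [c||b' /tr].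
- by rewrite /= /horner_morph map_polyC hornerC /= phiC.
- exact: yr.
- move/map_poly_eq0P => E; have E' : map_poly phi b' = 0 by apply/map_poly_eq0P => j; apply: phi0.
  by rewrite /= /horner_morph E' horner0.
Qed.

(** Case of an algebraic [x]: a minimal equation [G] and [b] are combined into a constant [c0] by
    pseudo-division. A point that keeps [c0] and the leading coefficient of [G] nonzero extends by a
    root of [G], where [b] cannot vanish. As [e] is not injective, all identities hold up to
    polynomials [Z] with coefficients in its kernel. *)
Lemma specializes_poly_alg (b G : {poly B}) : ev b != 0 -> ev G = 0 ->
  map_poly e G != 0 ->
  exists phi : {rmorphism {poly B} -> k},
    [/\ forall c, phi (iB c)%:P = c, phi b != 0 & forall b', ev b' = 0 -> phi b' = 0].
Proof.
move=> b0 evG0 eG0.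
(* The coefficients above the degree of the image lie in the kernel of [e]; once they are dropped,
   [e] does not kill the leading coefficient. *)
have trunc (p : {poly B}) : exists p', map_poly e p' = map_poly e p /\
    size p' = size (map_poly e p).
  exists (take_poly (size (map_poly e p)) p).
  have E : map_poly e (take_poly (size (map_poly e p)) p) = map_poly e p.
    apply/polyP => i; rewrite !coef_map coef_take_poly; case: ltnP => // si.
    by rewrite raddf0 -coef_map nth_default.
  split=> //; apply/eqP; rewrite eqn_leq size_take_poly -{1}E.
  exact: size_poly.
pose PG n := `[< exists G, [/\ map_poly e G != 0, ev G = 0 & size (map_poly e G) = n] >].
have exG : exists n, PG n by exists (size (map_poly e G)); apply/asboolP; exists G.
case: (ex_minnP exG) => n /asboolP[{evG0 eG0}G0 [nzG evG0 sG]] minG.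
have [{}G [EG szG]] := trunc G0.
have {nzG} nzG : map_poly e G != 0 by rewrite EG.
have {evG0} evG : ev G = 0 by rewrite /ev EG.
have {sG szG EG G0} szG : size G = n by rewrite szG.
have seG (p : {poly B}) : (size (map_poly e p) <= size p)%N by apply: size_poly.
have minG0 p : ev p = 0 -> (size p < n)%N -> map_poly e p = 0.
  move=> evp sp; apply/eqP/negPn/negP => nz.
  have : PG (size (map_poly e p)) by apply/asboolP; exists p.
  by move/minG => np; have := leq_ltn_trans np (leq_ltn_trans (seG p) sp); rewrite ltnn.
have n_le : (n <= size (map_poly e G))%N by apply: minG; apply/asboolP; exists G.
have szeG : size (map_poly e G) = n by apply/eqP; rewrite eqn_leq n_le andbT -szG seG.
have nzG' : G != 0 by apply: contra nzG => /eqP->; rewrite rmorph0.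
have lG : e (lead_coef G) != 0.
  by rewrite /lead_coef -coef_map szG -{1}szeG -lead_coefE lead_coef_eq0.
(* Sizes of the elements of the ideal generated by [b], [G] and the kernel of [e] that do not vanish
   at [x]. *)
pose PP m := `[< exists P U V Z, [/\ P = U * b + V * G + Z, map_poly e Z = 0,
   ev P != 0 & size (map_poly e P) = m] >].
have exP : exists m, PP m.
  exists (size (map_poly e b)); apply/asboolP; exists b, 1, 0, 0.
  by rewrite mul1r mul0r !addr0 rmorph0.
case: (ex_minnP exP) => m /asboolP[P0 [U [V [Z [EP0 Z0 evP0 sP0]]]]] minP.
have [P [EP szP]] := trunc P0.
have evP : ev P != 0 by rewrite /ev EP.
have nzP : map_poly e P != 0 by apply/eqP => E; move: evP; rewrite /ev E horner0 eqxx.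
have {sP0} szP : size P = m by rewrite szP.
have szeP : size (map_poly e P) = m.
  apply/eqP; rewrite eqn_leq -{1}szP seG /= minP //; apply/asboolP.
  by exists P0, U, V, Z; split; rewrite ?EP.
pose Z' := Z + (P - P0).
have EP' : P = U * b + V * G + Z' by rewrite /Z' addrA -EP0 addrC subrK.
have {Z0} Z0 : map_poly e Z' = 0 by rewrite rmorphD rmorphB /= Z0 EP subrr addr0.
move: Z' EP' Z0 => {EP0 EP P0 evP0} {}Z EP Z0.
have nzP' : P != 0 by apply: contra nzP => /eqP->; rewrite rmorph0.
have lP : e (lead_coef P) != 0.
  by rewrite /lead_coef -coef_map szP -{1}szeP -lead_coefE lead_coef_eq0.
have minP0 U' V' Z' P' : P' = U' * b + V' * G + Z' -> map_poly e Z' = 0 ->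
    (size P' < m)%N -> ev P' = 0.
  move=> E' Z'0 lt; apply/eqP/negPn/negP => nz.
  have : PP (size (map_poly e P')) by apply/asboolP; exists P', U', V', Z'.
  by move/minP => mp; have := leq_ltn_trans mp (leq_ltn_trans (seG P') lt); rewrite ltnn.
have lt_mn : (m < n)%N.
  rewrite ltnNge; apply/negP => nm.
  have E := Pdiv.ComRing.rdivp_eq G P.
  have := Pdiv.CommonRing.ltn_rmodpN0 P nzG'; rewrite szG => lt.
  set c := _ ^+ _ in E; set qq := Pdiv.CommonRing.rdivp _ _ in E.
  have EM : Pdiv.CommonRing.rmodp P G = (c *: U) * b + (c *: V - qq) * G + c *: Z.
    have -> : Pdiv.CommonRing.rmodp P G = c *: P - qq * G by rewrite E addrC addKr.
    by rewrite EP -!mul_polyC; ring.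
  have Z'0 : map_poly e (c *: Z) = 0 by rewrite map_polyZ Z0 scaler0.
  have := minP0 _ _ _ _ EM Z'0 (leq_trans lt nm).
  have : ev (c *: P) = ev (Pdiv.CommonRing.rmodp P G) by rewrite E evD evM evG mulr0 add0r.
  move=> <- /eqP; rewrite -mul_polyC evM evC mulf_eq0 (negPf evP) orbF.
  by rewrite rmorphXn expf_eq0 (negPf lG) andbF.
(* Otherwise, dividing [G] by [P] leaves a remainder killed by [e], and the quotient is an equation
   of [x] of smaller degree than [G]. *)
have m1 : m = 1%N.
  case: m => [|[//|m]] in minP szP szeP minP0 lt_mn *.
    by move/eqP: szP; rewrite size_poly_eq0 (negPf nzP').
  exfalso.
  have E := Pdiv.ComRing.rdivp_eq P G.
  have := Pdiv.CommonRing.ltn_rmodpN0 G nzP'; rewrite szP => lt.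
  set c := _ ^+ _ in E; set qq := Pdiv.CommonRing.rdivp _ _ in E.
  have ec : e c != 0 by rewrite rmorphXn expf_neq0.
  have EM : Pdiv.CommonRing.rmodp G P = (- qq * U) * b + (c%:P - qq * V) * G + (- qq * Z).
    have -> : Pdiv.CommonRing.rmodp G P = c *: G - qq * P by rewrite E addrC addKr.
    by rewrite EP -mul_polyC; ring.
  have Z'0 : map_poly e (- qq * Z) = 0 by rewrite rmorphM /= Z0 mulr0.
  have r0 := minP0 _ _ _ _ EM Z'0 lt.
  have eR : map_poly e (Pdiv.CommonRing.rmodp G P) = 0 by apply: minG0 => //; apply: ltn_trans lt lt_mn.
  have q0 : ev qq = 0.
    have : ev (c *: G) = ev qq * ev P by rewrite E evD evM r0 addr0.
    rewrite -mul_polyC evM evG mulr0 => /esym/eqP.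
    by rewrite mulf_eq0 (negPf evP) orbF => /eqP.
  have : map_poly e (c *: G) = map_poly e qq * map_poly e P.
    by rewrite E rmorphD rmorphM /= eR addr0.
  have [q'|nzq] := eqVneq (map_poly e qq) 0.
    rewrite q' mul0r map_polyZ => /eqP; rewrite -mul_polyC mulf_eq0 polyC_eq0.
    by rewrite (negPf ec) (negPf nzG).
  move=> E2; have := congr1 (fun p : {poly R} => size p) E2.
  rewrite /= map_polyZ size_scale // szeG size_mul // szeP.
  have : (n <= size (map_poly e qq))%N by apply: minG; apply/asboolP; exists qq.
  clear; lia.
have [c0 EPc] : exists c0, P = c0%:P.
  by exists P`_0; apply: size1_polyC; rewrite szP m1.
have c0nz : e c0 != 0 by rewrite -evC -EPc.
have [phi [phiC phib phi0]] : exists phi : {rmorphism B -> k},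
    [/\ forall c, phi (iB c) = c, phi (c0 * lead_coef G) != 0 & forall b', e b' = 0 -> phi b' = 0].
  by apply: spec; rewrite rmorphM mulf_neq0.
move: phib; rewrite rmorphM mulf_eq0 negb_or => /andP[phic0 philG].
have map0 p : map_poly e p = 0 -> map_poly phi p = 0.
  by move/map_poly_eq0P => E; apply/map_poly_eq0P => j; apply: phi0.
have n2 : (1 < n)%N by rewrite -m1.
have spG : size (map_poly phi G) = n.
  apply/eqP; rewrite eqn_leq; apply/andP; split; first by rewrite -szG; apply: size_poly.
  rewrite leqNgt; apply/negP => lt; move: philG; rewrite /lead_coef -coef_map szG.
  by rewrite nth_default ?eqxx //; case: (n) lt n2.
have /closed_rootP[y yr] : size (map_poly phi G) != 1%N by rewrite spG; case: (n) n2 => [|[]].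
pose psi : {rmorphism {poly B} -> k} := horner_morph (fun c => mulrC y (phi c)).
have psiG : psi G = 0 by apply/eqP.
have psi0 p : map_poly e p = 0 -> psi p = 0.
  by move=> /map0 E; rewrite /psi /= /horner_morph E horner0.
have psiC c : psi c%:P = phi c by rewrite /psi /= /horner_morph map_polyC hornerC.
exists psi; split=> [c||b' evb'].
- by rewrite [LHS]psiC.
- have : psi P != 0 by rewrite EPc psiC.
  rewrite EP !rmorphD !rmorphM /= psiG mulr0 addr0 (psi0 _ Z0) addr0 mulf_eq0 negb_or.
  by case/andP.
- have E := Pdiv.ComRing.rdivp_eq G b'.
  have lt := Pdiv.CommonRing.ltn_rmodpN0 b' nzG'; rewrite szG in lt.
  set c := _ ^+ _ in E; set qq := Pdiv.CommonRing.rdivp _ _ in E.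
  have r0 : ev (Pdiv.CommonRing.rmodp b' G) = 0.
    have -> : Pdiv.CommonRing.rmodp b' G = c *: b' - qq * G by rewrite E addrC addKr.
    by rewrite evD -mulNr evM evG mulr0 addr0 -mul_polyC evM evb' mulr0.
  have := congr1 psi E; rewrite -mul_polyC rmorphD !rmorphM psiG mulr0 add0r.
  rewrite (psi0 _ (minG0 _ r0 lt)) psiC => /eqP; rewrite mulf_eq0 rmorphXn expf_eq0.
  by rewrite (negPf philG) andbF => /eqP.
Qed.

Lemma specializes_poly :
  @specializes {poly B} (fun c => (iB c)%:P) ev.
Proof.
move=> b b0; have [[G [evG nzG]]|tr] := pselect (exists G, ev G = 0 /\ map_poly e G != 0).
  exact: (specializes_poly_alg b0 evG nzG).
apply: specializes_poly_trans => // G evG; apply/eqP/negPn/negP => nz.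
by apply: tr; exists G.
Qed.

End Step.

(** The variables are adjoined one by one: [B] is an iterated polynomial ring over [k], and [e]
    evaluates at [gamma]. The domain [R] may be very large, such as a power series ring; the point
    [z] is nevertheless defined over [k]. *)
Theorem nullstellensatz (iota : {rmorphism k -> R}) n (gamma : 'I_n -> R) (F : {mpoly k[n]}) :
  mmap iota gamma F != 0 ->
  exists2 z : 'I_n -> k, F.@[z] != 0 &
    forall f : {mpoly k[n]}, mmap iota gamma f = 0 -> f.@[z] = 0.
Proof.
pose g (i : nat) := if insub i is Some j then gamma j else 0.
have [B [iB [e [ei sp [X XE]]]]] : exists (B : comNzRingType) (iB : {rmorphism k -> B})
    (e : {rmorphism B -> R}), [/\ forall c, e (iB c) = iota c, specializes iB e &
    exists X : nat -> B, forall i, (i < n)%N -> e (X i) = g i].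
  elim: n {gamma F} g => [|m IH] g.
    exists k, idfun, iota; split=> //; last by exists (fun=> 0).
    move=> b b0; exists idfun; split=> //=.
      by apply: contra b0 => /eqP->; rewrite rmorph0.
    by move=> b' /eqP; rewrite fmorph_eq0 => /eqP.
  have [B [iB [e [ei sp [X XE]]]]] := IH g.
  have cm (c : B) : GRing.comm (g m) (e c) by apply: mulrC.
  exists {poly B}, (polyC \o iB), (horner_morph cm); split=> [c||].
  - by rewrite [LHS]/(horner_morph cm _) /horner_morph map_polyC hornerC /= ei.
  - exact: specializes_poly.
  - exists (fun i => if i == m then 'X else (X i)%:P) => i.
    rewrite ltnS leq_eqVlt => /orP[/eqP->|lt]; rewrite [LHS]/(horner_morph cm _) /horner_morph.
      by rewrite eqxx map_polyX hornerX.
    by rewrite (ltn_eqF lt) map_polyC hornerC -XE.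
pose Xi (i : 'I_n) := X i.
have emb f : e (mmap iB Xi f) = mmap iota gamma f.
  rewrite rmorph_mmap; apply: eq_mmap => [c|i]; first exact: ei.
  by rewrite /= /Xi XE // /g valK.
rewrite -emb => /sp[phi [phiC phib phi0]].
have phiE f : phi (mmap iB Xi f) = f.@[phi \o Xi].
  by rewrite rmorph_mmap; apply: eq_mmap => c //=.
exists (phi \o Xi) => [|f]; first by rewrite -phiE.
by rewrite -emb => /phi0; rewrite phiE.
Qed.

Lemma mmap_mpolyX n (F : {mpoly k[n]}) : mmap (@mpolyC n k) (fun i => 'X_i) F = F.
Proof.
rewrite /mmap [RHS](mpolyE F); apply: eq_bigr => m _.
by rewrite mul_mpolyC -mmap1_id.
Qed.

End Nullstellensatz.

(** The generic point of affine space, whose coordinates are the variables themselves, is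
    specialized. *)
Lemma mpoly_nonroot (k : closedFieldType) n (F : {mpoly k[n]}) : F != 0 -> exists z, F.@[z] != 0.
Proof.
rewrite -{1}(mmap_mpolyX F) => /(@nullstellensatz k {mpoly k[n]} (mpolyC n (R:=k)) n (fun i => 'X_i) F).
by case=> z z0 _; exists z.
Qed.

(** * Algebraic dependence of n + 1 polynomials in n variables *)

Section AlgebraicDependence.
Variable k : fieldType.

Lemma msize_prod_le n (I : Type) (r : seq I) (P : pred I) (F : I -> {mpoly k[n]}) c :
  (forall i, (msize (F i) <= c.+1)%N) ->
  (msize (\prod_(i <- r | P i) F i) <= (size r * c).+1)%N.
Proof.
move=> Fc; elim: r => [|i r IH]; first by rewrite big_nil msize1.
rewrite big_cons; case: ifP => _ /=; last by rewrite (leq_trans IH) // ltnS leq_mul2r leqnSn orbT.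
have [->|n1] := eqVneq (F i) 0; first by rewrite mul0r msize0.
have [->|n2] := eqVneq (\prod_(j <- r | P j) F j) 0; first by rewrite mulr0 msize0.
rewrite msizeM // mulSn; move: IH (Fc i); move: (msize _) (msize _) (size r * c)%N => x y z.
clear; lia.
Qed.

Lemma msize_exp_le n (F : {mpoly k[n]}) c e : (msize F <= c.+1)%N ->
  (msize (F ^+ e) <= (e * c).+1)%N.
Proof.
move=> Fc; have := @msize_prod_le n nat (iota 0 e) predT (fun=> F) c (fun=> Fc).
by rewrite size_iota -(subn0 e) prodr_const_nat subn0.
Qed.

(** Monomial count: there are [m ^ n.+1] products of the [F i] with exponents below [m], and they
    lie in a space of dimension [M ^ n] with [M] linear in [m]. *)
Lemma mpoly_alg_dep n (F : 'I_n.+1 -> {mpoly k[n]}) :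
  exists2 P : {mpoly k[n.+1]}, P != 0 & mmap (@mpolyC n k) F P = 0.
Proof.
pose c := (\max_i msize (F i))%N.
have Fc i : (msize (F i) <= c.+1)%N.
  by rewrite (leq_trans _ (leqnSn _)) // /c (leq_bigmax i).
(* Chosen so that [M ^ n], which is [m ^ n] times [m.-1], stays below [m ^ n.+1]. *)
pose m := ((n.+1 * c.+1) ^ n).+1; pose M := (n.+1 * c.+1 * m)%N.
pose Fu (u : {ffun 'I_n.+1 -> 'I_m}) := \prod_i F i ^+ u i.
have sFu u : (msize (Fu u) <= M)%N.
  have := @msize_prod_le n 'I_n.+1 (index_enum 'I_n.+1) predT (fun i => F i ^+ u i) (m * c).
  rewrite -/(Fu u) /index_enum -enumT size_enum_ord => H.
  have {}H := H (fun i => leq_trans (msize_exp_le (u i) (Fc i)) _).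
  have : (msize (Fu u) <= (n.+1 * (m * c)).+1)%N.
    by apply: H => i; rewrite ltnS leq_mul2r (ltnW (ltn_ord _)) orbT.
  move=> H'; apply: leq_trans H' _; rewrite /M -mulnA ltn_pmul2l //.
  by rewrite [(c.+1 * m)%N]mulnC ltn_pmul2l.
pose mon (v : {ffun 'I_n -> 'I_M}) := [multinom (v i : nat) | i < n].
pose A := \matrix_(i < #|{ffun 'I_n.+1 -> 'I_m}|, j < #|{ffun 'I_n -> 'I_M}|)
   (Fu (enum_val i))@_(mon (enum_val j)).
have rA : (\rank (kermx A) > 0)%N.
  rewrite mxrank_ker subn_gt0 (leq_ltn_trans (rank_leq_col A)) //.
  rewrite !card_ffun !card_ord /M expnMn expnS ltn_pmul2r ?expn_gt0 //.
have [i ri] : exists i, row i (kermx A) != 0.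
  apply/existsP; rewrite -negb_forall; apply: contraL rA => /forallP H.
  rewrite -leqNgt leqn0 mxrank_eq0; apply/eqP/row_matrixP => i; rewrite row0.
  exact/eqP/H.
pose co u := kermx A i (enum_rank u).
have H0 : \sum_u co u *: Fu u = 0.
  apply/mpolyP => v; rewrite mcoeff0 raddf_sum /=.
  have [vM|] := boolP [forall i, v i < M]%N; last first.
    rewrite negb_forall => /existsP[j]; rewrite -leqNgt => vj.
    rewrite big1 // => u _; rewrite mcoeffZ memN_msupp_eq0 ?mulr0 //.
    apply: msize_mdeg_ge; apply: leq_trans (sFu u) (leq_trans vj _).
    by rewrite mdegE (bigD1 j) //= leq_addr.
  pose v' : {ffun 'I_n -> 'I_M} := [ffun j => Ordinal (forallP vM j)].
  have vE : v = mon v' by apply/mnmP => j; rewrite mnmE ffunE.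
  have := congr1 (fun B : 'M_(_, _) => B i (enum_rank v')) (mulmx_ker A).
  rewrite [in RHS]mxE [in LHS]mxE => E; rewrite -[RHS]E [RHS](reindex (@enum_rank _)) /=.
    by apply: eq_bigr => u _; rewrite mcoeffZ [A _ _]mxE !enum_rankK -vE /co.
  by apply: onW_bij; apply: enum_rank_bij.
pose P := \sum_u co u *: 'X_[[multinom (u i : nat) | i < n.+1]] : {mpoly k[n.+1]}.
exists P; last first.
  rewrite -[RHS]H0 raddf_sum; apply: eq_bigr => u _ /=.
  rewrite mmapZ mmapX mul_mpolyC /Fu /mmap1.
  by apply: (congr1 (fun x => co u *: x)); apply: eq_bigr => l _; rewrite mnmE.
apply: contra ri => /eqP P0; apply/eqP/rowP => j; rewrite [LHS]mxE [RHS]mxE.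
have := congr1 (mcoeff [multinom (enum_val j i : nat) | i < n.+1]) P0.
rewrite mcoeff0 raddf_sum (bigD1 (enum_val j)) //= big1 => [|u uj].
  by rewrite addr0 mcoeffZ mcoeffX eqxx mulr1 /co enum_valK.
rewrite mcoeffZ mcoeffX; case: eqP => [E|]; last by rewrite mulr0.
case/eqP: uj; apply/ffunP => l; apply: val_inj.
by have := congr1 (fun v : 'X_{1..n.+1} => v l) E; rewrite !mnmE.
Qed.

End AlgebraicDependence.

(** * Projective sets and closed chains *)

Section MpolyMorphisms.
Variable k : comNzRingType.

Lemma mmap_scale (A : comNzRingType) n (f : {rmorphism k -> A}) (h : 'I_n -> A) (c : A)
    (F : {mpoly k[n]}) d : F \is d.-homog ->
  mmap f (fun i => c * h i) F = c ^+ d * mmap f h F.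
Proof.
move/dhomogP => hom; rewrite /mmap big_distrr /= !big_seq; apply: eq_bigr => m mF.
have dE : d = (\sum_(i < n) m i)%N by rewrite -(hom m mF) /= mdegE.
rewrite mulrCA; congr (_ * _); rewrite /mmap1 dE.
rewrite -prodrXr -big_split /=; apply: eq_bigr => i _; exact: exprMn.
Qed.

End MpolyMorphisms.

Section Cones.
Variables (k : closedFieldType) (N : nat).
Implicit Types (Z Y A B : 'rV[k]_N -> Prop) (z t : 'rV[k]_N) (f g : {mpoly k[N]}).

Definition cone Z : Prop := forall z c, c != 0 -> Z z -> Z (c *: z).

Lemma meval_scale f d z c : f \is d.-homog -> f.@[(c *: z) ord0] = c ^+ d * f.@[z ord0].
Proof.
move=> hom; rewrite -(mmap_scale idfun (z ord0) c hom); apply: eq_mmap => // i.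
by rewrite mxE.
Qed.

Lemma meval_pihomog f z : f.@[z ord0] = \sum_(d < msize f) (pihomog mdeg d f).@[z ord0].
Proof. by rewrite {1}(pihomog_partitionE (leqnn (msize f))) raddf_sum. Qed.

(** On the line through [z], [f] is a polynomial in the scalar, with the values of its components as
    coefficients; it has infinitely many roots. *)
Lemma cone_pihomog Z f : cone Z -> (forall z, Z z -> f.@[z ord0] = 0) ->
  forall d z, Z z -> (pihomog mdeg d f).@[z ord0] = 0.
Proof.
move=> coneZ f0 d z Zz.
have [ld|ld] := ltnP d (msize f); last first.
  rewrite pihomogE big_seq_cond big_pred0 ?meval0 // => m; apply/negbTE.
  rewrite negb_and -implybE; apply/implyP => /msize_mdeg_lt lt; by rewrite neq_ltn (leq_trans lt ld).
pose p := \poly_(d < msize f) (pihomog mdeg d f).@[z ord0].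
have pc c : c != 0 -> p.[c] = 0.
  move=> c0; rewrite -(f0 _ (coneZ z c c0 Zz)) meval_pihomog horner_poly.
  apply: eq_bigr => i _; rewrite (meval_scale _ _ (pihomogP mdeg i f)).
  by rewrite mulrC.
have [p0|p0] := eqVneq p 0; first by move: (congr1 (fun p : {poly k} => p`_d) p0); rewrite coef_poly ld coef0.
(* The factor ['X] forces the non-root to be a nonzero scalar. *)
have : p * 'X != 0 by rewrite mulf_neq0 ?polyX_eq0.
case/closed_nonrootP => c; rewrite rootM rootX negb_or => /andP[pc0 /pc E].
by move: pc0; rewrite /root E eqxx.
Qed.

(** Allows inhomogeneous equations to pass to a closure that is defined by homogeneous ones. *)
Lemma proj_closureP Z z : cone Z -> proj_closure Z z ->
  forall f, (forall z', Z z' -> f.@[z' ord0] = 0) -> f.@[z ord0] = 0.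
Proof.
move=> coneZ [_ H] f f0; rewrite meval_pihomog big1 // => d _; apply: H.
by split; [exists d; apply: pihomogP | move=> z'; apply: cone_pihomog].
Qed.

Lemma proj_closedP Z (S : {mpoly k[N]} -> Prop) : cone Z ->
  (forall z, Z z <-> z != 0 /\ forall f, S f -> f.@[z ord0] = 0) -> proj_closed Z.
Proof.
move=> coneZ HS; exists (vanishes_on Z) => [f [] //|z]; split=> [Zz|[z0 H]].
  by split=> [|f [_ h]]; [have [] := (HS z).1 Zz | apply: h].
apply/HS; split=> // f Sf; apply: (@proj_closureP Z) => //.
by move=> z' /HS[_]; apply.
Qed.

Lemma proj_closed_cone A : proj_closed A -> cone A.
Proof.
move=> [S Sh AS] z c c0 /AS[z0 H]; apply/AS; split.
  by rewrite scaler_eq0 negb_or c0.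
move=> f Sf; have [d hd] := Sh f Sf.
by rewrite /zero_at (meval_scale _ _ hd) H // mulr0.
Qed.

Lemma proj_closed_zero f : homogeneous f -> proj_closed (fun z => z != 0 /\ f.@[z ord0] = 0).
Proof.
move=> hf; exists (eq f) => [_ <-//|z]; split=> [[z0 fz]|[z0 H]]; split=> //; last exact: H.
by move=> _ <-.
Qed.

Definition tder z t f : k := \sum_(i < N) t ord0 i * (f^`M(i)).@[z ord0].

Lemma tder_dlin z t : dlin (fun f => f.@[z ord0]) (tder z t).
Proof.
split=> f g; rewrite /tder.
  by rewrite -big_split; apply: eq_bigr => i _; rewrite /= mderivD mevalD mulrDr.
rewrite big_distrr big_distrl -big_split /=; apply: eq_bigr => i _.
by rewrite mderivM mevalD !mevalM; ring.
Qed.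

Lemma tderX z t i : tder z t 'X_i = t ord0 i.
Proof.
rewrite /tder (bigD1 i) //= big1 => [|j ji].
  rewrite mderivX mnm1E eqxx scale1r addr0.
  have -> : (U_(i) - U_(i) = 0 :> 'X_{1..N})%MM by apply/mnmP => l; rewrite mnmBE mnm0E subnn.
  by rewrite mpolyX0 meval1 mulr1.
by rewrite mderivX mnm1E eq_sym (negPf ji) scale0r meval0 mulr0.
Qed.

Lemma tderC z t c : tder z t c%:MP = 0.
Proof. by rewrite /tder big1 // => i _; rewrite mderivC meval0 mulr0. Qed.

Lemma cone_tangentP Z z t : cone Z -> cone_tangent Z z t ->
  forall f, (forall z', Z z' -> f.@[z' ord0] = 0) -> tder z t f = 0.
Proof.
move=> coneZ H f f0; rewrite [f](pihomog_partitionE (leqnn (msize f))).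
have t0 : tder z t 0 = 0 by rewrite -mpolyC0 tderC.
rewrite (big_morph (tder z t) (tder_dlin z t).1 t0) big1 //= => d _; apply: H.
by split; [exists d; apply: pihomogP | move=> z'; apply: cone_pihomog].
Qed.

(** Irreducibility as cancellation: each component of [g] vanishes where [f] does not, so [Z] is
    covered by the zeros of [f] and those of the component. *)
Lemma irr_mul Z f g : cone Z -> proj_irreducible Z -> (forall z, Z z -> z != 0) ->
  homogeneous f -> (exists2 z, Z z & f.@[z ord0] != 0) ->
  (forall z, Z z -> f.@[z ord0] * g.@[z ord0] = 0) ->
  forall z, Z z -> g.@[z ord0] = 0.
Proof.
move=> coneZ [_ irr] Z0 hf [z1 Zz1 fz1] fg z Zz; have [a ha] := hf.
rewrite meval_pihomog big1 // => d _.
have gd z' : Z z' -> f.@[z' ord0] * (pihomog mdeg d g).@[z' ord0] = 0.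
  move=> Zz'; have [->|fz] := eqVneq (f.@[z' ord0]) 0; first by rewrite mul0r.
  pose Z1 z := Z z /\ f.@[z ord0] != 0.
  rewrite (@cone_pihomog Z1) ?mulr0 // => [z2 c c0 [Zz2 fz2]|z2 [Zz2 fz2]].
    by split; [apply: coneZ | rewrite (meval_scale _ _ ha) mulf_neq0 ?expf_neq0].
  by have /eqP := fg z2 Zz2; rewrite mulf_eq0 (negPf fz2) => /eqP.
have hd : homogeneous (pihomog mdeg d g) by exists d; apply: pihomogP.
have := irr _ _ (proj_closed_zero hf) (proj_closed_zero hd).
case=> [z' Zz'|ZA|ZB].
- have /eqP := gd z' Zz'; rewrite mulf_eq0 => /orP[] /eqP E; [left|right]; split=> //; exact: Z0.
- by have [_ E] := ZA z1 Zz1; rewrite E eqxx in fz1.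
- by have [_] := ZB z Zz.
Qed.

Section PointLocus.
Variables (R : idomainType) (iota : {rmorphism k -> R}) (gamma : 'I_N -> R).

(** The closure of the point with coordinates [gamma]. Its ideal is the kernel of an evaluation into
    a domain, hence prime. *)
Definition point_locus z : Prop :=
  z != 0 /\ forall f, homogeneous f -> mmap iota gamma f = 0 -> f.@[z ord0] = 0.

Lemma point_locus_closed : proj_closed point_locus.
Proof.
exists (fun f => homogeneous f /\ mmap iota gamma f = 0) => [f []//|z].
by split=> [[z0 H]|[z0 H]]; split=> // f; [case=> hf /H; apply | move=> hf f0; apply: H].
Qed.

Lemma point_locus_ex (j : 'I_N) F : gamma j != 0 -> mmap iota gamma F != 0 ->
  exists2 z, point_locus z & F.@[z ord0] != 0.
Proof.
move=> gj Fg.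
have : mmap iota gamma (F * 'X_j) != 0 by rewrite rmorphM /= mmapX mmap1U mulf_neq0.
case/nullstellensatz => z zF zI.
exists (\row_i z i); last first.
  apply: contraNneq zF => E; rewrite mevalM.
  have -> : F.@[z] = 0 by rewrite -E; apply: meval_eq => i; rewrite mxE.
  by rewrite mul0r.
split=> [|f _ /zI <-]; last by apply: meval_eq => i; rewrite mxE.
apply: contraNneq zF => E; rewrite mevalM mevalXU.
by have := congr1 (fun r : 'rV_N => r ord0 j) E; rewrite !mxE => ->; rewrite mulr0.
Qed.

Lemma point_locus_irr (j : 'I_N) : gamma j != 0 -> proj_irreducible point_locus.
Proof.
move=> gj; split.
  have : mmap iota gamma 1 != 0 by rewrite rmorph1 oner_neq0.
  by case/(point_locus_ex gj) => z; exists z.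
move=> A B [S Sh AS] [T Th BT] cov.
have [H|/existsNP[z1 /not_implyP[Vz1 nA]]] := pselect (Defs.subset point_locus A); first by left.
have [H|/existsNP[z2 /not_implyP[Vz2 nB]]] := pselect (Defs.subset point_locus B); first by right.
have [f [Sf fz1]] : exists f, S f /\ f.@[z1 ord0] != 0.
  apply: contrapT => H; apply: nA; apply/AS; split; first by case: Vz1.
  move=> f Sf; apply/eqP/negPn/negP => nz; by apply: H; exists f.
have [g [Tg gz2]] : exists g, T g /\ g.@[z2 ord0] != 0.
  apply: contrapT => H; apply: nB; apply/BT; split; first by case: Vz2.
  move=> g Tg; apply/eqP/negPn/negP => nz; by apply: H; exists g.
have : mmap iota gamma (f * g) != 0.
  rewrite rmorphM mulf_neq0 //.
    by apply: contra fz1 => /eqP E; case: Vz1 => _ ->//; apply: Sh.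
  by apply: contra gz2 => /eqP E; case: Vz2 => _ ->//; apply: Th.
case/(point_locus_ex gj) => z Vz; rewrite mevalM mulf_eq0 negb_or => /andP[fz gz].
by case: (cov z Vz) => [/AS[_ /(_ f Sf) E]|/BT[_ /(_ g Tg) E]]; rewrite E eqxx in fz gz.
Qed.

End PointLocus.

Lemma mpoly_last n (P : {mpoly k[n.+1]}) : P != 0 ->
  exists q : {poly {mpoly k[n]}}, q != 0 /\
  forall (B : comNzRingType) (i : {rmorphism k -> B}) (h : 'I_n.+1 -> B),
    mmap i h P = (map_poly (mmap i (fun j => h (widen_ord (leqnSn n) j))) q).[h ord_max].
Proof.
pose X' (j : 'I_n.+1) : {poly {mpoly k[n]}} := if unlift ord_max j is Some l then ('X_l)%:P else 'X.
pose wd := widen_ord (leqnSn n).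
have wdE j : wd j = lift ord_max j.
  by apply: val_inj; rewrite /= /bump leqNgt ltn_ord.
have E (B : comNzRingType) (i : {rmorphism k -> B}) (h : 'I_n.+1 -> B) F :
    mmap i h F = (map_poly (mmap i (fun j => h (wd j)))
                   (mmap (polyC \o @mpolyC n k) X' F)).[h ord_max].
  have cm (c : {mpoly k[n]}) : GRing.comm (h ord_max) (mmap i (fun j => h (wd j)) c) by apply: mulrC.
  rewrite -[RHS]/(horner_morph cm _) (rmorph_mmap (polyC \o mpolyC n (R:=k)) (horner_morph cm)).
  apply: eq_mmap => [c|j] /=.
    by rewrite /horner_morph map_polyC hornerC /= mmapC.
  rewrite /horner_morph /X'; case: unliftP => [l ->|->].
    by rewrite map_polyC hornerC /= mmapX mmap1U wdE.
  by rewrite map_polyX hornerX.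
move=> P0; exists (mmap (polyC \o @mpolyC n k) X' P); split=> //.
apply: contraNneq P0 => E0; have := E _ (@mpolyC n.+1 k) (fun i => 'X_i) P.
by rewrite E0 map_poly0 horner0 mmap_mpolyX => ->.
Qed.

(* equations cutting out the members of a chain of irreducible closed subsets are
   algebraically independent *)
Lemma chain_alg_indep Z r c : cone Z -> closed_chain Z r c ->
  exists f : 'I_r.+1 -> {mpoly k[N]}, forall P : {mpoly k[r.+1]},
    (forall z, c r z -> (mmap (@mpolyC N k) f P).@[z ord0] = 0) -> P = 0.
Proof.
move=> coneZ [Hc Hs].
have conec i : (i <= r)%N -> cone (c i).
  move=> ir; have [[A clA AE] _] := Hc i ir; move=> z a a0 /AE[Zz Az]; apply/AE.
  by split; [apply: coneZ | apply: proj_closed_cone].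
have c0 i z : (i <= r)%N -> c i z -> z != 0.
  move=> ir; have [[A [S _ AS] AE] _] := Hc i ir.
  by move=> /AE[_ /AS[]].
suff : forall m, (m <= r)%N -> exists f : 'I_m.+1 -> {mpoly k[N]}, forall P : {mpoly k[m.+1]},
    (forall z, c m z -> (mmap (@mpolyC N k) f P).@[z ord0] = 0) -> P = 0.
  by apply.
elim=> [|m IH] mr.
  have [_ [[z cz] _]] := Hc 0%N mr; have z0 := c0 _ _ mr cz.
  have [j zj] : exists j, z ord0 j != 0.
    apply/existsP; rewrite -negb_forall; apply: contra z0 => /forallP H.
    by apply/eqP/rowP => j; rewrite mxE; apply/eqP/H.
  (* On the line of a single point a nonzero coordinate takes every nonzero value; the factor
     ['X_ord0] selects such a value off the zeros of [P]. *)
  exists (fun=> 'X_j) => P HP; apply/eqP/negPn/negP => P0.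
  have : P * 'X_ord0 != 0 by rewrite mulf_neq0 // -msupp_eq0 msuppX.
  case/mpoly_nonroot => v; rewrite mevalM mevalXU mulf_eq0 negb_or => /andP[Pv v0].
  have := HP _ (conec _ mr z (v ord0 / z ord0 j) _ cz).
  rewrite mulf_neq0 ?invr_eq0 // => /(_ isT); rewrite rmorph_mmap => E.
  case/eqP: Pv; rewrite -[RHS]E; apply: eq_mmap => [a|i] /=; first by rewrite mevalC.
  by rewrite mevalXU mxE divfK // (ord1 i).
have [f fP] := IH (ltnW mr).
have [sub nsub] := Hs m mr.
have [g [hg g0 [z1 cz1 gz1]]] : exists g, [/\ homogeneous g, (forall z, c m z -> g.@[z ord0] = 0) &
    exists2 z, c m.+1 z & g.@[z ord0] != 0].
  have /existsNP[z1 /not_implyP[cz1 nz1]] := nsub.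
  have [[A [S Sh AS] AE] _] := Hc m (ltnW mr).
  have [f' [Sf fz]] : exists f, S f /\ f.@[z1 ord0] != 0.
    apply: contrapT => H; apply: nz1; apply/AE; split.
      by have [[A' _ AE'] _] := Hc m.+1 mr; have [] := (AE' z1).1 cz1.
    apply/AS; split; first exact: (c0 m.+1).
    move=> f' Sf; apply/eqP/negPn/negP => nz; by apply: H; exists f'.
  exists f'; split; [exact: Sh | | by exists z1].
  by move=> z /AE[_ /AS[_ H]]; apply: H.
pose f' (i : 'I_m.+2) := if unlift ord_max i is Some l then f l else g.
have f'max : f' ord_max = g by rewrite /f'; case: unliftP => // l /eqP; rewrite (negPf (neq_lift _ _)).
have f'wd l : f' (widen_ord (leqnSn m.+1) l) = f l.
  have -> : widen_ord (leqnSn m.+1) l = lift ord_max l.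
    by apply: val_inj; rewrite /= /bump leqNgt ltn_ord.
  by rewrite /f' liftK.
exists f' => P HP; apply/eqP/negPn/negP => /mpoly_last[q [q0 qE]].
pose eta : {rmorphism {mpoly k[m.+1]} -> {mpoly k[N]}} := mmap (@mpolyC N k) f.
have {HP}HP z : c m.+1 z -> (map_poly eta q).[g].@[z ord0] = 0.
  move/HP => H; rewrite -[RHS]H qE f'max; congr (_.@[_]).
  have E : map_poly eta q = map_poly (mmap (@mpolyC N k) (fun j => f' (widen_ord (leqnSn m.+1) j))) q.
    by apply: eq_map_poly => x; apply: eq_mmap => // l; rewrite f'wd.
  by rewrite E.
have exi : exists i, q`_i != 0.
  by exists (size q).-1; rewrite -lead_coefE lead_coef_eq0.
(* The largest power of [g] dividing the relation is cancelled by irreducibility. On the smaller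
   member [g] vanishes, so only the constant coefficient in [g] is left there. *)
case: (ex_minnP exi) => i qi mini.
have qd : q = drop_poly i q * 'X^i.
  rewrite -{1}(poly_take_drop i q) [take_poly i q](_ : _ = 0) ?add0r //.
  apply/polyP => l; rewrite coef_take_poly coef0; case: ltnP => // li.
  by apply/eqP/negPn/negP => /mini; lia.
have hgi : homogeneous (g ^+ i).
  by have [a ha] := hg; exists (a * i)%N; apply: dhomogMn.
pose G := (map_poly eta (drop_poly i q)).[g].
have G0 : forall z, c m.+1 z -> G.@[z ord0] = 0.
  apply: (irr_mul (f := g ^+ i)) => //; [exact: conec | by case: (Hc m.+1 mr) | by move=> z; apply: c0 | |].
    by exists z1 => //; rewrite rmorphXn expf_neq0.
  move=> z cz; rewrite mulrC -mevalM -(HP z cz); congr (_.@[_]).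
  by rewrite [in RHS]qd rmorphM /= map_polyXn hornerM hornerXn.
case/eqP: qi; apply: fP => z cz; have := G0 z (sub z cz).
rewrite /G -[g]add0r; move: (cz) => /g0 gz.
have cm (a : {mpoly k[N]}) : GRing.comm g a by apply: mulrC.
rewrite add0r horner_coef raddf_sum /=.
have [s0|s0] := posnP (size (map_poly eta (drop_poly i q))).
  have E : map_poly eta (drop_poly i q) = 0 by apply/eqP; rewrite -size_poly_eq0 s0.
  have := congr1 (fun p : {poly _} => p`_0) E.
  by rewrite coef_map coef_drop_poly add0n coef0 => -> _; rewrite meval0.
rewrite -(prednK s0) big_ord_recl big1 => [|l _]; last first.
  by rewrite mevalM rmorphXn /= gz expr0n mulr0.
by rewrite addr0 expr0 mulr1 coef_map coef_drop_poly add0n.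
Qed.

End Cones.

(** * Frames, parabolics and twisted orthogonals *)

Section FrobeniusMatrix.
Variables (q : nat) (B : comUnitRingType).
Hypothesis Bq : [pchar B].-nat q.

(** The hypothesis on [q] is an argument so that a ring morphism structure can be attached to the
    map. *)
Definition frobf (_ : [pchar B].-nat q) (x : B) : B := x ^+ q.
Let frobf_is_zmod : zmod_morphism (frobf Bq).
Proof.
move=> x y; apply: (addIr (y ^+ q)).
by rewrite /frobf -exprDn_pchar // !subrK.
Qed.
Let frobf_is_monoid : monoid_morphism (frobf Bq).
Proof. by split=> [|x y]; rewrite /frobf ?expr1n ?exprMn. Qed.
HB.instance Definition _ := GRing.isZmodMorphism.Build B B (frobf Bq) frobf_is_zmod.
HB.instance Definition _ := GRing.isMonoidMorphism.Build B B (frobf Bq) frobf_is_monoid.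
End FrobeniusMatrix.

Definition fmx (q : nat) (B : comUnitRingType) m n (M : 'M[B]_(m, n)) : 'M[B]_(m, n) :=
  map_mx (fun x => x ^+ q) M.
Arguments fmx q {B m n} M.

Section FrobeniusMatrixTheory.
Variables (q : nat) (B : comUnitRingType).
Hypothesis Bq : [pchar B].-nat q.
Let fE m n (M : 'M[B]_(m, n)) : fmx q M = map_mx (frobf Bq) M. Proof. by []. Qed.

Lemma fmxM m n r (X : 'M[B]_(m, n)) (Y : 'M_(n, r)) : fmx q (X *m Y) = fmx q X *m fmx q Y.
Proof. by rewrite !fE map_mxM. Qed.
Lemma fmx1 n : fmx q (1%:M : 'M[B]_n) = 1%:M.
Proof. by rewrite !fE map_mx1. Qed.
Lemma fmxD m n (X Y : 'M[B]_(m, n)) : fmx q (X + Y) = fmx q X + fmx q Y.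
Proof. by rewrite !fE map_mxD. Qed.
Lemma fmx_tr m n (X : 'M[B]_(m, n)) : fmx q X^T = (fmx q X)^T.
Proof. by rewrite /fmx map_trmx. Qed.
Lemma fmx_det n (X : 'M[B]_n) : \det (fmx q X) = (\det X) ^+ q.
Proof. by rewrite fE det_map_mx. Qed.
Lemma fmx_unit n (X : 'M[B]_n) : X \in unitmx -> fmx q X \in unitmx.
Proof. by rewrite !unitmxE fmx_det => u; rewrite unitrX. Qed.
Lemma fmx_inv n (X : 'M[B]_n) : X \in unitmx -> fmx q (invmx X) = invmx (fmx q X).
Proof.
move=> u; have fu := fmx_unit u.
by rewrite -[LHS](mulKmx fu) -fmxM mulmxV // fmx1 mulmx1.
Qed.
End FrobeniusMatrixTheory.

Lemma fmx_map (B B' : comUnitRingType) (f : {rmorphism B -> B'}) q m n (X : 'M[B]_(m, n)) :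
  map_mx f (fmx q X) = fmx q (map_mx f X).
Proof. by apply/matrixP => i j; rewrite !mxE rmorphXn. Qed.

Lemma pchar_rmorph (B B' : nzSemiRingType) (f : {rmorphism B -> B'}) q :
  [pchar B].-nat q -> [pchar B'].-nat q.
Proof. by apply: sub_in_pnat => r _; apply: rmorph_pchar. Qed.

(* [D] is the list of the dimensions of the members of a flag; [nz D i j] holds at the
   matrix positions below the block diagonal of type [D] *)
Definition nz (D : seq nat) (i j : nat) : bool := has (fun x => j < x <= i)%N D.

Lemma nzP D i j : reflect (exists2 x, x \in D & (j < x <= i)%N) (nz D i j).
Proof. exact: hasP. Qed.

Lemma nz_le D i j i' j' : nz D i j -> (i <= i')%N -> (j' <= j)%N -> nz D i' j'.
Proof. by move=> /nzP[x xD] ? ? ?; apply/nzP; exists x => //; lia. Qed.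

Section Parabolics.
Variables (B : comUnitRingType) (d : nat) (D : seq nat).
Implicit Types M N p : 'M[B]_d.

(** [inP] is the parabolic algebra of the standard flag of type [D], [inN] the opposite nilradical,
    and [inZ] the shape required of [N_s]: a parabolic shape relaxed by one column. *)
Definition inP M := forall i j : 'I_d, nz D i j -> M i j = 0.
Definition inN M := forall i j : 'I_d, ~~ nz D i j -> M i j = 0.
Definition inZ M := forall i j : 'I_d, nz D i j.+1 -> M i j = 0.
Definition projN M : 'M[B]_d := \matrix_(i, j) if nz D i j then M i j else 0.
Definition outZ M : 'M[B]_d := \matrix_(i, j) if nz D i j.+1 then M i j else 0.

Lemma inP_mulZ p M : inP p -> inZ M -> inZ (p *m M).
Proof.
move=> pP MZ i j /nzP[x xD /andP[jx xi]]; rewrite mxE big1 // => l _.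
have [lx|xl] := ltnP l x; first by rewrite pP ?mul0r //; apply/nzP; exists x; rewrite ?lx.
by rewrite MZ ?mulr0 //; apply/nzP; exists x; rewrite ?jx.
Qed.

(** The right factor has to preserve the flag of the shifted dimensions [x - 1]. *)
Lemma inZ_mulP M p : inZ M -> (forall i j : 'I_d, nz D i.+1 j.+1 -> p i j = 0) ->
  inZ (M *m p).
Proof.
move=> MZ pP i j /nzP[x xD /andP[jx xi]]; rewrite mxE big1 // => l _.
have [lx|xl] := ltnP l.+1 x; first by rewrite MZ ?mul0r //; apply/nzP; exists x; rewrite ?lx.
by rewrite pP ?mulr0 //; apply/nzP; exists x; rewrite ?jx.
Qed.

Lemma inP_mul p p' : inP p -> inP p' -> inP (p *m p').
Proof.
move=> pP pP' i j /nzP[x xD /andP[jx xi]]; rewrite mxE big1 // => l _.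
have [lx|xl] := ltnP l x; first by rewrite pP ?mul0r //; apply/nzP; exists x; rewrite ?lx.
by rewrite pP' ?mulr0 //; apply/nzP; exists x; rewrite ?jx.
Qed.

Lemma projN_inN M : inN (projN M).
Proof. by move=> i j nij; rewrite mxE (negPf nij). Qed.
Lemma projN_inP M : inP (M - projN M).
Proof. by move=> i j nij; rewrite !mxE nij subrr. Qed.
Lemma projN_id M : inN M -> projN M = M.
Proof. by move=> MN; apply/matrixP => i j; rewrite mxE; case: ifPn => // /MN. Qed.

Lemma outZ_id M : outZ (outZ M) = outZ M.
Proof. by apply/matrixP => i j; rewrite !mxE; case: ifP => e; rewrite ?e. Qed.
Lemma outZ_eq0 M : inZ M <-> outZ M = 0.
Proof.
split=> [MZ|E i j nij].
  by apply/matrixP => i j; rewrite !mxE; case: ifP => // /MZ.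
by have := congr1 (fun M : 'M_d => M i j) E; rewrite !mxE nij.
Qed.
Lemma outZB M N : outZ (M - N) = outZ M - outZ N.
Proof. by apply/matrixP => i j; rewrite !mxE; case: ifP; rewrite ?subr0. Qed.
Lemma inZZ c M : inZ M -> inZ (c *: M).
Proof. by move=> MZ i j n; rewrite mxE MZ ?mulr0. Qed.
Lemma inND M N : inN M -> inN N -> inN (M + N).
Proof. by move=> MZ NZ i j n; rewrite mxE MZ ?NZ ?addr0. Qed.
Lemma inP1 : inP 1%:M.
Proof. by move=> i j /nzP[x xD h]; rewrite mxE; case: eqP => // e; rewrite e in h; lia. Qed.

(* [M] is unitriangular with respect to [D], up to the permutation [s] of its rows *)
Definition normalized (s : 'S_d) M := forall i j : 'I_d, ~~ nz D i j -> M (s i) j = (i == j)%:R.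

(** Right multiplication by [1 + nu] stays in the chart, since positions below the block diagonal
    compose to such positions. *)
Lemma normalizedD s M nu : normalized s M -> inN nu -> normalized s (M + M *m nu).
Proof.
move=> Mn nuN i j nij; rewrite mxE Mn // mxE big1 ?addr0 // => l _.
have [nlj|?] := boolP (nz D l j); last by rewrite nuN ?mulr0.
have [nil|ni] := boolP (nz D i l).
  by case/negP: nij; apply: nz_le nlj _ (leqnn j); have /nzP[x _] := nil; lia.
rewrite Mn //; case: eqP => [E|]; last by rewrite mul0r.
by rewrite E nlj in nij.
Qed.

End Parabolics.

(** The span preserved by [p^T] is mapped into itself with the same rank, hence onto itself, so the
    inverse preserves it too. *)
Lemma inP_inv (K : fieldType) d D (p : 'M[K]_d) : p \in unitmx -> inP D p -> inP D (invmx p).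
Proof.
move=> pu pP i j /nzP[x xD /andP[jx xi]].
pose E : 'M[K]_d := pid_mx x.
have Ee (a b : 'I_d) : E a b = ((a == b) && (a < x))%N%:R by rewrite mxE.
have pE : E *m p^T = E *m p^T *m E.
  apply/matrixP => a b; rewrite [RHS]mxE (bigD1 b) //= big1 => [|l lb]; last first.
    by rewrite Ee (negPf lb) mulr0.
  rewrite addr0 Ee eqxx /=; case: ltnP => bx; first by rewrite mulr1.
  rewrite mulr0 mxE big1 // => l _; rewrite Ee; case: eqP => [<-|]; last by rewrite mul0r.
  case: ltnP => ax; last by rewrite mul0r.
  by rewrite mxE pP ?mulr0 //; apply/nzP; exists x; rewrite ?ax.
have sub : (E *m p^T <= E)%MS by rewrite pE submxMl.
have rk : \rank (E *m p^T) = \rank E by rewrite mxrankMfree // row_free_unit unitmx_tr.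
have [_] := mxrank_leqif_sup sub; rewrite rk eqxx => /esym/submxP[X XE].
have : E *m (invmx p)^T = X *m E.
  by rewrite {1}XE -!mulmxA -trmx_mul mulVmx // trmx1 mulmx1.
move=> /(congr1 (fun M : 'M_d => M j i)); rewrite mxE (bigD1 j) //= big1 => [|l lb]; last first.
  by rewrite Ee eq_sym (negPf lb) mul0r.
rewrite addr0 Ee eqxx jx mul1r mxE => ->; rewrite mxE big1 // => l _.
rewrite Ee; case: eqP => [->|]; last by rewrite mulr0.
by rewrite ltnNge xi /= mulr0.
Qed.

(** Pigeonhole: a permutation avoiding the block would send [d - x + 1] rows into [d - x]
    columns. *)
Lemma det_zero_block (B : comNzRingType) d (M : 'M[B]_d) x : (0 < x <= d)%N ->
  (forall i j : 'I_d, (x.-1 <= i)%N -> (j < x)%N -> M i j = 0) -> \det M = 0.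
Proof.
move=> xd M0; rewrite /determinant big1 // => s _.
suff [i [ix sx]] : exists i : 'I_d, (x.-1 <= i)%N /\ (s i < x)%N.
  by rewrite (bigD1 i) //= M0 // mul0r mulr0.
apply: contrapT => H.
have sub : [set s i | i : 'I_d & (x.-1 <= i)%N] \subset [set j : 'I_d | (x <= j)%N].
  apply/subsetP => j /imsetP[i]; rewrite inE => ix ->; rewrite inE leqNgt.
  by apply/negP => sx; apply: H; exists i.
have cge y : (y <= d)%N -> #|[set j : 'I_d | (y <= j)%N]| = (d - y)%N.
  move=> yd; rewrite -sum1_card (eq_bigl (fun j : 'I_d => (y <= j)%N)) => [|j]; last by rewrite inE.
  have -> : (\sum_(j < d | y <= j) 1 = \sum_(y <= j < d) 1)%N.
    by rewrite (big_nat_widenl y 0) // big_mkord.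
  by rewrite sum_nat_const_nat muln1.
have := subset_leq_card sub; rewrite card_imset; last exact: perm_inj.
rewrite !cge; lia.
Qed.

Section Duality.
Variables (q : nat) (B : comUnitRingType) (d : nat).
Hypothesis Bq : [pchar B].-nat q.
Implicit Types (S h N : 'M[B]_d).

Definition w0 : 'M[B]_d := \matrix_(i, j) (i == rev_ord j)%:R.

Lemma w0Ml n (M : 'M[B]_(d, n)) i j : (w0 *m M) i j = M (rev_ord i) j.
Proof.
rewrite mxE (bigD1 (rev_ord i)) //= big1 => [|l li]; rewrite mxE.
  by rewrite rev_ordK eqxx mul1r addr0.
rewrite (_ : _ == _ = false) ?mul0r //.
by apply: contra_neqF li => /eqP->; rewrite rev_ordK.
Qed.

Lemma w0Mr n (M : 'M[B]_(n, d)) i j : (M *m w0) i j = M i (rev_ord j).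
Proof.
rewrite mxE (bigD1 (rev_ord j)) //= big1 => [|l li]; rewrite mxE.
  by rewrite eqxx mulr1 addr0.
by rewrite (negPf li) mulr0.
Qed.

Lemma w0K : w0 *m w0 = 1%:M.
Proof. by apply/matrixP => i j; rewrite w0Ml !mxE (inj_eq rev_ord_inj). Qed.

Lemma w0_tr : w0^T = w0.
Proof.
by apply/matrixP => i j; rewrite !mxE -(inj_eq rev_ord_inj) rev_ordK eq_sym.
Qed.

Lemma w0_unit : w0 \in unitmx.
Proof. by case/mulmx1_unit: w0K. Qed.

Lemma fmx_w0 : fmx q w0 = w0.
Proof.
apply/matrixP => i j; rewrite !mxE.
have q0 : q != 0%N by case: q Bq.
by case: eqP; rewrite ?expr1n // expr0n (negPf q0).
Qed.

(* a frame of the flag of the Frobenius twist of the orthogonal of the flag of [h] *)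
Definition Cm S h : 'M[B]_d := invmx S^T *m (fmx q (invmx h))^T *m w0.

(** The effect on a twisted orthogonal frame of the change of frame [p]. The conjugation by [w0]
    makes it block upper triangular again, for the complementary dimensions. *)
Definition dualp (p : 'M[B]_d) : 'M[B]_d := w0 *m (fmx q (invmx p))^T *m w0.

Lemma Cm_unit S h : S \in unitmx -> h \in unitmx -> Cm S h \in unitmx.
Proof.
move=> Su hu; rewrite /Cm !unitmx_mul unitmx_inv unitmx_tr Su unitmx_tr w0_unit andbT.
by rewrite fmx_unit // unitmx_inv.
Qed.

Lemma invmxM n (X Y : 'M[B]_n) : X \in unitmx -> Y \in unitmx ->
  invmx (X *m Y) = invmx Y *m invmx X.
Proof.
move=> Xu Yu; have XYu : X *m Y \in unitmx by rewrite unitmx_mul Xu.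
rewrite -[RHS](mulKmx XYu) -!mulmxA mulKVmx // mulmxV // mulmx1.
by [].
Qed.

Lemma Cm_mul S h p : h \in unitmx -> p \in unitmx -> Cm S (h *m p) = Cm S h *m dualp p.
Proof.
move=> hu pu; rewrite /Cm /dualp invmxM // fmxM // trmx_mul -!mulmxA.
by rewrite (mulmxA w0 w0) w0K mul1mx !mulmxA.
Qed.

Lemma Cm_inv S h : S \in unitmx -> h \in unitmx ->
  invmx (Cm S h) = w0 *m (fmx q h)^T *m S^T.
Proof.
move=> Su hu.
have E : (w0 *m (fmx q h)^T *m S^T) *m Cm S h = 1%:M.
  rewrite /Cm -!mulmxA (mulmxA S^T) mulmxV ?unitmx_tr // mul1mx.
  rewrite (mulmxA (fmx q h)^T) -trmx_mul -fmxM // mulVmx // fmx1 // trmx1 mul1mx.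
  exact: w0K.
have [_ Cu] := mulmx1_unit E.
by rewrite -[LHS]mul1mx -E mulmxK.
Qed.

(* the composite of two twisted orthogonals is the square of the Frobenius *)
Lemma Cm_twist S h1 h2 N2 : S \in unitmx -> fmx q (fmx q S) = S -> h1 \in unitmx ->
  h2 \in unitmx -> N2 \in unitmx -> h2 *m N2 = Cm (fmx q S)^T h1 ->
  Cm S h2 = fmx q (fmx q h1) *m (w0 *m (fmx q N2)^T *m w0).
Proof.
move=> Su SS h1u h2u N2u E.
have S2u : (fmx q S)^T \in unitmx by rewrite unitmx_tr fmx_unit.
have E2 : invmx h2 = N2 *m (w0 *m (fmx q h1)^T *m fmx q S).
  rewrite -[fmx q S]trmxK -Cm_inv // -E invmxM //.
  by rewrite mulmxA mulmxV // mul1mx.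
rewrite /Cm E2 !(fmxM Bq) fmx_w0 SS fmx_tr !trmx_mul trmxK w0_tr.
by rewrite !mulmxA mulVmx ?unitmx_tr // mul1mx.
Qed.

End Duality.

Section DualParabolic.
Variables (q : nat) (K : fieldType) (d : nat).
Hypothesis Kq : [pchar K].-nat q.

(** The member of dimension [x - 1] of a twisted orthogonal flag comes from the member of dimension
    [d + 1 - x] of the flag; for [x = 1] the shape [inZ] imposes nothing. *)
Definition dual_dims (D D' : seq nat) : Prop :=
  [/\ forall x, x \in D -> (x < d)%N, forall x, x \in D' -> (x < d)%N &
      forall x, (1 < x < d)%N -> (x \in D) = ((d.+1 - x)%N \in D')].

Lemma dualp_inP D D' (p : 'M[K]_d) : dual_dims D D' -> p \in unitmx -> inP D' p ->
  forall i j : 'I_d, nz D i.+1 j.+1 -> (dualp q p) i j = 0.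
Proof.
move=> [lt1 _ dual] pu pP i j /nzP[x xD /andP[jx xi]]; have xlt := lt1 x xD.
have id := ltn_ord i; have jd := ltn_ord j.
rewrite /dualp w0Mr w0Ml mxE mxE (@inP_inv _ _ D') //.
  by rewrite expr0n; case: q Kq.
apply/nzP; exists (d.+1 - x)%N; first by rewrite -dual //; lia.
by rewrite /=; lia.
Qed.

Lemma dualp_unit (p : 'M[K]_d) : p \in unitmx -> dualp q p \in unitmx.
Proof.
move=> pu; rewrite /dualp !unitmx_mul w0_unit unitmx_tr andbT.
by rewrite (fmx_unit Kq) ?unitmx_inv.
Qed.

(** Makes the condition [inZ] one on flags, independent of the frames chosen for them. *)
Lemma inZ_frame_change D D' S (h h' p p' : 'M[K]_d) : dual_dims D D' ->
  h \in unitmx -> h' \in unitmx -> p \in unitmx -> p' \in unitmx -> inP D p -> inP D' p' ->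
  inZ D (invmx h *m Cm q S h') -> inZ D (invmx (h *m p) *m Cm q S (h' *m p')).
Proof.
move=> dual hu hu' pu pu' pP pP' H.
have -> : invmx (h *m p) *m Cm q S (h' *m p') = invmx p *m (invmx h *m Cm q S h') *m dualp q p'.
  by rewrite Cm_mul // invmxM // !mulmxA.
apply: inZ_mulP; last exact: dualp_inP dual pu' pP'.
by apply: inP_mulZ => //; apply: inP_inv.
Qed.

End DualParabolic.

Lemma map_invmx_unit (B B' : comUnitRingType) (f : {rmorphism B -> B'}) n (X : 'M[B]_n) :
  X \in unitmx -> map_mx f (invmx X) = invmx (map_mx f X).
Proof.
move=> u; have E : map_mx f (invmx X) *m map_mx f X = 1%:M by rewrite -map_mxM mulVmx // map_mx1.
have [_ fu] := mulmx1_unit E.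
by rewrite -[LHS](mulmxK fu) E mul1mx.
Qed.

Lemma map_unitmx_f (B B' : comUnitRingType) (f : {rmorphism B -> B'}) n (X : 'M[B]_n) :
  X \in unitmx -> map_mx f X \in unitmx.
Proof. by rewrite !unitmxE det_map_mx => u; apply: rmorph_unit. Qed.

Lemma map_Cm (B B' : comUnitRingType) (f : {rmorphism B -> B'}) q n (S X : 'M[B]_n) :
  S \in unitmx -> X \in unitmx -> map_mx f (Cm q S X) = Cm q (map_mx f S) (map_mx f X).
Proof.
move=> Su Xu; rewrite /Cm !map_mxM map_invmx_unit ?unitmx_tr // -!map_trmx.
rewrite fmx_map map_invmx_unit //; congr (_ *m _ *m _).
by apply/matrixP => i j; rewrite !mxE rmorph_nat.
Qed.

(** * Formal deformations of frames *)

Section MatrixCongruence.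
Variable R : idomainType.
Local Notation A := (pser R).

Definition meqm m a b (X Y : 'M[A]_(a, b)) : Prop := forall i j, ps_eqm m (X i j) (Y i j).

Lemma meqm_refl m a b (X : 'M[A]_(a, b)) : meqm m X X. Proof. by []. Qed.
Lemma meqm_0 a b (X Y : 'M[A]_(a, b)) : meqm 0 X Y. Proof. by []. Qed.
Lemma meqm_sym m a b (X Y : 'M[A]_(a, b)) : meqm m X Y -> meqm m Y X.
Proof. by move=> H i j; apply: ps_eqm_sym. Qed.
Lemma meqm_trans m a b (X Y Z : 'M[A]_(a, b)) : meqm m X Y -> meqm m Y Z -> meqm m X Z.
Proof. by move=> H H' i j; apply: ps_eqm_trans (H i j) (H' i j). Qed.
Lemma meqm_le m n a b (X Y : 'M[A]_(a, b)) : (m <= n)%N -> meqm n X Y -> meqm m X Y.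
Proof. by move=> mn H i j; apply: ps_eqm_le mn (H i j). Qed.
Lemma meqmD m a b (X Y X' Y' : 'M[A]_(a, b)) :
  meqm m X X' -> meqm m Y Y' -> meqm m (X + Y) (X' + Y').
Proof. by move=> H H' i j; rewrite !mxE; apply: ps_eqmD. Qed.
Lemma meqmN m a b (X X' : 'M[A]_(a, b)) : meqm m X X' -> meqm m (- X) (- X').
Proof. by move=> H i j; rewrite !mxE; apply: ps_eqmN. Qed.
Lemma ps_eqm_sum m (I : Type) (r : seq I) (P : pred I) (F G : I -> A) :
  (forall i, ps_eqm m (F i) (G i)) ->
  ps_eqm m (\sum_(i <- r | P i) F i) (\sum_(i <- r | P i) G i).
Proof. by move=> H; elim/big_rec2: _ => // i x y _ IH; apply: ps_eqmD. Qed.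
Lemma meqmM m a b c (X X' : 'M[A]_(a, b)) (Y Y' : 'M[A]_(b, c)) :
  meqm m X X' -> meqm m Y Y' -> meqm m (X *m Y) (X' *m Y').
Proof.
by move=> H H' i j; rewrite !mxE; apply: ps_eqm_sum => l; apply: ps_eqmM.
Qed.
Lemma meqm_mul m n a b c (X : 'M[A]_(a, b)) (Y : 'M[A]_(b, c)) :
  meqm m X 0 -> meqm n Y 0 -> meqm (m + n) (X *m Y) 0.
Proof.
move=> H H' i j; rewrite !mxE.
apply: (@ps_eqm_trans _ _ _ (\sum_(l < b) 0)); last by rewrite big1.
apply: ps_eqm_sum => l; apply: ps_eqm_mul => //.
  by have := H i l; rewrite mxE.
by have := H' l j; rewrite mxE.
Qed.
Lemma meqm_mul0l m a b c (X : 'M[A]_(a, b)) (Y : 'M[A]_(b, c)) :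
  meqm m X 0 -> meqm m (X *m Y) 0.
Proof. by move=> H; rewrite -[X in meqm _ _ X](mul0mx _ Y); apply: meqmM H (@meqm_refl _ _ _ _). Qed.
Lemma meqm_mul0r m a b c (X : 'M[A]_(a, b)) (Y : 'M[A]_(b, c)) :
  meqm m Y 0 -> meqm m (X *m Y) 0.
Proof. by move=> H; rewrite -[X in meqm _ _ X](mulmx0 _ X); apply: meqmM (@meqm_refl _ _ _ _) H. Qed.
Lemma meqmMl m a b c (X X' : 'M[A]_(a, b)) (Y : 'M[A]_(b, c)) :
  meqm m X X' -> meqm m (X *m Y) (X' *m Y).
Proof. by move=> H; apply: meqmM H (@meqm_refl _ _ _ _). Qed.
Lemma meqmMr m a b c (X : 'M[A]_(a, b)) (Y Y' : 'M[A]_(b, c)) :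
  meqm m Y Y' -> meqm m (X *m Y) (X *m Y').
Proof. by move=> H; apply: meqmM (@meqm_refl _ _ _ _) H. Qed.
Lemma meqm_tr m a b (X Y : 'M[A]_(a, b)) : meqm m X Y -> meqm m X^T Y^T.
Proof. by move=> H i j; rewrite !mxE; exact: H. Qed.
Lemma meqm_sub0 m a b (X Y : 'M[A]_(a, b)) : meqm m X Y <-> meqm m (X - Y) 0.
Proof.
split=> H; first by rewrite -(subrr Y); apply: meqmD.
by rewrite -[X](subrK Y) -[Y in X in meqm _ _ X]add0r; apply: meqmD.
Qed.
Lemma meqmP a b (X Y : 'M[A]_(a, b)) : (forall m, meqm m X Y) -> X = Y.
Proof. by move=> H; apply/matrixP => i j; apply: ps_eqP => m; apply: H. Qed.

Lemma meqm1P a b (X Y : 'M[A]_(a, b)) :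
  meqm 1 X Y <-> map_mx (@ps_coef0 R) X = map_mx (@ps_coef0 R) Y.
Proof.
split=> [H|H i j [|//] _].
  by apply/matrixP => i j; rewrite !mxE; apply: (H i j 0%N).
by have := congr1 (fun M : 'M_(_, _) => M i j) H; rewrite !mxE.
Qed.

Lemma ps_unitmx n (X : 'M[A]_n) : map_mx (@ps_coef0 R) X \in unitmx -> X \in unitmx.
Proof. by rewrite !unitmxE det_map_mx; apply: ps_unit. Qed.

Lemma ps_constmxK a b (X : 'M[R]_(a, b)) : map_mx (@ps_coef0 R) (map_mx (@ps_const R) X) = X.
Proof. by apply/matrixP => i j; rewrite !mxE. Qed.

Lemma meqm_inv m n (X Y : 'M[A]_n) : X \in unitmx -> Y \in unitmx ->
  meqm m X Y -> meqm m (invmx X) (invmx Y).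
Proof.
move=> Xu Yu /meqm_sub0 H; apply/meqm_sub0.
have -> : invmx X - invmx Y = - (invmx X *m (X - Y) *m invmx Y).
  by rewrite mulmxBr mulmxBl mulVmx // mul1mx mulmxK // opprB.
rewrite -[X in meqm _ _ X]oppr0; apply: meqmN.
apply: meqm_mul0l; exact: meqm_mul0r.
Qed.

Variable q : nat.
Hypothesis (Aq : [pchar A].-nat q) (q2 : (1 < q)%N).

(** Frobenius contracts: a difference divisible by [X^m] has a [q]-th power divisible by [X^(2m)],
    and [2m > m]. Both iterations below gain their precision here. *)
Lemma meqm_fmx m a b (X Y : 'M[A]_(a, b)) : (0 < m)%N -> meqm m X Y ->
  meqm m.+1 (fmx q X) (fmx q Y).
Proof.
move=> m0 /meqm_sub0 H i j; rewrite !mxE.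
have -> : X i j = Y i j + (X - Y) i j by rewrite !mxE [RHS]addrC subrK.
rewrite exprDn_pchar // -[X in ps_eqm _ _ X]addr0; apply: ps_eqmD => //.
have := H i j; rewrite [(0 : 'M_(_, _)) i j]mxE => e0.
rewrite -(subnK q2) addnC exprD expr2 -[X in ps_eqm _ _ X](mul0r ((X - Y) i j ^+ (q - 2))).
apply: ps_eqmM => //; apply: (@ps_eqm_le _ _ (m + m)); first by lia.
exact: ps_eqm_mul.
Qed.

Lemma meqm_Cm m n (S X Y : 'M[A]_n) : (0 < m)%N -> X \in unitmx -> Y \in unitmx ->
  meqm m X Y -> meqm m.+1 (Cm q S X) (Cm q S Y).
Proof.
move=> m0 Xu Yu XY; apply: meqmMl; apply: meqmMr; apply: meqm_tr.
exact: meqm_fmx m0 (meqm_inv Xu Yu XY).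
Qed.

Definition mlim a b (s : nat -> 'M[A]_(a, b)) : 'M[A]_(a, b) :=
  \matrix_(i, j) ps_lim (fun n => s n i j).
Lemma mlimP a b (s : nat -> 'M[A]_(a, b)) : (forall n, meqm n (s n.+1) (s n)) ->
  forall n, meqm n (mlim s) (s n).
Proof.
move=> H n i j; rewrite mxE; apply: (@ps_limP _ (fun n => s n i j)) => m; exact: H.
Qed.

End MatrixCongruence.

Lemma pser_pnat (R : idomainType) q : [pchar R].-nat q -> [pchar (pser R)].-nat q.
Proof. exact: (pchar_rmorph (@ps_const R)). Qed.

(* a formal version of Lang's theorem *)
Lemma lang_lift (R : idomainType) q d (h : bool -> 'M[R]_d) (N S : bool -> 'M[pser R]_d) :
  [pchar R].-nat q -> (1 < q)%N ->
  (forall s, h s \in unitmx) -> (forall s, map_mx (@ps_coef0 R) (N s) \in unitmx) ->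
  (forall s, S s \in unitmx) ->
  (forall s, h s *m map_mx (@ps_coef0 R) (N s) = Cm q (map_mx (@ps_coef0 R) (S s)) (h (~~ s))) ->
  exists H : bool -> 'M[pser R]_d, forall s,
    map_mx (@ps_coef0 R) (H s) = h s /\ H s *m N s = Cm q (S s) (H (~~ s)).
Proof.
move=> Rq q2 hu Nu Su E; have Aq := pser_pnat Rq.
have NU s : N s \in unitmx by apply: ps_unitmx.
(* The solutions are the fixed points of [T], which is contracting because [Cm] involves
   Frobenius. *)
pose T (H : bool -> 'M[pser R]_d) s := Cm q (S s) (H (~~ s)) *m invmx (N s).
pose sq n := iter n T (fun s => map_mx (@ps_const R) (h s)).
have sq0 n s : map_mx (@ps_coef0 R) (sq n s) = h s /\ sq n s \in unitmx.
  suff H : map_mx (@ps_coef0 R) (sq n s) = h s.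
    by split=> //; apply: ps_unitmx; rewrite H.
  elim: n s => [|n IH] s; first exact: ps_constmxK.
  have U : sq n (~~ s) \in unitmx by apply: ps_unitmx; rewrite IH.
  rewrite /sq iterS -/(sq n) /T map_mxM map_Cm // IH -E map_invmx_unit //.
  by rewrite mulmxK.
have sqS n s : meqm n.+1 (sq n.+1 s) (sq n s).
  elim: n s => [|n IH] s; first by apply/meqm1P; rewrite !(sq0 _ _).1.
  exact: (meqmMl _ (meqm_Cm Aq q2 (S s) (ltn0Sn n) (sq0 n.+1 (~~ s)).2 (sq0 n (~~ s)).2 (IH (~~ s)))).
pose H s := mlim (fun n => sq n s).
have HP n s : meqm n (H s) (sq n s).
  by apply: mlimP => m; apply: meqm_le (leqnSn m) (sqS m s).
have H0 s : map_mx (@ps_coef0 R) (H s) = h s.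
  by have /meqm1P -> := HP 1%N s; rewrite (sq0 1%N s).1.
have Hu s : H s \in unitmx by apply: ps_unitmx; rewrite H0.
exists H => s; split=> //.
have EH : H s = Cm q (S s) (H (~~ s)) *m invmx (N s).
  apply: meqmP => m; apply: (@meqm_le _ m m.+2); first by rewrite (leq_trans (leqnSn m)).
  apply: (meqm_trans (HP m.+2 s)).
  exact: (meqmMl _ (meqm_Cm Aq q2 (S s) (ltn0Sn m) (sq0 m.+1 (~~ s)).2 (Hu (~~ s))
     (meqm_sym (HP m.+1 (~~ s))))).
by rewrite EH mulmxKV.
Qed.

Section Germs.
Variables (k : fieldType) (q d : nat).
Hypothesis (kq : [pchar k].-nat q) (q2 : (1 < q)%N).
Variables (D : bool -> seq nat) (S : bool -> 'M[k]_d) (h0 : bool -> 'M[k]_d).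
Hypothesis (Su : forall s, S s \in unitmx) (h0u : forall s, h0 s \in unitmx).

(** A local [k]-algebra with residue field [k]: [al] is the reduction, and nonzero residues come
    from units. *)
Record augmented (R : idomainType) (iota : {rmorphism k -> R}) (al : {rmorphism R -> k}) : Prop := {
  aug_K : forall a, al (iota a) = a;
  aug_unit : forall x, al x != 0 -> x \is a GRing.unit }.

Lemma augmented_id : @augmented k idfun idfun.
Proof. by split=> // x; rewrite unitfE. Qed.

Lemma augmented_pser (R : idomainType) (iota : {rmorphism k -> R}) (al : {rmorphism R -> k}) : @augmented R iota al ->
  @augmented (pser R) (@ps_const R \o iota) (al \o @ps_coef0 R).
Proof. by case=> aK aU; split=> [a|f /aU] /=; [rewrite ps_constK | apply: ps_unit]. Qed.

Lemma aug_unitmx (R : idomainType) (iota : {rmorphism k -> R}) (al : {rmorphism R -> k}) n (X : 'M[R]_n) : @augmented R iota al ->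
  map_mx al X \in unitmx -> X \in unitmx.
Proof.
by move=> [_ U]; rewrite !unitmxE det_map_mx unitfE; apply: U.
Qed.

Definition Nm (R : idomainType) (iota : {rmorphism k -> R}) (h : bool -> 'M[R]_d) s : 'M[R]_d :=
  invmx (h s) *m Cm q (map_mx iota (S s)) (h (~~ s)).

Lemma map_Nm (R R' : idomainType) (iota : {rmorphism k -> R}) (f : {rmorphism R -> R'}) h s :
  (forall s, h s \in unitmx) ->
  map_mx f (Nm iota h s) = Nm (f \o iota) (fun s => map_mx f (h s)) s.
Proof.
move=> hu; rewrite /Nm map_mxM map_invmx_unit // map_Cm ?map_unitmx_f //.
by congr (_ *m Cm _ _ _); apply/matrixP => i j; rewrite !mxE.
Qed.

Hypothesis (N0Z : forall s, inZ (D s) (Nm idfun h0 s)).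

Definition kills (R : idomainType) (iota : k -> R) (del : R -> R) : Prop :=
  dlin id del /\ forall a, del (iota a) = 0.

Lemma kills_0 (R : idomainType) (iota : k -> R) (del : R -> R) : @kills R iota del -> del 0 = 0.
Proof. by case=> -[dD _] _; apply: (addrI (del 0)); rewrite -dD !addr0. Qed.

Lemma kills_1 (R : idomainType) (iota : k -> R) (del : R -> R) : @kills R iota del -> del 1 = 0.
Proof.
case=> -[_ dM] _; have := dM 1 1; rewrite !mulr1 !mul1r => E.
by apply: (addrI (del 1)); rewrite addr0 -E.
Qed.

Lemma kills_deriv (R : idomainType) (iota : {rmorphism k -> R}) : @kills (pser R) (@ps_const R \o iota) (@ps_deriv R).
Proof.
split; first exact: ps_deriv_dlin.
by move=> a; apply: funext => i; rewrite /ps_deriv /ps_const /= mul0rn.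
Qed.

Lemma kills_map (R : idomainType) (iota : {rmorphism k -> R}) (del : R -> R) : kills iota del ->
  kills (@ps_const R \o iota) (ps_map del).
Proof.
move=> Hk; have [Hd Hi] := Hk; split; first exact: ps_map_dlin.
move=> a; apply: funext => i; rewrite /ps_map /ps_const /=.
by case: ifP => _; rewrite ?Hi // (kills_0 Hk).
Qed.

(* the universal deformation, in which the entries of [N] in the allowed positions vary *)
Record big_germ (vars : seq (bool * ('I_d * 'I_d))) (R : idomainType) (iota : {rmorphism k -> R})
    (al : {rmorphism R -> k}) (h N : bool -> 'M[R]_d) : Prop := {
  bg_aug : augmented iota al;
  bg_h : forall s, map_mx al (h s) = h0 s;
  bg_N : forall s, h s *m N s = Cm q (map_mx iota (S s)) (h (~~ s));
  bg_Z : forall s, inZ (D s) (N s);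
  bg_der : forall v, v \in vars -> exists2 del : R -> R, kills iota del &
    forall s, map_mx del (N s) = if s == v.1 then delta_mx v.2.1 v.2.2 else 0 }.

Lemma big_germ_nil : exists (R : idomainType) (iota : {rmorphism k -> R}) al h N, @big_germ [::] R iota al h N.
Proof.
exists k, idfun, idfun, h0, (Nm idfun h0); split=> //; first exact: augmented_id.
- by move=> s; apply: map_mx_id.
- by move=> s; rewrite /Nm mulKVmx.
Qed.

(** A new variable is added to one entry of [N], and the formal Lang theorem carries the frames
    along. The old derivations act on the coefficients. *)
Lemma big_germ_cons (v : bool * ('I_d * 'I_d)) vars (R : idomainType) (iota : {rmorphism k -> R}) (al : {rmorphism R -> k}) h N : @big_germ vars R iota al h N ->
  ~~ nz (D v.1) v.2.1 v.2.2.+1 ->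
  exists (R' : idomainType) (iota' : {rmorphism k -> R'}) al' h' N', @big_germ (v :: vars) R' iota' al' h' N'.
Proof.
case=> aug ha hN NZ der nv.
pose A := pser R; pose iA : {rmorphism k -> A} := @ps_const R \o iota.
pose N' s : 'M[A]_d := map_mx (@ps_const R) (N s) +
  (if s == v.1 then @ps_var R *: delta_mx v.2.1 v.2.2 else 0).
have Rq := pchar_rmorph iota kq.
have N'0 s : map_mx (@ps_coef0 R) (N' s) = N s.
  rewrite /N' map_mxD ps_constmxK; case: eqP => _; last by rewrite map_mx0 addr0.
  apply/matrixP => i j; rewrite !mxE [X in _ + X](_ : _ = 0) ?addr0 //=.
  by rewrite /ps_coef0 psM big_ord1 mul0r.
have hu s : h s \in unitmx by apply: (aug_unitmx aug); rewrite ha.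
have Cu s : Cm q (map_mx iota (S s)) (h (~~ s)) \in unitmx by rewrite Cm_unit ?map_unitmx_f.
have Nu s : N s \in unitmx.
  by have := Cu s; rewrite -hN unitmx_mul => /andP[].
have [h' Hh'] : exists H : bool -> 'M[A]_d, forall s,
    map_mx (@ps_coef0 R) (H s) = h s /\ H s *m N' s = Cm q (map_mx iA (S s)) (H (~~ s)).
  apply: lang_lift => // s; rewrite ?N'0 ?map_unitmx_f //.
  by rewrite hN -map_mx_comp; congr Cm; apply/matrixP => i j; rewrite !mxE /= ps_constK.
exists A, iA, (al \o @ps_coef0 R), h', N'; split.
- exact: augmented_pser.
- by move=> s; rewrite map_mx_comp (Hh' s).1.
- by move=> s; rewrite (Hh' s).2.
- move=> s i j nij; rewrite !mxE NZ // rmorph0 add0r; case: eqP => [E|]; rewrite ?mxE //.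
  case: andP => [[/eqP Ei /eqP Ej]|_]; last by rewrite mulr0.
  by move: nij; rewrite E Ei Ej (negPf nv).
- move=> w; rewrite inE; case: (boolP (w == v)) => [/eqP->|wv] /=.
    move=> _; exists (@ps_deriv R); first exact: kills_deriv.
    move=> s; apply/matrixP => i j; rewrite !mxE.
    rewrite (ps_deriv_dlin R).1 [ps_deriv (ps_const _)](_ : _ = 0) ?add0r; last first.
      by apply: funext => l; rewrite /ps_deriv /ps_const /= mul0rn.
    case: eqP => _; rewrite ?mxE; last by apply: funext => l; rewrite /ps_deriv /= mul0rn.
    case: andP => _; last first.
      by rewrite mulr0; apply: funext => l; rewrite /ps_deriv /= mul0rn.
    rewrite mulr1; apply: funext => l; rewrite /ps_deriv /ps_var eqSS.
    by case: l => [|l] //=; rewrite mul0rn.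
  move=> /der[del Hk Hd]; exists (ps_map del); first exact: kills_map.
  move=> s; apply/matrixP => i j; rewrite !mxE.
  rewrite (ps_map_dlin Hk.1).1 [X in _ + X](_ : _ = 0) ?addr0; last first.
    apply: funext => l; rewrite /ps_map; case: eqP => _; rewrite ?mxE ?(kills_0 Hk) //.
    case: andP => _; rewrite ?mulr1 ?mulr0 ?(kills_0 Hk) // /ps_var.
    by case: eqP => _; rewrite /= ?(kills_0 Hk) ?(kills_1 Hk).
  have := congr1 (fun M : 'M_d => M i j) (Hd s); rewrite mxE => E.
  have -> : (if s == w.1 then delta_mx w.2.1 w.2.2 else 0) i j =
     ps_const ((if s == w.1 then delta_mx w.2.1 w.2.2 else 0 : 'M[R]_d) i j).
    by case: eqP => _; rewrite !mxE ?rmorph0 // rmorph_nat.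
  rewrite -E; apply: funext => l; rewrite /ps_map /ps_const.
  by case: eqP => // _; rewrite (kills_0 Hk).
Qed.

Lemma big_germ_exists (vars : seq (bool * ('I_d * 'I_d))) :
  (forall v, v \in vars -> ~~ nz (D v.1) v.2.1 v.2.2.+1) ->
  exists (R : idomainType) (iota : {rmorphism k -> R}) al h N, @big_germ vars R iota al h N.
Proof.
elim: vars => [|v vars IH] H; first exact: big_germ_nil.
have [|R [iota [al [h [N G]]]]] := IH; first by move=> w wv; apply: H; rewrite inE wv orbT.
by apply: big_germ_cons G _; apply: H; rewrite mem_head.
Qed.

End Germs.

(** * General position of the universal deformation *)

Section Genericity.
Variables (R : idomainType) (d l : nat) (D : seq nat) (h C N : 'M[R]_d) (dels : (R -> R) -> Prop).
Hypothesis (hu : h \in unitmx) (Nu : N \in unitmx) (Cu : C \in unitmx) (hN : h *m N = C).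
Hypothesis dlinD : forall del, dels del -> dlin id del.
Hypothesis delC : forall del, dels del -> forall i j, del (C i j) = 0.
Hypothesis NZ : inZ D N.
Hypothesis delN : forall a b : 'I_d, ~~ nz D a b.+1 -> exists2 del, dels del & map_mx del N = delta_mx a b.
Hypothesis lD : (l < d)%N -> l \in D.
Hypothesis Dd : forall x, x \in D -> (0 < x < d)%N.

Let del0 del : dels del -> del 0 = 0.
Proof. by move=> /dlinD[dD _]; apply: (addrI (del 0)); rewrite -dD !addr0. Qed.

Let map_delM del a b c (X : 'M[R]_(a, b)) (Y : 'M[R]_(b, c)) : dels del ->
  map_mx del (X *m Y) = X *m map_mx del Y + map_mx del X *m Y.
Proof.
move=> dd; have [dD dM] := dlinD dd; apply/matrixP => i j; rewrite !mxE.
rewrite (big_morph del dD (del0 dd)) -big_split; apply: eq_bigr => u _ /=.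
by rewrite !mxE dM.
Qed.

Let map_del1 del n : dels del -> map_mx del (1%:M : 'M[R]_n) = 0.
Proof.
move=> dd; have d1 : del 1 = 0.
  have := (dlinD dd).2 1 1; rewrite !mulr1 !mul1r => E.
  by apply: (addrI (del 1)); rewrite addr0 -E.
by apply/matrixP => i j; rewrite !mxE; case: eqP => _; rewrite ?d1 ?(del0 dd).
Qed.

Definition const_row (c : 'rV[R]_d) : Prop := forall del, dels del -> map_mx del c = 0.

Lemma const_row_invC i : const_row (row i (invmx C)).
Proof.
move=> del dd; have dC : map_mx del C = 0 by apply/matrixP => a b; rewrite !mxE delC.
have := map_delM (invmx C) C dd; rewrite mulVmx // map_del1 // dC mulmx0 add0r => E.
have {}E : map_mx del (invmx C) = 0 by rewrite -[LHS](mulmxK Cu) -E mul0mx.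
by apply/rowP => j; rewrite !mxE; have := congr1 (fun M : 'M_d => M i j) E; rewrite !mxE.
Qed.

(** As derivations kill [C = h N], moving entry [(j, b')] of [N] changes [c *m h] by entry [j] of
    [c *m h] times minus row [b'] of [invmx N]. If the first [l] entries stay zero while entry [j]
    is nonzero, these rows vanish on the first [l] columns; by induction they vanish further, and
    the zero block makes [N] singular. *)
Lemma generic_row_aux a : forall c, const_row c -> (forall b : 'I_d, (b < l)%N -> (c *m h) ord0 b = 0) ->
  forall j : 'I_d, j = a :> nat -> (c *m h) ord0 j = 0.
Proof.
elim/ltn_ind: a => a IH c cc cl j ja.
apply: contrapT => /eqP rj.
have lj : (l <= j)%N by rewrite leqNgt; apply: contra rj => /cl->.
have lD' : l \in D by apply: lD; apply: leq_ltn_trans lj (ltn_ord j).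
have KN (b b' : 'I_d) : (b < l)%N -> ~~ nz D j (nat_of_ord b').+1 -> (invmx N) b' b = 0.
  move=> bl /delN[del dd dN].
  have dh : map_mx del h *m N = - (h *m delta_mx j b').
    apply/eqP; rewrite -addr_eq0 addrC -dN -map_delM // hN.
    by apply/eqP/matrixP => u v; rewrite !mxE delC.
  have E : map_mx del (c *m h) = - (c *m h *m delta_mx j b' *m invmx N).
    rewrite map_delM // cc // mul0mx addr0 -[map_mx del h](mulmxK Nu) dh.
    by rewrite mulNmx mulmxN !mulmxA.
  have := congr1 (fun M : 'rV_d => M ord0 b) E; rewrite mxE cl // del0 //.
  rewrite mxE mxE (bigD1 b') //= big1 => [|u ub]; last first.
    rewrite mxE big1 ?mul0r // => v _.
    by rewrite [delta_mx _ _ _ _]mxE (negPf ub) andbF mulr0.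
  rewrite addr0 mxE (bigD1 j) //= big1 => [|v vj]; last first.
    by rewrite [delta_mx _ _ _ _]mxE (negPf vj) mulr0.
  rewrite [delta_mx _ _ _ _]mxE !eqxx mulr1 addr0 => /esym/eqP.
  by rewrite oppr_eq0 mulf_eq0 (negPf rj) => /eqP.
(* With [x] the last flag dimension up to [j], the free positions [(j, b')] are those with
   [b' >= x - 1]. *)
have [x [xD xj xmax]] : exists x, [/\ x \in D, (x <= j)%N & forall y, y \in D -> (y <= j)%N -> (y <= x)%N].
  have ex : exists x, (x \in D) && (x <= j)%N by exists l; rewrite lD' lj.
  have bd x : (x \in D) && (x <= j)%N -> (x <= j)%N by case/andP.
  case: (ex_maxnP ex bd) => x /andP[xD xj] xmax; exists x; split=> // y yD yj.
  by apply: xmax; rewrite yD.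
(* The induction hypothesis is applied to another constant row, that of [invmx C], at columns below
   [x <= j]. *)
have zero (a' b : 'I_d) : (x.-1 <= a')%N -> (b < x)%N -> (invmx N) a' b = 0.
  move=> xa bx.
  have rowE b' : (row a' (invmx C) *m h) ord0 b' = (invmx N) a' b'.
    rewrite -row_mul mxE; have -> // : invmx C *m h = invmx N.
    by rewrite -hN invmxM // mulmxKV.
  rewrite -rowE; apply: (IH b) => //; first by rewrite -ja (leq_trans bx).
    exact: const_row_invC.
  move=> b' b'l; rewrite rowE; apply: KN => //; apply/nzP => -[y yD /andP[ay yj]].
  by have := xmax y yD yj; have := Dd yD; lia.
have : \det (invmx N) = 0.
  apply: (@det_zero_block _ _ _ x) => //; first by have := Dd xD; lia.
by move=> E; move: Nu; rewrite -unitmx_inv unitmxE E unitr0.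
Qed.

Lemma generic_row c : const_row c -> c != 0 -> exists2 b : 'I_d, (b < l)%N & (c *m h) ord0 b != 0.
Proof.
move=> cc c0; apply: contrapT => H; case/eqP: c0.
rewrite -[c](mulmxK hu) (_ : c *m h = 0) ?mul0mx //; apply/rowP => j; rewrite [RHS]mxE.
apply: (@generic_row_aux j c cc _ j erefl) => b bl.
by apply/eqP/negPn/negP => nz; apply: H; exists b.
Qed.

(** The rows of [invmx N] are the constant rows of [invmx C] multiplied by [h]. *)
Lemma generic_last i : exists2 b : 'I_d, (b < l)%N & (invmx N) i b != 0.
Proof.
have [||b bl] := @generic_row (row i (invmx C)); first exact: const_row_invC.
  apply: contraTneq Cu => E; apply/negP => Cu'.
  have := congr1 (fun v : 'rV_d => (v *m C) ord0 i) E.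
  by rewrite -row_mul mulVmx // mul0mx !mxE eqxx => /eqP; rewrite oner_eq0.
rewrite -row_mul mxE => nzb; exists b => //; move: nzb.
by have -> : invmx C *m h = invmx N by rewrite -hN invmxM // mulmxKV.
Qed.

End Genericity.

(** * Germs of normalized frames by Newton's method *)

Section NormalGerms.
Variables (k : fieldType) (q d : nat).
Hypothesis (kq : [pchar k].-nat q) (q2 : (1 < q)%N).
Variables (D : bool -> seq nat) (S : bool -> 'M[k]_d) (h0 : bool -> 'M[k]_d) (pi : bool -> 'S_d).
Hypothesis (Su : forall s, S s \in unitmx) (h0u : forall s, h0 s \in unitmx).
Hypothesis h0n : forall s, normalized (D s) (pi s) (h0 s).
Hypothesis N0Z : forall s, inZ (D s) (Nm q S idfun h0 s).
Variables (dim : bool -> nat) (c Lam : forall s, 'I_(dim s) -> 'M[k]_d).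
Hypothesis cN : forall s e, inN (D s) (c (s := s) e).
Hypothesis cZ : forall s e, inZ (D s) (c (s := s) e *m Nm q S idfun h0 s).

(** A linear functional with coefficients in [k], extended to matrices over any ring under [k]. On
    normalized frames these functionals are the local coordinates. *)
Definition lam (R : comNzRingType) (iota : k -> R) s f (M : 'M[R]_d) : R :=
  \sum_i \sum_j iota (Lam (s := s) f i j) * M i j.

Hypothesis lam_c : forall s f e, lam idfun f (h0 s *m c (s := s) e) = (f == e)%:R.

Lemma lamD (R : comNzRingType) (iota : k -> R) s (f : 'I_(dim s)) (M M' : 'M[R]_d) : @lam R iota s f (M + M') = lam iota f M + lam iota f M'.
Proof.
rewrite /lam -big_split; apply: eq_bigr => i _; rewrite -big_split.
by apply: eq_bigr => j _; rewrite mxE mulrDr.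
Qed.
Lemma lamZ (R : comNzRingType) (iota : k -> R) s (f : 'I_(dim s)) a (M : 'M[R]_d) : @lam R iota s f (a *: M) = a * lam iota f M.
Proof.
rewrite /lam big_distrr; apply: eq_bigr => i _; rewrite big_distrr.
by apply: eq_bigr => j _ /=; rewrite mxE mulrCA.
Qed.
Lemma lam0 (R : comNzRingType) (iota : k -> R) s (f : 'I_(dim s)) : @lam R iota s f 0 = 0.
Proof. by rewrite -(scale0r 0) lamZ mul0r. Qed.
Lemma lam_sum (R : comNzRingType) (iota : k -> R) s (f : 'I_(dim s)) (I : finType) (F : I -> 'M[R]_d) :
  @lam R iota s f (\sum_i F i) = \sum_i lam iota f (F i).
Proof. by apply: (big_morph _ (@lamD R iota s f) (lam0 iota f)). Qed.
Lemma lam_map (R R' : comNzRingType) (g : {rmorphism R -> R'}) (iota : k -> R) s (f : 'I_(dim s)) (M : 'M[R]_d) :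
  g (@lam R iota s f M) = lam (g \o iota) f (map_mx g M).
Proof.
rewrite /lam rmorph_sum; apply: eq_bigr => i _; rewrite rmorph_sum.
by apply: eq_bigr => j _; rewrite rmorphM mxE.
Qed.
Lemma eq_lam (R : comNzRingType) (i1 i2 : k -> R) s (f : 'I_(dim s)) (M : 'M[R]_d) :
  i1 =1 i2 -> @lam R i1 s f M = lam i2 f M.
Proof. by move=> E; rewrite /lam; do 2!(apply: eq_bigr => ? _); rewrite E. Qed.

Lemma lam_eqm (R : idomainType) (iota : k -> pser R) m s (f : 'I_(dim s)) (M M' : 'M[pser R]_d) :
  meqm m M M' -> ps_eqm m (@lam _ iota s f M) (lam iota f M').
Proof.
move=> H; do 2!(apply: ps_eqm_sum => ?); apply: ps_eqmM; [exact: ps_eqm_refl | exact: H].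
Qed.

Section Newton.
Variables (R : idomainType) (iota : {rmorphism k -> R}) (al : {rmorphism R -> k}).
Hypothesis aug : augmented iota al.
Variable h : bool -> 'M[R]_d.
Hypothesis hal : forall s, map_mx al (h s) = h0 s.
Hypothesis hn : forall s, normalized (D s) (pi s) (h s).
Hypothesis hZ : forall s, inZ (D s) (Nm q S iota h s).

Let A := pser R.
Let iA : {rmorphism k -> A} := @ps_const R \o iota.
Variable tg : forall s, 'I_(dim s) -> A.
Hypothesis tg0 : forall s f, ps_coef0 (tg (s := s) f) = lam iota f (h s).

Let hu s : h s \in unitmx. Proof. by apply: (aug_unitmx aug); rewrite hal. Qed.
Let Rq : [pchar R].-nat q. Proof. exact: (pchar_rmorph iota kq). Qed.
Let Aq : [pchar A].-nat q. Proof. exact: pser_pnat. Qed.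
Let Nu s : Nm q S iota h s \in unitmx.
Proof. by rewrite /Nm unitmx_mul unitmx_inv hu Cm_unit ?map_unitmx_f. Qed.
Let aliota : al \o iota =1 idfun. Proof. by move=> x; apply: (aug_K aug). Qed.
Let map_aliota n m (M : 'M[k]_(n, m)) : map_mx al (map_mx iota M) = M.
Proof. by apply/matrixP => i j; rewrite !mxE; apply: aliota. Qed.
Let Nal s : map_mx al (Nm q S iota h s) = Nm q S idfun h0 s.
Proof.
rewrite map_Nm //.
rewrite /Nm !hal; congr (_ *m Cm _ _ _); apply/matrixP => i j; rewrite !mxE; exact: aliota.
Qed.

(** The solutions [c] of the linearized condition at [h0], spread out over [R]. The part dropped by
    [projN] is in [inP] and does not disturb [inZ]. *)
Let cR s e : 'M[R]_d := projN (D s) (map_mx iota (c (s := s) e *m Nm q S idfun h0 s) *m invmx (Nm q S iota h s)).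
Let LR s : 'M[R]_(dim s) := \matrix_(f, e) lam iota f (h s *m cR (s := s) e).

Let LRu s : LR s \in unitmx.
Proof.
apply: (aug_unitmx aug); suff -> : map_mx al (LR s) = 1%:M by apply: unitmx1.
apply/matrixP => f e; rewrite !mxE lam_map (eq_lam _ _ aliota) map_mxM hal.
suff -> : map_mx al (cR e) = c e by apply: lam_c.
have N0u : Nm q S idfun h0 s \in unitmx by rewrite -Nal map_unitmx_f.
have -> : map_mx al (cR e) = projN (D s) (map_mx al (map_mx iota (c e *m Nm q S idfun h0 s) *m
    invmx (Nm q S iota h s))).
  by apply/matrixP => i j; rewrite [LHS]mxE [RHS]mxE [cR e i j]mxE; case: ifP => _; [rewrite [RHS]mxE | rewrite rmorph0].
by rewrite map_mxM map_aliota map_invmx_unit // Nal mulmxK // projN_id.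
Qed.

Let hb s : 'M[A]_d := map_mx (@ps_const R) (h s).
Let Nb s : 'M[A]_d := map_mx (@ps_const R) (Nm q S iota h s).
Let cb s e : 'M[A]_d := map_mx (@ps_const R) (cR (s := s) e).

Let Nbu s : Nb s \in unitmx. Proof. exact: map_unitmx_f. Qed.

(** Deformations are unobstructed: since [inP] times [inZ] lies in [inZ], any error outside [inZ] is
    corrected by an element of the opposite nilradical. *)
Let inZ_proj (B : comUnitRingType) (s : bool) (X N : 'M[B]_d) : N \in unitmx -> inZ (D s) N ->
  outZ (D s) (projN (D s) (X *m invmx N) *m N) = outZ (D s) X.
Proof.
move=> Nu' NZ'; have PZ := inP_mulZ (@projN_inP _ _ (D s) (X *m invmx N)) NZ'.
move: PZ; rewrite mulmxBl mulmxKV // => PZ.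
apply/matrixP => i j; rewrite [LHS]mxE [RHS]mxE; case: ifP => // nij.
have := PZ i j nij; rewrite mxE [X in _ + X]mxE => /eqP.
by rewrite subr_eq0 => /eqP.
Qed.

Let cbZ s e : outZ (D s) (cb (s := s) e *m Nb s) = 0.
Proof.
have E : outZ (D s) (cR e *m Nm q S iota h s) = 0.
  rewrite inZ_proj //; apply/outZ_eq0 => i j nij; rewrite mxE cZ ?rmorph0 //.
rewrite /cb /Nb -map_mxM; apply/outZ_eq0 => i j nij; rewrite mxE.
by move/outZ_eq0: E => ->; rewrite ?rmorph0.
Qed.

Let NbE s : Nb s = Nm q S iA hb s.
Proof. exact: (@map_Nm _ _ _ _ Su _ _ iota (@ps_const R) h s hu). Qed.

Let NbZ s : inZ (D s) (Nb s).
Proof. by move=> i j nij; rewrite mxE hZ ?rmorph0. Qed.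

Let NH (H : bool -> 'M[A]_d) s := Nm q S iA H s.
(** One Newton step: [nu1] removes the part of [NH H] outside [inZ]; [beta] then corrects the
    coordinates along the solutions [cb], which leave that part unchanged. *)
Let nu1 (H : bool -> 'M[A]_d) s := projN (D s) (outZ (D s) (NH H s) *m invmx (Nb s)).
Let beta (H : bool -> 'M[A]_d) s : 'cV[A]_(dim s) :=
  - (invmx (map_mx (@ps_const R) (LR s)) *m
     \col_f (lam iA f (H s) - tg f + lam iA f (hb s *m nu1 H s))).
Let nu (H : bool -> 'M[A]_d) s := nu1 H s + \sum_e beta H s e ord0 *: cb e.
Let T (H : bool -> 'M[A]_d) s := H s + hb s *m nu H s.

Let good n (H : bool -> 'M[A]_d) : Prop :=
  [/\ forall s, map_mx (@ps_coef0 R) (H s) = h s,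
      forall s, normalized (D s) (pi s) (H s),
      forall s, meqm n.+1 (outZ (D s) (NH H s)) 0 &
      forall s f, ps_eqm n.+1 (lam iA f (H s)) (tg (s := s) f)].

Let projN_eqm n s (X : 'M[A]_d) : meqm n X 0 -> meqm n (projN (D s) X) 0.
Proof.
move=> H i j; have := H i j; rewrite !mxE; by case: ifP.
Qed.

Let outZ_eqm n s (X Y : 'M[A]_d) : meqm n X Y -> meqm n (outZ (D s) X) (outZ (D s) Y).
Proof. by move=> H i j; have := H i j; rewrite !mxE; case: ifP. Qed.

Let hbn s : normalized (D s) (pi s) (hb s).
Proof. by move=> i j nij; rewrite mxE hn // rmorph_nat. Qed.

(** At the precision gained, [NH (H + hb nu)] is [NH H - nu Nb]: the twisted factor is already
    constant there, because of Frobenius. *)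
Let Tgood n H : good n H -> good n.+1 (T H) /\ (forall s, meqm n.+1 (T H s) (H s)).
Proof.
case=> H0 Hn HZ HL.
have nu1e s : meqm n.+1 (nu1 H s) 0 by apply: projN_eqm; apply: meqm_mul0l; exact: HZ.
have betae s : meqm n.+1 (beta H s) 0.
  rewrite -[X in meqm _ _ X]oppr0; apply: meqmN; apply: meqm_mul0r => f j.
  rewrite !mxE -[X in ps_eqm _ _ X]addr0; apply: ps_eqmD.
    rewrite -(subrr (tg f)); apply: ps_eqmD (HL s f) _; exact: ps_eqm_refl.
  rewrite -(lam0 iA f); apply: lam_eqm; apply: meqm_mul0r; exact: nu1e.
have nue s : meqm n.+1 (nu H s) 0.
  rewrite -[X in meqm _ _ X]addr0; apply: meqmD; first exact: nu1e.
  move=> i j; rewrite summxE mxE.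
  apply: (@ps_eqm_trans _ _ _ (\sum_(e < dim s) 0)); last by rewrite big1.
  apply: ps_eqm_sum => e; rewrite mxE -[X in ps_eqm _ _ X](mul0r (cb e i j)).
  apply: ps_eqmM; last exact: ps_eqm_refl.
  by have := betae s e ord0; rewrite [X in ps_eqm _ _ X]mxE.
have nuN s : inN (D s) (nu H s).
  apply: inND; first exact: projN_inN.
  move=> i j nij; rewrite summxE big1 // => e _.
  by rewrite !mxE (negPf nij) rmorph0 mulr0.
have de s : meqm n.+1 (hb s *m nu H s) 0 by apply: meqm_mul0r; exact: nue.
have Te s : meqm n.+1 (T H s) (H s).
  rewrite -[X in meqm _ _ X]addr0; apply: meqmD; [exact: meqm_refl | exact: de].
have T0 s : map_mx (@ps_coef0 R) (T H s) = h s.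
  by rewrite -H0; apply/meqm1P; exact: (meqm_le (ltn0Sn n) (Te s)).
have Hu s : H s \in unitmx by apply: ps_unitmx; rewrite H0.
have Tu s : T H s \in unitmx by apply: ps_unitmx; rewrite T0.
have hbu s : hb s \in unitmx by apply: map_unitmx_f.
have Hhb s : meqm 1 (H s) (hb s) by apply/meqm1P; rewrite H0 ps_constmxK.
have Thb s : meqm 1 (T H s) (hb s) by apply/meqm1P; rewrite T0 ps_constmxK.
split; last exact: Te.
split; first exact: T0.
- move=> s i j nij; rewrite mxE Hn //.
  have -> : (hb s *m nu H s) (pi s i) j = 0; last by rewrite addr0.
  have := normalizedD (@hbn s) (@nuN s) nij; rewrite mxE hbn // => E.
  by apply: (addrI (i == j)%:R); rewrite addr0.
- move=> s.
  have NN : meqm n.+2 (NH (T H) s) (NH H s - nu H s *m Nb s).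
    have CC : meqm n.+2 (Cm q (map_mx iA (S s)) (T H (~~ s))) (Cm q (map_mx iA (S s)) (H (~~ s))).
      exact: (meqm_Cm Aq q2 _ (ltn0Sn n) (Tu (~~ s)) (Hu (~~ s)) (Te (~~ s))).
    have II : meqm n.+2 (invmx (T H s)) (invmx (H s) - invmx (H s) *m (hb s *m nu H s) *m invmx (H s)).
      have EI : invmx (T H s) = invmx (H s) - invmx (T H s) *m (hb s *m nu H s) *m invmx (H s).
        have -> : hb s *m nu H s = T H s - H s by rewrite /T addrC addKr.
        by rewrite mulmxBr mulVmx // mulmxBl mul1mx mulmxK // opprB addrCA subrr addr0.
      rewrite {1}EI; apply: meqmD; first exact: meqm_refl.
      apply: meqmN; apply: meqmMl; apply/meqm_sub0; rewrite -mulmxBl -[n.+2]add1n.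
      apply: meqm_mul; last exact: de.
      apply: (iffLR (meqm_sub0 _ _ _)); apply: (meqm_inv (Tu s) (Hu s)).
      exact: (meqm_trans (Thb s) (meqm_sym (Hhb s))).
    apply: (meqm_trans (meqmM II CC)); rewrite mulmxBl; apply: meqmD; first exact: meqm_refl.
    apply: meqmN; rewrite -!mulmxA -/(Nm q S iA H s) -/(NH H s).
    have -> : invmx (H s) *m (hb s *m (nu H s *m NH H s)) = (invmx (H s) *m hb s) *m (nu H s *m NH H s).
      by rewrite !mulmxA.
    have X1 : meqm n.+2 (invmx (H s) *m hb s *m (nu H s *m NH H s)) (nu H s *m NH H s).
      apply/meqm_sub0; rewrite -{2}[nu H s *m _]mul1mx -mulmxBl -[n.+2]add1n; apply: meqm_mul.
        apply: (iffLR (meqm_sub0 _ _ _)); rewrite -(mulVmx (Hu s)); apply: meqmMr; exact: meqm_sym.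
      by apply: meqm_mul0l; exact: nue.
    apply: (meqm_trans X1); apply/meqm_sub0; rewrite -mulmxBr -[n.+2]addn1.
    apply: meqm_mul; first exact: nue.
    apply: (iffLR (meqm_sub0 _ _ _)); rewrite /NH NbE; apply: meqmM.
      exact: (meqm_inv (Hu s) (hbu s) (Hhb s)).
    exact: (meqm_le (leqnSn 1) (meqm_Cm Aq q2 _ (ltn0Sn 0) (Hu (~~ s)) (hbu (~~ s)) (Hhb (~~ s)))).
  apply: (meqm_trans (outZ_eqm s NN)).
  have -> : outZ (D s) (NH H s - nu H s *m Nb s) = outZ (D s) (NH H s) - outZ (D s) (nu H s *m Nb s).
    exact: outZB.
  have -> : outZ (D s) (nu H s *m Nb s) = outZ (D s) (NH H s).
    rewrite mulmxDl mulmx_suml.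
    have -> : outZ (D s) (nu1 H s *m Nb s + \sum_e beta H s e ord0 *: cb e *m Nb s) =
        outZ (D s) (nu1 H s *m Nb s).
      apply/matrixP => i j; rewrite [LHS]mxE [RHS]mxE; case: ifP => // nij.
      rewrite mxE summxE big1 ?addr0 // => e _; rewrite -scalemxAl mxE.
      by move/outZ_eq0: (cbZ e) => ->; rewrite ?mulr0.
    by rewrite inZ_proj // outZ_id.
  by rewrite subrr; exact: meqm_refl.
- move=> s f.
  have -> : lam iA f (T H s) = tg f; last exact: ps_eqm_refl.
  rewrite /T /nu mulmxDr !lamD mulmx_sumr lam_sum.
  have -> : \sum_e lam iA f (hb s *m (beta H s e ord0 *: cb e)) =
      (map_mx (@ps_const R) (LR s) *m beta H s) f ord0.
    rewrite [RHS]mxE; apply: eq_bigr => e _; rewrite -scalemxAr lamZ mulrC; congr (_ * _).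
    by rewrite !mxE lam_map map_mxM.
  rewrite /beta mulmxN mulKVmx ?map_unitmx_f // !mxE.
  by ring.
Qed.

(** The iteration starts at the constant frames [hb]. The coordinates can be prescribed because
    their matrix [LR] on the solutions reduces to the identity, hence is invertible. *)
Lemma newton_lift : exists H : bool -> 'M[A]_d, [/\
  forall s, map_mx (@ps_coef0 R) (H s) = h s, forall s, normalized (D s) (pi s) (H s),
  forall s, inZ (D s) (Nm q S iA H s) & forall s f, lam iA f (H s) = tg (s := s) f].
Proof.
pose sq n := iter n T hb.
have sqg n : good n (sq n).
  elim: n => [|n IH]; last by rewrite /sq iterS; exact: (Tgood IH).1.
  split=> [s|//|s|s f]; first exact: ps_constmxK.
    rewrite /NH /sq /= -NbE (_ : outZ _ _ = 0); first exact: meqm_refl.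
    by apply/outZ_eq0.
  case=> [|//] _; rewrite /sq /= -[LHS]/(ps_coef0 _) -[RHS]/(ps_coef0 _) tg0.
  by rewrite /hb -lam_map.
have sqS n s : meqm n.+1 (sq n.+1 s) (sq n s) by rewrite /sq iterS; exact: (Tgood (sqg n)).2.
pose H s := mlim (fun n => sq n s).
have HP n s : meqm n (H s) (sq n s).
  by apply: mlimP => m; apply: meqm_le (leqnSn m) (sqS m s).
have H0 s : map_mx (@ps_coef0 R) (H s) = h s.
  by have /meqm1P -> := HP 1%N s; case: (sqg 1%N).
have Hu s : H s \in unitmx by apply: ps_unitmx; rewrite H0.
have squ n s : sq n s \in unitmx by apply: ps_unitmx; have [-> _ _ _] := sqg n.
exists H; split; first exact: H0.
- move=> s i j nij; apply: ps_eqP => n; apply: (ps_eqm_trans (HP n s _ _)).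
  have [_ Hn _ _] := sqg n; rewrite Hn //; exact: ps_eqm_refl.
- move=> s; apply/outZ_eq0; apply: meqmP => n.
  have [_ _ Z _] := sqg n; apply: (meqm_trans _ (meqm_le (leqnSn n) (Z s))).
  apply: outZ_eqm; apply: meqmM; first exact: (meqm_inv (Hu s) (squ n s) (HP n s)).
  case: n {Z} => [|n]; first exact: meqm_0.
  exact: (meqm_le (leqnSn n.+1) (meqm_Cm Aq q2 _ (ltn0Sn n) (Hu (~~ s)) (squ n.+1 (~~ s)) (HP n.+1 (~~ s)))).
- move=> s f; apply: ps_eqP => n; have [_ _ _ L] := sqg n.
  apply: (ps_eqm_trans _ (ps_eqm_le (leqnSn n) (L s f))).
  apply: lam_eqm; exact: HP.
Qed.

End Newton.

(** In contrast with the universal deformation, the frames stay in one chart and only the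
    coordinates in [vars] vary, the others keeping their values at [h0]. *)
Record normal_germ (vars : seq {s : bool & 'I_(dim s)}) (R : idomainType)
    (iota : {rmorphism k -> R}) (al : {rmorphism R -> k}) (h : bool -> 'M[R]_d) : Prop := {
  ng_aug : augmented iota al;
  ng_h : forall s, map_mx al (h s) = h0 s;
  ng_norm : forall s, normalized (D s) (pi s) (h s);
  ng_Z : forall s, inZ (D s) (Nm q S iota h s);
  ng_lam : forall s (f : 'I_(dim s)), existT _ s f \notin vars ->
     lam iota f (h s) = iota (lam idfun f (h0 s));
  ng_der : forall v, v \in vars -> exists2 del : R -> R, kills iota del &
     forall s (f : 'I_(dim s)), del (lam iota f (h s)) = (existT _ s f == v)%:R }.

Lemma normal_germ_nil : @normal_germ [::] k idfun idfun h0.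
Proof.
split=> //; first exact: augmented_id.
by move=> s; apply: map_mx_id.
Qed.

Lemma normal_germ_cons v vars (R : idomainType) (iota : {rmorphism k -> R}) al h :
  normal_germ vars iota al h -> v \notin vars ->
  exists2 h' : bool -> 'M[pser R]_d,
    @normal_germ (v :: vars) (pser R) (@ps_const R \o iota) (al \o @ps_coef0 R) h' &
    forall s, map_mx (@ps_coef0 R) (h' s) = h s.
Proof.
case=> aug ha hn hZ hlam der nv.
pose tg s (f : 'I_(dim s)) : pser R := ps_const (lam iota f (h s)) +
  (if existT _ s f == v then @ps_var R else 0).
have [s f|H [H0 Hn HZ HL]] := newton_lift aug ha hn hZ (tg := tg).
  by rewrite /tg rmorphD /= ps_constK; case: ifP => _; rewrite /ps_coef0 ?addr0 // /ps_var /= addr0.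
exists H => //; split=> //; first exact: augmented_pser.
- by move=> s; rewrite map_mx_comp H0.
- move=> s f; rewrite inE negb_or => /andP[nfv fv]; rewrite HL /tg (negPf nfv) addr0.
  by rewrite hlam.
- move=> w; rewrite inE; case: (boolP (w == v)) => [/eqP->|wv] /=.
    move=> _; exists (@ps_deriv R); first exact: kills_deriv.
    move=> s f; rewrite HL /tg (ps_deriv_dlin R).1 [ps_deriv (ps_const _)](_ : _ = 0) ?add0r.
      case: ifP => _; apply: funext => l; rewrite /ps_deriv.
        by rewrite /ps_var eqSS; case: l => [|l] //=; rewrite mul0rn.
      by rewrite /= mul0rn.
    by apply: funext => l; rewrite /ps_deriv /ps_const /= mul0rn.
  move=> wvars; have [del Hk Hd] := der w wvars; exists (ps_map del); first exact: kills_map.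
  move=> s f; rewrite HL /tg (ps_map_dlin Hk.1).1 [X in _ + X](_ : _ = 0) ?addr0.
    transitivity (ps_const ((existT _ s f == w)%:R : R)); last by rewrite rmorph_nat.
    rewrite -Hd; apply: funext => l; rewrite /ps_map /ps_const.
    by case: eqP => // _; rewrite (kills_0 Hk).
  apply: funext => l; rewrite /ps_map; case: ifP => _; rewrite ?(kills_0 Hk) // /ps_var.
  by case: eqP => _; rewrite /= ?(kills_0 Hk) ?(kills_1 Hk).
Qed.

End NormalGerms.

(* the least element of [D] which exceeds [j], or [d] *)
Definition nxt (D : seq nat) (d j : nat) : nat := foldr minn d [seq x <- D | (j < x)%N].

Lemma nxt_le D d j x : x \in D -> (j < x)%N -> (nxt D d j <= x)%N.
Proof.
rewrite /nxt => xD jx; have : x \in [seq x <- D | (j < x)%N] by rewrite mem_filter jx.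
elim: [seq _ <- _ | _] => //= a s IH; rewrite inE => /orP[/eqP->|/IH]; first exact: geq_minl.
by apply: leq_trans; apply: geq_minr.
Qed.

Lemma nxt_gt D d j : (j < d)%N -> (j < nxt D d j)%N.
Proof.
move=> jd; rewrite /nxt; have : all (fun x => j < x)%N [seq x <- D | (j < x)%N] by apply: filter_all.
by elim: [seq _ <- _ | _] => //= a s IH /andP[ja /IH]; rewrite leq_min ja.
Qed.

Lemma nxt_led D d j : (nxt D d j <= d)%N.
Proof. by rewrite /nxt; elim: [seq _ <- _ | _] => //= a s IH; rewrite geq_min IH orbT. Qed.

Lemma nxt_in D d j : (nxt D d j < d)%N -> nxt D d j \in D.
Proof.
rewrite /nxt => lt.
have : foldr minn d [seq x <- D | (j < x)%N] \in [seq x <- D | (j < x)%N].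
  move: lt; elim: [seq _ <- _ | _] => /= [|a s IH]; first by rewrite ltnn.
  move: (foldr minn d s) IH => m IH; case: (ltngtP a m) => am H.
  - by rewrite mem_head.
  - by rewrite inE (IH H) orbT.
  - by rewrite am mem_head.
by rewrite mem_filter => /andP[].
Qed.

Lemma nz_nxt D d (i j : nat) : (forall x, x \in D -> (x < d)%N) -> (j < d)%N -> (i < d)%N ->
  nz D i j = (nxt D d j <= i)%N.
Proof.
move=> Dd jd id; apply/nzP/idP => [[x xD /andP[jx xi]]|le].
  exact: leq_trans (nxt_le d xD jx) xi.
have nd := leq_ltn_trans le id.
by exists (nxt D d j); [apply: nxt_in | rewrite nxt_gt].
Qed.

(** * Flags in Pluecker coordinates *)

Section Minors.
Variable B : comNzRingType.

(** Pluecker coordinates over an arbitrary commutative ring, as needed for germs and for matrices of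
    variables. *)
Definition gpl d (A : 'M[B]_d) (x : 'I_d) (c : {ffun 'I_x -> 'I_d}) : B :=
  \det (mxsub c (widen_ord (ltnW (ltn_ord x))) A).

Definition gpp d (J : {set 'I_d}) (A : 'M[B]_d) (c : plucker_index J) : B :=
  \prod_(x : {x : 'I_d | x \in flag_dims J}) gpl A (c x).

(* Cramer's rule *)
Lemma det_row_subst n (L M : 'M[B]_n) (j : 'I_n) :
  (forall i l, i != j -> M i l = L i l) -> \det M = (row j M *m \adj L) ord0 j.
Proof.
move=> ML; rewrite (expand_det_row M j) mxE; apply: eq_bigr => l _.
rewrite !mxE; congr (_ * _); rewrite /cofactor; congr (_ * \det _).
by apply/matrixP => a b; rewrite !mxE ML // eq_sym neq_lift.
Qed.

Lemma det_adj_mul n (M : 'M[B]_n) : \det (\adj M) * \det M = (\det M) ^+ n.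
Proof. by rewrite -det_mulmx mul_adj_mx det_scalar. Qed.

End Minors.

Lemma gpl_map (B B' : comNzRingType) (f : {rmorphism B -> B'}) d (A : 'M[B]_d) x c :
  f (@gpl B d A x c) = gpl (map_mx f A) c.
Proof. by rewrite /gpl -det_map_mx; congr (\det _); apply/matrixP => i j; rewrite !mxE. Qed.

Lemma gpp_map (B B' : comNzRingType) (f : {rmorphism B -> B'}) d J (A : 'M[B]_d) (c : plucker_index J) :
  f (gpp A c) = gpp (map_mx f A) c.
Proof. by rewrite /gpp rmorph_prod; apply: eq_bigr => x _; rewrite gpl_map. Qed.

(** With the row permutation of an LUP decomposition, each leading minor is a product of diagonal
    entries of [U]. *)
Lemma lup_minors (K : fieldType) d (h : 'M[K]_d) : h \in unitmx ->
  exists s : 'S_d, forall x : 'I_d,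
    \det (mxsub (fun l : 'I_x => s (widen_ord (ltnW (ltn_ord x)) l)) (widen_ord (ltnW (ltn_ord x))) h) != 0.
Proof.
case: d => [|n] in h *; first by exists 1%g => -[].
move=> hu.
case: (cormen_lup h) (cormen_lup_perm h) (cormen_lup_correct h)
  (@cormen_lup_lower _ _ h) (@cormen_lup_upper _ _ h) => [[P L] U] /=.
move=> /is_perm_mxP[s ->] E Llow Uup.
have Uu : \det U != 0.
  have : perm_mx s *m h \in unitmx by rewrite unitmx_mul unitmx_perm.
  by rewrite -[_ *m _]/(perm_mx s * h) E unitmx_mul => /andP[_]; rewrite unitmxE unitfE.
have dU : \prod_i U i i != 0.
  suff <- : \det U = \prod_i U i i by [].
  rewrite -det_tr det_trig; first by apply: eq_bigr => i _; rewrite mxE.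
  by apply/is_trig_mxP => i j ij; rewrite mxE Uup.
exists s => x.
pose w (l : 'I_x) : 'I_n.+1 := widen_ord (ltnW (ltn_ord x)) l.
have EB : mxsub (fun l => s (w l)) w h = mxsub w w L *m mxsub w w U.
  have /matrixP E' := E.
  apply/matrixP => i j; have := E' (w i) (w j); rewrite -[_ * h]/(_ *m h) -row_permE mxE => E2.
  rewrite mxE E2 !mxE (bigID (fun l : 'I_n.+1 => (l < x)%N)) /=.
  rewrite [X in _ + X]big1 ?addr0 => [|l lx]; last first.
    have il : (i < l)%N by rewrite (leq_trans (ltn_ord i)) // leqNgt.
    by rewrite Llow /= ?(ltnW il) // -(inj_eq val_inj) /= ltn_eqF ?mul0r.
  rewrite (big_ord_narrow (ltnW (ltn_ord x))); apply: eq_bigr => l _.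
  by rewrite !mxE.
rewrite EB det_mulmx mulf_neq0 //.
  rewrite det_trig; first by rewrite big1 ?oner_neq0 // => i _; rewrite mxE Llow ?eqxx.
  by apply/is_trig_mxP => i j ij; rewrite mxE Llow ?(ltnW ij) // -(inj_eq val_inj) /= ltn_eqF.
rewrite -det_tr det_trig.
  apply/prodf_neq0 => i _; rewrite !mxE; move/prodf_neq0: dU; exact.
by apply/is_trig_mxP => i j ij; rewrite !mxE Uup.
Qed.

Section Flags.
Variables (d : nat) (J : {set 'I_d}).

Definition dseq : seq nat := [seq val x | x <- enum (flag_dims J)].

Lemma mem_dseq (x : 'I_d) : (val x \in dseq) = (x \in flag_dims J).
Proof. by rewrite (mem_map val_inj) mem_enum. Qed.

Lemma dseqP x : x \in dseq -> exists2 y : 'I_d, y \in flag_dims J & x = y.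
Proof. by case/mapP => y; rewrite mem_enum => yJ ->; exists y. Qed.

Lemma dseq_lt x : x \in dseq -> (0 < x < d)%N.
Proof.
by case/dseqP => y; rewrite inE => /andP[y0 _] ->; rewrite y0 ltn_ord.
Qed.

Let wd (x : 'I_d) : 'I_x -> 'I_d := widen_ord (ltnW (ltn_ord x)).

Section Parab.
Variable B : comUnitRingType.

Lemma colsub_mulP (h p : 'M[B]_d) (x : 'I_d) : x \in flag_dims J -> inP dseq p ->
  colsub (wd (x := x)) (h *m p) = colsub (wd (x := x)) h *m mxsub (wd (x := x)) (wd (x := x)) p.
Proof.
move=> xJ pP; apply/matrixP => i j; rewrite !mxE (bigID (fun l : 'I_d => (l < x)%N)) /=.
rewrite [X in _ + X]big1 ?addr0 => [|l lx]; last first.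
  rewrite pP ?mulr0 //; apply/nzP; exists x; first by rewrite mem_dseq.
  by rewrite /= ltn_ord leqNgt.
rewrite (big_ord_narrow (ltnW (ltn_ord x))); apply: eq_bigr => l _.
by rewrite !mxE.
Qed.

(** The character by which the parabolic acts on the Pluecker coordinates of a frame. *)
Definition pchi (p : 'M[B]_d) : B :=
  \prod_(x : {x : 'I_d | x \in flag_dims J}) \det (mxsub (wd (x := sval x)) (wd (x := sval x)) p).

Lemma gpp_mulP (h p : 'M[B]_d) c : inP dseq p -> gpp (h *m p) c = pchi p * gpp (J := J) h c.
Proof.
move=> pP; rewrite /gpp /pchi -big_split; apply: eq_bigr => -[x xJ] _ /=.
rewrite /gpl mulrC -det_mulmx; congr (\det _).
have := colsub_mulP h xJ pP => /matrixP E.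
by apply/matrixP => i j; have := E (c (exist _ x xJ) i) j; rewrite !mxE => ->; apply: eq_bigr => l _; rewrite !mxE.
Qed.

End Parab.

Lemma pchi_unit (K : fieldType) (p : 'M[K]_d) : p \in unitmx -> inP dseq p -> pchi p != 0.
Proof.
move=> pu pP; have qP := inP_inv pu pP.
apply/prodf_neq0 => -[x xJ] _ /=.
have := colsub_mulP p xJ qP; rewrite mulmxV // => /matrixP E.
have : mxsub (wd (x := x)) (wd (x := x)) p *m mxsub (wd (x := x)) (wd (x := x)) (invmx p) = 1%:M.
  apply/matrixP => i j; have := E (wd i) j; rewrite !mxE => E'.
  transitivity ((wd i == wd j)%:R : K); last by rewrite -!val_eqE.
  by rewrite E'; apply: eq_bigr => l _; rewrite !mxE.
by case/mulmx1_unit; rewrite unitmxE unitfE.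
Qed.

(** One row index of the minor of size [x] is replaced. By Cramer's rule such neighbours of a
    coordinate recover the entries of a frame. *)
Definition updp (c : plucker_index J) (x i : nat) (r : 'I_d) : plucker_index J :=
  finfun (fun y : {x : 'I_d | x \in flag_dims J} =>
    [ffun l : 'I_(sval y) => if (val (sval y) == x) && (val l == i) then r else c y l]).

Lemma gpl_updp_neq (B : comNzRingType) (A : 'M[B]_d) c x i r (y : {x : 'I_d | x \in flag_dims J}) :
  val (sval y) != x -> gpl A (updp c x i r y) = gpl A (c y).
Proof.
move=> yx; rewrite /gpl; congr (\det _); apply/matrixP => a b; rewrite !mxE !ffunE.
by rewrite (negPf yx).
Qed.

Lemma gpl_updp_eq (B : comNzRingType) (A : 'M[B]_d) c (y : {x : 'I_d | x \in flag_dims J}) (i : 'I_(sval y)) r :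
  gpl A (updp c (sval y) i r y) =
  (colsub (wd (x := sval y)) A *m \adj (mxsub (c y) (wd (x := sval y)) A)) r i.
Proof.
rewrite /gpl (@det_row_subst _ _ (mxsub (c y) (wd (x := sval y)) A) _ i).
  by rewrite !mxE; apply: eq_bigr => l _; rewrite !mxE !ffunE !eqxx.
by move=> a l ai; rewrite !mxE !ffunE eqxx /= (inj_eq val_inj) (negPf ai).
Qed.

Lemma gpp_updp (B : comNzRingType) (A : 'M[B]_d) c (y : {x : 'I_d | x \in flag_dims J}) (i : 'I_(sval y)) r :
  gpp A (updp c (sval y) i r) = (\prod_(y' | y' != y) gpl A (c y')) *
  (colsub (wd (x := sval y)) A *m \adj (mxsub (c y) (wd (x := sval y)) A)) r i.
Proof.
rewrite /gpp (bigD1 y) //= gpl_updp_eq mulrC; congr (_ * _).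
apply: eq_bigr => y' y'y; apply: gpl_updp_neq.
by apply: contra y'y => /eqP E; apply/eqP/val_inj/val_inj.
Qed.

(* the coordinate chart attached to a permutation of the rows *)
Definition cperm (s : 'S_d) : plucker_index J :=
  finfun (fun y : {x : 'I_d | x \in flag_dims J} => [ffun l : 'I_(sval y) => s (wd l)]).

Lemma lower_trig (B : comUnitRingType) (s : 'S_d) (h : 'M[B]_d) (x : 'I_d) :
  normalized dseq s h -> is_trig_mx (mxsub (fun l : 'I_x => s (wd l)) (wd (x := x)) h).
Proof.
move=> hn; apply/is_trig_mxP => i j ij; rewrite mxE hn.
  by rewrite -(inj_eq val_inj) /= ltn_eqF.
by apply/nzP => -[y _] /=; lia.
Qed.

Lemma gpl_norm (B : comUnitRingType) (s : 'S_d) (h : 'M[B]_d) y :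
  normalized dseq s h -> gpl h (cperm s y) = 1.
Proof.
move=> hn; rewrite /gpl (_ : mxsub _ _ _ = mxsub (fun l : 'I_(sval y) => s (wd l)) (wd (x := sval y)) h).
  rewrite det_trig ?lower_trig // big1 // => i _; rewrite mxE hn ?eqxx //.
  by apply/nzP => -[x _] /=; lia.
by apply/matrixP => a b; rewrite !mxE !ffunE.
Qed.

Lemma gpp_norm (B : comUnitRingType) (s : 'S_d) (h : 'M[B]_d) :
  normalized dseq s h -> gpp h (cperm s) = 1.
Proof. by move=> hn; rewrite /gpp big1 // => y _; apply: gpl_norm. Qed.

Lemma normalized_unit (B : comUnitRingType) (s : 'S_d) (h : 'M[B]_d) :
  normalized dseq s h -> h \in unitmx.
Proof.
move=> hn; have E : row_perm s h = perm_mx s *m h by rewrite row_permE.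
have : row_perm s h \in unitmx.
  rewrite unitmxE det_trig; last first.
    apply/is_trig_mxP => i j ij; rewrite mxE hn -?(inj_eq val_inj) /= ?ltn_eqF //.
    by apply/nzP => -[y _] /=; lia.
  rewrite big1 ?unitr1 // => i _; rewrite mxE hn ?eqxx //.
  by apply/nzP => -[x _] /=; lia.
by rewrite E unitmx_mul unitmx_perm.
Qed.

(** Column [j] is read in the smallest flag member containing it: the rows of the chart make it a
    unit vector there, so the adjugate acts trivially on it. *)
Lemma gpp_updp_norm (B : comUnitRingType) (s : 'S_d) (h : 'M[B]_d) (j r : 'I_d) :
  normalized dseq s h -> (nxt dseq d j < d)%N ->
  gpp h (updp (cperm s) (nxt dseq d j) j r) = h r j.
Proof.
move=> hn nd; have nD := nxt_in nd; have [x xJ xE] := dseqP nD.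
pose y : {x : 'I_d | x \in flag_dims J} := exist _ x xJ.
have jx : (j < x)%N by rewrite -xE nxt_gt.
rewrite xE -[X in updp _ X]/(val (sval y)) -[X in updp _ _ X]/(val (Ordinal jx : 'I_(sval y))).
rewrite gpp_updp big1 ?mul1r => [|y' _]; last exact: gpl_norm.
pose L := mxsub (cperm s y) (wd (x := x)) h.
have LE a b : L a b = h (s (wd a)) (wd b) by rewrite !mxE !ffunE.
have detL : \det L = 1 by exact: gpl_norm.
have Lj a : L a (Ordinal jx) = (a == Ordinal jx)%:R.
  rewrite LE hn; first by rewrite -(inj_eq val_inj) /= -(inj_eq val_inj).
  rewrite (@nz_nxt _ d) //= ?xE -?ltnNge ?ltn_ord //; last exact: (ltn_trans (ltn_ord a)).
  by move=> z /dseq_lt/andP[].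
have Aj : \adj L *m delta_mx (Ordinal jx) (0 : 'I_1) = delta_mx (Ordinal jx) 0.
  have E : L *m delta_mx (Ordinal jx) (0 : 'I_1) = delta_mx (Ordinal jx) 0.
    apply/colP => a; rewrite mxE (bigD1 (Ordinal jx)) //= big1 => [|b bj].
      by rewrite Lj !mxE !eqxx mulr1 addr0 andbT.
    by rewrite !mxE (negPf bj) mulr0.
  by rewrite -{1}E mulmxA mul_adj_mx detL mul1mx.
rewrite -/L [LHS](_ : _ = (colsub (wd (x := x)) h *m (\adj L *m delta_mx (Ordinal jx) 0)) r (0 : 'I_1)).
  rewrite Aj mxE (bigD1 (Ordinal jx)) //= big1 => [|b bj]; last first.
    by rewrite [delta_mx _ _ _ _]mxE (negPf bj) mulr0.
  rewrite [delta_mx _ _ _ _]mxE !eqxx mulr1 addr0 mxE; congr (h r _); exact: val_inj.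
rewrite mulmxA [RHS]mxE (bigD1 (Ordinal jx)) //= big1 => [|b bj]; last first.
  by rewrite [delta_mx _ _ _ _]mxE (negPf bj) mulr0.
by rewrite [delta_mx _ _ _ _]mxE !eqxx mulr1 addr0.
Qed.

(** Column [j] of [p] is taken from the inverse of the block of size [nxt j] on the chosen rows and,
    when no flag dimension exceeds [j], from the inverse of [h]. *)
Lemma normalize (K : fieldType) (s : 'S_d) (h : 'M[K]_d) : h \in unitmx ->
  gpp h (cperm s) != 0 ->
  exists p : 'M[K]_d, [/\ p \in unitmx, inP dseq p & normalized dseq s (h *m p)].
Proof.
move=> hu hs.
pose Bx (x : 'I_d) : 'M[K]_x := mxsub (fun l => s (wd l)) (wd (x := x)) h.
have Bu (x : 'I_d) : x \in flag_dims J -> Bx x \in unitmx.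
  move=> xJ; rewrite unitmxE unitfE.
  have -> : Bx x = mxsub (cperm s (exist _ x xJ)) (wd (x := x)) h.
    by apply/matrixP => a b; rewrite !mxE !ffunE.
  by move/prodf_neq0: hs => /(_ (exist _ x xJ) isT).
pose px (x : 'I_d) (i j : 'I_d) : K :=
  if (insub (val i) : option 'I_x, insub (val j) : option 'I_x) is (Some i', Some j')
  then invmx (Bx x) i' j' else 0.
have pxE (x : 'I_d) (i' j' : 'I_x) (i j : 'I_d) : i = i' :> nat -> j = j' :> nat ->
    px x i j = invmx (Bx x) i' j'.
  by move=> E1 E2; rewrite /px [val i]E1 [val j]E2 !valK.
pose p : 'M[K]_d := \matrix_(i, j)
  if (insub (nxt dseq d j) : option 'I_d) is Some x then px x i j else invmx h i (s j).
have Dd x : x \in dseq -> (x < d)%N by case/dseq_lt/andP.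
have pP : inP dseq p.
  move=> i j; rewrite (@nz_nxt _ d) // => le; rewrite mxE.
  have nd := leq_ltn_trans le (ltn_ord i).
  rewrite insubT /px /= insubF //.
  by apply/negbTE; rewrite -leqNgt.
have hpn : normalized dseq s (h *m p).
  move=> i j; rewrite (@nz_nxt _ d) // -ltnNge => lt.
  have [nd|dn] := ltnP (nxt dseq d j) d; last first.
    have -> : (h *m p) (s i) j = (h *m invmx h) (s i) (s j).
      by rewrite !mxE; apply: eq_bigr => l _; rewrite [p _ _]mxE insubF // ltnNge dn.
    by rewrite mulmxV // mxE (inj_eq perm_inj).
  have [x xJ xE] := dseqP (nxt_in nd).
  have ix : (i < x)%N by rewrite -xE.
  have jx : (j < x)%N by rewrite -xE nxt_gt.
  have -> : (h *m p) (s i) j = (Bx x *m invmx (Bx x)) (Ordinal ix) (Ordinal jx).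
    rewrite !mxE (bigID (fun l : 'I_d => (l < x)%N)) /= [X in _ + X]big1 ?addr0 => [|l lx]; last first.
      rewrite mxE insubT /px /= insubF ?mulr0 //.
      by apply/negbTE; rewrite xE.
    rewrite (big_ord_narrow (ltnW (ltn_ord x))); apply: eq_bigr => l _.
    rewrite [Bx _ _ _]mxE; congr (h (s _) _ * _); first exact: val_inj.
    by rewrite mxE xE valK (pxE x l (Ordinal jx)).
  by rewrite mulmxV ?Bu // mxE -(inj_eq val_inj).
exists p; split=> //; have := normalized_unit hpn.
by rewrite unitmx_mul => /andP[].
Qed.

Lemma chart_exists (K : fieldType) (h : 'M[K]_d) : h \in unitmx ->
  exists s : 'S_d, gpp h (cperm s) != 0.
Proof.
move=> /lup_minors[s sP]; exists s; apply/prodf_neq0 => y _; rewrite /gpl.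
have -> : mxsub (cperm s y) (wd (x := sval y)) h = mxsub (fun l => s (wd l)) (wd (x := sval y)) h.
  by apply/matrixP => a b; rewrite !mxE !ffunE.
exact: sP.
Qed.

End Flags.

Section FlagFrame.
Variables (K : fieldType) (d : nat) (J : {set 'I_d}).
Local Notation FD := {x : 'I_d | x \in flag_dims J}.

(** The frame is built one vector at a time, each taken in the smallest prescribed space of
    dimension larger than the span reached so far. *)
Lemma flag_frame (V : forall y : FD, 'M[K]_(sval y, d)) :
  (forall y, row_free (V y)) -> (forall x y : FD, (sval x < sval y)%N -> (V x <= V y)%MS) ->
  exists2 h : 'M[K]_d, h \in unitmx & forall y : FD, exists2 q : 'M_(sval y), q \in unitmx &
    colsub (widen_ord (ltnW (ltn_ord (sval y)))) h = (V y)^T *m q.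
Proof.
move=> Vf Vsub.
have Vle (x y : FD) : (sval x <= sval y)%N -> (V x <= V y)%MS.
  rewrite leq_eqVlt => /orP[/eqP E|]; last exact: Vsub.
  by have -> : x = y by apply/val_inj/val_inj.
pose M n (r : nat -> 'rV[K]_d) := \matrix_(i < n) r i.
have : forall n, (n <= d)%N -> exists r, [/\ row_free (M n r),
    forall y : FD, (n <= sval y)%N -> (M n r <= V y)%MS &
    forall y : FD, (sval y <= n)%N -> (M (sval y) r <= V y)%MS].
  elim=> [|n IH] nd.
    exists (fun=> 0); split=> [|y _|y]; first by rewrite -row_leq_rank.
      by apply/row_subP => -[].
    by rewrite leqn0 => /eqP E; apply/row_subP => i; have := ltn_ord i; rewrite {2}E.
  have [r [rf rV rD]] := IH (ltnW nd).
  have [U [rU MU UV]] : exists U : 'M[K]_d, [/\ (n < \rank U)%N, (M n r <= U)%MS &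
      forall y : FD, (n < sval y)%N -> (U <= V y)%MS].
    have [lt|ge] := ltnP (nxt (dseq J) d n) d; last first.
      exists 1%:M; split; rewrite ?mxrank1 ?submx1 // => y ny.
      have yD : val (sval y) \in dseq J by rewrite mem_dseq; case: y {ny}.
      by have := leq_ltn_trans (nxt_le d yD ny) (ltn_ord _); rewrite ltnNge ge.
    have [x xJ xE] := dseqP (nxt_in lt).
    pose y : FD := exist _ x xJ.
    have ny : (n < sval y)%N by rewrite /= -xE nxt_gt.
    exists (<<V y>>%MS); split.
    - by rewrite mxrank_gen; move: (Vf y); rewrite /row_free => /eqP->.
    - by rewrite genmxE rV // ltnW.
    - move=> y' ny'; rewrite genmxE; apply: Vle; rewrite /= -xE; apply: nxt_le => //.
      by rewrite mem_dseq; case: y' {ny'}.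
  have [i vi] : exists i, ~~ (row i U <= M n r)%MS.
    apply/existsP; rewrite -negb_forall; apply: contraL rU => /forallP H.
    rewrite -leqNgt; apply: leq_trans (rank_leq_row (M n r)).
    by apply: mxrankS; apply/row_subP.
  pose r' m := if m == n then row i U else r m.
  have Mr' m : (m <= n)%N -> M m r' = M m r.
    move=> mn; apply/row_matrixP => j; rewrite !rowK /r' ltn_eqF //.
    exact: leq_trans (ltn_ord j) mn.
  have MM : (M n r <= M n.+1 r')%MS.
    apply/row_subP => j; have -> : row j (M n r) = row (widen_ord (leqnSn n) j) (M n.+1 r').
      by rewrite !rowK /r' /= ltn_eqF.
    exact: row_sub.
  have vM : (row i U <= M n.+1 r')%MS.
    have -> : row i U = row ord_max (M n.+1 r') by rewrite rowK /r' /= eqxx.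
    exact: row_sub.
  have M'U : (M n.+1 r' <= U)%MS.
    apply/row_subP => j; rewrite rowK /r'; case: eqP => [_|/eqP jn]; first exact: row_sub.
    have jn' : (j < n)%N by rewrite ltn_neqAle jn -ltnS ltn_ord.
    by have := submx_trans (row_sub (Ordinal jn') (M n r)) MU; rewrite rowK.
  exists r'; split.
  - rewrite -row_leq_rank; have : (M n r < M n.+1 r')%MS.
      rewrite /ltmx MM /=; apply: contra vi; exact: submx_trans.
    by move/rank_ltmx; move: rf; rewrite /row_free => /eqP->.
  - by move=> y ny; apply: submx_trans M'U (UV y ny).
  - move=> y; rewrite leq_eqVlt => /orP[/eqP E|].
      have H m : m = n.+1 -> (M m r' <= V y)%MS.
        by move=> ->; apply: submx_trans M'U (UV y _); rewrite E.
      exact: H E.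
    by rewrite ltnS => yn; rewrite Mr' //; apply: rD.
move=> /(_ d (leqnn d))[r [rf _ rD]].
exists (M d r)^T; first by rewrite unitmx_tr -row_free_unit.
move=> y; have yd := ltnW (ltn_ord (sval y)).
have /submxP[Q QE] := rD y yd.
have Qu : Q \in unitmx.
  rewrite -row_free_unit -row_leq_rank; have := mxrankM_maxl Q (V y); rewrite -QE.
  suff -> : \rank (M (sval y) r) = sval y by [].
  apply/eqP; rewrite -[_ == _]/(row_free _); apply/row_freeP.
  have /row_freeP[X XE] := rf.
  exists (colsub (widen_ord yd) X).
  have -> : M (sval y) r = rowsub (widen_ord yd) (M d r).
    by apply/matrixP => i j; rewrite !mxE.
  apply/matrixP => i j; have := congr1 (fun M : 'M_d => M (widen_ord yd i) (widen_ord yd j)) XE.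
  rewrite !mxE -!val_eqE /= => <-; apply: eq_bigr => l _; by rewrite !mxE.
exists Q^T; first by rewrite unitmx_tr.
rewrite -trmx_mul -QE; apply/matrixP => i j; by rewrite !mxE.
Qed.

End FlagFrame.

Lemma adj_invmx (K : comUnitRingType) n (M : 'M[K]_n) : M \in unitmx -> \adj M = \det M *: invmx M.
Proof.
move=> Mu; rewrite -[LHS](mulKmx Mu) mul_mx_adj.
by rewrite mul_mx_scalar.
Qed.

Section FlagVariety.
Variables (d : nat) (J : {set 'I_d} * {set 'I_d}).
Definition Js (s : bool) : {set 'I_d} := if s then J.1 else J.2.
Local Notation D := (fun s => dseq (Js s)).
Definition fcomp (c : flag_index J) (s : bool) : plucker_index (Js s) :=
  if s as b return plucker_index (Js b) then c.1 else c.2.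
Local Notation FD s := {x : 'I_d | x \in flag_dims (Js s)}.
Definition upd (c : flag_index J) (s : bool) (x i : nat) (r : 'I_d) : flag_index J :=
  if s then (updp c.1 x i r, c.2) else (c.1, updp c.2 x i r).

Section Points.
Variable B : comUnitRingType.
Implicit Types (h p : bool -> 'M[B]_d) (z : flag_index J -> B) (pi : bool -> 'S_d).

Definition fp h (c : flag_index J) : B := gpp (h true) c.1 * gpp (h false) c.2.

Lemma fpE h c s : fp h c = gpp (h s) (fcomp c s) * gpp (h (~~ s)) (fcomp c (~~ s)).
Proof. by case: s; rewrite /fp //= mulrC. Qed.

Definition cbase pi : flag_index J := (cperm J.1 (pi true), cperm J.2 (pi false)).

(* the frame of the point [z] in the chart of [pi], multiplied by the base coordinate *)
Definition Hm z pi (s : bool) : 'M[B]_d := \matrix_(r, j)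
  if (nxt (D s) d j < d)%N then z (upd (cbase pi) s (nxt (D s) d j) j r)
  else z (cbase pi) * (r == pi s j)%:R.

Lemma fp_norm h pi : (forall s, normalized (D s) (pi s) (h s)) -> fp h (cbase pi) = 1.
Proof. by move=> hn; rewrite /fp !gpp_norm ?mulr1 //; [apply: (hn false)|apply: (hn true)]. Qed.

Lemma Hm_norm h pi s : (forall s, normalized (D s) (pi s) (h s)) -> Hm (fp h) pi s = h s.
Proof.
move=> hn; apply/matrixP => r j; rewrite mxE; case: ltnP => nd.
  rewrite (fpE _ _ s) /upd; case: s hn nd => hn nd /=.
    by rewrite (gpp_updp_norm _ (hn true)) // gpp_norm ?mulr1 //; apply: (hn false).
  by rewrite (gpp_updp_norm _ (hn false)) // gpp_norm ?mulr1 //; apply: (hn true).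
rewrite fp_norm // mul1r -{2}[r](permKV (pi s)) hn; last first.
  rewrite (@nz_nxt _ d) //; last by move=> x /dseq_lt/andP[].
  by rewrite -ltnNge (leq_trans (ltn_ord _) nd).
by rewrite -(inj_eq (@perm_inj _ (pi s)^-1%g)) permK.
Qed.

Lemma Hm_scale a z pi s : Hm (fun c => a * z c) pi s = a *: Hm z pi s.
Proof. by apply/matrixP => r j; rewrite !mxE; case: ifP => // _; rewrite mulrA. Qed.

Lemma eq_Hm z z' pi s : z =1 z' -> Hm z pi s = Hm z' pi s.
Proof. by move=> E; apply/matrixP => r j; rewrite !mxE !E. Qed.

Lemma fp_mulP h p c : (forall s, inP (D s) (p s)) ->
  fp (fun s => h s *m p s) c = (pchi J.1 (p true) * pchi J.2 (p false)) * fp h c.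
Proof.
move=> pP; rewrite /fp (gpp_mulP _ _ (pP true)) (gpp_mulP _ _ (pP false)).
by rewrite mulrACA.
Qed.

Lemma eq_fp h h' c : h =1 h' -> fp h c = fp h' c.
Proof. by move=> E; rewrite /fp !E. Qed.

(** The weight of [fp] under a common scaling of the two frames. *)
Definition fdeg : nat := (\sum_(x : FD true) sval x + \sum_(x : FD false) sval x)%N.

Lemma fp_scale h a c : fp (fun s => a *: h s) c = a ^+ fdeg * fp h c.
Proof.
have E (J' : {set 'I_d}) : pchi J' (a%:M : 'M[B]_d) = a ^+ (\sum_(x : {x : 'I_d | x \in flag_dims J'}) sval x).
  rewrite /pchi -prodrXr; apply: eq_bigr => x _; rewrite -det_scalar; congr (\det _).
  by apply/matrixP => i j; rewrite !mxE -!val_eqE.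
rewrite -(@eq_fp (fun s => h s *m a%:M)); last by move=> s; rewrite mul_mx_scalar.
rewrite (@fp_mulP h (fun=> a%:M)); first by rewrite !E -exprD.
move=> s i j /nzP[x _ /andP[jx xi]]; rewrite mxE; case: eqP => // ij.
by rewrite ij leqNgt jx in xi.
Qed.

(* the equations of the flag variety in the chart *)
Definition E1 z pi (c : flag_index J) : B :=
  z (cbase pi) * (z c * z (cbase pi) ^+ fdeg - z (cbase pi) * fp (Hm z pi) c).

(** At a flag with [z c] nonzero the columns span the member [y]: the matrix is a multiple of a
    frame of this member times the adjugate of its minor chosen by [c]. *)
Definition Wm z c s (y : FD s) : 'M[B]_(d, sval y) := \matrix_(r, i) z (upd c s (val (sval y)) i r).
Arguments Wm z c {s} y.

Definition Wc z c s (c' : flag_index J) (y : FD s) : 'M[B]_(sval y) :=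
  mxsub (fcomp c' s y) id (Wm z c y).
Arguments Wc z c {s} c' y.

(** With [Wm] in place of frames, [Eb] says that the coordinates are products of minors, and [Ed]
    that the members are nested; denominators are cleared so that both make sense at every point. *)
Definition Eb z (c c' : flag_index J) : B :=
  z c * ((\prod_(y : FD true) \det (Wc z c c' y)) * (\prod_(y : FD false) \det (Wc z c c' y)))
   - z c ^+ fdeg * z c'.

Definition Ed z c s (x y : FD s) : 'M[B]_(d, sval x) :=
  \det (Wc z c c y) *: Wm z c x -
    Wm z c y *m \adj (Wc z c c y) *m mxsub (fcomp c s y) id (Wm z c x).

End Points.
Arguments Wm {B} z c {s} y.
Arguments Wc {B} z c {s} c' y.
Arguments Ed {B} z c {s} x y.

Lemma fp_map (B B' : comUnitRingType) (f : {rmorphism B -> B'}) h c :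
  f (fp h c) = fp (fun s => map_mx f (h s)) c.
Proof. by rewrite /fp rmorphM !gpp_map. Qed.

Lemma Hm_map (B B' : comUnitRingType) (f : {rmorphism B -> B'}) z pi s :
  map_mx f (Hm z pi s) = Hm (f \o z) pi s.
Proof. by apply/matrixP => r j; rewrite !mxE; case: ifP => // _; rewrite rmorphM rmorph_nat. Qed.

Lemma E1_map (B B' : comUnitRingType) (f : {rmorphism B -> B'}) z pi c :
  f (E1 z pi c) = E1 (f \o z) pi c.
Proof.
rewrite /E1 rmorphM rmorphB [f (_ * _ ^+ _)]rmorphM rmorphXn [f (_ * fp _ _)]rmorphM fp_map.
congr (_ * (_ - _ * _)).
by apply: eq_fp => s; rewrite Hm_map.
Qed.

Lemma Wm_map (B B' : comUnitRingType) (f : {rmorphism B -> B'}) z c s (y : FD s) :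
  map_mx f (Wm z c y) = Wm (f \o z) c y.
Proof. by apply/matrixP => r j; rewrite !mxE. Qed.

Lemma Wc_map (B B' : comUnitRingType) (f : {rmorphism B -> B'}) z c s c' (y : FD s) :
  map_mx f (Wc z c c' y) = Wc (f \o z) c c' y.
Proof. by apply/matrixP => r j; rewrite !mxE. Qed.

Lemma Eb_map (B B' : comUnitRingType) (f : {rmorphism B -> B'}) z c c' :
  f (Eb z c c') = Eb (f \o z) c c'.
Proof.
rewrite /Eb rmorphB !rmorphM rmorphXn !rmorph_prod; congr (_ * (_ * _) - _).
  by apply: eq_bigr => y _; rewrite -det_map_mx Wc_map.
by apply: eq_bigr => y _; rewrite -det_map_mx Wc_map.
Qed.

Lemma Ed_map (B B' : comUnitRingType) (f : {rmorphism B -> B'}) z c s (x y : FD s) :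
  map_mx f (Ed z c x y) = Ed (f \o z) c x y.
Proof.
rewrite /Ed map_mxB map_mxZ !map_mxM map_mx_adj -det_map_mx !Wc_map !Wm_map.
by rewrite map_mxsub Wm_map.
Qed.

Section FlagPoints.
Variable K : fieldType.
Implicit Types (h p : bool -> 'M[K]_d) (z : flag_index J -> K) (pi : bool -> 'S_d).

Definition is_flag z : Prop := exists (a : K) h,
  [/\ a != 0, forall s, h s \in unitmx & forall c, z c = a * fp h c].

Lemma chart_point a h z pi : (forall s, h s \in unitmx) -> (forall c, z c = a * fp h c) ->
  z (cbase pi) != 0 -> exists p, [/\ forall s, p s \in unitmx, forall s, inP (D s) (p s),
    forall s, normalized (D s) (pi s) (h s *m p s),
    forall c, z c = z (cbase pi) * fp (fun s => h s *m p s) c &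
    forall s, Hm z pi s = z (cbase pi) *: (h s *m p s)].
Proof.
move=> hu zE z0.
have hc s : gpp (h s) (cperm (Js s) (pi s)) != 0.
  move: z0; rewrite zE /fp !mulf_eq0 !negb_or => /and3P[_ h1 h2].
  by case: s.
have /choice[p pP] s := normalize (hu s) (hc s).
have pn s : normalized (D s) (pi s) (h s *m p s) by case: (pP s).
have pu s : p s \in unitmx by case: (pP s).
have pPP s : inP (D s) (p s) by case: (pP s).
have zE' c : z c = z (cbase pi) * fp (fun s => h s *m p s) c.
  have := fp_norm pn; rewrite fp_mulP // => E; rewrite fp_mulP // zE [z _]zE.
  rewrite [in RHS]mulrA -[a * _ * _ in RHS]mulrA [fp h _ * _]mulrC E mulr1.
  by [].
exists p; split=> // s; rewrite -(Hm_norm s pn) -Hm_scale.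
by apply: eq_Hm.
Qed.

Lemma E1_flag z pi c : is_flag z -> E1 z pi c = 0.
Proof.
move=> [a [h [a0 hu zE]]]; rewrite /E1; have [->|z0] := eqVneq (z (cbase pi)) 0; first by rewrite mul0r.
have [p [_ _ _ zE' HE]] := chart_point hu zE z0.
rewrite (eq_fp c HE) fp_scale (zE' c); move: (fp _ c) (z (cbase pi)) => u v.
by rewrite [v ^+ _ * u]mulrC mulrA subrr mulr0.
Qed.

Lemma Wm_flag a h z c s (y : FD s) : (forall c, z c = a * fp h c) ->
  Wm z c y = (a * (\prod_(y' | y' != y) gpl (h s) (fcomp c s y')) * gpp (h (~~ s)) (fcomp c (~~ s))) *:
   (colsub (widen_ord (ltnW (ltn_ord (sval y)))) (h s) *m
    \adj (mxsub (fcomp c s y) (widen_ord (ltnW (ltn_ord (sval y)))) (h s))).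
Proof.
move=> zE; apply/matrixP => r i; rewrite mxE [RHS]mxE zE (fpE _ _ s).
have -> : fcomp (upd c s (val (sval y)) i r) (~~ s) = fcomp c (~~ s) by case: s y i.
have -> : fcomp (upd c s (val (sval y)) i r) s = updp (fcomp c s) (val (sval y)) i r by case: s y i.
by rewrite gpp_updp; ring.
Qed.

Lemma Wm_flag' a h z c s (y : FD s) : (forall c, z c = a * fp h c) -> exists2 t : K,
  t * gpl (h s) (fcomp c s y) = z c &
  Wm z c y = t *: (colsub (widen_ord (ltnW (ltn_ord (sval y)))) (h s) *m
    \adj (mxsub (fcomp c s y) (widen_ord (ltnW (ltn_ord (sval y)))) (h s))).
Proof.
move=> zE; rewrite (Wm_flag c y zE); set t := _ * _ * _; exists t => //.
rewrite zE (fpE _ _ s) /t {1 3}/gpp [X in _ = _ * (X * _)](bigD1 y) //=; ring.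
Qed.

Lemma Eb_flag z c c' : is_flag z -> Eb z c c' = 0.
Proof.
move=> [a [h [a0 hu zE]]].
have W s (y : FD s) : \det (Wc z c c' y) * gpl (h s) (fcomp c s y) =
    z c ^+ (sval y) * gpl (h s) (fcomp c' s y).
  have [t tE WE] := Wm_flag' c y zE.
  have -> : Wc z c c' y = t *: (mxsub (fcomp c' s y) (widen_ord (ltnW (ltn_ord (sval y)))) (h s) *m
      \adj (mxsub (fcomp c s y) (widen_ord (ltnW (ltn_ord (sval y)))) (h s))).
    rewrite /Wc WE; apply/matrixP => i j; rewrite !mxE; congr (_ * _).
    by apply: eq_bigr => l _; rewrite !mxE.
  rewrite detZ det_mulmx -!mulrA det_adj_mul -tE exprMn -/(gpl (h s) _).
  by rewrite -!mulrA; congr (_ * _); exact: mulrC.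
have WW s : (\prod_(y : FD s) \det (Wc z c c' y)) * gpp (h s) (fcomp c s) =
    z c ^+ (\sum_(y : FD s) sval y) * gpp (h s) (fcomp c' s).
  rewrite /gpp -prodrXr -!big_split; apply: eq_bigr => y _; exact: W.
rewrite /Eb /fdeg exprD; have := WW true; have := WW false.
have zcE := zE c; rewrite [z c']zE /fp; move: zcE; rewrite /fp.
set X1 := \prod_(y : FD true) _; set X2 := \prod_(y : FD false) _.
set Z1 := _ ^+ _; set Z2 := _ ^+ _.
rewrite /fcomp => zcE W2 W1; apply/eqP; rewrite subr_eq0; apply/eqP.
transitivity (a * ((X1 * gpp (h true) c.1) * (X2 * gpp (h false) c.2))); first by rewrite zcE; ring.
by rewrite W1 W2; ring.
Qed.

Lemma Ed_flag z c s (x y : FD s) : is_flag z -> (sval x < sval y)%N -> Ed z c x y = 0.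
Proof.
move=> [a [h [a0 hu zE]]] xy; rewrite /Ed.
have [tx txE WxE] := Wm_flag' c x zE; have [ty tyE WyE] := Wm_flag' c y zE.
set Ay := colsub _ _ in WyE; set By := mxsub _ _ _ in WyE.
have WcE : Wc z c c y = ty *: (By *m \adj By).
  rewrite /Wc WyE; apply/matrixP => i j; rewrite !mxE; congr (_ * _).
  by apply: eq_bigr => l _; rewrite !mxE.
have [X XE] : exists X, Wm z c x = Ay *m X.
  pose wxy : 'I_(sval x) -> 'I_(sval y) := widen_ord (ltnW xy).
  exists (tx *: (colsub wxy 1%:M *m \adj (mxsub (fcomp c s x) (widen_ord (ltnW (ltn_ord (sval x)))) (h s)))).
  rewrite WxE -scalemxAr mulmxA; congr (_ *: (_ *m _)).
  apply/matrixP => i j; rewrite mxE [RHS]mxE (bigD1 (wxy j)) //= big1 => [|l lj].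
    by rewrite !mxE eqxx mulr1 addr0; congr (h s i _); apply: val_inj.
  by rewrite !mxE (negPf lj) mulr0.
have XcE : mxsub (fcomp c s y) id (Wm z c x) = By *m X.
  by rewrite XE; apply/matrixP => i j; rewrite !mxE; apply: eq_bigr => l _; rewrite !mxE.
rewrite XcE WcE mul_mx_adj scale_scalar_mx XE WyE.
case: (sval y : nat) Ay By {WyE WcE XcE XE} X => [|n] Ay By X.
  by rewrite (thinmx0 Ay) !mul0mx !scaler0 !mul0mx subrr.
rewrite det_scalar.
have -> : \adj ((ty * \det By)%:M : 'M_n.+1) = ((ty * \det By) ^+ n)%:M.
  have H (e : K) : \adj (e%:M : 'M_n.+1) = (e ^+ n)%:M.
    apply/matrixP => i j; rewrite mxE /cofactor.
    have [->|ij] := eqVneq i j.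
      rewrite (_ : row' j (col' j e%:M) = e%:M) ?det_scalar ?mxE ?eqxx.
        by rewrite -signr_odd oddD addbb mul1r.
      by apply/matrixP => u v; rewrite !mxE (inj_eq lift_inj).
    rewrite [RHS]mxE (negPf ij) mulr0n.
    suff -> : \det (row' j (col' i e%:M)) = 0 by rewrite mulr0.
    have [u uE] : exists u, i = lift j u by case: (unliftP j i) ij => [u ->|->]; [exists u | rewrite eqxx].
    rewrite (expand_det_row _ u) big1 // => v _; rewrite !mxE -uE.
    by rewrite (negPf (neq_lift i v)) mul0r.
  exact: H.
rewrite -scalemxAl mul_mx_scalar -!scalemxAl scalerA -(mulmxA Ay) [X in _ - _ *: X]mulmxA.
have -> : Ay *m \adj By *m (By *m X) = \det By *: (Ay *m X).
  by rewrite mulmxA -(mulmxA Ay) mul_adj_mx mul_mx_scalar -scalemxAl.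
rewrite !scalerA exprS -scalerBl.
by rewrite (_ : _ - _ = 0) ?scale0r //; ring.
Qed.

(** At a nonzero coordinate [c], [Eb] makes the minors of [Wm] chosen by [c] nonzero, and [Ed] nests
    the spans. The minors of a common frame are proportional to those of [Wm], and [Eb] identifies
    these with the coordinates. *)
Lemma is_flagP z : (exists c, z c != 0) ->
  (forall c c', Eb z c c' = 0) ->
  (forall c s (x y : FD s), (sval x < sval y)%N -> Ed z c x y = 0) -> is_flag z.
Proof.
move=> [c zc] HEb HEd.
have : (\prod_(y : FD true) \det (Wc z c c y)) * (\prod_(y : FD false) \det (Wc z c c y)) != 0.
  have /eqP := HEb c c; rewrite /Eb subr_eq0 mulrC (inj_eq (mulIf zc)) => /eqP->.
  by rewrite expf_neq0.
rewrite mulf_eq0 negb_or => /andP[/prodf_neq0 P1 /prodf_neq0 P2].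
have Wu s (y : FD s) : Wc z c c y \in unitmx.
  by rewrite unitmxE unitfE; case: s y => y; [apply: P1 | apply: P2].
have {P1 P2} [h hP] : exists h, forall s, h s \in unitmx /\
    forall y : FD s, exists2 q : 'M_(sval y), q \in unitmx &
      colsub (widen_ord (ltnW (ltn_ord (sval y)))) (h s) = Wm z c y *m q.
  suff H s : exists h : 'M[K]_d, h \in unitmx /\ forall y : FD s, exists2 q : 'M_(sval y), q \in unitmx &
      colsub (widen_ord (ltnW (ltn_ord (sval y)))) h = Wm z c y *m q.
    by have [h1 H1] := H true; have [h2 H2] := H false; exists (fun s => if s then h1 else h2); case.
  have [||h hu hq] := @flag_frame K d (Js s) (fun y => (Wm z c y)^T).
  - move=> y; apply/row_freeP; exists ((rowsub (fcomp c s y) 1%:M)^T *m (invmx (Wc z c c y))^T).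
    rewrite mulmxA -!trmx_mul -[rowsub _ _ *m _]/(_ *m _) mul_rowsub_mx mul1mx.
    by rewrite -[rowsub _ _]/(Wc z c c y) mulVmx ?trmx1.
  - move=> x y xy; apply/submxP.
    have /eqP := HEd c s x y xy; rewrite /Ed subr_eq0 => /eqP E.
    have det0 : \det (Wc z c c y) != 0 by have := Wu s y; rewrite unitmxE unitfE.
    exists ((\det (Wc z c c y))^-1 *: (\adj (Wc z c c y) *m mxsub (fcomp c s y) id (Wm z c x)))^T.
    rewrite -trmx_mul -scalemxAr mulmxA -E scalerA mulVf // scale1r.
    by [].
  by exists h; split=> // y; have [q qu qE] := hq y; exists q => //; rewrite qE trmxK.
have /choice[qd' qdP] : forall u : {s : bool & FD s}, exists e : K, e != 0 /\
    forall c', gpl (h (tag u)) (fcomp c' (tag u) (tagged u)) = \det (Wc z c c' (tagged u)) * e.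
  move=> [s y] /=; have [q qu qE] := (hP s).2 y; exists (\det q).
  split=> [|c']; first by rewrite -unitfE -unitmxE.
  rewrite -det_mulmx; congr (\det _); apply/matrixP => i j.
  have /matrixP/(_ (fcomp c' s y i) j) := qE; rewrite !mxE /= => ->.
  by apply: eq_bigr => l _; rewrite !mxE.
pose qd s (y : FD s) := qd' (Tagged (fun s => FD s) y).
have gplE s (y : FD s) c' : gpl (h s) (fcomp c' s y) = \det (Wc z c c' y) * qd s y.
  exact: (qdP (Tagged (fun s => FD s) y)).2.
have qd0 s (y : FD s) : qd s y != 0 by case: (qdP (Tagged (fun s => FD s) y)).
pose e := (\prod_(y : FD true) qd true y) * (\prod_(y : FD false) qd false y).
have e0 : e != 0 by rewrite mulf_neq0 //; apply/prodf_neq0.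
have fpE' c' : fp h c' * e^-1 = (\prod_(y : FD true) \det (Wc z c c' y)) * (\prod_(y : FD false) \det (Wc z c c' y)).
  rewrite /fp /gpp (eq_bigr _ (fun y _ => gplE true y c')) (eq_bigr _ (fun y _ => gplE false y c')).
  by rewrite !big_split /= mulrACA -/e mulfK.
exists (z c * (z c ^+ fdeg)^-1 * e^-1), h; split.
- by rewrite !mulf_neq0 ?invr_eq0 ?expf_neq0.
- by move=> s; case: (hP s).
- move=> c'; have /eqP := HEb c c'; rewrite /Eb subr_eq0 -fpE' => /eqP E.
  have zd0 : z c ^+ fdeg != 0 by rewrite expf_neq0.
  apply: (mulfI zd0); rewrite -E.
  have G (u v w x : K) : v != 0 -> w != 0 -> u * (x / w) = v * (u / v / w * x).
    by move=> v0 w0; field; rewrite v0 w0.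
  exact: G zd0 e0.
Qed.

End FlagPoints.

End FlagVariety.
Arguments Wm {d J B} z c {s} y.
Arguments Wc {d J B} z c {s} c' y.
Arguments Ed {d J B} z c {s} x y.

(** * Cyclic vectors for the Frobenius *)

(** A product of twisted linear factors [1 + b m sg], with [sg] the entrywise power [Q], applied to
    [x]. *)
Fixpoint zseq (B : comUnitRingType) d Q (b : nat -> B) (x : 'rV[B]_d) n : 'rV[B]_d :=
  if n is m.+1 then zseq Q b x m + b m *: fmx Q (zseq Q b x m) else x.

Lemma eq_zseq (B : comUnitRingType) d Q (b b' : nat -> B) (x : 'rV[B]_d) n :
  (forall i, (i < n)%N -> b i = b' i) -> zseq Q b x n = zseq Q b' x n.
Proof. by elim: n => //= n IH E; rewrite IH ?E // => i lt; rewrite E // ltnW. Qed.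

Section FrobeniusSpaces.
Variables (k : fieldType) (d Q : nat).
Hypothesis (kQ : [pchar k].-nat Q) (Q1 : (1 < Q)%N).
Local Notation sg := (fmx Q).

Let sgE m n (M : 'M[k]_(m, n)) : sg M = map_mx (frobf kQ) M. Proof. by []. Qed.

Lemma sg_submx m n p (A : 'M[k]_(m, n)) (B : 'M_(p, n)) : (sg A <= sg B)%MS = (A <= B)%MS.
Proof. by rewrite !sgE map_submx. Qed.

Lemma sg_rank m n (A : 'M[k]_(m, n)) : \rank (sg A) = \rank A.
Proof. by rewrite sgE mxrank_map. Qed.

Lemma sg_eq0 m n (A : 'M[k]_(m, n)) : (sg A == 0) = (A == 0).
Proof. by rewrite -!mxrank_eq0 sg_rank. Qed.

Lemma sgZ m n a (A : 'M[k]_(m, n)) : sg (a *: A) = a ^+ Q *: sg A.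
Proof. by apply/matrixP => i j; rewrite !mxE exprMn. Qed.

Lemma sg_sum m n (I : Type) (r : seq I) (P : pred I) (F : I -> 'M[k]_(m, n)) :
  sg (\sum_(i <- r | P i) F i) = \sum_(i <- r | P i) sg (F i).
Proof. by rewrite sgE (raddf_sum (@map_mx _ _ (frobf kQ) m n)). Qed.

Lemma iter_sgZ m n i a (A : 'M[k]_(m, n)) : iter i sg (a *: A) = a ^+ (Q ^ i) *: iter i sg A.
Proof. by elim: i => //= i ->; rewrite sgZ -exprM -expnSr. Qed.

Lemma iter_sgD m n i (A B : 'M[k]_(m, n)) : iter i sg (A + B) = iter i sg A + iter i sg B.
Proof. by elim: i => //= i ->; rewrite (fmxD kQ). Qed.

Lemma iter_sg_sum m n i (I : Type) (r : seq I) (P : pred I) (F : I -> 'M[k]_(m, n)) :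
  iter i sg (\sum_(j <- r | P j) F j) = \sum_(j <- r | P j) iter i sg (F j).
Proof. by elim: i => //= i ->; rewrite sg_sum. Qed.

(* Lang's theorem for a subspace: a vector of minimal support with an entry 1 is fixed. *)
Lemma stable_fixed m (A : 'M[k]_(m, d)) : (sg A <= A)%MS -> A != 0 ->
  exists v : 'rV[k]_d, [/\ v != 0, sg v = v & (v <= A)%MS].
Proof.
move=> AA A0.
pose supp (v : 'rV[k]_d) := #|[set i | v ord0 i != 0]|.
suff H n (v : 'rV[k]_d) : supp v = n -> v != 0 -> (v <= A)%MS ->
    exists v : 'rV[k]_d, [/\ v != 0, sg v = v & (v <= A)%MS].
  by have /rowV0Pn[v vA v0] := A0; apply: (H _ v).
elim/ltn_ind: n v => n IH v vn v0 vA.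
have /existsP[i vi] : [exists i, v ord0 i != 0].
  apply: contraR v0; rewrite negb_exists => /forallP H; apply/eqP/rowP => i; rewrite mxE.
  by have := H i; rewrite negbK => /eqP.
pose w := (v ord0 i)^-1 *: v.
have wi : w ord0 i = 1 by rewrite mxE mulVf.
have wA : (w <= A)%MS by rewrite scalemx_sub.
have [D0|D0] := eqVneq (sg w - w) 0.
  exists w; split=> //; last by apply/eqP; rewrite -subr_eq0 D0.
  by apply: contraTneq (oner_neq0 k) => w0; rewrite -wi w0 mxE eqxx.
apply: (IH _ _ (sg w - w) erefl D0); last first.
  by rewrite addmx_sub // ?eqmx_opp // (submx_trans _ AA) // sg_submx.
rewrite -vn; apply: proper_card; apply/properP; split.
  apply/subsetP => j; rewrite !inE; apply: contra => /eqP vj.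
  by rewrite !mxE vj mulr0 expr0n (gtn_eqF (ltnW Q1)) subrr.
exists i; rewrite !inE //.
by rewrite mxE [(- w) _ _]mxE [sg w _ _]mxE wi expr1n subrr eqxx.
Qed.

Definition kr (u : 'rV[k]_d) n : 'M[k]_(n, d) := \matrix_(i < n) iter i sg u.

Lemma kr_row u n i : (i < n)%N -> (iter i sg u <= kr u n)%MS.
Proof. by move=> lt; have := row_sub (Ordinal lt) (kr u n); rewrite rowK. Qed.

Lemma kr_sub u n m (A : 'M_(m, d)) : (forall i, (i < n)%N -> (iter i sg u <= A)%MS) -> (kr u n <= A)%MS.
Proof. by move=> H; apply/row_subP => i; rewrite rowK H. Qed.

Lemma kr_le u n m : (n <= m)%N -> (kr u n <= kr u m)%MS.
Proof. by move=> nm; apply: kr_sub => i lt; apply: kr_row; apply: leq_trans nm. Qed.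

Lemma sg_kr u n : sg (kr u n) = kr (sg u) n.
Proof. by apply/row_matrixP => i; rewrite rowK -iterSr iterS -[row i (sg _)]map_row rowK. Qed.

Lemma krS u n : (kr u n.+1 :=: u + kr (sg u) n)%MS.
Proof.
apply/eqmxP/andP; split; last first.
  rewrite addsmx_sub (kr_row u (ltn0Sn n)) kr_sub // => i lt; rewrite -iterSr.
  exact: kr_row.
apply: kr_sub => -[_|i lt]; first exact: addsmxSl.
by rewrite iterSr (submx_trans _ (addsmxSr _ _)) // kr_row.
Qed.

Lemma krSr u n : (kr u n.+1 :=: kr u n + iter n sg u)%MS.
Proof.
apply/eqmxP/andP; split; last first.
  by rewrite addsmx_sub kr_le // kr_row.
apply: kr_sub => i; rewrite ltnS leq_eqVlt => /orP[/eqP->|lt]; first exact: addsmxSr.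
by rewrite (submx_trans _ (addsmxSl _ _)) // kr_row.
Qed.

Lemma kr_stable u n : (iter n sg u <= kr u n)%MS -> (sg (kr u n) <= kr u n)%MS.
Proof.
move=> H; rewrite sg_kr; apply: kr_sub => i lt; rewrite -iterSr.
by move: lt; rewrite leq_eqVlt => /orP[/eqP iE|lt]; [rewrite iE|apply: kr_row].
Qed.

Lemma kr_dep u n : ~~ row_free (kr u n) -> exists2 m, (m < n)%N & (iter m sg u <= kr u m)%MS.
Proof.
elim: n => [|n IH]; first by rewrite -row_leq_rank.
have [f|/IH[m lt H] _] := boolP (row_free (kr u n)); last by exists m; rewrite // ltnW.
move=> nf; exists n => //; apply: contraR nf => ns.
rewrite -row_leq_rank (krSr u n); have : (kr u n < kr u n + iter n sg u)%MS.
  rewrite /ltmx addsmxSl /=; apply: contra ns; apply: submx_trans; exact: addsmxSr.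
by move/rank_ltmx; move: f; rewrite /row_free => /eqP->.
Qed.

Definition no_fixed m (A : 'M[k]_(m, d)) := forall v : 'rV[k]_d, sg v = v -> (v <= A)%MS -> v = 0.

Lemma no_fixed_stable m (A : 'M[k]_(m, d)) : no_fixed A -> (sg A <= A)%MS -> A = 0.
Proof.
move=> nA AA; apply/eqP; apply: contraT => /(stable_fixed AA)[v [v0 vf /(nA v vf) vz]].
by rewrite vz eqxx in v0.
Qed.

Lemma kr_free m (A : 'M[k]_(m, d)) u n : no_fixed A -> u != 0 -> (kr u n <= A)%MS -> row_free (kr u n).
Proof.
move=> nA u0 uA; apply: contraT => /kr_dep[m' lt st].
have K0 : kr u m' = 0.
  apply: no_fixed_stable (kr_stable st) => v vf vK; apply: (nA v vf).
  by rewrite (submx_trans vK) // (submx_trans _ uA) // kr_le // ltnW.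
have uK : (u <= kr u m')%MS.
  by case: m' st {lt K0} => [|m'] st //; exact: kr_row (ltn0Sn m').
by move: u0; rewrite -submx0 (submx_trans uK) // K0 sub0mx.
Qed.

(** A Krylov space that is not everything is contained in a stable proper one; the annihilator of
    the latter is stable, hence contains a rational linear form, which kills [x]. *)
Lemma kr_cyclic x : (forall c : 'rV[k]_d, sg c = c -> c != 0 -> c *m x^T != 0) -> kr x d \in unitmx.
Proof.
move=> H; rewrite -row_free_unit; apply: contraT => /kr_dep[m lt st].
pose K := kermx (kr x m)^T.
have K0 : K != 0.
  rewrite kermx_eq0 -row_leq_rank -ltnNge; apply: leq_ltn_trans lt.
  by rewrite mxrank_tr rank_leq_row.
have stK : (kr x m <= sg (kr x m))%MS.
  have := kr_stable st; move=> /mxrank_leqif_sup/leqifP; rewrite sg_rank; case: ifP => // _.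
  by rewrite ltnn.
have KK : (sg K <= K)%MS.
  apply/sub_kermxP; have /submxP[X XE] := stK.
  rewrite {1}XE trmx_mul mulmxA -fmx_tr -(fmxM kQ) mulmx_ker.
  by rewrite (_ : fmx Q 0 = 0) ?mul0mx //; apply/eqP; rewrite sg_eq0.
have [c [c0 cf cK]] := stable_fixed KK K0.
have /negP[] := H c cf c0.
have xK : (x <= kr x m)%MS.
  by case: m st {lt K K0 stK KK cK} => [|m] st; [| exact: kr_row (ltn0Sn m)].
have /submxP[X ->] := xK; rewrite trmx_mul mulmxA.
by move/sub_kermxP: cK => ->; rewrite mul0mx.
Qed.

Local Notation zseq := (zseq Q).

Section Cyclic.
(* holds over an algebraically closed field *)
Hypothesis root_sg : forall u : 'rV[k]_d, exists v, sg v = u.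

Lemma root_iter i (u : 'rV[k]_d) : exists v, iter i sg v = u.
Proof.
elim: i u => [|i IH] u; first by exists u.
by have [v <-] := IH u; have [w <-] := root_sg v; exists w; rewrite iterSr.
Qed.

Lemma iter_sg_submx i m n (A : 'M[k]_(m, d)) (B : 'M_(n, d)) :
  (iter i sg A <= iter i sg B)%MS = (A <= B)%MS.
Proof. by elim: i => //= i <-; rewrite sg_submx. Qed.

(** Each intersection with a twist lowers the rank by at most one, so [A] and its first [a] twists
    share a nonzero vector. Its root under the [a]-th iterate of [sg] generates [A]. *)
Lemma cyclic_vector (A : 'M[k]_d) a : no_fixed A -> \rank A = a.+1 -> (\rank (A + sg A)%MS <= a.+2)%N ->
  exists2 u, u != 0 & (kr u a.+1 :=: A)%MS.
Proof.
move=> nA rA rAA.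
pose B i : 'M[k]_d := iter i (fun B => (A :&: sg B)%MS) A.
have BA i : (B i <= A)%MS by case: i => [|i] //=; apply: capmxSl.
have rB i : (i <= a)%N -> (a.+1 - i <= \rank (B i))%N.
  elim: i => [_|i IH lt]; first by rewrite subn0 /= rA.
  have := IH (ltnW lt); have := mxrank_sum_cap A (sg (B i)); rewrite sg_rank rA -[(A :&: sg (B i))%MS]/(B i.+1).
  have : (\rank (A + sg (B i))%MS <= a.+2)%N.
    by apply: leq_trans rAA; apply: mxrankS; rewrite addsmxS // sg_submx.
  lia.
have : B a != 0 by rewrite -mxrank_eq0 -lt0n (leq_trans _ (rB a _)) // subSnn.
case/rowV0Pn => w wB w0.
have BsA i j : (j <= i)%N -> (B i <= iter j sg A)%MS.
  elim: j i => [|j IH] i; first by move=> _; exact: BA.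
  by case: i => // i lt; rewrite /= (submx_trans (capmxSr _ _)) // sg_submx IH.
have [u uE] := root_iter a w.
have u0 : u != 0 by apply: contra w0 => /eqP u0; rewrite -uE u0; elim: (a) => //= i /eqP->; rewrite sg_eq0.
exists u => //.
have uA : (kr u a.+1 <= A)%MS.
  apply: kr_sub => i; rewrite ltnS => ia.
  rewrite -(iter_sg_submx (a - i)) -iterD subnK // uE (submx_trans wB) //.
  by apply: BsA; apply: leq_subr.
apply/eqmxP; rewrite uA /=.
have := mxrank_leqif_sup uA; rewrite rA; have := kr_free nA u0 uA; rewrite /row_free => /eqP->.
by case=> _ <-.
Qed.

(** Both [A] and its twist lie in the twist of [W], so [A] has a cyclic vector. Its root under [sg]
    lies in [W], but not in [A], which would otherwise be stable. *)
Lemma flag_step_vector (A W : 'M[k]_d) a : no_fixed A -> \rank A = a -> \rank W = a.+1 ->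
  (A <= W)%MS -> (A <= sg W)%MS -> exists u, (kr u a.+1 :=: W)%MS /\ (kr (sg u) a :=: A)%MS.
Proof.
move=> nA rA rW AW AsW; case: a => [|a] in rA rW *.
  have /rowV0Pn[u uW u0] : W != 0 by rewrite -mxrank_eq0 rW.
  exists u; split; last first.
    have A0 : A = 0 by apply/eqP; rewrite -mxrank_eq0 rA.
    by apply/eqmxP; rewrite kr_sub //= A0 sub0mx.
  have uW' : (kr u 1 <= W)%MS by apply: kr_sub => -[].
  apply/eqmxP; rewrite uW' /=; have := mxrank_leqif_sup uW'; rewrite rW.
  suff -> : \rank (kr u 1) = 1%N by case=> _ <-.
  apply/eqP; rewrite eqn_leq rank_leq_row lt0n mxrank_eq0; apply: contra u0 => /eqP K0.
  by have := kr_row u (ltn0Sn 0); rewrite K0 => /submx0null/eqP.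
have [|u1 u10 u1A] := cyclic_vector nA rA.
  by rewrite -rW -(sg_rank W); apply: mxrankS; rewrite addsmx_sub AsW sg_submx.
have [u uE] := root_sg u1.
have uW : (u <= W)%MS.
  by rewrite -sg_submx uE (submx_trans _ AsW) // -u1A (kr_row u1 (ltn0Sn a)).
have uA : ~~ (u <= A)%MS.
  apply/negP => uA.
  have kA : (kr u a.+1 <= A)%MS.
    apply: kr_sub => -[|i] // lt; rewrite iterSr uE -u1A.
    by apply: kr_row; apply: ltnW.
  have u0 : u != 0 by apply: contra u10 => /eqP u0; rewrite -uE sg_eq0 u0.
  have kE : (A <= kr u a.+1)%MS.
    have := mxrank_leqif_sup kA; rewrite rA; have := kr_free nA u0 kA; rewrite /row_free => /eqP->.
    by case=> _ <-.
  have : A = 0.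
    apply: no_fixed_stable => //; rewrite -u1A -uE -sg_kr sg_submx.
    by rewrite (submx_trans _ kE) // u1A.
  by move=> A0; move: rA; rewrite A0 mxrank0.
exists u; rewrite uE; split=> //.
have kW : (kr u a.+2 <= W)%MS by rewrite krS uE addsmx_sub uW u1A.
apply/eqmxP; rewrite kW /=; have := mxrank_leqif_sup kW; rewrite rW.
suff -> : \rank (kr u a.+2) = a.+2 by case=> _ <-.
apply/eqP; rewrite eqn_leq rank_leq_row /= krS uE -{1}rA.
have AS : (A <= u + kr u1 a.+1)%MS by rewrite -u1A addsmxSr.
apply: rank_ltmx; rewrite /ltmx AS /=; apply: contra uA.
by apply: submx_trans; apply: addsmxSl.
Qed.

End Cyclic.

Lemma kr_comb u n (v : 'rV_d) : (v <= kr u n)%MS ->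
  exists c : nat -> k, v = \sum_(i < n) c i *: iter i sg u.
Proof.
case/submxP => X ->; exists (fun i => if insub i is Some j then X ord0 j else 0).
by rewrite mulmx_sum_row; apply: eq_bigr => i _; rewrite rowK valK.
Qed.

Lemma sum_kr_sub (u : 'rV[k]_d) n m (A : 'M[k]_(m, d)) (c : nat -> k) j :
  (forall i, (i < n)%N -> (iter (i + j) sg u <= A)%MS) ->
  (iter j sg (\sum_(i < n) c i *: iter i sg u)%R <= A)%MS.
Proof.
move=> H; rewrite iter_sg_sum; apply: summx_sub => i _.
by rewrite iter_sgZ scalemx_sub // -iterD addnC H.
Qed.

Lemma kr_top_coef (u : 'rV[k]_d) n m (A : 'M[k]_(m, d)) (c : nat -> k) j :
  (forall i, (i < n)%N -> (iter (i + j) sg u <= A)%MS) -> ~~ (iter (n + j) sg u <= A)%MS ->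
  (iter j sg (\sum_(i < n.+1) c i *: iter i sg u)%R <= A)%MS -> c n = 0.
Proof.
move=> H nA; rewrite big_ord_recr /= iter_sgD iter_sgZ -iterD addnC => vA.
apply/eqP; apply: contraNT nA => cn; have := sum_kr_sub c H => sA.
have {vA} : (c n ^+ (Q ^ j) *: iter (j + n) sg u <= A)%MS.
  rewrite addnC; move: (iter j sg _) sA vA => X sA vA.
  by rewrite -[Y in (Y <= _)%MS](addKr X) addmx_sub ?eqmx_opp.
rewrite addnC => {}vA; have := scalemx_sub (c n ^+ (Q ^ j))^-1 vA.
by rewrite scalerA mulVf ?expf_neq0 // scale1r.
Qed.

(** The twists of [u] of orders [1] to [w - 1] lie in the Krylov space of [sg u'], which kills the
    top coefficients of [u] in terms of [u'] one by one. The two non-inclusions keep the extreme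
    coefficients nonzero. *)
Lemma flag_step_poly (u u' : 'rV[k]_d) w w' : (0 < w)%N -> (w < w')%N -> (kr u w <= kr u' w')%MS ->
  (kr (sg u) w.-1 <= kr (sg u') w'.-1)%MS -> ~~ (kr u w <= kr (sg u') w'.-1)%MS ->
  ~~ (sg (kr u w) <= kr (sg u') w'.-1)%MS -> ~~ (iter w' sg u' <= kr (sg u') w'.-1)%MS ->
  exists c : nat -> k, [/\ c 0 != 0, c (w' - w)%N != 0 & u = \sum_(i < (w' - w).+1) c i *: iter i sg u'].
Proof.
move=> w0 ww WW AA WA sWA nst.
case: w w0 ww WW AA WA sWA => // w _; case: w' nst => // w' nst; rewrite ltnS /= subSS => ww WW AA WA sWA.
have inA i : (0 < i <= w')%N -> (iter i sg u' <= kr (sg u') w')%MS.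
  by case: i => // i /= lt; rewrite -iterS iterSr kr_row.
have [c cE] := kr_comb (submx_trans (kr_row u (ltn0Sn w)) WW).
have sA i : (0 < i <= w)%N -> (iter i sg u <= kr (sg u') w')%MS.
  by case: i => // i /= lt; rewrite -iterS iterSr (submx_trans _ AA) // kr_row.
have uE j : (j <= w)%N -> u = \sum_(i < (w' - j).+1) c i *: iter i sg u'.
  elim: j => [_|j IH lt]; first by rewrite subn0.
  have {IH} uE := IH (ltnW lt).
  have c0 : c (w' - j)%N = 0.
    apply: (@kr_top_coef u' (w' - j) _ (kr (sg u') w') c j.+1).
    - by move=> i lti; apply: inA; lia.
    - by rewrite (_ : _ + _ = w'.+1)%N //; lia.
    - by rewrite -uE; apply: sA; lia.
  by rewrite {1}uE big_ord_recr /= c0 scale0r addr0 subnSK // (leq_trans lt) // ltnW.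
exists c; split; last exact: uE.
- apply: contra WA => /eqP c0; rewrite krS addsmx_sub AA andbT.
  rewrite (uE w) // big_ord_recl c0 scale0r add0r; apply: summx_sub => i _.
  by rewrite scalemx_sub // inA //=; have := ltn_ord i; rewrite /bump; lia.
- apply: contra sWA => /eqP c0; rewrite sg_kr krSr addsmx_sub AA -iterSr /=.
  rewrite -[sg (iter w sg u)]/(iter w.+1 sg u) [u in iter w.+1 _ u](uE w) // big_ord_recr /= c0 scale0r addr0.
  by apply: (@sum_kr_sub u' _ _ _ c w.+1) => i lti; apply: inA; lia.
Qed.

Lemma zseq_cat (b b' : nat -> k) (x : 'rV[k]_d) n m :
  zseq (fun i => if (i < n)%N then b i else b' (i - n)%N) x (n + m) = zseq b' (zseq b x n) m.
Proof.
have E m' : (m' <= n)%N -> zseq (fun i => if (i < n)%N then b i else b' (i - n)%N) x m' = zseq b x m'.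
  by elim: m' => //= m' IH lt; rewrite IH ?lt // ltnW.
elim: m => [|m IH]; first by rewrite addn0 E.
by rewrite addnS /= IH ltnNge leq_addr /= addKn.
Qed.

Section Factor.
Hypothesis root_poly : forall n (c : nat -> k), c 0 != 0 -> c n.+1 != 0 ->
  exists2 v, v != 0 & \sum_(i < n.+2) c i * v ^+ (Q ^ i) = 0.

(** A nonzero root [v] of the additive polynomial gives a right factor [1 + b sg], with [b] chosen
    so that this factor kills [v]. *)
Lemma twisted_factor n : forall c : nat -> k, c 0 != 0 -> c n != 0 ->
  exists2 b : nat -> k, (forall i, b i != 0) &
    forall x : 'rV[k]_d, \sum_(i < n.+1) c i *: iter i sg x = c 0 *: zseq b x n.
Proof.
elim: n => [|n IH] c c0 cn; first by exists (fun=> 1) => [i|x]; rewrite ?oner_neq0 // big_ord1.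
have [v v0 vE] := root_poly c0 cn; pose b := - (v / v ^+ Q).
have vQ : v ^+ Q != 0 by rewrite expf_neq0.
have b0 : b != 0 by rewrite oppr_eq0 mulf_neq0 ?invr_eq0.
have bv : v + b * v ^+ Q = 0 by rewrite /b mulNr mulfVK // subrr.
(* division on the right by 1 + b sg *)
pose c' := fix c' i := if i is j.+1 then c i - c' j * b ^+ (Q ^ j) else c 0.
have div (V : lmodType k) (y : nat -> V) m : \sum_(i < m.+1) c i *: y i =
    \sum_(i < m) c' i *: (y i + b ^+ (Q ^ i) *: y i.+1) + c' m *: y m.
  elim: m => [|m IHm]; first by rewrite big_ord1 big_ord0 add0r.
  rewrite big_ord_recr IHm big_ord_recr /= scalerBl scalerDr scalerA -!addrA; congr (_ + (_ + _)).
  by rewrite addrC subrK.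
(* The remainder is evaluated at [v], where both the polynomial and the divisor vanish. *)
have r0 : c' n.+1 = 0.
  have := div k^o (fun i => v ^+ (Q ^ i)) n.+1; rewrite [LHS]vE big1 ?add0r => [/esym/eqP|i _].
    by rewrite mulf_eq0 (negPf (expf_neq0 _ v0)) orbF => /eqP.
  rewrite -[_ *: _]/(_ * _) -[b ^+ _ *: _]/(_ * _).
  have -> : v ^+ (Q ^ i) + b ^+ (Q ^ i) * v ^+ (Q ^ i.+1) = (v + b * v ^+ Q) ^+ (Q ^ i).
    rewrite exprDn_pchar ?exprMn -?exprM -?expnS //.
    by rewrite (pnatX) kQ.
  by rewrite bv expr0n (gtn_eqF (_ : 0 < Q ^ i)%N) ?expn_gt0 ?(ltnW Q1) ?mulr0.
have c'n : c' n != 0.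
  by apply: contra cn => /eqP cz; move/eqP: r0; rewrite /= cz mul0r subr0.
have [b' b'0 b'E] := IH c' c0 c'n.
exists (fun i => if i is j.+1 then b' j else b) => [[]|x] //.
rewrite (div _ (fun i => iter i sg x) n.+1) r0 scale0r addr0.
have := b'E (x + b *: sg x); rewrite -[c' 0]/(c 0) => E.
have -> : zseq (fun i => if i is j.+1 then b' j else b) x n.+1 = zseq b' (x + b *: sg x) n.
  have := zseq_cat (fun=> b) b' x 1 n; rewrite add1n /= => <-.
  by apply: (@eq_zseq _ _ _ _ _ x n.+1) => -[] // i _; rewrite subSS subn0.
rewrite -E; apply: eq_bigr => i _; congr (_ *: _).
by rewrite iter_sgD iter_sgZ -iterSr.
Qed.

(** Going down the dimensions, the factorizations of the successive steps are concatenated into a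
    single sequence [b]. *)
Lemma flag_chain_vector (u : nat -> 'rV[k]_d) (s : seq nat) w0 :
  path (fun w' w => (w < w')%N) w0 s ->
  (forall w' w, w' \in w0 :: s -> w \in w0 :: s -> (w < w')%N -> exists c : nat -> k,
     [/\ c 0 != 0, c (w' - w)%N != 0 & u w = \sum_(i < (w' - w).+1) c i *: iter i sg (u w')]) ->
  forall x a, a != 0 -> u w0 = a *: x ->
  exists2 b : nat -> k, (forall i, b i != 0) &
    forall w, w \in w0 :: s -> exists2 e, e != 0 & u w = e *: zseq b x (w0 - w).
Proof.
elim: s w0 => [|w1 s IH] w0 /=.
  move=> _ _ x a a0 ux; exists (fun=> 1) => [i|w]; first exact: oner_neq0.
  by rewrite inE => /eqP->; exists a; rewrite // subnn.
case/andP=> w10 ps H x a a0 ux.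
have [|||c [c0 cn uc]] := H w0 w1; rewrite ?inE ?eqxx ?orbT //.
pose c' i := c i * a ^+ (Q ^ i).
have [||b bn bE] := @twisted_factor (w0 - w1) c'.
- by rewrite mulf_neq0 // expf_neq0.
- by rewrite mulf_neq0 // expf_neq0.
have u1 : u w1 = c' 0 *: zseq b x (w0 - w1).
  by rewrite -bE uc ux; apply: eq_bigr => i _; rewrite iter_sgZ scalerA.
have c'0 : c' 0 != 0 by rewrite mulf_neq0 // expf_neq0.
have [|b' bn' bE'] := IH w1 ps _ (zseq b x (w0 - w1)) (c' 0) c'0 u1.
  by move=> w' w w's ws; apply: H; rewrite inE ?w's ?ws orbT.
exists (fun i => if (i < w0 - w1)%N then b i else b' (i - (w0 - w1))%N).
  by move=> i; case: ifP.
move=> w; rewrite inE => /orP[/eqP->|ws]; first by exists a; rewrite // subnn.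
have ww1 : (w <= w1)%N.
  move: ws; rewrite inE => /orP[/eqP-> //|ws].
  by have /allP/(_ w ws)/ltnW := order_path_min (fun y x z (H1 : (y < x)%N) H2 => ltn_trans H2 H1) ps.
have [e e0 eE] := bE' w ws; exists e => //.
by rewrite eE (_ : w0 - w = (w0 - w1) + (w1 - w))%N ?zseq_cat //; lia.
Qed.

End Factor.

End FrobeniusSpaces.

(** * Bruhat cells of Coxeter words *)

Section ClosedRoots.
Variables (k : closedFieldType) (Q : nat).
Hypothesis Q1 : (1 < Q)%N.

Lemma fmx_root d (u : 'rV[k]_d) : exists v, fmx Q v = u.
Proof.
have root (a : k) : exists x, x ^+ Q = a.
  have /closed_rootP[x] : size ('X^Q - a%:P) != 1%N.
    rewrite size_polyDl size_polyXn; last by rewrite size_polyN (leq_ltn_trans (size_polyC_leq1 _)) // ltnS (ltnW Q1).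
    by rewrite eqSS -lt0n (ltnW Q1).
  by rewrite /root !hornerE subr_eq0 => /eqP; exists x.
have [f fE] := choice (fun i => root (u ord0 i)).
by exists (\row_i f i); apply/rowP => i; rewrite !mxE.
Qed.

(** The additive polynomial is divided by its variable, which removes the root 0 since [c 0] is
    nonzero. *)
Lemma twisted_root n (c : nat -> k) : c 0 != 0 -> c n.+1 != 0 ->
  exists2 v, v != 0 & \sum_(i < n.+2) c i * v ^+ (Q ^ i) = 0.
Proof.
move=> c0 cn; pose P : {poly k} := \sum_(i < n.+2) c i *: 'X^((Q ^ i).-1).
have Pc m : (m < n.+2)%N -> P`_(Q ^ m).-1 = c m.
  move=> lt; rewrite coef_sum (bigD1 (Ordinal lt)) //= coefZ coefXn eqxx mulr1.
  rewrite big1 ?addr0 // => i im; rewrite coefZ coefXn; case: eqP => [E|]; last by rewrite mulr0.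
  have {}E : (Q ^ m = Q ^ i)%N.
    by rewrite -(prednK (_ : 0 < Q ^ m)%N) ?E ?prednK // expn_gt0 (ltnW Q1).
  by case/negP: im; apply/eqP/val_inj => /=; apply/eqP; rewrite -(eqn_exp2l _ _ Q1) E.
have /closed_rootP[v vP] : size P != 1%N.
  apply/negP => /size_poly1P[a a0 PE].
  have := Pc n.+1 (leqnn _); rewrite PE coefC => E; move: cn; rewrite -E.
  have : (1 < Q ^ n.+1)%N by rewrite -{1}(expn0 Q) ltn_exp2l.
  by case: (Q ^ _)%N => [|[|m]] // _; rewrite eqxx.
have {}vP : \sum_(i < n.+2) c i * v ^+ (Q ^ i).-1 = 0.
  by move: vP; rewrite /root /P horner_sum => /eqP vP; rewrite -[RHS]vP; apply: eq_bigr => i _; rewrite !hornerE.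
exists v; last first.
  transitivity ((\sum_(i < n.+2) c i * v ^+ (Q ^ i).-1) * v); last by rewrite vP mul0r.
  rewrite mulr_suml; apply: eq_bigr => i _; rewrite -mulrA -exprSr prednK //.
  by rewrite expn_gt0 (ltnW Q1).
apply: contra c0 => /eqP v0; rewrite -vP v0 big_ord_recl /= mulr1 big1 ?addr0 // => i _.
rewrite expr0n /bump /= (gtn_eqF _) ?mulr0 //.
by rewrite -ltnS prednK ?expn_gt0 ?(ltnW Q1) // -{1}(expn0 Q) ltn_exp2l.
Qed.

End ClosedRoots.

Section Coxeter.
Variable d : nat.

Lemma coxeter_wordE l (i : 'I_d) : (0 < l <= d)%N ->
  [/\ (i < l.-1)%N -> coxeter_word d l i = i :> nat, i = l.-1 :> nat -> coxeter_word d l i = d.-1 :> nat &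
      (l <= i)%N -> coxeter_word d l i = i.-1 :> nat].
Proof.
move=> /andP[l0 ld].
pose F n : 'S_d := if insub n is Some x then simple_refl (x : 'I_d) else 1%g.
have -> : coxeter_word d l = (\prod_(l <= n < d) F n)%g.
  rewrite big_geq_mkord /coxeter_word; apply: eq_big => // x _.
  by rewrite /F valK.
have H m : (l <= m <= d)%N -> let y : nat := (\prod_(l <= n < m) F n)%g i in
    [/\ (i < l.-1)%N || (m <= i)%N -> y = i, i = l.-1 :> nat -> y = m.-1 & (l <= i < m)%N -> y = i.-1].
  elim: m => [|m IH] lm; first by lia.
  have [lm'|lm'] := eqVneq l m.+1.
    by rewrite -lm' big_geq // perm1 /=; split; lia.
  have {lm'} lm' : (l <= m < d)%N by lia.
  rewrite big_nat_recr /=; last by case/andP: lm'.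
  rewrite permM /F; case: insubP => [x _ xm|]; last by case/andP: lm' => _ ->.
  have px : ord_pred x = m.-1 :> nat.
    rewrite /= -[nat_of_ord x]/(val x) xm; case: (m) lm' => [|m'] lm'; first by lia.
    by rewrite addSn /= modnDr modn_small //; lia.
  have {}xm : x = m :> nat := xm.
  have := IH _; move: ((\prod_(l <= n < m) F n)%g i) => y /(_ _)[|H1 H2 H3]; first by lia.
  rewrite /simple_refl; case: tpermP => [yE|yE|y1 y2].
  - by rewrite yE px in H1 H2 H3; rewrite xm; split; lia.
  - by rewrite yE xm in H1 H2 H3; rewrite px; split; lia.
  - have {}y1 : y != m.-1 :> nat by rewrite -px; apply/eqP => /val_inj.
    have {}y2 : y != m :> nat by rewrite -xm; apply/eqP => /val_inj.
    by split; lia.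
have [|H1 H2 H3] := H d; first by rewrite ld leqnn.
have := ltn_ord i; split=> // ?; [apply: H1 | apply: H3]; lia.
Qed.

Variable K : fieldType.
Implicit Types N U : 'M[K]_d.

Definition upper U := U \in unitmx /\ forall i j : 'I_d, (j < i)%N -> U i j = 0.

Lemma nz_iota (i j : 'I_d) : nz (iota 1 d) i j = (j < i)%N.
Proof.
apply/nzP/idP => [[x _]|ji]; first by lia.
by exists (nat_of_ord i); rewrite ?ji ?leqnn // mem_iota; have := ltn_ord i; lia.
Qed.

Lemma upper_inv U : upper U -> upper (invmx U).
Proof.
move=> [Uu Ul]; split=> [|i j]; first by rewrite unitmx_inv.
rewrite -nz_iota; move: i j; apply: inP_inv => // i j; rewrite nz_iota; exact: Ul.
Qed.

Lemma upper_mul U U' : upper U -> upper U' -> upper (U *m U').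
Proof.
move=> [Uu Ul] [Uu' Ul']; split=> [|i j]; first by rewrite unitmx_mul Uu.
rewrite -nz_iota; move: i j; apply: inP_mul => i j; rewrite nz_iota; [exact: Ul|exact: Ul'].
Qed.

Definition hessenberg N := forall i j : 'I_d, (j.+1 < i)%N -> N i j = 0.

Lemma mulmx_perm_col N (s : 'S_d) i j : (N *m perm_mx s) i (s j) = N i j.
Proof.
rewrite mxE (bigD1 j) //= !mxE eqxx mulr1 big1 ?addr0 // => l lj.
by rewrite !mxE (inj_eq perm_inj) (negPf lj) mulr0.
Qed.

Lemma hessenberg_upper N U : upper U -> hessenberg N -> hessenberg (U *m N) /\ hessenberg (N *m U).
Proof.
move=> [_ uU] hN; split=> i j ji; rewrite mxE big1 // => l _.
  by have [li|il] := ltnP l i; [rewrite uU ?mul0r | rewrite hN ?mulr0 //; lia].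
by have [lj|jl] := ltnP j l; [rewrite uU ?mulr0 | rewrite hN ?mul0r //; lia].
Qed.

Lemma hessenberg_coxeter l : (0 < l <= d)%N -> hessenberg (perm_mx (coxeter_word d l) : 'M[K]_d).
Proof.
move=> ld i j ji; rewrite !mxE; case: eqP => // E.
by have [H1 H2 H3] := coxeter_wordE i ld; have := ltn_ord i; rewrite E in H1 H2 H3; lia.
Qed.

(** A single column operation suffices: the combination [c] of columns equal to the unit vector at
    row [l - 1] replaces the last column, and the cycle of the Coxeter word then makes the matrix
    upper triangular. *)
Lemma hessenberg_bruhat N l : N \in unitmx -> (0 < l <= d)%N -> hessenberg N ->
  (forall i j : 'I_d, (j < l.-1)%N -> (j < i)%N -> N i j = 0) ->
  (forall i j : 'I_d, (l.-1 <= j)%N -> i = j.+1 :> nat -> N i j != 0) ->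
  exists U U', [/\ upper U, upper U' & N = U *m perm_mx (coxeter_word d l) *m U'].
Proof.
move=> Nu ld hN low sub.
have l1d : (l.-1 < d)%N by lia.
have d1d : (d.-1 < d)%N by lia.
pose jl : 'I_d := Ordinal l1d; pose jd : 'I_d := Ordinal d1d.
have [c Nc] : exists c, N *m c = delta_mx jl (ord0 : 'I_1).
  by exists (invmx N *m delta_mx jl ord0); rewrite mulKVmx.
(* Otherwise back substitution along the subdiagonal gives [c j = 0] for all [j >= l - 1], while row
   [l - 1] of [N] has no entry before that column. *)
have cd : c jd ord0 != 0.
  apply/negP => /eqP cd.
  have cz n : forall j : 'I_d, (l.-1 <= j)%N -> (d.-1 - j = n)%N -> c j ord0 = 0.
    elim/ltn_ind: n => -[|n] IH j lj jn.
      by rewrite (_ : j = jd) //; apply: val_inj => /=; have := ltn_ord j; lia.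
    have jd' : (j.+1 < d)%N by lia.
    have := congr1 (fun M : 'cV_d => M (Ordinal jd') ord0) Nc; rewrite mxE (bigD1 j) //= big1 => [|u uj].
      rewrite addr0 mxE -val_eqE /= (_ : (_ == _) = false) /=; last by apply/negP => /eqP; lia.
      by move/eqP; rewrite mulf_eq0 (negPf (sub _ _ _ _)) //= => /eqP.
    have [uj'|uj'] := ltnP u j; first by rewrite hN ?mul0r //=; lia.
    have {}uj : (u != j :> nat) by [].
    rewrite [c u _](IH (d.-1 - u)%N) ?mulr0 //; have := ltn_ord u; lia.
  have := congr1 (fun M : 'cV_d => M jl ord0) Nc; rewrite mxE big1 => [|u _].
    by rewrite mxE !eqxx => /esym/eqP; rewrite oner_eq0.
  have [ul|ul] := ltnP u l.-1; first by rewrite low ?mul0r.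
  by rewrite (cz _ u ul erefl) mulr0.
pose U' : 'M[K]_d := \matrix_(i, j) if j == jd then c i ord0 else (i == j)%:R.
have U'up : upper U'.
  have tr : forall i j : 'I_d, (j < i)%N -> U' i j = 0.
    move=> i j ji; rewrite mxE; case: eqP => [jE|_]; last by rewrite -val_eqE gtn_eqF.
    by move: ji; rewrite jE /=; have := ltn_ord i; lia.
  split=> //; rewrite -unitmx_tr unitmxE det_trig; last first.
    by apply/is_trig_mxP => i j ij; rewrite mxE tr.
  rewrite unitfE; apply/prodf_neq0 => i _; rewrite !mxE.
  by have [->|_] := eqVneq i jd; rewrite // eqxx oner_neq0.
pose s := coxeter_word d l.
have NU i j : (N *m U') i j = if j == jd then (i == jl)%:R else N i j.
  case: ifP => jE.
    transitivity ((N *m c) i ord0).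
      by rewrite !mxE; apply: eq_bigr => u _; rewrite !mxE jE.
    by rewrite Nc mxE eqxx andbT.
  rewrite mxE (bigD1 j) //= mxE jE eqxx mulr1 big1 ?addr0 // => u uj.
  by rewrite mxE jE (negPf uj) mulr0.
exists (N *m U' *m perm_mx s^-1), (invmx U'); split.
- split; first by rewrite !unitmx_mul Nu U'up.1 unitmx_perm.
  move=> i j ji; rewrite -{1}(permK s j) mulmx_perm_col NU.
  have [s1 s2 s3] := coxeter_wordE j ld; rewrite -/s in s1 s2 s3.
  have jd1 := ltn_ord j; have sjd := ltn_ord (s j).
  case: eqP => [sE|/eqP sE].
    have {}sE : s j = d.-1 :> nat by rewrite sE.
    case: eqP => // iE; have {}iE : i = l.-1 :> nat by rewrite iE.
    suff : False by []; lia.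
  have {}sE : s j != d.-1 :> nat by [].
  have [jl'|jl'] := ltnP j l.-1; first by apply: low; rewrite s1.
  by apply: hN; lia.
- exact: upper_inv U'up.
- by rewrite -!mulmxA (mulmxA (perm_mx _)) -perm_mxM mulVg perm_mx1 mul1mx mulmxV ?mulmx1 // U'up.1.
Qed.

End Coxeter.


(** The first [l] exponents are taken in decreasing order; then the twist of the frame for [l - 1]
    has all its columns but the last among those of the frame for [l]. *)
Definition rv l j : nat := if (j < l)%N then (l.-1 - j)%N else j.

(* the flags of the points of the variety have the frames [Gm H l] and [fmx Q (Gm H l.-1)] *)
Definition Gm (B : comUnitRingType) d Q H l (b : nat -> B) (x : 'rV[B]_d) : 'M[B]_d :=
  \matrix_(r, j) iter (rv l j) (fmx Q) (zseq Q b x (H - (j.+1 - l))) ord0 r.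

Section ParamFrames.
Variables (k : fieldType) (d Q H l : nat) (b : nat -> k) (x : 'rV[k]_d).
Hypothesis (kQ : [pchar k].-nat Q).
Hypothesis (lHd : (l + H <= d)%N).
Local Notation sg := (fmx Q).
Local Notation zs := (zseq Q b x).
Local Notation G l := (Gm Q H l b x).

Lemma Gm_row l' (j : 'I_d) : row j (G l')^T = iter (rv l' j) sg (zs (H - (j.+1 - l'))).
Proof. by apply/rowP => i; rewrite !mxE. Qed.

Lemma sg_Gm_row l' (j : 'I_d) : row j (sg (G l'))^T = iter (rv l' j).+1 sg (zs (H - (j.+1 - l'))).
Proof. by apply/rowP => i; rewrite !mxE. Qed.

Lemma zseq_sub n : (zs n - x <= kr Q (sg x) n)%MS.
Proof.
have H1 m : (zs m <= kr Q x m.+1)%MS /\ (zs m - x <= kr Q (sg x) m)%MS.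
  elim: m => [|m [IH1 IH2]] /=; first by rewrite subrr sub0mx (kr_row Q x (ltn0Sn 0)).
  have s1 : (sg (zs m) <= kr Q (sg x) m.+1)%MS by rewrite -sg_kr (sg_submx kQ).
  have s2 : (zs m + b m *: sg (zs m) - x <= kr Q (sg x) m.+1)%MS.
    rewrite addrAC addmx_sub ?scalemx_sub // (submx_trans IH2) // kr_le //.
  split=> //; rewrite -(subrK x (_ + _)) addmx_sub ?(kr_row Q x (ltn0Sn _)) //.
  by rewrite (submx_trans s2) // (krS Q x) addsmxSr.
by case: (H1 n).
Qed.

Lemma zseq_kr m t : (zs (m + t) <= kr Q (zs m) t.+1)%MS.
Proof.
elim: t => [|t IH]; first by rewrite addn0 (kr_row Q _ (ltn0Sn 0)).
rewrite addnS /= addmx_sub //; first by rewrite (submx_trans IH) // kr_le.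
rewrite scalemx_sub // krS (submx_trans _ (addsmxSr _ _)) // -sg_kr.
by rewrite (sg_submx kQ).
Qed.

(** Downward induction on [e]: column [rv l' e] is the [e]-th twist of [x] up to later twists. *)
Lemma Gm_unit l' : (l' <= l)%N -> kr Q x d \in unitmx -> G l' \in unitmx.
Proof.
move=> l'l xu; rewrite -unitmx_tr -row_full_unit -sub1mx.
have : row_full (kr Q x d) by rewrite row_full_unit.
rewrite -sub1mx => /submx_trans; apply.
suff Hn n e : (d - e = n)%N -> (e < d)%N -> (iter e sg x <= (G l')^T)%MS.
  by apply: kr_sub => e; apply: Hn.
elim/ltn_ind: n e => n IH e en ed.
have jd : (rv l' e < d)%N by rewrite /rv; case: ifP => // _; lia.
have rvK : rv l' (rv l' e) = e by rewrite /rv; case: (ltnP e l') => ?; [rewrite ifT|rewrite ifF]; lia.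
pose j := Ordinal jd; have := row_sub j (G l')^T; rewrite Gm_row {1}rvK.
set f := (H - _)%N => zA.
have ef : (e + f < d)%N by rewrite /f /= /rv; case: ifP; lia.
have -> : iter e sg x = iter e sg (zs f) - iter e sg (zs f - x).
  by apply/eqP; rewrite eq_sym subr_eq -(iter_sgD kQ) addrC subrK.
rewrite addmx_sub // eqmx_opp.
apply: submx_trans (_ : (iter e sg (kr Q (sg x) f) <= _)%MS).
  by rewrite (iter_sg_submx kQ) // zseq_sub.
have -> : iter e sg (kr Q (sg x) f) = kr Q (iter e.+1 sg x) f.
  by elim: (e) => //= e' ->; rewrite sg_kr.
apply: kr_sub => i lti; rewrite -iterD.
by apply: (IH (d - (i + e.+1))%N); lia.
Qed.

Lemma Gm_flag l' i : (l' <= l)%N -> (i <= H)%N -> forall j : 'I_d, (j < l' + i)%N ->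
  (row j (G l')^T <= kr Q (zs (H - i)) (l' + i))%MS.
Proof.
move=> l'l iH j ji; rewrite Gm_row.
pose t := (H - (j.+1 - l') - (H - i))%N.
have -> : (H - (j.+1 - l') = (H - i) + t)%N by rewrite /t; lia.
have := zseq_kr (H - i) t; rewrite -(iter_sg_submx kQ (rv l' j)) => /submx_trans; apply.
have -> : iter (rv l' j) sg (kr Q (zs (H - i)) t.+1) = kr Q (iter (rv l' j) sg (zs (H - i))) t.+1.
  by elim: (rv l' j) => //= e ->; rewrite sg_kr.
apply: kr_sub => e et; rewrite -iterD; apply: kr_row.
by move: et; rewrite /t /rv; case: ifP; lia.
Qed.

Hypothesis (l0 : (0 < l)%N).
Local Notation G1 := (G l).
Local Notation C := (sg (G l.-1)).

Lemma Gm_rel1 (j j' : 'I_d) : (j.+1 < d)%N -> j' = (if (j < l.-1)%N then j : nat else j.+1) :> nat ->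
  row j C^T = row j' G1^T.
Proof.
move=> jd j'E; rewrite sg_Gm_row Gm_row j'E.
have -> : (H - (j.+1 - l.-1) = H - ((if j < l.-1 then j : nat else j.+1).+1 - l))%N by case: ifP; lia.
have -> // : (rv l.-1 j).+1 = rv l (if (j < l.-1)%N then j : nat else j.+1).
by rewrite /rv; case: (ltnP j l.-1) => ?; [rewrite ifT|rewrite ifF]; lia.
Qed.

(** For [l - 1 <= j < l + H - 1] the recursion of [zseq] produces a subdiagonal entry, a power of
    some [b] up to sign. From [l + H - 1] on the sequence has come down to [x], and a single column
    remains. *)
Lemma Gm_rel2 (j : 'I_d) : exists v : 'rV[k]_d, [/\ row j C^T = v *m (sg G1)^T,
  forall i : 'I_d, (j.+1 < i)%N -> v ord0 i = 0,
  forall i : 'I_d, (j < i)%N -> ((l + H).-1 <= j)%N -> v ord0 i = 0 &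
  (forall i, b i != 0) -> forall i : 'I_d, i = j.+1 :> nat -> (j < (l + H).-1)%N -> v ord0 i != 0].
Proof.
have jd := ltn_ord j.
have dE (i : 'I_d) : delta_mx (ord0 : 'I_1) i *m (sg G1)^T = iter (rv l i).+1 sg (zs (H - (i.+1 - l))).
  by rewrite -rowE sg_Gm_row.
have [jl|jl] := ltnP j l.-1.
  have j1 : (j.+1 < d)%N by lia.
  exists (delta_mx ord0 (Ordinal j1)); split.
  - rewrite dE sg_Gm_row /rv jl ifT /=; last lia.
    have -> : (H - (j.+1 - l.-1) = H - (j.+2 - l))%N by lia.
    by have -> : (l.-2 - j = l.-1 - j.+1)%N by lia.
  - by move=> i ji; rewrite mxE eqxx -val_eqE gtn_eqF.
  - by move=> i; lia.
  - by move=> _ i ij _; rewrite mxE eqxx -val_eqE /= ij eqxx oner_neq0.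
have md : ((if j == l.-1 :> nat then 0 else j) < d)%N by case: ifP; lia.
pose m := Ordinal md.
have mj : (m <= j)%N by rewrite /=; case: ifP.
have mE : (rv l m).+1 = j.+1 by rewrite /rv /=; case: eqP => [->|?]; [rewrite ifT|rewrite ifF]; lia.
have mH : (H - (m.+1 - l) = H - (j - l.-1))%N by rewrite /=; case: eqP; lia.
have jE : row j C^T = iter j.+1 sg (zs (H - (j.+1 - l.-1))).
  by rewrite sg_Gm_row /rv ifF //; lia.
have [jH|jH] := leqP (l + H).-1 j.
  exists (delta_mx ord0 m); split.
  - by rewrite dE mE mH jE (_ : H - (j.+1 - l.-1) = H - (j - l.-1))%N //; lia.
  - by move=> i ji; rewrite mxE eqxx -val_eqE gtn_eqF //; apply: leq_ltn_trans mj (ltnW ji).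
  - by move=> i ji _; rewrite mxE eqxx -val_eqE gtn_eqF //; apply: leq_ltn_trans mj ji.
  - by move=> _ i; lia.
have j1 : (j.+1 < d)%N by lia.
pose t := (H - (j.+1 - l.-1))%N.
have tE : (H - (j - l.-1) = t.+1)%N by rewrite /t; lia.
exists (delta_mx ord0 m - b t ^+ (Q ^ j.+1) *: delta_mx ord0 (Ordinal j1)); split.
- rewrite mulmxBl -scalemxAl !dE mE mH tE jE -/t /=.
  have -> : (H - (j.+2 - l) = t)%N by rewrite /t; lia.
  have -> : rv l j.+1 = j.+1 by rewrite /rv ifF //; lia.
  rewrite -[sg (iter j sg (_ + _))]/(iter j.+1 sg _) (iter_sgD kQ) iter_sgZ.
  by rewrite -(iterSr j.+1) addrK.
- move=> i ji; have i1 : (i == m) = false.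
    by rewrite -val_eqE gtn_eqF //; apply: leq_ltn_trans mj (ltnW ji).
  have i2 : (i == Ordinal j1) = false by rewrite -val_eqE gtn_eqF.
  by rewrite !mxE i1 i2 !andbF mulr0 subr0.
- by move=> i; lia.
- move=> bn i ij _; have i1 : (i == m) = false.
    by rewrite -val_eqE gtn_eqF //; apply: leq_ltn_trans mj _; rewrite /= ij.
  have i2 : (i == Ordinal j1) = true by rewrite -val_eqE /= ij eqxx.
  by rewrite !mxE i1 i2 /= mulr1 sub0r oppr_eq0 expf_neq0.
Qed.

End ParamFrames.

(** * Deligne-Lusztig varieties in terms of frames *)

Section FineDL.
Variables (k : closedFieldType) (q d : nat) (S : 'M[k]_d) (b : 'M[k]_d * 'M[k]_d).
Variable J : {set 'I_d} * {set 'I_d}.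
Hypothesis (kq : [pchar k].-nat q).
Hypothesis (Su : S \in unitmx) (SS : fmx q (fmx q S) = S).
Hypothesis (b1u : b.1 \in unitmx) (b2u : b.2 \in unitmx) (bb : fmx q (fmx q b.2) = b.2).
Hypothesis orth : forall a c : 'I_d, (a + c + 2 <= d)%N -> (b.1^T *m S *m fmx q b.2) a c = 0.
Local Notation D := (fun s => dseq (Js J s)).
Local Notation w0 := (w0 k d).
Implicit Types g x y : 'M[k]_d * 'M[k]_d.

(** The form seen from either flag: exchanging the two spaces twists and transposes [S]. *)
Definition Sf s : 'M[k]_d := if s then S else (fmx q S)^T.
Definition pr (g : 'M[k]_d * 'M[k]_d) (s : bool) := if s then g.1 else g.2.
Let T := b.1^T *m S *m fmx q b.2.
(** Compares the reference frame [b] with the twisted orthogonal of its partner. It is upper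
    triangular because the two reference flags are orthogonal. *)
Let Rf s := if s then w0 *m T^T else w0 *m fmx q T.

Lemma Sf_unit s : Sf s \in unitmx.
Proof. by case: s; rewrite /Sf // unitmx_tr fmx_unit. Qed.

Lemma bu s : pr b s \in unitmx. Proof. by case: s. Qed.

Let Tu : T \in unitmx.
Proof. by rewrite !unitmx_mul unitmx_tr b1u Su fmx_unit. Qed.

Let Rup s : upper (Rf s).
Proof.
have q0 : (0 < q)%N by case/andP: kq.
case: s; rewrite /Rf; split; rewrite ?unitmx_mul ?w0_unit ?unitmx_tr ?fmx_unit // => i j ji.
  by rewrite w0Ml mxE orth //=; have := ltn_ord i; lia.
rewrite w0Ml mxE orth ?expr0n ?gtn_eqF //=; have := ltn_ord i; lia.
Qed.

(** Translates the Frobenius of the group into the twisted orthogonal of frames. *)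
Lemma Phi_frame g s : inG g -> pr (Phi q S g) s *m pr b s =
  Cm q (Sf s) (pr g (~~ s) *m pr b (~~ s)) *m Rf s.
Proof.
move=> [g1 g2]; case: s; rewrite /pr /Phi /= /Cm /Rf mulmxA -[_ *m w0 *m w0]mulmxA w0K mulmx1.
- rewrite /adj2 -[frob q _]/(fmx q _) /T -!mulmxA; congr (_ *m _).
  rewrite [(b.1^T *m _)^T]trmx_mul trmx_mul trmxK invmxM // (fmxM kq) trmx_mul !mulmxA; congr (_ *m _ *m _).
  by rewrite -mulmxA -trmx_mul -(fmxM kq) mulmxV // fmx1 // trmx1 mulmx1.
- rewrite /adj1 -[frob q _]/(fmx q _) !(fmxM kq) fmx_inv // trmxK -!mulmxA; congr (_ *m _).
  rewrite (fmx_tr q) invmxM // [in RHS](fmxM kq) trmx_mul -!mulmxA; congr (_ *m _).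
  by rewrite bb fmx_tr !mulmxA -trmx_mul -(fmxM kq) mulmxV // fmx1 // trmx1 mul1mx.
Qed.

Lemma Phi1 : Phi q S (1%:M, 1%:M) = (1%:M, 1%:M).
Proof.
rewrite /Phi /= /adj1 /adj2 invmx1 -[frob q _]/(fmx q _) -[frob q (invmx S *m _ *m _)]/(fmx q _) fmx1 //.
by rewrite !trmx1 !mulmx1 !mulVmx ?unitmx_tr // fmx1.
Qed.

Let Rinv s : invmx (Rf s) = invmx (pr b s) *m Cm q (Sf s) (pr b (~~ s)).
Proof.
have [Ru _] := Rup s; rewrite -[RHS](mulmxK Ru).
have := @Phi_frame (1%:M, 1%:M) s (conj (unitmx1 _ _) (unitmx1 _ _)); rewrite Phi1.
have p1 s' : pr (1%:M, 1%:M) s' = 1%:M by case: s'.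
rewrite !p1 !mul1mx => E; rewrite -[invmx _ *m _ *m _]mulmxA -E.
by rewrite mulVmx ?bu // mul1mx.
Qed.

Lemma stab_inP (J' : {set 'I_d}) (A : 'M[k]_d) : stab_std_flag J' A <-> A \in unitmx /\ inP (dseq J') A.
Proof.
split=> -[Au H]; split=> //.
  by move=> i j /nzP[x /dseqP[y yJ ->] jx]; apply: H yJ jx.
by move=> x i j xJ jx; apply: H; apply/nzP; exists (nat_of_ord x); rewrite ?mem_dseq.
Qed.

Lemma stab_upper (A : 'M[k]_d) : stab_std_flag set0 A <-> upper A.
Proof.
split=> -[Au H]; split=> //.
  move=> i j ji; apply: (H i) => //; last by rewrite ji leqnn.
  by rewrite inE in_set0 andbT (leq_ltn_trans _ ji).
by move=> x i j _ jx; apply: H; lia.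
Qed.

Definition cj s (A : 'M[k]_d) := invmx (pr b s) *m A *m pr b s.

Lemma cjM s A B : cj s (A *m B) = cj s A *m cj s B.
Proof. by rewrite /cj !mulmxA mulmxK ?bu. Qed.

Lemma cj_inv s A : A \in unitmx -> cj s (invmx A) = invmx (cj s A).
Proof. by move=> Au; rewrite /cj !invmxM ?unitmx_mul ?unitmx_inv ?bu ?Au // invmxK mulmxA. Qed.

Lemma parabolicP x : parabolic b J x <-> forall s, cj s (pr x s) \in unitmx /\ inP (D s) (cj s (pr x s)).
Proof.
split=> [[/stab_inP H1 /stab_inP H2] []//|H].
by split; apply/stab_inP; [apply: (H true)|apply: (H false)].
Qed.

Lemma borelP x : borel b x <-> forall s, upper (cj s (pr x s)).
Proof.
split=> [[/stab_upper H1 /stab_upper H2] []//|H].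
by split; apply/stab_upper; [apply: (H true)|apply: (H false)].
Qed.

Lemma bruhat_cellP (w : 'S_d * 'S_d) y : bruhat_cell b w y <->
  forall s, exists U U', [/\ upper U, upper U' &
    cj s (pr y s) = U *m perm_mx (if s then w.1 else w.2) *m U'].
Proof.
have cw s : cj s (pr (weyl_rep b w) s) = perm_mx (if s then w.1 else w.2).
  by case: s; rewrite /cj /weyl_rep /= !mulmxA mulVmx ?mul1mx -?mulmxA ?mulVmx ?mulmx1.
split.
  move=> [u [u' [/borelP uP /borelP u'P ->]]] s; exists (cj s (pr u s)), (cj s (pr u' s)); split=> //.
  by rewrite -(cw s) -!cjM; case: s.
move=> H; have [U1 [U1' [a1 b1 c1]]] := H true; have [U2 [U2' [a2 b2 c2]]] := H false.
have cjK s A : cj s (pr b s *m A *m invmx (pr b s)) = A.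
  by rewrite /cj !mulmxA mulVmx ?bu // mul1mx -mulmxA mulVmx ?bu // mulmx1.
exists (pr b true *m U1 *m invmx (pr b true), pr b false *m U2 *m invmx (pr b false)).
exists (pr b true *m U1' *m invmx (pr b true), pr b false *m U2' *m invmx (pr b false)).
split.
- by apply/borelP => -[]; rewrite [pr _ _]/= cjK.
- by apply/borelP => -[]; rewrite [pr _ _]/= cjK.
have cj_inj s A B : cj s A = cj s B -> A = B.
  move=> E; rewrite -[A](mulKVmx (bu s)) -[B](mulKVmx (bu s)).
  by congr (_ *m _); apply: (can_inj (mulmxK (bu s))).
rewrite [y]surjective_pairing /mulG; congr (_, _).
- apply: (cj_inj true); rewrite [LHS]c1 [RHS]cjM cjM.
  by have k1 := cjK true; rewrite /= in k1 *; rewrite !k1.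
- apply: (cj_inj false); rewrite [LHS]c2 [RHS]cjM cjM.
  by have k1 := cjK false; rewrite /= in k1 *; rewrite !k1.
Qed.

Lemma flag_pointE g i : flag_point b J g ord0 i = fp (fun s => pr g s *m pr b s) (enum_val i).
Proof. by rewrite mxE. Qed.

Definition Nk (h : bool -> 'M[k]_d) s : 'M[k]_d := invmx (h s) *m Cm q (Sf s) (h (~~ s)).

Definition frame_point (z : 'rV[k]_#|flag_index J|) := exists (a : k) h, [/\ a != 0, forall s, h s \in unitmx,
  forall s, inZ (D s) (Nk h s) & forall i, z ord0 i = a * fp h (enum_val i)].

(** The twist by the parabolic element is absorbed by the frames, which become [h p]. What remains
    is an element of the Bruhat cell times a triangular matrix, hence a Hessenberg matrix. *)
Lemma fine_DL_frame l1 l0 (z : 'rV[k]_#|flag_index J|) : (0 < l1 <= d)%N -> (0 < l0 <= d)%N ->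
  @fine_DL k q d S b J (coxeter_word d l1, coxeter_word d l0) z -> frame_point z.
Proof.
move=> l1d l0d [c [g [x [y [c0 gG zE [/parabolicP xP /bruhat_cellP yP] E]]]]].
have gu s : pr g s \in unitmx by case: s; case: gG.
have xu s : pr x s \in unitmx.
  by have [] := xP s; rewrite /cj !unitmx_mul unitmx_inv bu /= andbT.
have xG : inG x by split; [apply: (xu true)|apply: (xu false)].
pose h s := pr g s *m pr b s; pose p s := cj s (pr x s).
have hu s : h s \in unitmx by rewrite unitmx_mul gu bu.
have pu s : p s \in unitmx by case: (xP s).
have Es s : invmx (pr g s) *m pr (Phi q S g) s = pr x s *m pr y s *m invmx (pr (Phi q S x) s).
  by case: s; [have := congr1 fst E | have := congr1 snd E].
have gE s : cj s (invmx (pr g s) *m pr (Phi q S g) s) = Nk h s *m Rf s.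
  by rewrite /cj -!mulmxA Phi_frame // /Nk /h invmxM ?bu // !mulmxA.
have xE s : cj s (pr (Phi q S x) s) = invmx (Rf s) *m dualp q (p (~~ s)) *m Rf s.
  rewrite /cj -mulmxA Phi_frame // Rinv (mulmxA (invmx _)); congr (_ *m _).
  rewrite -[RHS](mulmxA (invmx _)) -Cm_mul ?bu //; congr (_ *m Cm _ _ _).
  by rewrite /p /cj mulmxA mulKVmx ?bu.
have [dp dpE] : exists dp, dp = fun s => dualp q (p (~~ s)) by exists (fun s => dualp q (p (~~ s))).
have du s : dp s \in unitmx by rewrite dpE dualp_unit.
have {}xE s : cj s (pr (Phi q S x) s) = invmx (Rf s) *m dp s *m Rf s by rewrite dpE xE.
have Phiu s : pr (Phi q S x) s \in unitmx.
  have : cj s (pr (Phi q S x) s) \in unitmx.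
    by rewrite xE !unitmx_mul unitmx_inv (Rup s).1 du.
  by rewrite /cj !unitmx_mul => /andP[/andP[_ ->]].
have G (P Y R X : 'M[k]_d) : P \in unitmx -> R \in unitmx -> X \in unitmx ->
    invmx P *m (P *m Y *m invmx (invmx R *m X *m R) *m invmx R) *m X = Y *m invmx R.
  move=> Pu Ru Xu; have RXu : invmx R *m X \in unitmx by rewrite unitmx_mul unitmx_inv Ru.
  have Riu : invmx R \in unitmx by rewrite unitmx_inv.
  rewrite (invmxM RXu Ru) (invmxM Riu Xu) invmxK -!mulmxA mulKmx //.
  by rewrite (mulKVmx Ru) mulVmx // mulmx1.
exists (c * (pchi J.1 (p true) * pchi J.2 (p false))^-1), (fun s => h s *m p s); split.
- rewrite mulf_neq0 // invr_eq0 mulf_neq0 // pchi_unit //; [exact: (xP true).2|exact: (xP false).2].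
- by move=> s; rewrite unitmx_mul hu pu.
- move=> s; have [U [U' [Uu Uu' yE]]] := yP s.
  have H : hessenberg (Nk (fun s => h s *m p s) s).
    have -> : Nk (fun s => h s *m p s) s = cj s (pr y s) *m invmx (Rf s).
      rewrite {1}/Nk invmxM // Cm_mul //.
      have -> : dualp q (p (~~ s)) = dp s by rewrite dpE.
      rewrite mulmxA -[_ *m invmx (h s) *m _]mulmxA -/(Nk h s).
      have := gE s; rewrite Es !cjM -/(p s) cj_inv // xE => /(congr1 (fun M => M *m invmx (Rf s))).
      rewrite (mulmxK (Rup s).1) => <-.
      by apply: G; rewrite ?pu ?du ?(Rup s).1.
    rewrite yE -[_ *m U' *m _]mulmxA.
    set w := if s then _ else _.
    have Hw : hessenberg (perm_mx w : 'M[k]_d) by rewrite /w; case: (s); apply: hessenberg_coxeter.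
    have [HU _] := hessenberg_upper Uu Hw.
    by have [_] := hessenberg_upper (upper_mul Uu' (upper_inv (Rup s))) HU.
  by move=> i j /nzP[x' _ ji]; apply: H; lia.
- move=> i; rewrite fp_mulP; last by move=> s; case: (xP s).
  rewrite mulrA mulfVK; last by rewrite mulf_neq0 // pchi_unit //; [exact: (xP true).2|exact: (xP false).2].
  by rewrite zE mxE flag_pointE.
Qed.

(** Frames whose matrices [Nk] already lie in the Bruhat cell need no parabolic twist: the parabolic
    element is the identity. *)
Lemma frame_fine_DL l1 l0 (z : 'rV[k]_#|flag_index J|) a h : a != 0 -> (forall s, h s \in unitmx) ->
  (forall s, exists U U', [/\ upper U, upper U' &
    Nk h s = U *m perm_mx (coxeter_word d (if s then l1 else l0)) *m U']) ->
  (forall i, z ord0 i = a * fp h (enum_val i)) ->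
  @fine_DL k q d S b J (coxeter_word d l1, coxeter_word d l0) z.
Proof.
move=> a0 hu H zE; pose g := (h true *m invmx b.1, h false *m invmx b.2).
have gb s : pr g s *m pr b s = h s by case: s; rewrite /= mulmxKV.
have gu s : pr g s \in unitmx by case: s; rewrite /= unitmx_mul unitmx_inv hu.
have gG : inG g by split; [apply: (gu true)|apply: (gu false)].
exists a, g, (1%:M, 1%:M), (mulG (invG g) (Phi q S g)); split=> //.
- by apply/rowP => i; rewrite zE mxE flag_pointE; congr (_ * _); apply: eq_fp => s; rewrite gb.
- split.
    apply/parabolicP => s; have -> : pr (1%:M, 1%:M) s = 1%:M by case: s.
    by rewrite /cj mulmx1 mulVmx ?bu ?unitmx1; split=> //; apply: inP1.
  apply/bruhat_cellP => s; have [U [U' [Uu Uu' NE]]] := H s.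
  exists U, (U' *m Rf s); split=> //; first exact: upper_mul.
  rewrite mulmxA (_ : (if s then (coxeter_word d l1, coxeter_word d l0).1 else _) = coxeter_word d (if s then l1 else l0)); last by case: s {NE}.
  rewrite -NE /Nk -!gb -mulmxA /cj.
  have -> : pr (mulG (invG g) (Phi q S g)) s = invmx (pr g s) *m pr (Phi q S g) s by case: s {NE}.
  by rewrite -!mulmxA Phi_frame // invmxM ?bu // !mulmxA.
- by rewrite Phi1 /mulG /invG /= !invmx1 !mul1mx !mulmx1.
Qed.

End FineDL.

Lemma rev_ord_ge d a (i : 'I_d) : (0 < a)%N -> (i < d.+1 - a)%N -> (a.-1 <= rev_ord i)%N.
Proof. by move=> a0; rewrite /= => ?; lia. Qed.

Section PidRows.
Variables (k : fieldType) (d : nat).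
Implicit Types X Y N : 'M[k]_d.

Lemma pid_row m X (j : 'I_d) : (j < m)%N -> (row j X <= (pid_mx m : 'M_d) *m X)%MS.
Proof.
move=> jm; have := row_sub j ((pid_mx m : 'M_d) *m X); rewrite row_mul.
rewrite (_ : row j (pid_mx m) = delta_mx ord0 j) -?rowE //.
by apply/rowP => i; rewrite !mxE jm andbT eq_sym.
Qed.

Lemma pid_sub m n X (A : 'M[k]_(n, d)) : (forall j : 'I_d, (j < m)%N -> (row j X <= A)%MS) ->
  ((pid_mx m : 'M_d) *m X <= A)%MS.
Proof.
move=> H; apply/row_subP => j; rewrite row_mul.
have [jm|mj] := ltnP j m.
  rewrite (_ : row j (pid_mx m) = delta_mx ord0 j) -?rowE ?H //.
  by apply/rowP => i; rewrite !mxE jm andbT eq_sym.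
rewrite (_ : row j (pid_mx m) = 0) ?mul0mx ?sub0mx //.
by apply/rowP => i; rewrite !mxE ltnNge mj andbF.
Qed.

Lemma pid_rank m X : X \in unitmx -> (m <= d)%N -> \rank ((pid_mx m : 'M_d) *m X) = m.
Proof. by move=> Xu md; rewrite mxrankMfree ?row_free_unit // rank_pid_mx. Qed.

Lemma pid_coord m X (v : 'rV[k]_d) : X \in unitmx -> (v <= (pid_mx m : 'M_d) *m X)%MS <->
  forall i : 'I_d, (m <= i)%N -> (v *m invmx X) ord0 i = 0.
Proof.
move=> Xu; split.
  case/submxP => a -> i mi; rewrite mulmxA mulmxK // mxE big1 // => j _.
  by rewrite mxE; case: eqP => [->|]; rewrite ?ltnNge ?mi ?andbF mulr0.
move=> H; rewrite -(mulmxKV Xu v) mulmx_sum_row; apply: summx_sub => i _.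
have [im|mi] := ltnP i m; first by rewrite scalemx_sub // pid_row.
by rewrite H // scale0r sub0mx.
Qed.

Lemma pid_mulmx m w X N : (forall i j : 'I_d, (j < m)%N -> (w <= i)%N -> N i j = 0) ->
  ((pid_mx m : 'M_d) *m (X *m N)^T <= (pid_mx w : 'M_d) *m X^T)%MS.
Proof.
move=> H; apply: pid_sub => j jm; rewrite trmx_mul row_mul mulmx_sum_row.
apply: summx_sub => i _; rewrite !mxE; have [iw|wi] := ltnP i w.
  by rewrite scalemx_sub // pid_row.
by rewrite H // scale0r sub0mx.
Qed.

Lemma pid_le m m' X : (m <= m')%N -> ((pid_mx m : 'M_d) *m X <= (pid_mx m' : 'M_d) *m X)%MS.
Proof. by move=> mm; apply: pid_sub => j jm; apply: pid_row; apply: leq_trans mm. Qed.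

Lemma flag_coord w X Y (j i : 'I_d) : X \in unitmx -> (row j Y^T <= (pid_mx w : 'M_d) *m X^T)%MS ->
  (w <= i)%N -> (invmx X *m Y) i j = 0.
Proof.
move=> Xu; rewrite pid_coord ?unitmx_tr // => H wi; rewrite -(H i wi).
by rewrite -trmx_inv -row_mul -trmx_mul !mxE.
Qed.

End PidRows.

Lemma fmx_fmx (B : comUnitRingType) q m n (M : 'M[B]_(m, n)) : fmx q (fmx q M) = fmx (q * q) M.
Proof. by apply/matrixP => i j; rewrite !mxE exprM. Qed.

(** * Solutions in general position and their parameters *)

Section GenericPoint.
Variables (k : closedFieldType) (q d : nat) (S : 'M[k]_d).
Variable J : {set 'I_d} * {set 'I_d}.
Hypothesis (kq : [pchar k].-nat q) (q1 : (1 < q)%N).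
Hypothesis (Su : S \in unitmx) (SS : fmx q (fmx q S) = S).
Variables (l H : nat) (Om : seq nat).
Hypothesis (l_gt0 : (0 < l)%N) (lHd : (l + H <= d)%N).
Local Notation Q := (q * q)%N.
Local Notation sg := (fmx Q).
Local Notation D := (fun s => dseq (Js J s)).
Local Notation w0 := (w0 k d).
Local Notation Sf := (Sf q S).
Local Notation Nk := (Nk q S).
Local Notation l0 := (d.+1 - (l + H))%N.

Let kQ : [pchar k].-nat Q. Proof. by rewrite pnatM kq. Qed.
Let Q1 : (1 < Q)%N. Proof. by rewrite (leq_trans q1) // leq_pmulr // ltnW. Qed.

(** The second frame is itself a twisted orthogonal, so that its own twisted orthogonal is simply
    [sg] applied to the frame for [l - 1]. *)
Definition pframe (b : nat -> k) (x : 'rV[k]_d) (s : bool) : 'M[k]_d :=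
  if s then Gm Q H l b x else Cm q (Sf false) (Gm Q H l.-1 b x).

Section OnePoint.
Variables (b : nat -> k) (x : 'rV[k]_d).
Hypothesis xu : kr Q x d \in unitmx.

Let G1u : Gm Q H l b x \in unitmx. Proof. exact: (Gm_unit b kQ lHd (leqnn l) xu). Qed.
Let G0u : Gm Q H l.-1 b x \in unitmx. Proof. exact: (Gm_unit b kQ lHd (leq_pred l) xu). Qed.

Lemma pframe_unit s : pframe b x s \in unitmx.
Proof. by case: s => //=; apply: (Cm_unit kq) => //; apply: (Sf_unit kq Su false). Qed.

Lemma pframe_Cm : Cm q S (pframe b x false) = sg (Gm Q H l.-1 b x).
Proof.
have e : pframe b x false *m 1%:M = Cm q (fmx q S)^T (Gm Q H l.-1 b x) by rewrite mulmx1.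
rewrite (Cm_twist kq Su SS G0u (pframe_unit false) (unitmx1 _ _) e).
by rewrite fmx1 // trmx1 mulmx1 w0K mulmx1 fmx_fmx.
Qed.

(** All columns of [N_1] but the last are unit vectors, by [Gm_rel1]. For [N_2], the conjugate by
    [w0] of its twisted transpose expresses [sg (Gm l.-1)] in [sg (Gm l)], and [Gm_rel2] gives its
    columns. *)
Lemma pframe_bruhat : (forall i, b i != 0) -> forall s, exists U U', [/\ upper U, upper U' &
  Nk (pframe b x) s = U *m perm_mx (coxeter_word d (if s then l else l0)) *m U'].
Proof.
move=> b0; have Nu s : Nk (pframe b x) s \in unitmx.
  by rewrite unitmx_mul unitmx_inv pframe_unit Cm_unit ?Sf_unit ?pframe_unit.
case.
  have NE (i j j' : 'I_d) : (j.+1 < d)%N -> j' = (if (j < l.-1)%N then j : nat else j.+1) :> nat ->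
      Nk (pframe b x) true i j = (i == j')%:R.
    move=> jd j'E; have := Gm_rel1 b x kQ lHd l_gt0 jd j'E => E.
    have -> : Nk (pframe b x) true = invmx (Gm Q H l b x) *m sg (Gm Q H l.-1 b x).
      by rewrite /Nk /= -pframe_Cm.
    transitivity ((invmx (Gm Q H l b x) *m Gm Q H l b x) i j').
      rewrite !mxE; apply: eq_bigr => u _; congr (_ * _).
      by have /rowP/(_ u) := E; rewrite !mxE.
    by rewrite mulVmx // mxE.
  have j' (j : 'I_d) : (j.+1 < d)%N -> exists j' : 'I_d, j' = (if (j < l.-1)%N then j : nat else j.+1) :> nat.
    by move=> jd; case: ltnP => _; [exists j | exists (Ordinal jd)].
  apply: hessenberg_bruhat => //; first by lia.
  - move=> i j ji; have jd' : (j.+1 < d)%N by have := ltn_ord i; lia.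
    have [u uE] := j' j jd'; rewrite (NE _ _ u) // -val_eqE /= uE.
    by case: eqP => // E; move: E; case: ifP; lia.
  - move=> i j jl ji; have jd : (j.+1 < d)%N by have := ltn_ord i; lia.
    have [u uE] := j' j jd; rewrite (NE _ _ u) // -val_eqE /= uE jl.
    by rewrite gtn_eqF.
  - move=> i j jl ij; have jd : (j.+1 < d)%N by have := ltn_ord i; lia.
    have [u uE] := j' j jd; rewrite (NE _ _ u) // -val_eqE /= uE ltnNge jl ij /= eqxx.
    exact: oner_neq0.
set N2 := Nk _ false; pose N2' := w0 *m (fmx q N2)^T *m w0.
have N2E : sg (Gm Q H l.-1 b x) = sg (Gm Q H l b x) *m N2'.
  rewrite -pframe_Cm -fmx_fmx; apply: (Cm_twist kq Su SS G1u (pframe_unit false) (Nu false)).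
  by rewrite /N2 /Nk mulKVmx // pframe_unit.
have ent a c : (N2' a c == 0) = (N2 (rev_ord c) (rev_ord a) == 0).
  rewrite /N2' w0Mr w0Ml !mxE expf_eq0.
  by case/andP: kq => ->.
have /choice[sv svP] : forall j : 'I_d, exists v : 'rV[k]_d, [/\ row j N2'^T = v,
  forall i : 'I_d, (j.+1 < i)%N -> v ord0 i = 0,
  forall i : 'I_d, (j < i)%N -> ((l + H).-1 <= j)%N -> v ord0 i = 0 &
  forall i : 'I_d, i = j.+1 :> nat -> (j < (l + H).-1)%N -> v ord0 i != 0].
  move=> j; have [v [vE v1 v2 v3]] := Gm_rel2 b x kQ lHd l_gt0 j.
  exists v; split=> //; last exact: v3.
  have sGu : (sg (Gm Q H l b x))^T \in unitmx by rewrite unitmx_tr fmx_unit.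
  by apply: (can_inj (mulmxK sGu)); rewrite -row_mul -trmx_mul -N2E vE.
have vE i j : N2' i j = sv j ord0 i by have [<- _ _ _] := svP j; rewrite !mxE.
have N20 (a c : 'I_d) : sv (rev_ord a) ord0 (rev_ord c) = 0 -> N2 a c = 0.
  by move=> E; apply/eqP; rewrite -[a]rev_ordK -[c]rev_ordK -ent vE E.
apply: hessenberg_bruhat; [exact: Nu | lia | | |].
- move=> i j ji; apply: N20; have [_ v1 _ _] := svP (rev_ord i); apply: v1 => /=.
  by have := ltn_ord i; lia.
- move=> i j jl ji; apply: N20; have [_ v1 v2 _] := svP (rev_ord i).
  have iv : rev_ord i = (d - i.+1)%N :> nat by [].
  have jv : rev_ord j = (d - j.+1)%N :> nat by [].
  have := ltn_ord i; have [il|il] := leqP (l + H).-1 (rev_ord i); first by move=> ?; apply: v2 => //; lia.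
  by move=> ?; apply: v1; lia.
- move=> i j jl ij; have [_ _ _ v3] := svP (rev_ord i).
  have iv : rev_ord i = (d - i.+1)%N :> nat by [].
  have jv : rev_ord j = (d - j.+1)%N :> nat by [].
  have id := ltn_ord i; rewrite -[i]rev_ordK -[j]rev_ordK -ent vE; apply: v3; lia.
Qed.

End OnePoint.

Hypothesis Om_bd : forall w, w \in Om -> (l <= w <= l + H)%N.
Hypothesis Om_min : l \in Om.
Hypothesis Om_max : exists2 s, Om = (l + H)%N :: s & path (fun w' w => (w < w')%N) (l + H)%N s.
Hypothesis D1P : forall x, (x \in D true) = (x \in Om) && (x < d)%N.
Hypothesis D2P : forall x, (x \in D false) = [&& (0 < x)%N, (x < d)%N & (d.+1 - x)%N \in Om].

Section Frames.
Variable h : bool -> 'M[k]_d.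
Hypothesis (hu : forall s, h s \in unitmx) (hZ : forall s, inZ (D s) (Nk h s)).
(** General position: no rational linear form vanishes on the smallest member of either flag and, in
    [g34], the last row of the inverse of [N_s] does not vanish on the first columns. *)
Hypothesis g12 : forall s (c : 'rV[k]_d), sg c = c -> c != 0 ->
  exists2 i : 'I_d, (i < if s then l else l0)%N & (c *m h s) ord0 i != 0.
Hypothesis g34 : forall s, exists r i : 'I_d,
  [/\ r = d.-1 :> nat, (i < if s then l else l0)%N & invmx (Nk h s) r i != 0].

Let C := Cm q S (h false).
(** As row spaces: the member of dimension [w] of the first flag and, in [A], the member of
    dimension [w - 1] of the twisted orthogonal of the second. *)
Let W w : 'M[k]_d := (pid_mx w : 'M_d) *m (h true)^T.
Let A w : 'M[k]_d := (pid_mx w.-1 : 'M_d) *m C^T.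
Let Cu : C \in unitmx. Proof. by apply: (Cm_unit kq). Qed.
Let Om_maxin : (l + H)%N \in Om.
Proof. by have [s -> _] := Om_max; rewrite inE eqxx. Qed.
Let Omd w : w \in Om -> (0 < w <= d)%N.
Proof. by move/Om_bd; lia. Qed.

Let N2' := w0 *m (fmx q (Nk h false))^T *m w0.
Let CE : C = sg (h true) *m N2'.
Proof.
have Nu : Nk h false \in unitmx by rewrite unitmx_mul unitmx_inv hu; apply: (Cm_unit kq); rewrite ?Sf_unit ?hu.
rewrite -fmx_fmx; apply: (Cm_twist kq Su SS (hu true) (hu false) Nu).
by rewrite /Nk mulKVmx.
Qed.

Let AW w : w \in Om -> (A w <= W w)%MS.
Proof.
move=> wO; have := Omd wO => wd; have [wd'|wd'] := ltnP w d; last first.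
  by apply: submx_full; rewrite /W (_ : w = d) ?pid_mx_1 ?mul1mx ?row_full_unit ?unitmx_tr //; lia.
rewrite /A /W (_ : C = h true *m Nk h true); last by rewrite /Nk mulKVmx.
apply: pid_mulmx => i j jw wi; apply: hZ; apply/nzP; exists w; first by rewrite D1P wO.
by lia.
Qed.

Let AsW w : w \in Om -> (A w <= sg (W w))%MS.
Proof.
move=> wO; have := Omd wO => wd.
rewrite /A /W (fmxM kQ) fmx_tr (_ : fmx Q (pid_mx w) = pid_mx w); last first.
  by apply/matrixP => i j; rewrite !mxE; case: andP => _; rewrite ?expr1n // expr0n gtn_eqF // ltnW.
rewrite CE; apply: pid_mulmx => i j jw wi; have q0 : (0 < q)%N by rewrite ltnW.
rewrite /N2' w0Mr w0Ml mxE [fmx q _ _ _]mxE hZ ?expr0n ?gtn_eqF //.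
apply/nzP; exists (d.+1 - w)%N; first by rewrite D2P; apply/and3P; split; [lia|lia|rewrite subKn //; lia].
by have := ltn_ord i; have := ltn_ord j; rewrite /=; lia.
Qed.

(** A rational vector in the largest [A] becomes, through [S], a rational linear form vanishing on
    the smallest member of the second flag. *)
Let nA : no_fixed Q (A (l + H)).
Proof.
move=> v vf vA; apply/eqP; apply: contraT => v0.
pose c := fmx q (v *m S).
have vS : sg (v *m S) = v *m S by rewrite (fmxM kQ) vf -fmx_fmx SS.
have qc : fmx q c = v *m S by rewrite /c fmx_fmx vS.
have c0 : c != 0.
  apply: contra v0 => /eqP c0; apply/eqP; rewrite -[v](mulmxK Su) -qc c0.
  rewrite (_ : fmx q 0 = 0) ?mul0mx //; apply/eqP; by rewrite sg_eq0.
have cf : sg c = c by rewrite -fmx_fmx qc.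
have [i il] := @g12 false c cf c0; case/negP.
rewrite -[_ == 0](_ : ((c *m h false) ord0 i ^+ q == 0) = _); last first.
  by rewrite expf_eq0; case/andP: kq => ->.
have -> : (c *m h false) ord0 i ^+ q = (fmx q (c *m h false)) ord0 i by rewrite [RHS]mxE.
have CuT : C^T \in unitmx by rewrite unitmx_tr.
have := (pid_coord _ _ CuT).1 vA (rev_ord i); rewrite -trmx_inv (Cm_inv kq Su (hu false)).
rewrite !trmx_mul !trmxK w0_tr !mulmxA w0Mr rev_ordK -qc -(fmxM kq) => ->; first exact: eqxx.
by apply: rev_ord_ge il; rewrite addn_gt0 l_gt0.
Qed.

(** Either inclusion would put a column of [h true], or of its twist, in [A (l + H)], and so
    annihilate the last-row entry of the inverse of [N_s] given by [g34]. *)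
Let minW w w' : w \in Om -> w' \in Om -> ~~ (W w <= A w')%MS /\ ~~ (sg (W w) <= A w')%MS.
Proof.
move=> wO w'O; have AA : (A w' <= A (l + H))%MS.
  by apply: pid_le; have := Om_bd w'O; lia.
have CuT : C^T \in unitmx by rewrite unitmx_tr.
have Nu s : Nk h s \in unitmx.
  by rewrite unitmx_mul unitmx_inv hu; apply: (Cm_unit kq); rewrite ?Sf_unit ?hu.
have lw : (l <= w)%N by case/andP: (Om_bd wO).
split; apply/negP => WA.
  have [r [i [rd il /negP[]]]] := g34 true.
  have ri : (row i (h true)^T <= A (l + H))%MS.
    by rewrite (submx_trans _ AA) // (submx_trans _ WA) // pid_row // (leq_trans il).
  have := flag_coord Cu ri; rewrite (_ : invmx C *m h true = invmx (Nk h true)).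
    by move=> E; apply/eqP; apply: E; rewrite rd -!subn1 leq_sub2r.
  have hiu : invmx (h true) \in unitmx by rewrite unitmx_inv.
  by rewrite -[Nk h true]/(invmx (h true) *m C) (invmxM hiu Cu) invmxK.
have [r [i [rd il /negP[]]]] := g34 false.
have d0 : (0 < d)%N by apply: leq_ltn_trans (ltn_ord r).
pose j0 : 'I_d := Ordinal d0.
have ri : (row j0 (sg (h true))^T <= A (l + H))%MS.
  rewrite (submx_trans _ AA) // (submx_trans _ WA) // /W (fmxM kQ) fmx_tr.
  rewrite (_ : fmx Q (pid_mx w) = pid_mx w); first by rewrite pid_row //=; apply: leq_trans l_gt0 lw.
  by apply/matrixP => u v; rewrite !mxE; case: andP => _; rewrite ?expr1n // expr0n gtn_eqF // ltnW.
have := flag_coord Cu ri; have sgu : sg (h true) \in unitmx by rewrite fmx_unit.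
have N2'u : N2' \in unitmx by rewrite !unitmx_mul w0_unit unitmx_tr fmx_unit.
rewrite (_ : invmx C *m sg (h true) = invmx N2'); last first.
  by rewrite CE invmxM // mulmxKV.
have -> : invmx N2' = w0 *m (fmx q (invmx (Nk h false)))^T *m w0.
  rewrite -[RHS](mulKmx N2'u) /N2' -!mulmxA (mulmxA w0 w0) w0K mul1mx.
  rewrite (mulmxA (fmx q (Nk h false))^T) -trmx_mul -(fmxM kq) mulVmx // fmx1 // trmx1 mul1mx w0K mulmx1.
  by [].
move=> /(_ (rev_ord i)); rewrite w0Mr w0Ml mxE [fmx q _ _ _]mxE => E.
have {}E : invmx (Nk h false) (rev_ord j0) (rev_ord (rev_ord i)) ^+ q = 0.
  by apply: E; apply: rev_ord_ge il; rewrite addn_gt0 l_gt0.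
apply/eqP; move/eqP: E; rewrite expf_eq0 rev_ordK => /andP[_ /eqP <-]; congr (invmx _ _ _).
by apply: val_inj => /=; rewrite rd subn1.
Qed.

Let stepP : exists u : nat -> 'rV[k]_d, forall w, w \in Om ->
  (kr Q (u w) w :=: W w)%MS /\ (kr Q (sg (u w)) w.-1 :=: A w)%MS.
Proof.
suff H1 w : exists u : 'rV[k]_d, w \in Om -> (kr Q u w :=: W w)%MS /\ (kr Q (sg u) w.-1 :=: A w)%MS.
  by have [u uP] := choice H1; exists u => w; apply: uP.
case: (boolP (w \in Om)) => [wO|_]; last by exists 0.
have wd := Omd wO.
have nAw : no_fixed Q (A w).
  move=> v vf vA; apply: nA => //; apply: submx_trans vA _.
  by apply: pid_le; have := Om_bd wO; lia.
have rA : \rank (A w) = w.-1 by rewrite pid_rank ?unitmx_tr //; lia.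
have rW : \rank (W w) = w.-1.+1 by rewrite pid_rank ?unitmx_tr //; lia.
have [u] := flag_step_vector kQ Q1 (@fmx_root k Q Q1 d) nAw rA rW (AW wO) (AsW wO).
by rewrite prednK; [exists u|lia].
Qed.

(** The generator of the largest [W], scaled to first coordinate 1, is [x]. The generators of the
    smaller ones are twisted polynomials in it, and their compatible factorizations give [b]. *)
Lemma generic_frame_param : exists b x, [/\ kr Q x d \in unitmx, (forall i : 'I_d, i = 0%N :> nat -> x ord0 i = 1),
  (forall i, b i != 0) & exists p : bool -> 'M[k]_d, [/\ forall s, p s \in unitmx,
    forall s, inP (D s) (p s) & forall s, pframe b x s = h s *m p s]].
Proof.
have [u uP] := stepP.
have d0 : (0 < d)%N by lia.
have cyc w (c : 'rV[k]_d) : w \in Om -> sg c = c -> c != 0 -> c *m (u w)^T != 0.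
  move=> wO cf c0; have [i il] := @g12 true c cf c0; apply: contra => /eqP E.
  have iw : (i < w)%N by apply: leq_trans il _; case/andP: (Om_bd wO).
  have : (row i (h true)^T <= kermx c^T)%MS.
    apply: (submx_trans (pid_row _ iw)); rewrite -/(W w) -(uP w wO).1.
    apply: kr_sub => j _; apply/sub_kermxP; elim: j => [|j IH] /=.
      by rewrite -[u w]trmxK -trmx_mul E trmx0.
    by rewrite -cf -(fmx_tr Q) -(fmxM kQ) IH; apply/eqP; rewrite sg_eq0.
  move/sub_kermxP => E'; have <- : (row i (h true)^T *m c^T) ord0 ord0 = (c *m h true) ord0 i.
    by rewrite -row_mul -trmx_mul !mxE.
  by rewrite E' mxE eqxx.
have sub_min w : w \in Om -> (w <= l + H)%N by move/Om_bd/andP => [].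
have [s OmE sP] := Om_max.
have poly w' w : w' \in Om -> w \in Om -> (w < w')%N -> exists c : nat -> k,
    [/\ c 0 != 0, c (w' - w)%N != 0 & u w = \sum_(i < (w' - w).+1) c i *: iter i sg (u w')].
  move=> w'O wO ww; have [w1 w2] := uP w wO; have [w1' w2'] := uP w' w'O.
  have /andP[w0 _] := Omd wO.
  have [m1 m2] := minW wO w'O.
  apply: (flag_step_poly kQ Q1) => //.
  - by rewrite w1 w1' pid_le // ltnW.
  - by rewrite w2 w2' pid_le // -!subn1 leq_sub2r // ltnW.
  - by rewrite w1 w2'.
  - apply: contra m2; rewrite w2'; apply: submx_trans.
    by rewrite sg_submx // w1.
  - apply/negP => st; have w'0 : (0 < w')%N := leq_trans w0 (ltnW ww).
    have st' : (sg (kr Q (sg (u w')) w'.-1) <= kr Q (sg (u w')) w'.-1)%MS.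
      by apply: kr_stable; rewrite -iterSr prednK.
    have nK : no_fixed Q (kr Q (sg (u w')) w'.-1).
      move=> v vf; rewrite w2' => vA; apply: nA => //; apply: submx_trans vA _.
      by apply: pid_le; rewrite -!subn1 leq_sub2r // sub_min.
    have K0 := no_fixed_stable kQ Q1 nK st'.
    have rA : \rank (A w') = w'.-1.
      rewrite pid_rank ?unitmx_tr //; apply: leq_trans (leq_pred _) _.
      by case/andP: (Omd w'O).
    move: rA; rewrite -w2' K0 mxrank0 => E.
    have : (1 < w')%N := leq_ltn_trans w0 ww.
    by rewrite -(prednK w'0) -E.
pose um := u (l + H)%N; pose i0 : 'I_d := Ordinal d0.
have um0 : um ord0 i0 != 0.
  have := cyc (l + H)%N (delta_mx ord0 i0) Om_maxin _ _.
  rewrite -rowE => H1; apply: contraTneq (H1 _ _) => [E||].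
  - by rewrite negbK; apply/eqP/rowP => j; rewrite !mxE ord1 E.
  - by apply/rowP => j; rewrite !mxE; case: (_ && _); rewrite ?expr1n // expr0n gtn_eqF // ltnW.
  - by apply/negP => /eqP/rowP/(_ i0); rewrite !mxE !eqxx => /eqP; rewrite oner_eq0.
pose x := (um ord0 i0)^-1 *: um.
have ux : u (l + H)%N = um ord0 i0 *: x by rewrite scalerA mulfV // scale1r.
have polyO : forall w' w, w' \in (l + H)%N :: s -> w \in (l + H)%N :: s -> (w < w')%N -> exists c : nat -> k,
    [/\ c 0 != 0, c (w' - w)%N != 0 & u w = \sum_(i < (w' - w).+1) c i *: iter i sg (u w')].
  by rewrite -OmE.
have [b b0 bP] := flag_chain_vector kQ Q1 (@twisted_root k Q Q1) sP polyO um0 ux.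
rewrite -OmE in bP.
have xu : kr Q x d \in unitmx.
  apply: (kr_cyclic kQ Q1) => c cf c0; have := cyc _ c Om_maxin cf c0; rewrite ux.
  apply: contra => /eqP E; rewrite linearZ /= -scalemxAr E scaler0 //.
have krE (w : 'rV[k]_d) (e : k) i n : e != 0 -> (kr Q (iter i sg (e *: w)) n :=: kr Q (iter i sg w) n)%MS.
  have H1 (e' : k) (w' : 'rV[k]_d) : e' != 0 -> (kr Q (iter i sg (e' *: w')) n <= kr Q (iter i sg w') n)%MS.
    move=> e0; apply: kr_sub => j lt; rewrite -iterD iter_sgZ scalemx_sub // iterD.
    exact: kr_row.
  move=> e0; apply/eqmxP; rewrite H1 //=.
  by have := H1 e^-1 (e *: w); rewrite scalerA mulVf // scale1r invr_eq0; apply.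
have zW w : w \in Om -> (kr Q (zseq Q b x (l + H - w)) w :=: W w)%MS.
  move=> wO; have [e e0 eE] := bP w wO.
  by have := krE (zseq Q b x (l + H - w)) e 0 w e0; rewrite /= -eE => H1; apply: eqmx_trans (eqmx_sym H1) (uP w wO).1.
have zA w : w \in Om -> (kr Q (sg (zseq Q b x (l + H - w))) w.-1 :=: A w)%MS.
  move=> wO; have [e e0 eE] := bP w wO.
  by have := krE (zseq Q b x (l + H - w)) e 1 w.-1 e0; rewrite /= -eE => H1; apply: eqmx_trans (eqmx_sym H1) (uP w wO).2.
exists b, x; split=> //.
  by move=> i iE; rewrite (_ : i = i0) ?mxE ?mulVf //; apply: val_inj.
exists (fun s => invmx (h s) *m pframe b x s).
have pu s' : invmx (h s') *m pframe b x s' \in unitmx by rewrite unitmx_mul unitmx_inv hu pframe_unit.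
split=> //; last by move=> s'; rewrite mulKVmx.
case.
  move=> i j /nzP[w]; rewrite D1P => /andP[wO _] /andP[jw wi].
  apply: (@flag_coord _ _ w) => //; rewrite -/(W w) -zW //.
  have /andP[lw wlH] := Om_bd wO.
  have := @Gm_flag _ _ Q H l b x kQ lHd l (w - l) (leqnn _) _ j _; rewrite subnKC //.
  rewrite subnBA // [(H + l)%N]addnC; apply=> //.
  by rewrite leq_subLR.
pose C' := Cm q S (pframe b x false).
have pE : C' = C *m dualp q (invmx (h false) *m pframe b x false).
  by rewrite -(Cm_mul kq) // mulKVmx.
have key (i j : 'I_d) w : w \in Om -> (j < w.-1)%N -> (w.-1 <= i)%N -> (invmx C *m C') i j = 0.
  move=> wO jw wi; apply: (@flag_coord _ _ w.-1) => //; rewrite -/(A w) -zA //.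
  have /andP[lw wlH] := Om_bd wO.
  have jl : (j < l.-1 + (w - l))%N.
    by rewrite -subn1 addnC addnBA // subnK // subn1.
  have := @Gm_flag _ _ Q H l b x kQ lHd l.-1 (w - l) (leq_pred _) _ j jl.
  rewrite subnBA // [(H + l)%N]addnC leq_subLR => /(_ wlH).
  have -> : (l.-1 + (w - l) = w.-1)%N by rewrite -!subn1 addnC addnBA // subnK.
  rewrite -(sg_submx kQ) sg_kr; congr (_ <= _)%MS.
  by rewrite /C' pframe_Cm //; apply/rowP => i'; rewrite !mxE.
have dE i j : (invmx C *m C') i j = (invmx (invmx (h false) *m pframe b x false)) (rev_ord j) (rev_ord i) ^+ q.
  by rewrite pE mulKmx // /dualp w0Mr w0Ml mxE [fmx q _ _ _]mxE.
rewrite -[X in inP _ X]invmxK; apply: inP_inv; first by rewrite unitmx_inv.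
move=> i j /nzP[w]; rewrite D2P => /and3P[w0 wd wO] /andP[jw wi].
have := dE (rev_ord j) (rev_ord i); rewrite !rev_ordK (key _ _ _ wO).
- by move=> /esym/eqP; rewrite expf_eq0 => /andP[_ /eqP].
- by rewrite /= subSn ?(ltnW wd) //= ltn_sub2l // ltnS.
- by rewrite /= subSn ?(ltnW wd) //= leq_sub2l.
Qed.

End Frames.

End GenericPoint.

(** The rational linear forms being finitely many, general position can be expressed by one
    polynomial. *)
Lemma fixed_points_finite (k : closedFieldType) (Q d : nat) : (1 < Q)%N ->
  exists L : seq 'rV[k]_d, forall c : 'rV[k]_d, (c \in L) = (c != 0) && (fmx Q c == c).
Proof.
move=> Q1; have [r rE] := closed_field_poly_normal ('X^Q - 'X : {poly k}).
have rP a : a ^+ Q = a -> a \in r.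
  move=> aQ; have : root ('X^Q - 'X) a by rewrite /root !hornerE aQ subrr.
  rewrite rE rootZ ?root_prod_XsubC // lead_coef_eq0 -size_poly_eq0.
  by rewrite size_polyDl ?size_polyN ?size_polyX ?size_polyXn.
pose f (g : {ffun 'I_d -> 'I_(size r).+1}) : 'rV[k]_d := \row_i nth 0 r (g i).
exists [seq c <- [seq f g | g <- enum {ffun 'I_d -> 'I_(size r).+1}] | (c != 0) && (fmx Q c == c)].
move=> c; rewrite mem_filter andb_idr // => /andP[_ /eqP cf].
apply/mapP; exists [ffun i => inord (index (c ord0 i) r)]; first by rewrite mem_enum.
apply/rowP => i; rewrite mxE ffunE inordK ?ltnS ?index_size // nth_index // rP //.
by have /rowP/(_ i) := cf; rewrite mxE.
Qed.

(** * Specialization of frames to the base field *)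

Section Specialize.
Variables (k : closedFieldType) (q d : nat) (S : 'M[k]_d) (D : bool -> seq nat).
Hypothesis (kq : [pchar k].-nat q) (Su : S \in unitmx).
Local Notation Sf := (Sf q S).

Definition frame_index : finType := (bool * bool * 'I_d * 'I_d)%type.
Local Notation n0 := #|frame_index|.
Local Notation A := {mpoly k[n0]}.

(** The entries of the inverses are coordinates too, so that invertibility is a polynomial relation
    and survives specialization. *)
Definition frame_coords (R : Type) (h y : bool -> 'M[R]_d) (e : 'I_n0) : R :=
  let: (s, t, i, j) := enum_val e in if t then h s i j else y s i j.

(* [t] distinguishes the entries of the frame from those of its inverse *)
Definition XM (t s : bool) : 'M[A]_d := \matrix_(i, j) 'X_(enum_rank (s, t, i, j)).

Lemma XM_map (R : comNzRingType) (phi : {rmorphism A -> R}) (h y : bool -> 'M[R]_d) :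
  (forall e, phi 'X_e = frame_coords h y e) ->
  forall s, map_mx phi (XM true s) = h s /\ map_mx phi (XM false s) = y s.
Proof.
by move=> H s; split; apply/matrixP => i j; rewrite !mxE H /frame_coords enum_rankK.
Qed.

Definition XN s : 'M[A]_d :=
  XM false s *m (map_mx (@mpolyC n0 k) (invmx (Sf s)^T) *m (fmx q (XM false (~~ s)))^T *m w0 A d).

Lemma w0_map (B B' : comUnitRingType) (f : {rmorphism B -> B'}) : map_mx f (w0 B d) = w0 B' d.
Proof. by apply/matrixP => i j; rewrite !mxE rmorph_nat. Qed.

Lemma XN_map (R : idomainType) (iota : {rmorphism k -> R}) (phi : {rmorphism A -> R}) (h : bool -> 'M[R]_d) :
  (forall c, phi c%:MP = iota c) -> (forall e, phi 'X_e = frame_coords h (fun s => invmx (h s)) e) ->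
  forall s, map_mx phi (XN s) = Nm q Sf iota h s.
Proof.
move=> phiC phiX s; have XMm := XM_map phiX.
have E1 : map_mx phi (fmx q (XM false (~~ s)))^T = (fmx q (invmx (h (~~ s))))^T.
  by apply/matrixP => i j; have /matrixP/(_ j i) := (XMm (~~ s)).2; rewrite !mxE rmorphXn => ->.
have E2 : map_mx phi (map_mx (@mpolyC n0 k) (invmx (Sf s)^T)) = invmx (map_mx iota (Sf s))^T.
  rewrite map_trmx -map_invmx_unit ?unitmx_tr ?Sf_unit //.
  by apply/matrixP => i j; rewrite !mxE phiC.
by rewrite /XN /Nm /Cm !map_mxM (XMm s).2 E1 E2 w0_map.
Qed.

(** The two conditions on the frames are polynomial relations in these coordinates, hence hold at a
    [k]-point that keeps [F] nonzero. *)
Lemma specialize (R : idomainType) (iota : {rmorphism k -> R}) (h : bool -> 'M[R]_d) (F : A) :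
  (forall s, h s \in unitmx) -> (forall s, inZ (D s) (Nm q Sf iota h s)) ->
  mmap iota (frame_coords h (fun s => invmx (h s))) F != 0 ->
  exists h0 : bool -> 'M[k]_d, [/\ forall s, h0 s \in unitmx, forall s, inZ (D s) (Nk q S h0 s) &
    F.@[frame_coords h0 (fun s => invmx (h0 s))] != 0].
Proof.
move=> hu hZ /nullstellensatz[v vF vI].
pose h0 s : 'M[k]_d := \matrix_(i, j) v (enum_rank (s, true, i, j)).
pose y0 s : 'M[k]_d := \matrix_(i, j) v (enum_rank (s, false, i, j)).
have vE : v =1 frame_coords h0 y0.
  move=> e; rewrite /frame_coords; case E : (enum_val e) => [[[s t] i] j].
  by rewrite -[e]enum_valK E; case: t {E}; rewrite mxE.
pose phiR : {rmorphism A -> R} := mmap iota (frame_coords h (fun s => invmx (h s))).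
pose phik : {rmorphism A -> k} := meval v.
have phiRX e : phiR 'X_e = frame_coords h (fun s => invmx (h s)) e by rewrite /phiR /= mmapX mmap1U.
have phikX e : phik 'X_e = frame_coords h0 y0 e by rewrite /phik /= mevalXU vE.
have hy s : h0 s *m y0 s = 1%:M.
  have [[XR YR] [Xk Yk]] := (XM_map phiRX s, XM_map phikX s).
  rewrite -Xk -Yk -map_mxM; apply/matrixP => i j; rewrite mxE.
  have : phiR ((XM true s *m XM false s) i j - (i == j)%:R) = 0.
    rewrite rmorphB rmorph_nat; apply/eqP; rewrite subr_eq0; apply/eqP.
    transitivity ((map_mx phiR (XM true s *m XM false s)) i j); first by rewrite [RHS]mxE.
    by rewrite map_mxM XR YR mulmxV // mxE.
  move/vI => /eqP; rewrite -[meval v _]/(phik _) rmorphB rmorph_nat subr_eq0 => /eqP ->.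
  by rewrite mxE.
have h0u s : h0 s \in unitmx by case: (mulmx1_unit (hy s)).
have y0E s : y0 s = invmx (h0 s) by rewrite -[RHS]mulmx1 -(hy s) mulKmx.
have phikX' e : phik 'X_e = frame_coords h0 (fun s => invmx (h0 s)) e.
  rewrite phikX /frame_coords; case: (enum_val e) => [[[s t] i] j]; by rewrite y0E.
exists h0; split=> //.
  move=> s i j nzij.
  have -> : Nk q S h0 s = Nm q Sf idfun h0 s by rewrite /Nm map_mx_id.
  rewrite -(XN_map (iota := idfun) (phi := phik) (h := h0)) //; last by move=> c; apply: mevalC.
  rewrite mxE; apply: vI; rewrite -[mmap _ _ _]/(phiR _).
  transitivity ((map_mx phiR (XN s)) i j); first by rewrite [RHS]mxE.
  rewrite (XN_map (iota := iota) (h := h)) //; first exact: hZ.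
  by move=> c; rewrite /phiR /= mmapC.
apply: contraNneq vF => <-; apply/eqP; apply: meval_eq => e.
by rewrite -phikX' /phik /= mevalXU.
Qed.

End Specialize.

Lemma dlin_exp (B : comNzRingType) (D : B -> B) x n : dlin id D -> D (x ^+ n) = (n%:R * x ^+ n.-1) * D x.
Proof.
move=> [dD dM]; elim: n => [|n IH].
  rewrite expr0 mul0r mul0r; have := dM 1 1; rewrite !mulr1 !mul1r => E.
  by apply: (addrI (D 1)); rewrite addr0 -E.
rewrite exprS dM IH /=; case: n {IH} => [|n]; first by rewrite expr0; ring.
by rewrite exprS /= -!natr1; ring.
Qed.

Lemma pchar_nat_eq0 (B : nzRingType) q : [pchar B].-nat q -> (1 < q)%N -> q%:R = 0 :> B.
Proof.
move=> qB q1; have /andP[_ /allP] := qB; set r := pdiv q => /(_ r).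
have rp : prime r by apply: pdiv_prime.
rewrite mem_primes rp (ltnW q1) pdiv_dvd => /(_ isT) rc.
have /dvdnP[m ->] : (r %| q)%N by apply: pdiv_dvd.
by rewrite natrM (pcharf0 rc) mulr0.
Qed.

Lemma dlin_mul_eq0 (B : comNzRingType) (D : B -> B) m n p (X : 'M[B]_(m, n)) (Y : 'M_(n, p)) : dlin id D ->
  (forall i j, D (X i j) = 0) -> (forall i j, D (Y i j) = 0) -> forall i j, D ((X *m Y) i j) = 0.
Proof.
move=> [dD dM] X0 Y0 i j; rewrite mxE.
have d0 : D 0 = 0 by apply: (addrI (D 0)); rewrite -dD !addr0.
rewrite (big_morph D dD d0) big1 // => l _.
by rewrite dM X0 Y0 mulr0 mul0r addr0.
Qed.

(** * Density of the parametrized solutions *)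

Section Core.
Variables (k : closedFieldType) (q d : nat) (S : 'M[k]_d).
Variable J : {set 'I_d} * {set 'I_d}.
Hypothesis (kq : [pchar k].-nat q) (q1 : (1 < q)%N).
Hypothesis (Su : S \in unitmx) (SS : fmx q (fmx q S) = S).
Variables (l H : nat) (Om : seq nat).
Hypothesis (l_gt0 : (0 < l)%N) (lHd : (l + H <= d)%N).
Local Notation Q := (q * q)%N.
Local Notation D := (fun s => dseq (Js J s)).
Local Notation Sf := (Sf q S).
Local Notation Nk := (Nk q S).
Local Notation pframe := (pframe q S l H).
Local Notation ls s := (if s then l else d.+1 - (l + H))%N.
Hypothesis Om_bd : forall w, w \in Om -> (l <= w <= l + H)%N.
Hypothesis Om_min : l \in Om.
Hypothesis Om_max : exists2 s, Om = (l + H)%N :: s & path (fun w' w => (w < w')%N) (l + H)%N s.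
Hypothesis D1P : forall x, (x \in D true) = (x \in Om) && (x < d)%N.
Hypothesis D2P : forall x, (x \in D false) = [&& (0 < x)%N, (x < d)%N & (d.+1 - x)%N \in Om].
Local Notation N := #|flag_index J|.
Local Notation n0 := #|frame_index d|.

Definition fpv (B : comUnitRingType) (h : bool -> 'M[B]_d) (i : 'I_N) : B := fp h (enum_val i).

Definition gpar (b : nat -> k) (x : 'rV[k]_d) : Prop :=
  [/\ kr Q x d \in unitmx, forall i : 'I_d, i = 0%N :> nat -> x ord0 i = 1 & forall i, b i != 0].

Definition Zpar (z : 'rV[k]_N) : Prop := exists (a : k) b x, [/\ a != 0, gpar b x &
  forall i, z ord0 i = a * fpv (pframe b x) i].

Definition Yframe (h : bool -> 'M[k]_d) : Prop :=
  (forall s, h s \in unitmx) /\ forall s, inZ (D s) (Nk h s).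

(** The inverse of [N_s] is polynomial in the entries of the frames alone. *)
Definition NI s : 'M[{mpoly k[n0]}]_d :=
  w0 {mpoly k[n0]} d *m (fmx q (XM k d true (~~ s)))^T *m map_mx (@mpolyC n0 k) (Sf s)^T *m XM k d true s.

Section Eval.
Variables (R : idomainType) (iota : {rmorphism k -> R}) (phi : {rmorphism {mpoly k[n0]} -> R})
  (h : bool -> 'M[R]_d).
Hypothesis (phiC : forall c, phi c%:MP = iota c)
  (phiX : forall e, phi 'X_e = frame_coords h (fun s => invmx (h s)) e).

Lemma eval_fpv f : phi (mmap (@mpolyC n0 k) (fpv (XM k d true)) f) = mmap iota (fpv h) f.
Proof.
rewrite rmorph_mmap; apply: eq_mmap => [c|i] /=; first exact: phiC.
by rewrite /fpv fp_map; apply: eq_fp => s; case: (XM_map phiX s).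
Qed.

Lemma eval_row (c : 'rV[k]_d) s i :
  phi ((map_mx (@mpolyC n0 k) c *m XM k d true s) ord0 i) = (map_mx iota c *m h s) ord0 i.
Proof.
have [XR _] := XM_map phiX s; rewrite -XR !mxE rmorph_sum; apply: eq_bigr => j _.
by rewrite rmorphM !mxE phiC.
Qed.

Lemma eval_NI s i j : (forall s, h s \in unitmx) -> phi (NI s i j) = invmx (Nm q Sf iota h s) i j.
Proof.
move=> hu; have Rq := pchar_rmorph iota kq.
have Siu : map_mx iota (Sf s) \in unitmx by rewrite map_unitmx_f // Sf_unit.
rewrite /Nm invmxM ?unitmx_inv ?(Cm_unit Rq) // invmxK (Cm_inv Rq) //.
transitivity (map_mx phi (NI s) i j); first by rewrite [RHS]mxE.
have E1 : map_mx phi (fmx q (XM k d true (~~ s)))^T = (fmx q (h (~~ s)))^T.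
  by apply/matrixP => a b; have /matrixP/(_ b a) := (XM_map phiX (~~ s)).1; rewrite !mxE rmorphXn => ->.
have E2 : map_mx phi (map_mx (@mpolyC n0 k) (Sf s)^T) = (map_mx iota (Sf s))^T.
  by apply/matrixP => a b; rewrite !mxE phiC.
by rewrite /NI !map_mxM (XM_map phiX s).1 E1 E2 w0_map.
Qed.

End Eval.

(** On the universal germ through [h0], [f] and one entry for each condition of general position are
    nonzero, and so is their product [F]. A specialization keeping [F] nonzero is a parametrized
    solution at which [f] does not vanish. *)
Lemma vanish_frames f h0 : homogeneous f -> (forall z, Zpar z -> f.@[z ord0] = 0) -> Yframe h0 ->
  f.@[fpv h0] = 0.
Proof.
move=> fh fZ [h0u h0Z]; apply/eqP/negPn/negP => fh0.
have NkE h s : Nk h s = Nm q Sf idfun h s by rewrite /Nm map_mx_id.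
have N0Z s : inZ (D s) (Nm q Sf idfun h0 s) by rewrite -NkE.
pose vars : seq (bool * ('I_d * 'I_d)) :=
  [seq v : bool * ('I_d * 'I_d) <- enum {: bool * ('I_d * 'I_d)} | ~~ nz (D v.1) v.2.1 v.2.2.+1].
have [|R [iota [al [h [Nn G]]]]] := @big_germ_exists k q d kq q1 D Sf h0 (Sf_unit kq Su) h0u N0Z vars.
  by move=> v; rewrite mem_filter => /andP[].
have [aug hal hN NZ der] := G.
have Rq := pchar_rmorph iota kq.
have hu s : h s \in unitmx by apply: (aug_unitmx aug); rewrite hal.
have Cu s : Cm q (map_mx iota (Sf s)) (h (~~ s)) \in unitmx.
  by apply: (Cm_unit Rq); rewrite ?map_unitmx_f ?Sf_unit.
have Nu s : Nn s \in unitmx by have := Cu s; rewrite -hN unitmx_mul => /andP[].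
have NnE s : Nn s = Nm q Sf iota h s by rewrite /Nm -hN mulKmx.
pose dels := @kills k R iota.
have dlinD del : dels del -> dlin id del by case.
(* Up to constant factors the twisted orthogonal consists of [q]-th powers, which derivations
   kill. *)
have delC s del : dels del -> forall i j, del (Cm q (map_mx iota (Sf s)) (h (~~ s)) i j) = 0.
  move=> [dl dk].
  have d1 (b : bool) : del b%:R = 0.
    by case: b; [exact: kills_1 (conj dl dk) | exact: kills_0 (conj dl dk)].
  have F (M : 'M[R]_d) i j : del ((fmx q M) i j) = 0.
    by rewrite mxE (dlin_exp _ _ dl) (pchar_nat_eq0 Rq q1) !mul0r.
  apply: dlin_mul_eq0 => //; last by move=> i j; rewrite mxE.
  apply: dlin_mul_eq0 => //; last by move=> i j; rewrite mxE.
  by move=> i j; rewrite map_trmx -map_invmx_unit ?unitmx_tr ?Sf_unit // mxE dk.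
have delN s (a b : 'I_d) : ~~ nz (D s) a b.+1 -> exists2 del, dels del & map_mx del (Nn s) = delta_mx a b.
  move=> nab; have [|del dk dN] := der (s, (a, b)).
    by rewrite mem_filter /= nab mem_enum.
  by exists del => //; rewrite dN eqxx.
have lD s : (ls s < d)%N -> ls s \in D s.
  case: s; first by rewrite D1P Om_min => ->.
  move=> ltd; rewrite D2P ltd subKn; last by apply: leq_trans lHd _.
  have [s -> _] := Om_max; rewrite inE eqxx !andbT subn_gt0 ltnS.
  by rewrite lHd.
have Dd s x : x \in D s -> (0 < x < d)%N by apply: dseq_lt.
have gr s c := @generic_row R d (ls s) (D s) (h s) _ (Nn s) dels (hu s) (Nu s) (Cu s) (hN s) dlinD
  (delC s) (delN s) (lD s) (Dd s) c.
have gl s i := @generic_last R d (ls s) (D s) (h s) _ (Nn s) dels (hu s) (Nu s) (Cu s) (hN s) dlinD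
  (delC s) (delN s) (lD s) (Dd s) i.
have d0 : (0 < d)%N by apply: leq_trans lHd; rewrite addn_gt0 l_gt0.
have [L LP] := fixed_points_finite k d (leq_trans q1 (leq_pmulr q (ltnW q1)) : (1 < Q)%N).
have dlt : (d.-1 < d)%N by rewrite prednK.
pose rl : 'I_d := Ordinal dlt.
have /choice[bb bbP] : forall sc : bool * 'rV[k]_d, exists i : 'I_d, sc.2 \in L ->
    (i < ls sc.1)%N /\ (map_mx iota sc.2 *m h sc.1) ord0 i != 0.
  move=> [s c] /=; case: (boolP (c \in L)) => [cL|_]; last by exists rl.
  have [||i il ci] := gr s (map_mx iota c).
  - by move=> del [_ dk]; apply/matrixP => i j; rewrite !mxE dk.
  - by move: cL; rewrite LP map_mx_eq0 => /andP[].
  by exists i.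
have /choice[bn bnP] : forall s, exists i : 'I_d, (i < ls s)%N /\ invmx (Nn s) rl i != 0.
  by move=> s; have [i il ni] := gl s rl; exists i.
pose F : {mpoly k[n0]} := mmap (@mpolyC n0 k) (fpv (XM k d true)) f *
  ((\prod_s \prod_(c <- L) (map_mx (@mpolyC n0 k) c *m XM k d true s) ord0 (bb (s, c))) *
   \prod_s NI s rl (bn s)).
have evF (B : idomainType) (iB : {rmorphism k -> B}) (phi : {rmorphism {mpoly k[n0]} -> B}) (hB : bool -> 'M[B]_d) :
    (forall c, phi c%:MP = iB c) -> (forall e, phi 'X_e = frame_coords hB (fun s => invmx (hB s)) e) ->
    (forall s, hB s \in unitmx) -> (phi F != 0) = (mmap iB (fpv hB) f != 0) &&
      ([forall s, all (fun c => (map_mx iB c *m hB s) ord0 (bb (s, c)) != 0) L] &&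
       [forall s, invmx (Nm q Sf iB hB s) rl (bn s) != 0]).
  move=> pC pX hBu; rewrite /F !rmorphM !mulf_eq0 !negb_or (eval_fpv pC pX) !rmorph_prod.
  congr (_ && (_ && _)).
    apply/prodf_neq0/forallP => [H1 s|H1 s _].
      have := H1 s isT; rewrite rmorph_prod prodf_seq_neq0; apply: sub_all => c.
      by rewrite (eval_row pC pX).
    rewrite rmorph_prod prodf_seq_neq0; have := H1 s; apply: sub_all => c.
    by rewrite (eval_row pC pX).
  by apply/prodf_neq0/forallP => [H1 s|H1 s _]; have := H1 s; rewrite (eval_NI pC pX) // => /(_ isT).
have Fne : mmap iota (frame_coords h (fun s => invmx (h s))) F != 0.
  rewrite -[mmap _ _ F]/((mmap iota (frame_coords h (fun s => invmx (h s))) : {rmorphism _ -> _}) F).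
  rewrite (evF _ iota _ h) //=; first 1 last.
  - by move=> c; rewrite /= mmapC.
  - by move=> e; rewrite /= mmapX mmap1U.
  apply/and3P; split.
  - apply: contra fh0 => /eqP E; have := rmorph_mmap iota al (fpv h) f.
    rewrite E rmorph0 => E'; rewrite [f.@[_]](_ : _ = mmap (al \o iota) (al \o fpv h) f).
      by rewrite -E'.
    apply: eq_mmap => [c|i] /=; first by rewrite (aug_K aug).
    by rewrite /fpv fp_map; apply: eq_fp => s; rewrite hal.
  - by apply/forallP => s; apply/allP => c cL; have [] := bbP (s, c) cL.
  - by apply/forallP => s; rewrite -NnE; case: (bnP s).
have NZ' s : inZ (D s) (Nm q Sf iota h s) by rewrite -NnE.
have [h1 [h1u h1Z h1F]] := specialize kq Su hu NZ' Fne.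
move: h1F; rewrite -[meval _ F]/((meval (frame_coords h1 (fun s => invmx (h1 s))) : {rmorphism _ -> _}) F).
rewrite (evF _ (idfun : {rmorphism k -> k}) _ h1) //=; first last.
- by move=> e; rewrite /= mevalXU.
- by move=> c; rewrite /= mevalC.
case/and3P => f1 /forallP g12 /forallP g34.
have [||b [x [xu x0 b0 [p [pu pP pE]]]]] := generic_frame_param kq q1 Su SS l_gt0 lHd Om_bd Om_min Om_max D1P D2P h1u h1Z.
- move=> s c cf c0; have cL : c \in L by rewrite LP c0 cf eqxx.
  have [il _] := bbP (s, c) cL; exists (bb (s, c)) => //.
  by have /allP/(_ c cL) := g12 s; rewrite map_mx_id.
- move=> s; exists rl, (bn s); split=> //; first by case: (bnP s).
  by rewrite NkE; apply: g34.
case/negP: f1; apply/eqP.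
pose e := pchi J.1 (p true) * pchi J.2 (p false).
have e0 : e != 0.
  by rewrite mulf_neq0 // pchi_unit //; [exact: (pP true) | exact: (pP false)].
have := fZ (\row_i fpv h1 i) _ => H1; rewrite -[RHS]H1; last first.
  exists e^-1, b, x; split=> //; first by rewrite invr_eq0.
  move=> i; rewrite mxE /fpv (eq_fp _ pE) fp_mulP // mulrA mulVf ?mul1r //.
by apply: eq_mmap => [c //|i]; rewrite mxE.
Qed.

End Core.

Lemma adj_scale (K : fieldType) d (a : K) (g : 'M[K]_d) : a != 0 -> g \in unitmx ->
  exists2 e, e != 0 & \adj (a *: g) = e *: invmx g.
Proof.
move=> a0 gu.
have zu : a *: g \in unitmx by rewrite unitmxE detZ unitrM unitrX ?unitfE //= -unitfE -unitmxE.
exists (\det (a *: g) * a^-1).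
  by rewrite mulf_neq0 ?invr_eq0 // -unitfE -unitmxE.
rewrite adj_invmx // -scalerA; congr (_ *: _).
have e1 : (a *: g) *m (a^-1 *: invmx g) = 1%:M.
  by rewrite -scalemxAl -scalemxAr scalerA mulfV // scale1r mulmxV.
by rewrite -[LHS]mulmx1 -e1 mulKmx.
Qed.

(** * The closure of the fine Deligne-Lusztig variety *)

Section ChartEquations.
Variables (d q : nat) (J : {set 'I_d} * {set 'I_d}).

(* the condition that [z] comes from frames [h] with [Nk h s] in the span [inZ], in the chart of [pi];
   [Si s] stands for the inverse transpose of the form *)
Definition E2 (B : comUnitRingType) (Si : bool -> 'M[B]_d) (z : flag_index J -> B) pi s : 'M[B]_d :=
  z (cbase J pi) *: (\adj (Hm z pi s) *m Si s *m (fmx q (\adj (Hm z pi (~~ s))))^T *m w0 B d).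

Lemma E2_map (B B' : comUnitRingType) (f : {rmorphism B -> B'}) Si z pi s :
  map_mx f (E2 Si z pi s) = E2 (fun s => map_mx f (Si s)) (f \o z) pi s.
Proof.
rewrite /E2 map_mxZ !map_mxM !map_mx_adj Hm_map -map_trmx w0_map fmx_map map_mx_adj Hm_map.
by [].
Qed.

Lemma E2_chart (K : fieldType) (Si : bool -> 'M[K]_d) (z : flag_index J -> K) pi (z0 : K) (g : bool -> 'M[K]_d) s :
  z (cbase J pi) = z0 -> z0 != 0 -> [pchar K].-nat q -> (forall s, g s \in unitmx) ->
  (forall s, Hm z pi s = z0 *: g s) -> exists2 e, e != 0 &
  E2 Si z pi s = e *: (invmx (g s) *m (Si s *m (fmx q (invmx (g (~~ s))))^T *m w0 K d)).
Proof.
move=> zE z00 kq gu HE; rewrite /E2 !HE zE.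
have [e1 e10 ->] := adj_scale z00 (gu s); have [e2 e20 ->] := adj_scale z00 (gu (~~ s)).
exists (z0 * (e1 * e2 ^+ q)); first by rewrite !mulf_neq0 ?expf_neq0.
have -> : (fmx q (e2 *: invmx (g (~~ s))))^T = e2 ^+ q *: (fmx q (invmx (g (~~ s))))^T.
  by apply/matrixP => i j; rewrite !mxE exprMn.
by rewrite -scalerA; congr (_ *: _); rewrite -!scalemxAl -!scalemxAr -!scalemxAl scalerA !mulmxA mulrC.
Qed.

End ChartEquations.

Section Points.
Variables (k : closedFieldType) (q d : nat) (S : 'M[k]_d) (b : 'M[k]_d * 'M[k]_d).
Variable J : {set 'I_d} * {set 'I_d}.
Hypothesis (kq : [pchar k].-nat q) (q1 : (1 < q)%N).
Hypothesis (Su : S \in unitmx) (SS : fmx q (fmx q S) = S).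
Hypothesis (b1u : b.1 \in unitmx) (b2u : b.2 \in unitmx) (bb : fmx q (fmx q b.2) = b.2).
Hypothesis orth : forall a c : 'I_d, (a + c + 2 <= d)%N -> (b.1^T *m S *m fmx q b.2) a c = 0.
Variables (l H : nat) (Om : seq nat).
Hypothesis (l_gt0 : (0 < l)%N) (lHd : (l + H <= d)%N).
Local Notation Q := (q * q)%N.
Local Notation D := (fun s => dseq (Js J s)).
Local Notation Sf := (Sf q S).
Local Notation Nk := (Nk q S).
Local Notation pframe := (pframe q S l H).
Hypothesis Om_bd : forall w, w \in Om -> (l <= w <= l + H)%N.
Hypothesis Om_min : l \in Om.
Hypothesis Om_max : exists2 s, Om = (l + H)%N :: s & path (fun w' w => (w < w')%N) (l + H)%N s.
Hypothesis D1P : forall x, (x \in D true) = (x \in Om) && (x < d)%N.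
Hypothesis D2P : forall x, (x \in D false) = [&& (0 < x)%N, (x < d)%N & (d.+1 - x)%N \in Om].
Local Notation N := #|flag_index J|.
Local Notation A := {mpoly k[N]}.
Local Notation Zpar := (@Zpar k q d S J l H).
Local Notation Yframe := (Yframe q S J).
Local Notation cw := (coxeter_word d l, coxeter_word d (d.+1 - (l + H))%N).
Local Notation X0 := (@fine_DL k q d S b J cw).
Local Notation X := (@fine_DL_closure k q d S b J cw).
Implicit Types z : 'rV[k]_N.

Definition zpt z (c : flag_index J) : k := z ord0 (enum_rank c).
Definition zX (c : flag_index J) : A := 'X_(enum_rank c).
Definition SX s : 'M[A]_d := map_mx (@mpolyC N k) (invmx (Sf s)^T).

Lemma zpt_zX z : (fun c => (zX c).@[z ord0]) =1 zpt z.
Proof. by move=> c; rewrite /zX mevalXU. Qed.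

Lemma frame_pointE z : frame_point q S z <-> exists (a : k) h, [/\ a != 0, Yframe h &
  forall c, zpt z c = a * fp h c].
Proof.
split=> [[a [h [a0 hu hZ zE]]]|[a [h [a0 [hu hZ] zE]]]]; exists a, h; split=> //.
- by move=> c; rewrite /zpt zE enum_rankK.
- by move=> i; rewrite -[i in LHS]enum_valK -zE.
Qed.

Lemma flag_is_flag z : flag_variety b z <-> is_flag (zpt z).
Proof.
split=> [[a [g [a0 [g1 g2] zE]]]|[a [h [a0 hu zE]]]].
  exists a, (fun s => pr g s *m pr b s); split=> //.
    by case; rewrite /= unitmx_mul ?g1 ?g2.
  by move=> c; rewrite /zpt zE mxE flag_pointE enum_rankK.
exists a, (h true *m invmx b.1, h false *m invmx b.2); split=> //.
  by split; rewrite /= unitmx_mul unitmx_inv hu.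
apply/rowP => i; rewrite [RHS]mxE flag_pointE -[i in LHS]enum_valK -/(zpt z _) zE.
by congr (_ * _); apply: eq_fp; case; rewrite /= mulmxKV.
Qed.

Lemma X0_cone : cone X0.
Proof.
move=> z a a0 [c [g [x [y [c0 gG zE H1 H2]]]]]; exists (a * c), g, x, y; split=> //.
  by rewrite mulf_neq0.
by rewrite zE scalerA.
Qed.

Lemma X_cone : cone X.
Proof.
move=> z a a0 [[c [g [c0 gG zE]]] [z0 H1]]; split.
  by exists (a * c), g; rewrite mulf_neq0 // zE scalerA.
split=> [|f [[e fh] fX]]; first by rewrite scaler_eq0 negb_or a0.
by rewrite /zero_at (meval_scale _ _ fh) (H1 f) ?mulr0 //; split=> //; exists e.
Qed.

Let l0d : (0 < d.+1 - (l + H) <= d)%N. Proof. by lia. Qed.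
Let l1d : (0 < l <= d)%N. Proof. by lia. Qed.

Lemma X0_frame z : X0 z -> frame_point q S z.
Proof. exact: (fine_DL_frame kq Su b1u b2u bb orth l1d l0d). Qed.

Lemma dual_D s : dual_dims d (D s) (D (~~ s)).
Proof.
have [bd1 bd2] : (forall x, x \in D true -> (x < d)%N) /\ (forall x, x \in D false -> (x < d)%N).
  by split=> x /dseq_lt/andP[].
have bdO x : x \in Om -> (0 < x <= d)%N by move/Om_bd; lia.
have DD x : (0 < x < d)%N -> (x \in D false) = ((d - x)%N.+1 \in Om).
  by move=> /andP[x0 xd]; rewrite D2P x0 xd /= subSn // ltnW.
case: s; split=> //= x xd.
- have [e1 e2 e] : [/\ (0 < d.+1 - x)%N, (d.+1 - x < d)%N & (d.+1 - (d.+1 - x))%N = x] by split; lia.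
  have [_ xd2] := andP xd; by rewrite D1P D2P e1 e2 e xd2 andbT.
- rewrite D1P DD; last by lia.
  by rewrite -subSn; [rewrite (_ : (_ < d)%N) ?andbT //; lia | lia].
Qed.

Lemma frame_E2 z pi s : frame_point q S z ->
  inZ (D s) (E2 q (fun s => invmx (Sf s)^T) (zpt z) pi s).
Proof.
case/frame_pointE => a [h [a0 [hu hZ] zE]].
(* Outside the chart the factor in front of [E2] vanishes. *)
have [z0|z0] := eqVneq (zpt z (cbase J pi)) 0.
  by move=> i j _; rewrite /E2 z0 scale0r mxE.
have [p [pu pP pn zE' HE]] := chart_point hu zE z0.
have gu s' : h s' *m p s' \in unitmx by rewrite unitmx_mul hu pu.
have [e _ ->] := E2_chart (fun s => invmx (Sf s)^T) s erefl z0 kq gu HE.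
by apply: inZZ; apply: (inZ_frame_change kq (dual_D s)).
Qed.

Lemma E2_frame_chart z : is_flag (zpt z) ->
  (forall pi s, inZ (D s) (E2 q (fun s => invmx (Sf s)^T) (zpt z) pi s)) ->
  exists pi g, [/\ zpt z (cbase J pi) != 0, Yframe g,
    forall s, normalized (D s) (pi s) (g s), forall c, zpt z c = zpt z (cbase J pi) * fp g c &
    forall s, Hm (zpt z) pi s = zpt z (cbase J pi) *: g s].
Proof.
move=> [a [h [a0 hu zE]]] HZ.
have /choice[pi piP] : forall s, exists pi, gpp (J := Js J s) (h s) (cperm (Js J s) pi) != 0.
  by move=> s; apply: chart_exists.
have z0 : zpt z (cbase J pi) != 0.
  by rewrite zE /fp !mulf_neq0 //; [exact: (piP true) | exact: (piP false)].
have [p [pu pP pn zE' HE]] := chart_point hu zE z0.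
have gu s' : h s' *m p s' \in unitmx by rewrite unitmx_mul hu pu.
exists pi, (fun s => h s *m p s); split=> //; split=> // s i j nz_ij.
have [e e0 eE] := E2_chart (fun s => invmx (Sf s)^T) s erefl z0 kq gu HE.
have := HZ pi s i j nz_ij; rewrite eE mxE => /eqP; rewrite mulf_eq0 (negPf e0) /=.
by move/eqP.
Qed.

Lemma X_is_flag z : X z -> is_flag (zpt z).
Proof. by case=> /flag_is_flag. Qed.

(** The chart equations hold on the fine variety and thus on its closure; at a point of the flag
    variety they return normalized frames with the closed condition. *)
Lemma X_chart z : X z -> exists pi g, [/\ zpt z (cbase J pi) != 0, Yframe g,
    forall s, normalized (D s) (pi s) (g s), forall c, zpt z c = zpt z (cbase J pi) * fp g c &
    forall s, Hm (zpt z) pi s = zpt z (cbase J pi) *: g s].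
Proof.
move=> Xz; apply: E2_frame_chart; first exact: X_is_flag.
move=> pi s i j nz_ij; case: Xz => _ Xz.
have evE z' : (E2 q SX zX pi s i j).@[z' ord0] = E2 q (fun s => invmx (Sf s)^T) (zpt z') pi s i j.
  transitivity (map_mx (meval (z' ord0)) (E2 q SX zX pi s) i j); first by rewrite [RHS]mxE.
  rewrite E2_map; congr (fun_of_matrix _ i j).
  rewrite /E2; congr (_ *: _); first exact: zpt_zX.
  rewrite !(@eq_Hm _ _ _ _ (zpt z')) //; try exact: zpt_zX.
  suff -> : map_mx (meval (z' ord0)) (SX s) = invmx (Sf s)^T by [].
  by apply/matrixP => u v; rewrite [LHS]mxE [SX s u v]mxE; apply: mevalC.
rewrite -evE; apply: (proj_closureP X0_cone Xz) => z' /X0_frame fz'.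
by rewrite evE; apply: frame_E2.
Qed.

Lemma X_frame z : X z -> frame_point q S z.
Proof.
by move=> /X_chart[pi [g [z0 gY _ zE _]]]; apply/frame_pointE; exists (zpt z (cbase J pi)), g.
Qed.

Lemma Zpar_X0 z : Zpar z -> X0 z.
Proof.
case=> a [bs [x [a0 [xu x0 b0] zE]]]; apply: (frame_fine_DL kq Su b1u b2u bb orth a0 _ _ zE).
  by move=> s; apply: pframe_unit.
by move=> s; apply: pframe_bruhat.
Qed.

Lemma fp_neq0 (h : bool -> 'M[k]_d) : (forall s, h s \in unitmx) -> exists c, fp (J := J) h c != 0.
Proof.
move=> hu; have [pi1 P1] : exists pi, gpp (J := Js J true) (h true) (cperm (Js J true) pi) != 0 by apply: chart_exists.
have [pi2 P2] : exists pi, gpp (J := Js J false) (h false) (cperm (Js J false) pi) != 0 by apply: chart_exists.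
by exists (cperm _ pi1, cperm _ pi2); rewrite /fp mulf_neq0.
Qed.

Lemma vanish_frame f z : homogeneous f -> (forall z, Zpar z -> f.@[z ord0] = 0) -> frame_point q S z ->
  f.@[z ord0] = 0.
Proof.
move=> [e fh] fZ [a [h [a0 hu hZ zE]]].
have -> : z = a *: \row_i fpv h i by apply/rowP => i; rewrite !mxE zE.
rewrite (meval_scale _ _ fh).
have -> : f.@[(\row_i fpv h i) ord0] = f.@[fpv h] by apply: meval_eq => i; rewrite mxE.
rewrite (vanish_frames kq q1 Su SS l_gt0 lHd Om_bd Om_min Om_max D1P D2P) ?mulr0 //.
by exists e.
Qed.

Lemma frame_X z : frame_point q S z -> X z.
Proof.
move=> fz; have [a [h [a0 [hu hZ] zE]]] := (frame_pointE z).1 fz; split.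
  by apply/flag_is_flag; exists a, h.
split=> [|f [fh fX]]; last by apply: vanish_frame => // z' /Zpar_X0; apply: fX.
have [c c0] := fp_neq0 hu; apply: contraTneq c0 => z0.
have := zE c; rewrite z0 /zpt mxE => /esym/eqP; rewrite mulf_eq0 (negPf a0) /=.
by rewrite negbK.
Qed.

(** The closure is taken inside the flag variety, so closedness in projective space also requires
    that [Eb] and [Ed] cut out the flags. *)
Lemma X_closed : proj_closed X.
Proof.
apply: (@proj_closedP _ _ _ (fun f => forall z, X z -> f.@[z ord0] = 0) X_cone) => z.
split=> [Xz|[z0 Hz]]; first by split=> [|f]; [case: Xz => _ [] | exact].
split; last by split=> // f [fh fX]; apply: Hz => z' [_ [_]]; apply.
apply/flag_is_flag/is_flagP.
- have /existsP[i zi] : [exists i, z ord0 i != 0].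
    apply: contraR z0; rewrite negb_exists => /forallP zi; apply/eqP/rowP => i.
    by rewrite mxE; have := zi i; rewrite negbK => /eqP.
  by exists (enum_val i); rewrite /zpt enum_valK.
- move=> c c'; have evE z' : (Eb zX c c').@[z' ord0] = Eb (zpt z') c c'.
    rewrite -[meval _ _]/((meval (z' ord0) : {rmorphism A -> k}) _) Eb_map.
    by congr (Eb _ c c'); apply: funext; apply: zpt_zX.
  by rewrite -evE; apply: Hz => z' Xz'; rewrite evE; apply: Eb_flag; apply: X_is_flag.
- move=> c s x y xy; apply/matrixP => i j; rewrite [RHS]mxE.
  have evE z' : (Ed zX c x y i j).@[z' ord0] = Ed (zpt z') c x y i j.
    transitivity (map_mx (meval (z' ord0)) (Ed zX c x y) i j); first by rewrite [RHS]mxE.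
    rewrite Ed_map; congr (Ed _ c x y i j).
    by apply: funext; apply: zpt_zX.
  rewrite -[LHS]/(Ed (zpt z) c x y i j) -evE; apply: Hz => z' Xz'.
  by rewrite evE (Ed_flag _ (X_is_flag Xz')) ?mxE.
Qed.

End Points.

Section ParamMaps.
Variables (B B' : comUnitRingType) (phi : {rmorphism B -> B'}).

Lemma iter_fmx_map Q m n (x : 'M[B]_(m, n)) t :
  map_mx phi (iter t (fmx Q) x) = iter t (fmx Q) (map_mx phi x).
Proof. by elim: t => //= t IH; rewrite fmx_map IH. Qed.

Lemma zseq_map d Q b (x : 'rV[B]_d) t :
  map_mx phi (zseq Q b x t) = zseq Q (fun m => phi (b m)) (map_mx phi x) t.
Proof. by elim: t => //= t IH; rewrite map_mxD map_mxZ fmx_map IH. Qed.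

Lemma Gm_map d Q H l b (x : 'rV[B]_d) :
  map_mx phi (Gm Q H l b x) = Gm Q H l (fun m => phi (b m)) (map_mx phi x).
Proof.
apply/matrixP => r j; rewrite mxE [X in phi X]mxE [RHS]mxE -zseq_map -iter_fmx_map.
by rewrite [RHS]mxE.
Qed.

End ParamMaps.

Lemma eq_Gm (B : comUnitRingType) d Q H l (b b' : nat -> B) (x : 'rV[B]_d) :
  (forall i, (i < H)%N -> b i = b' i) -> Gm Q H l b x = Gm Q H l b' x.
Proof.
move=> E; apply/matrixP => r j; rewrite !mxE (@eq_zseq _ _ _ b b') // => i lt.
by apply: E; apply: leq_trans lt (leq_subr _ _).
Qed.

(** * The parametrization: irreducibility and the upper bound of the dimension *)

Section Parametrization.
Variables (k : closedFieldType) (q d : nat) (S : 'M[k]_d) (b : 'M[k]_d * 'M[k]_d).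
Variable J : {set 'I_d} * {set 'I_d}.
Hypothesis (kq : [pchar k].-nat q) (q1 : (1 < q)%N).
Hypothesis (Su : S \in unitmx) (SS : fmx q (fmx q S) = S).
Hypothesis (b1u : b.1 \in unitmx) (b2u : b.2 \in unitmx) (bb : fmx q (fmx q b.2) = b.2).
Hypothesis orth : forall a c : 'I_d, (a + c + 2 <= d)%N -> (b.1^T *m S *m fmx q b.2) a c = 0.
Variables (l H : nat) (Om : seq nat).
Hypothesis (l_gt0 : (0 < l)%N) (lHd : (l + H <= d)%N).
Local Notation Q := (q * q)%N.
Local Notation D := (fun s => dseq (Js J s)).
Local Notation Sf := (Sf q S).
Local Notation pframe := (pframe q S l H).
Hypothesis Om_bd : forall w, w \in Om -> (l <= w <= l + H)%N.
Hypothesis Om_min : l \in Om.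
Hypothesis Om_max : exists2 s, Om = (l + H)%N :: s & path (fun w' w => (w < w')%N) (l + H)%N s.
Hypothesis D1P : forall x, (x \in D true) = (x \in Om) && (x < d)%N.
Hypothesis D2P : forall x, (x \in D false) = [&& (0 < x)%N, (x < d)%N & (d.+1 - x)%N \in Om].
Local Notation N := #|flag_index J|.
Local Notation n := (d + H)%N.
Local Notation R := {mpoly k[n]}.
Local Notation Zpar := (@Zpar k q d S J l H).
Local Notation cw := (coxeter_word d l, coxeter_word d (d.+1 - (l + H))%N).
Local Notation X0 := (@fine_DL k q d S b J cw).
Local Notation X := (@fine_DL_closure k q d S b J cw).

(** Variable [0] is the scale of the cone, in the slot of the first coordinate of [x], which is
    fixed to 1. Then come the other coordinates of [x] and the [H] scalars [b]; out of range the
    value is 1. *)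
Definition pvar t : R := if insub t is Some i then 'X_i else 1.
Definition pb m : R := pvar (d + m).
Definition px : 'rV[R]_d := \row_i if i == 0%N :> nat then 1 else pvar i.

(* the frames [pframe pb px], up to a denominator *)
Definition Pfr s : 'M[R]_d := if s then \det (Gm Q H l.-1 pb px) ^+ q *: Gm Q H l pb px
  else map_mx (@mpolyC n k) (invmx (Sf false)^T) *m (fmx q (\adj (Gm Q H l.-1 pb px)))^T *m w0 R d.

Definition gamma (i : 'I_N) : R := pvar 0 * fpv Pfr i.

(** Its nonvanishing means that the scale is nonzero, [x] is cyclic and all [b] are nonzero. *)
Definition gen : R :=
  pvar 0 * (\det (\matrix_(i < d) iter i (fmx Q) px) * \prod_(m < H) pb m).

Section Evaluation.
Variable e : nat -> k.

Definition ev : {rmorphism R -> k} := meval (fun i : 'I_n => e i).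
Definition eb m := ev (pb m).
Definition ex := map_mx ev px.

Lemma ev_pvar t : (t < n)%N -> ev (pvar t) = e t.
Proof. by move=> tn; rewrite /pvar insubT /ev /= mevalXU. Qed.

Lemma ex0 (i : 'I_d) : i = 0%N :> nat -> ex ord0 i = 1.
Proof. by move=> i0; rewrite !mxE i0 eqxx rmorph1. Qed.

Lemma ex_gt0 (i : 'I_d) : (0 < i)%N -> ex ord0 i = e i.
Proof. by rewrite lt0n !mxE => /negPf ->; rewrite ev_pvar // ltn_addr. Qed.

Lemma ev_gamma i : kr Q ex d \in unitmx ->
  ev (gamma i) = e 0 * (\det (Gm Q H l.-1 eb ex) ^+ q) ^+ fdeg J * fpv (pframe eb ex) i.
Proof.
move=> xu; rewrite rmorphM ev_pvar; last by lia.
have Qk : [pchar k].-nat Q by rewrite pnatM kq.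
have G0u : Gm Q H l.-1 eb ex \in unitmx by apply: (Gm_unit eb Qk lHd (leq_pred l) xu).
rewrite /fpv fp_map -mulrA; congr (_ * _); rewrite -fp_scale; apply: eq_fp => -[] /=.
  by rewrite map_mxZ rmorphXn -det_map_mx !Gm_map.
rewrite !map_mxM w0_map -map_trmx fmx_map map_mx_adj Gm_map -/eb -/ex adj_invmx //.
have -> : map_mx ev (map_mx (@mpolyC n k) (invmx (Sf false)^T)) = invmx (Sf false)^T.
  by apply/matrixP => u v; rewrite 2!mxE; apply: mevalC.
rewrite /Cm; set g := \det _; set M := invmx (Gm _ _ _ _ _).
have -> : (fmx q (g *: M))^T = g ^+ q *: (fmx q M)^T by apply/matrixP => u v; rewrite !mxE exprMn.
by rewrite -scalemxAr -scalemxAl.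
Qed.

Lemma ev_gen : ev gen = e 0 * (\det (kr Q ex d) * \prod_(m < H) eb m).
Proof.
rewrite !rmorphM ev_pvar; last by lia.
rewrite -det_map_mx rmorph_prod; congr (_ * (\det _ * _)).
by apply/row_matrixP => i; rewrite -map_row !rowK iter_fmx_map.
Qed.

Lemma ev_mmap f : ev (mmap (@mpolyC n k) gamma f) = f.@[fun i => ev (gamma i)].
Proof. by rewrite rmorph_mmap; apply: eq_mmap => // c; apply: mevalC. Qed.

End Evaluation.

Lemma Zpar_cone : cone Zpar.
Proof.
move=> z c c0 [a [bs [x [a0 g zE]]]]; exists (c * a), bs, x; split=> //; first by rewrite mulf_neq0.
by move=> i; rewrite mxE zE mulrA.
Qed.

Lemma gen_Zpar e : ev e gen != 0 -> Zpar (\row_i ev e (gamma i)).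
Proof.
rewrite ev_gen !mulf_eq0 !negb_or => /and3P[e0 xu b0].
have {}xu : kr Q (ex e) d \in unitmx by rewrite unitmxE unitfE.
have Qk : [pchar k].-nat Q by rewrite pnatM kq.
pose b' m := if (m < H)%N then eb e m else 1.
have bE m : (m < H)%N -> eb e m = b' m by rewrite /b' => ->.
have G0u : Gm Q H l.-1 (eb e) (ex e) \in unitmx by apply: (Gm_unit (eb e) Qk lHd (leq_pred l) xu).
exists (e 0%N * (\det (Gm Q H l.-1 (eb e) (ex e)) ^+ q) ^+ fdeg J), b', (ex e); split.
- by rewrite mulf_neq0 // !expf_neq0 // -unitfE -unitmxE.
- split=> // [i|i]; first exact: ex0.
  rewrite /b'; case: ltnP => [iH|_]; last exact: oner_neq0.
  by move/prodf_neq0: b0 => /(_ (Ordinal iH) isT).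
- move=> i; rewrite mxE ev_gamma //; congr (_ * _); apply: eq_fp => s.
  by case: s; rewrite /= ?(eq_Gm _ _ _ bE).
Qed.

Lemma Zpar_ev z : Zpar z -> exists e, forall i, z ord0 i = ev e (gamma i).
Proof.
case=> a [bs [x [a0 [xu x0 b0] zE]]].
have Qk : [pchar k].-nat Q by rewrite pnatM kq.
pose g := (\det (Gm Q H l.-1 bs x) ^+ q) ^+ fdeg J.
have g0 : g != 0.
  rewrite !expf_neq0 // -unitfE -unitmxE.
  exact: (Gm_unit bs Qk lHd (leq_pred l) xu).
pose e t := if t == 0%N then a / g else if insub t is Some i then x ord0 i else bs (t - d)%N.
have xE : ex e = x.
  apply/rowP => i; have [i0|i0] := posnP i; first by rewrite ex0 // x0.
  by rewrite ex_gt0 // /e (gtn_eqF i0) valK.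
have bE m : (m < H)%N -> eb e m = bs m.
  move=> mH; rewrite /eb ev_pvar ?ltn_add2l // /e.
  by rewrite insubF ?addKn; [rewrite gtn_eqF //; lia | lia].
exists e => i; rewrite ev_gamma xE // zE (eq_Gm _ _ _ bE) -/g divfK //; congr (_ * _).
by apply: eq_fp => s; case: s; rewrite /= ?(eq_Gm _ _ _ bE).
Qed.

(** [x] is taken outside the finitely many rational hyperplanes, among them that of the first
    coordinate. *)
Lemma cyclic_exists : exists x : 'rV[k]_d, kr Q x d \in unitmx /\ forall i : 'I_d, i = 0%N :> nat -> x ord0 i = 1.
Proof.
have Qk : [pchar k].-nat Q by rewrite pnatM kq.
have Q1 : (1 < Q)%N := leq_trans q1 (leq_pmulr q (ltnW q1)).
have [L LP] := fixed_points_finite k d Q1.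
pose F : {mpoly k[d]} := \prod_(c <- L) \sum_j c ord0 j *: 'X_j.
have evF y : F.@[y] = \prod_(c <- L) \sum_j c ord0 j * y j.
  rewrite rmorph_prod; apply: eq_bigr => c _; rewrite raddf_sum; apply: eq_bigr => j _.
  by rewrite /= mevalZ mevalXU.
have F0 : F != 0.
  rewrite /F prodf_seq_neq0; apply/allP => c; rewrite LP => /andP[c0 _] /=.
  have /rV0Pn[j cj] := c0; apply: contra cj => /eqP/(congr1 (meval (fun i => (i == j)%:R))).
  rewrite meval0 raddf_sum (bigD1 j) //= big1 => [|i ij]; last by rewrite mevalZ mevalXU (negPf ij) mulr0.
  by rewrite mevalZ mevalXU eqxx mulr1 addr0 => ->.
have [y] := mpoly_nonroot F0; rewrite evF prodf_seq_neq0 => /allP yL.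
have yL' c : c \in L -> c *m (\row_i y i)^T != 0.
  move=> /yL /=; apply: contra => /eqP/matrixP/(_ ord0 ord0); rewrite !mxE => E.
  by apply/eqP; rewrite -[RHS]E; apply: eq_bigr => j _; rewrite !mxE.
have d0 : (0 < d)%N by lia.
pose i0 : 'I_d := Ordinal d0.
have y0 : y i0 != 0.
  have : delta_mx ord0 i0 \in L.
    rewrite LP; apply/andP; split.
      by apply/rV0Pn; exists i0; rewrite mxE !eqxx oner_neq0.
    apply/eqP/rowP => i; rewrite !mxE; case: (_ && _); rewrite ?expr1n // expr0n.
    by rewrite (gtn_eqF (leq_trans _ (leq_pmulr q (ltnW q1)))) // ltnW.
  move/yL; rewrite (bigD1 i0) //= big1 => [|j ji]; first by rewrite mxE !eqxx mul1r addr0.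
  by rewrite mxE (negPf ji) andbF mul0r.
exists ((y i0)^-1 *: \row_i y i); split.
  apply: (kr_cyclic Qk Q1) => c cf c0; rewrite linearZ /= -scalemxAr scaler_eq0 invr_eq0 (negPf y0) /=.
  by apply: yL'; rewrite LP c0 cf eqxx.
move=> i iE; have -> : i = i0 by apply: val_inj.
by rewrite !mxE mulVf.
Qed.

Lemma gen_point : exists e, ev e gen != 0.
Proof.
have [x [xu x0]] := cyclic_exists.
pose e t := if t == 0%N then 1 else if insub t is Some i then x ord0 i else 1.
have xE : ex e = x.
  apply/rowP => i; have [i0|i0] := posnP i; first by rewrite ex0 // x0.
  by rewrite ex_gt0 // /e (gtn_eqF i0) valK.
exists e; rewrite ev_gen xE mul1r mulf_neq0 //; first by rewrite -unitfE -unitmxE.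
apply/prodf_neq0 => m _; rewrite /eb ev_pvar ?ltn_add2l // /e.
by rewrite insubF ?if_same ?oner_neq0 //; lia.
Qed.

Lemma gen_neq0 : gen != 0.
Proof. by have [e] := gen_point; apply: contraNneq => ->; rewrite rmorph0. Qed.

Let vanish := vanish_frame kq q1 Su SS l_gt0 lHd Om_bd Om_min Om_max D1P D2P.
Let XF := X_frame kq q1 Su b1u b2u bb orth l_gt0 lHd Om_bd Om_min D1P D2P.
Let FX := frame_X kq q1 Su SS b1u b2u bb orth l_gt0 lHd Om_bd Om_min Om_max D1P D2P.

Lemma X_closure_Zpar z : X z -> proj_closure Zpar z.
Proof. by move=> Xz; split=> [|f [fh fZ]]; [case: Xz => _ [] | apply: vanish => //; apply: XF]. Qed.

Lemma gamma_X f z : mmap (@mpolyC n k) gamma f = 0 -> X z -> f.@[z ord0] = 0.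
Proof.
move=> f0 /X_closure_Zpar Xz; apply: (proj_closureP Zpar_cone Xz) => z' /Zpar_ev[e zE].
transitivity (f.@[fun i => ev e (gamma i)]); first exact: meval_eq.
by rewrite -ev_mmap f0 rmorph0.
Qed.

Lemma X_gamma f : (forall z, X z -> f.@[z ord0] = 0) -> mmap (@mpolyC n k) gamma f = 0.
Proof.
move=> fX; apply/eqP; apply: contraT => f0.
have [y] := mpoly_nonroot (mulf_neq0 gen_neq0 f0).
pose e t := if insub t is Some i then y i else 0.
have -> : meval y (gen * mmap (@mpolyC n k) gamma f) = ev e (gen * mmap (@mpolyC n k) gamma f).
  by apply: meval_eq => i; rewrite /e valK.
rewrite rmorphM mulf_eq0 negb_or => /andP[/gen_Zpar Zg].
rewrite ev_mmap => /eqP[]; have := fX (\row_i ev e (gamma i)) _ => <-.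
  by apply: meval_eq => i; rewrite mxE.
apply: FX; apply: (X0_frame kq q1 Su b1u b2u bb orth l_gt0 lHd Om_min).
exact: (Zpar_X0 kq q1 Su SS b1u b2u bb orth l_gt0 lHd).
Qed.

(** [X] is the closure of the image of an affine space, seen as one point with polynomial
    coordinates; irreducibility is then that of a point locus. *)
Lemma X_locus z : X z <-> point_locus (@mpolyC n k) gamma z.
Proof.
split=> [Xz|[z0 Hz]].
  by split=> [|f _ f0]; [case: Xz => _ [] | apply: gamma_X f0 Xz].
have [T Th XT] := X_closed q S J b1u b2u l H.
apply/XT; split=> // f Tf; apply: Hz; first exact: Th.
by apply: X_gamma => z' /XT[_]; apply.
Qed.

Lemma gamma_neq0 : exists j, gamma j != 0.
Proof.
have [e eg] := gen_point; have [a [bs [x [a0 [xu _ _] zE]]]] := gen_Zpar eg.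
have hu s : pframe bs x s \in unitmx by apply: pframe_unit.
have [c c0] := fp_neq0 J hu; exists (enum_rank c); apply: contra_neq c0 => g0.
have := zE (enum_rank c); rewrite mxE g0 rmorph0 /fpv enum_rankK => /esym/eqP.
by rewrite mulf_eq0 (negPf a0) => /eqP.
Qed.

Lemma X_irreducible : proj_irreducible X.
Proof.
have [j gj] := gamma_neq0.
have [[z Vz] irr] := @point_locus_irr k N R (@mpolyC n k) gamma j gj.
split=> [|A B Acl Bcl AB]; first by exists z; apply/X_locus.
by case: (irr A B Acl Bcl) => [z' /X_locus/AB //|sub|sub]; [left|right] => z' /X_locus/sub.
Qed.

(** A chain of length [n] would give [n + 1] independent functions on the cone over [X], but [gamma]
    turns them into polynomials in [n] variables. The scale variable accounts for the difference
    between the cone and [X]. *)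
Lemma X_chain_le r c : closed_chain X r c -> (r <= d.-1 + H)%N.
Proof.
move=> [Hc Hs]; rewrite leqNgt; apply/negP => lt.
have nr : (n <= r)%N by lia.
have cn : closed_chain X n c.
  by split=> i ni; [apply: Hc | apply: Hs]; apply: leq_trans nr.
have Xc : cone X := @X_cone _ _ _ _ _ _ _ _.
have [f fP] := chain_alg_indep Xc cn.
have [P P0 PE] := mpoly_alg_dep (fun i => mmap (@mpolyC n k) gamma (f i)).
case/negP: P0; apply/eqP/fP => z cz.
have [[A _ AE] _] := Hc n nr.
apply: (@gamma_X _ z); last by have [] := (AE z).1 cz.
have -> : mmap (@mpolyC n k) gamma (mmap (@mpolyC N k) f P) = mmap (@mpolyC n k) (fun i => mmap (@mpolyC n k) gamma (f i)) P.
  rewrite -[LHS]/((mmap (@mpolyC n k) gamma : {rmorphism _ -> _}) _) rmorph_mmap.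
  by apply: eq_mmap => // c'; apply: mmapC.
exact: PE.
Qed.

End Parametrization.

(** * Tangent spaces and local dimension *)

Section MaskSpace.
Variables (k : fieldType) (d : nat) (P : pred ('I_d * 'I_d)).

Definition maskf (v : 'rV[k]_#|P|) : 'M[k]_d :=
  \sum_(e < #|P|) v ord0 e *: delta_mx (enum_val e).1 (enum_val e).2.

Lemma maskf_is_linear : linear maskf.
Proof.
move=> a u v; rewrite /maskf scaler_sumr -big_split; apply: eq_bigr => e _ /=.
by rewrite !mxE scalerDl scalerA.
Qed.

HB.instance Definition _ := GRing.isLinear.Build k 'rV[k]_#|P| 'M[k]_d _ maskf maskf_is_linear.

Lemma maskfE v i j : maskf v i j = \sum_(e < #|P| | enum_val e == (i, j)) v ord0 e.
Proof.
rewrite summxE [RHS]big_mkcond; apply: eq_bigr => e _; rewrite !mxE -pair_eqE /=.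
by rewrite [i == _]eq_sym [j == _]eq_sym; case: ifP; rewrite ?mulr1 ?mulr0.
Qed.

Lemma maskf_out v i j : ~~ P (i, j) -> maskf v i j = 0.
Proof.
move=> nP; rewrite maskfE big1 // => e /eqP E.
by have := enum_valP e; rewrite E unfold_in (negPf nP).
Qed.

Lemma maskf_ex (M : 'M[k]_d) : (forall i j, ~~ P (i, j) -> M i j = 0) ->
  M = maskf (\row_e M (enum_val e).1 (enum_val e).2).
Proof.
move=> MP; apply/matrixP => i j; have [Pij|nP] := boolP (P (i, j)); last by rewrite maskf_out // MP.
have Pij' : (i, j) \in P by [].
rewrite maskfE (bigD1 (enum_rank_in Pij' (i, j))) /=; last by rewrite enum_rankK_in.
rewrite big1 ?addr0 => [|e /andP[/eqP E]]; first by rewrite mxE enum_rankK_in.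
by rewrite -(inj_eq enum_val_inj) enum_rankK_in // E eqxx.
Qed.

Lemma maskf_inj : injective maskf.
Proof.
move=> u v /matrixP E; apply/rowP => e; case Ee : (enum_val e) => [i j].
have H w : maskf w i j = w ord0 e.
  rewrite maskfE (bigD1 e) ?Ee //= big1 ?addr0 // => e' /andP[/eqP E1].
  by rewrite -(inj_eq enum_val_inj) E1 Ee eqxx.
by have := E i j; rewrite !H.
Qed.

Definition mask_space : {vspace 'M[k]_d} := limg (linfun maskf).

Lemma mem_mask (M : 'M[k]_d) : reflect (forall i j, ~~ P (i, j) -> M i j = 0) (M \in mask_space).
Proof.
apply: (iffP idP) => [/memv_imgP[v _ ->] i j|MP]; first by rewrite lfunE; apply: maskf_out.
by rewrite (maskf_ex MP) -[maskf _]lfunE memv_img // memvf.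
Qed.

Lemma dim_mask : \dim mask_space = #|P|.
Proof.
rewrite limg_dim_eq ?dimvf /dim /= ?mul1n //.
apply/eqP; rewrite capfv -/(lker _); apply/eqP/eqP/lker0P => u v.
by rewrite !lfunE => /maskf_inj.
Qed.

End MaskSpace.

(** * Solutions of the linearized condition *)

Section CommutantBasis.
Variables (k : fieldType) (d : nat) (D : seq nat) (N h : 'M[k]_d).
Hypothesis (d0 : (0 < d)%N) (Dd : forall x, x \in D -> (x < d)%N).
Hypothesis (Nu : N \in unitmx) (NZ : inZ D N) (hu : h \in unitmx).

Let Zpos := [pred p : 'I_d * 'I_d | ~~ nz D p.1 p.2.+1].
Let Ppos := [pred p : 'I_d * 'I_d | ~~ nz D p.1 p.2].
(** The number of rows open to [inP] in column [j], and to [inZ] in column [j - 1]. With the value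
    [d] at the end, the difference of the two counts telescopes. *)
Let f j := if (j < d)%N then nxt D d j else d.

Let fd j : (f j <= d)%N. Proof. by rewrite /f; case: ifP => // _; apply: nxt_led. Qed.

Let card_lt m : (m <= d)%N -> (\sum_(i < d | (i < m)%N) 1 = m)%N.
Proof. by move=> md; rewrite -(big_ord_widen d (fun=> 1%N) md) sum1_card card_ord. Qed.

Let nz_f (i : 'I_d) j : (j <= d)%N -> nz D i j = (f j <= i)%N.
Proof.
rewrite leq_eqVlt => /orP[/eqP->|jd]; last by rewrite /f jd (nz_nxt (d := d)).
rewrite /f ltnn leqNgt ltn_ord; apply/nzP => -[x /Dd xd]; lia.
Qed.

Let card_col g : (forall j : 'I_d, (g j <= d)%N) ->
  #|[pred p : 'I_d * 'I_d | (p.1 < g p.2)%N]| = (\sum_(j < d) g j)%N.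
Proof.
move=> gd; rewrite -sum1_card /= -(pair_big_dep predT (fun i j : 'I_d => (i < g j)%N) (fun _ _ => 1%N)) /=.
rewrite (exchange_big_dep predT) //=; apply: eq_bigr => j _.
exact: card_lt.
Qed.

Let card_ZP : #|Zpos| = (#|Ppos| + (d - nxt D d 0))%N.
Proof.
have -> : #|Zpos| = (\sum_(j < d) f j.+1)%N.
  rewrite -card_col //.
  by apply: eq_card => -[i j]; rewrite !inE /= nz_f // ltnNge.
have -> : #|Ppos| = (\sum_(j < d) f j)%N.
  rewrite -card_col //.
  by apply: eq_card => -[i j]; rewrite !inE /= (nz_f _ (ltnW (ltn_ord j))) ltnNge.
have f0 : f 0%N = nxt D d 0 by rewrite /f d0.
have fd' : f d = d by rewrite /f ltnn.
have : (f 0 + \sum_(j < d) f j.+1 = \sum_(j < d) f j + f d)%N.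
  by rewrite -(big_ord_recr d (fun j => f j)) big_ord_recl.
rewrite f0 fd'; have := nxt_led D d 0; lia.
Qed.

(** The component of [M *m invmx N] in [inP]; its kernel consists of the [nu *m N] with [nu] in the
    opposite nilradical. *)
Let psi (M : 'M[k]_d) : 'M[k]_d := M *m invmx N - projN D (M *m invmx N).

Let psi_is_linear : linear psi.
Proof.
move=> a u v; apply/matrixP => i j; rewrite /psi mulmxDl -scalemxAl !mxE.
by case: ifP => _; rewrite ?mulrBr ?subr0; ring.
Qed.

HB.instance Definition _ := GRing.isLinear.Build k 'M[k]_d 'M[k]_d _ psi psi_is_linear.

Let psiE M i j : psi M i j = if nz D i j then 0 else (M *m invmx N) i j.
Proof. by rewrite [LHS]mxE [X in _ + X]mxE [projN _ _ i j]mxE; case: ifP; rewrite ?subrr ?subr0. Qed.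

Let U := mask_space k Zpos.
Let V := (U :&: lker (linfun psi))%VS.

Let UP M : M \in U <-> inZ D M.
Proof.
split=> [/mem_mask MZ i j nzij|MZ]; first by apply: MZ; rewrite /= nzij.
by apply/mem_mask => i j /=; rewrite negbK; apply: MZ.
Qed.

Let VP nu : (nu *m N \in V) <-> inN D nu /\ inZ D (nu *m N).
Proof.
have K : (nu *m N \in lker (linfun psi)) <-> inN D nu.
  rewrite memv_ker lfunE /=; split=> [/eqP/matrixP E i j nij|nN].
    by have := E i j; rewrite psiE (negPf nij) mulmxK // mxE.
  by apply/eqP/matrixP => i j; rewrite psiE mulmxK // mxE; case: ifPn => // /nN.
rewrite memv_cap; split=> [/andP[/UP nZ /K nN] //|[/K -> /UP ->]] //.
Qed.

(** [psi] maps [inZ] onto [inP], as [inP] times [N] lies in [inZ]. The dimension is thus a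
    difference of two counts, whatever [N] is. *)
Let dimV : \dim V = (d - nxt D d 0)%N.
Proof.
have := limg_ker_dim (linfun psi) U; rewrite dim_mask.
have -> : (linfun psi @: U)%VS = mask_space k Ppos.
  apply/vspaceP => M; apply/memv_imgP/mem_mask => [[M' /UP MZ ->] i j|MP].
    by rewrite negbK lfunE /= => nij; rewrite psiE nij.
  exists (M *m N).
    by apply/UP; apply: inP_mulZ => // i j nij; apply: MP; rewrite /= negbK.
  rewrite lfunE; apply/matrixP => i j; rewrite psiE mulmxK //.
  by case: ifPn => // nij; apply: MP; rewrite /= negbK.
by rewrite dim_mask card_ZP addnC => /addnI ->.
Qed.

(** The dual functionals are written in terms of [h *m nu], the displacement of the frame, because
    this is what the Pluecker coordinates show. *)
Lemma commutant_basis : exists (c Lam : 'I_(d - nxt D d 0) -> 'M[k]_d), [/\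
  forall e, inN D (c e), forall e, inZ D (c e *m N),
  forall f e, \sum_i \sum_j Lam f i j * (h *m c e) i j = (f == e)%:R &
  forall nu, inN D nu -> inZ D (nu *m N) ->
    nu = \sum_e (\sum_i \sum_j Lam e i j * (h *m nu) i j) *: c e].
Proof.
rewrite -dimV; pose B := vbasis V.
have BV (e : 'I_(\dim V)) : B`_e *m invmx N *m N \in V by rewrite mulmxKV // vbasis_mem // mem_nth // size_tuple.
pose c (e : 'I_(\dim V)) : 'M[k]_d := B`_e *m invmx N.
pose Lam (e : 'I_(\dim V)) : 'M[k]_d := \matrix_(i, j) coord B e (invmx h *m delta_mx i j *m N).
have LamE e nu : \sum_i \sum_j Lam e i j * (h *m nu) i j = coord B e (nu *m N).
  have -> : nu *m N = \sum_i \sum_j (h *m nu) i j *: (invmx h *m delta_mx i j *m N).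
    rewrite -[nu in LHS](mulKmx hu) {1}[h *m nu]matrix_sum_delta mulmx_sumr mulmx_suml.
    apply: eq_bigr => i _; rewrite mulmx_sumr mulmx_suml; apply: eq_bigr => j _.
    by rewrite -scalemxAr -scalemxAl.
  rewrite linear_sum; apply: eq_bigr => i _; rewrite linear_sum; apply: eq_bigr => j _.
  by rewrite linearZ /= mxE mulrC.
exists c, Lam; split=> [e|e|f' e|nu nN nZ].
- by have [] := (VP _).1 (BV e).
- by have [] := (VP _).1 (BV e).
- by rewrite LamE mulmxKV // coord_free ?(basis_free (vbasisP V)) // eq_sym.
have nV : nu *m N \in V by apply/VP.
rewrite -[LHS](mulmxK Nu) {1}(coord_basis (vbasisP V) nV) mulmx_suml; apply: eq_bigr => e _.
by rewrite LamE -scalemxAl.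
Qed.

End CommutantBasis.

Section Derivations.
Variables (k B : comNzRingType) (n : nat).
Variables (Df Dg : {mpoly k[n]} -> B) (phi : {mpoly k[n]} -> B).
Hypothesis (DfP : dlin phi Df) (DgP : dlin phi Dg).
Hypothesis (DC : forall c, Df c%:MP = Dg c%:MP) (DX : forall i, Df 'X_i = Dg 'X_i).

Lemma dlin_mpoly_eq f : Df f = Dg f.
Proof.
have DA f1 f2 : Df f1 = Dg f1 -> Df f2 = Dg f2 -> Df (f1 + f2) = Dg (f1 + f2).
  by rewrite DfP.1 DgP.1 => -> ->.
have DM f1 f2 : Df f1 = Dg f1 -> Df f2 = Dg f2 -> Df (f1 * f2) = Dg (f1 * f2).
  by rewrite DfP.2 DgP.2 => -> ->.
have D1 : Df 1 = Dg 1 by rewrite -mpolyC1.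
rewrite [f]mpolyE; elim/big_ind: _ => // [|m _]; first by rewrite -mpolyC0.
rewrite -mul_mpolyC; apply: (DM) => //; rewrite mpolyXE_id.
apply: (big_ind (fun f => Df f = Dg f)) => // i _; elim: (m i) => [|e IH]; rewrite ?expr0 // exprS.
exact: (DM).
Qed.

End Derivations.

Lemma dlin_kills_det (A B : comNzRingType) (phi Df : A -> B) n (M : 'M[A]_n) : dlin phi Df ->
  Df 1 = 0 -> (forall i j, Df (M i j) = 0) -> Df (\det M) = 0.
Proof.
move=> [dA dM] D1 MD.
have D0 : Df 0 = 0 by apply: (addrI (Df 0)); rewrite -dA !addr0.
have DN x : Df x = 0 -> Df (- x) = 0.
  by move=> x0; apply: (addrI (Df x)); rewrite -dA subrr D0 x0 addr0.
have DD x y : Df x = 0 -> Df y = 0 -> Df (x + y) = 0 by rewrite dA => -> ->; rewrite addr0.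
have DM x y : Df x = 0 -> Df y = 0 -> Df (x * y) = 0 by rewrite dM => -> ->; rewrite mulr0 mul0r addr0.
rewrite /determinant; apply: (big_ind (fun x => Df x = 0)) => // s _; apply: (DM); last first.
  exact: (big_ind (fun x => Df x = 0)).
by case: (odd_perm s); rewrite ?expr1 ?expr0 //; apply: DN.
Qed.

Lemma Hm_fun d (J : {set 'I_d} * {set 'I_d}) (B B' : comUnitRingType) (Df : B -> B') z pi s i j :
  Df 0 = 0 -> Df (Hm (J := J) z pi s i j) = Hm (Df \o z) pi s i j.
Proof. by move=> D0; rewrite !mxE; case: ifP => // _; case: (i == _); rewrite ?mulr1 ?mulr0. Qed.

Lemma dlin0 (A B : nzRingType) (phi Df : A -> B) : dlin phi Df -> Df 0 = 0.
Proof. by case=> dA _; apply: (addrI (Df 0)); rewrite -dA !addr0. Qed.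

Lemma dlin1 (A B : comNzRingType) (phi : {rmorphism A -> B}) Df : dlin phi Df -> Df 1 = 0.
Proof.
case=> _ dM; have := dM 1 1; rewrite !mulr1 rmorph1 mul1r mulr1 => E.
by apply: (addrI (Df 1)); rewrite addr0 -E.
Qed.

Lemma dlin_exp_eq0 (A B : comNzRingType) (phi Df : A -> B) x n : dlin phi Df -> Df 1 = 0 ->
  Df x = 0 -> Df (x ^+ n) = 0.
Proof.
by move=> [_ dM] D1 Dx; elim: n => [|n IH]; rewrite ?expr0 // exprS dM IH Dx mulr0 mul0r addr0.
Qed.

Lemma dlin_expq (A B : comNzRingType) (phi : {rmorphism A -> B}) Df x q : dlin phi Df ->
  [pchar B].-nat q -> (1 < q)%N -> Df (x ^+ q) = 0.
Proof.
move=> dD Bq q1.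
have E n : Df (x ^+ n) = n%:R * phi x ^+ n.-1 * Df x.
  elim: n => [|n IH]; first by rewrite expr0 (dlin1 dD) !mul0r.
  rewrite exprS dD.2 IH rmorphXn; case: n {IH} => [|n]; first by rewrite expr0; ring.
  by rewrite exprS /= -!natr1; ring.
by rewrite E (pchar_nat_eq0 Bq q1) !mul0r.
Qed.

Lemma dlin_mulmx (A B : comNzRingType) (phi Df : A -> B) m n p (X : 'M[A]_(m, n)) (Y : 'M_(n, p)) :
  dlin phi Df -> map_mx Df (X *m Y) = map_mx phi X *m map_mx Df Y + map_mx Df X *m map_mx phi Y.
Proof.
move=> dD; apply/matrixP => i j; rewrite !mxE (big_morph Df dD.1 (dlin0 dD)) -big_split.
by apply: eq_bigr => l _; rewrite dD.2 !mxE.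
Qed.

Lemma dlin_kills_fp (A B : comUnitRingType) (phi Df : A -> B) d (J : {set 'I_d} * {set 'I_d}) (h : bool -> 'M[A]_d) c :
  dlin phi Df -> Df 1 = 0 -> (forall s i j, Df (h s i j) = 0) -> Df (fp (J := J) h c) = 0.
Proof.
move=> dD D1 hD.
have DM x y : Df x = 0 -> Df y = 0 -> Df (x * y) = 0 by rewrite dD.2 => -> ->; rewrite mulr0 mul0r addr0.
have G s (J' : {set 'I_d}) (c' : plucker_index J') : Df (gpp (h s) c') = 0.
  apply: (big_ind (fun x => Df x = 0)) => // y _; apply: dlin_kills_det dD D1 _ => i j.
  by rewrite mxE.
by apply: DM; apply: G.
Qed.

(** Forward elimination: in the rows chosen by [pi], [h] is lower unitriangular. *)
Lemma normalized_ldiv (k : fieldType) d (D : seq nat) (pi : 'S_d) (h M : 'M[k]_d) :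
  h \in unitmx -> normalized D pi h -> (forall i j : 'I_d, ~~ nz D i j -> M (pi i) j = 0) ->
  inN D (invmx h *m M).
Proof.
move=> hu hn HM; set nu := invmx h *m M.
have ME : M = h *m nu by rewrite mulKVmx.
suff H b (i j : 'I_d) : (i < b)%N -> ~~ nz D i j -> nu i j = 0 by move=> i j; apply: (H i.+1).
elim: b => // b IH in i j *; rewrite ltnS => ib nij.
have := HM i j nij; rewrite ME mxE (bigD1 i) //= hn ?eqxx ?mul1r; last first.
  by apply/negP => /nzP[x _]; lia.
rewrite big1 ?addr0 // => l li; have [nil|nil] := boolP (nz D i l); last first.
  by rewrite hn // eq_sym (negPf li) mul0r.
have [x xD /andP[lx xi]] := nzP _ _ _ nil.
rewrite [nu l j]IH ?mulr0 //; first by apply: leq_trans lx (leq_trans xi ib).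
apply: contra nij => /nzP[y yD /andP[jy yl]]; apply/nzP; exists y => //.
by rewrite jy (leq_trans yl) // ltnW // (leq_trans lx xi).
Qed.

Section GermDerivation.
Variables (k : closedFieldType) (N : nat) (R : idomainType) (iota : {rmorphism k -> R}).
Variables (al : {rmorphism R -> k}) (Dl : R -> k) (ga : 'I_N -> R).
Hypothesis (alK : forall a, al (iota a) = a) (DlP : dlin al Dl) (DlC : forall a, Dl (iota a) = 0).

(** A derivation of the germ followed by reduction is a tangent vector at the reduced point. *)
Lemma germ_tder f : Dl (mmap iota ga f) = tder (\row_i al (ga i)) (\row_i Dl (ga i)) f.
Proof.
apply: (@dlin_mpoly_eq k k N (fun f => Dl (mmap iota ga f)) _ (fun f => f.@[(\row_i al (ga i)) ord0])).
- have E g : al (mmap iota ga g) = g.@[(\row_i al (ga i)) ord0].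
    rewrite -[mmap iota ga g]/((mmap iota ga : {rmorphism _ -> _}) g) rmorph_mmap.
    by apply: eq_mmap => [c|i] /=; rewrite ?mxE.
  split=> f1 f2; first by rewrite mmapD DlP.1.
  by rewrite [mmap _ _ (_ * _)]rmorphM DlP.2 !E.
- exact: tder_dlin.
- by move=> c; rewrite mmapC DlC tderC.
- by move=> i; rewrite mmapX mmap1U tderX mxE.
Qed.

End GermDerivation.

(** * Tangent spaces and chains at the points of the closure *)

Section Smoothness.
Variables (k : closedFieldType) (q d : nat) (S : 'M[k]_d) (b : 'M[k]_d * 'M[k]_d).
Variable J : {set 'I_d} * {set 'I_d}.
Hypothesis (kq : [pchar k].-nat q) (q1 : (1 < q)%N).
Hypothesis (Su : S \in unitmx) (SS : fmx q (fmx q S) = S).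
Hypothesis (b1u : b.1 \in unitmx) (b2u : b.2 \in unitmx) (bb : fmx q (fmx q b.2) = b.2).
Hypothesis orth : forall a c : 'I_d, (a + c + 2 <= d)%N -> (b.1^T *m S *m fmx q b.2) a c = 0.
Variables (l H : nat) (Om : seq nat).
Hypothesis (l_gt0 : (0 < l)%N) (lHd : (l + H <= d)%N).
Local Notation Q := (q * q)%N.
Local Notation D := (fun s => dseq (Js J s)).
Local Notation Sf := (Sf q S).
Hypothesis Om_bd : forall w, w \in Om -> (l <= w <= l + H)%N.
Hypothesis Om_min : l \in Om.
Hypothesis Om_max : exists2 s, Om = (l + H)%N :: s & path (fun w' w => (w < w')%N) (l + H)%N s.
Hypothesis D1P : forall x, (x \in D true) = (x \in Om) && (x < d)%N.
Hypothesis D2P : forall x, (x \in D false) = [&& (0 < x)%N, (x < d)%N & (d.+1 - x)%N \in Om].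
Local Notation N := #|flag_index J|.
Local Notation A := {mpoly k[N]}.
Local Notation cw := (coxeter_word d l, coxeter_word d (d.+1 - (l + H))%N).
Local Notation X := (@fine_DL_closure k q d S b J cw).
Local Notation dim s := (d - nxt (D s) d 0)%N.

Let XF := X_frame kq q1 Su b1u b2u bb orth l_gt0 lHd Om_bd Om_min D1P D2P.
Let FX := frame_X kq q1 Su SS b1u b2u bb orth l_gt0 lHd Om_bd Om_min Om_max D1P D2P.
Let d0 : (0 < d)%N. Proof. exact: leq_trans (leq_trans l_gt0 (leq_addr H l)) lHd. Qed.

Lemma nxt_min s : nxt (D s) d 0 = (if s then l else d.+1 - (l + H))%N.
Proof.
have Dd x : x \in D s -> (0 < x < d)%N by apply: dseq_lt.
set m := (X in _ = X).
have m0 : (0 < m <= d)%N by rewrite /m; case: (s); lia.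
have mD : (m < d)%N -> m \in D s.
  rewrite /m; case: (s) => md; first by rewrite D1P Om_min.
  rewrite D2P md subKn; last by lia.
  by have [s' -> _] := Om_max; rewrite inE eqxx; lia.
have Dm x : x \in D s -> (m <= x)%N.
  rewrite /m; case: (s); first by rewrite D1P => /andP[/Om_bd]; lia.
  by rewrite D2P => /and3P[_ _ /Om_bd]; lia.
apply/eqP; rewrite eqn_leq; apply/andP; split.
  have [md|dm] := ltnP m d; first by apply: nxt_le; [apply: mD | case/andP: m0].
  by apply: leq_trans (nxt_led _ _ _) dm.
have [nd|] := ltnP (nxt (D s) d 0) d; first by apply: Dm; apply: nxt_in.
by apply: leq_trans; case/andP: m0.
Qed.

Section AtPoint.
Variables (z : 'rV[k]_N) (pi : bool -> 'S_d) (h0 : bool -> 'M[k]_d).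
Hypothesis (Xz : X z) (z0 : zpt z (cbase J pi) != 0).
Hypothesis (h0u : forall s, h0 s \in unitmx) (h0Z : forall s, inZ (D s) (Nk q S h0 s)).
Hypothesis h0n : forall s, normalized (D s) (pi s) (h0 s).
Hypothesis zE : forall c, zpt z c = zpt z (cbase J pi) * fp h0 c.
Hypothesis HE : forall s, Hm (zpt z) pi s = zpt z (cbase J pi) *: h0 s.
Local Notation kap := (zpt z (cbase J pi)).

Variables (c Lam : forall s, 'I_(dim s) -> 'M[k]_d).
Hypothesis cN : forall s e, inN (D s) (c (s := s) e).
Hypothesis cZ : forall s e, inZ (D s) (c (s := s) e *m Nk q S h0 s).
Local Notation lamz := (lam Lam).
Hypothesis lam_c : forall s f e, lamz idfun f (h0 s *m c (s := s) e) = (f == e)%:R.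
Hypothesis c_span : forall s nu, inN (D s) nu -> inZ (D s) (nu *m Nk q S h0 s) ->
  nu = \sum_e lamz idfun e (h0 s *m nu) *: c (s := s) e.
Local Notation normal_germ := (normal_germ q D Sf h0 pi Lam).
Local Notation V := {s : bool & 'I_(dim s)}.

Let NkE s : Nk q S h0 s = Nm q Sf idfun h0 s. Proof. by rewrite /Nm map_mx_id. Qed.
Let N0Z s : inZ (D s) (Nm q Sf idfun h0 s). Proof. by rewrite -NkE. Qed.
Let cZ' s e : inZ (D s) (c (s := s) e *m Nm q Sf idfun h0 s). Proof. by rewrite -NkE. Qed.

Lemma germ_cons v vars (R : idomainType) (iota : {rmorphism k -> R}) al h :
  normal_germ vars iota al h -> v \notin vars ->
  exists2 h' : bool -> 'M[pser R]_d,
    normal_germ (v :: vars) (@ps_const R \o iota) (al \o @ps_coef0 R) h' &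
    forall s, map_mx (@ps_coef0 R) (h' s) = h s.
Proof. exact: (normal_germ_cons kq q1 (Sf_unit kq Su) h0u cN cZ' lam_c). Qed.

Lemma germ_nil : normal_germ [::] idfun idfun h0.
Proof. exact: normal_germ_nil. Qed.

(** The local coordinate [v] minus its value at [h0], made homogeneous by the base coordinate; it
    vanishes on a germ where [v] is kept fixed. *)
Definition fv (v : V) : A := lamz (@mpolyC N k) (tagged v) (Hm (@zX k d J) pi (tag v)) -
  (lamz idfun (tagged v) (h0 (tag v)))%:MP * zX k (cbase J pi).

Lemma fv_homog v : homogeneous (fv v).
Proof.
exists 1%N; have zXh c' : @zX k d J c' \is 1.-homog by rewrite /zX dhomogX; apply/eqP; apply: mdeg1.
rewrite /fv mul_mpolyC rpredB ?rpredZ // /lam rpred_sum // => i _; rewrite rpred_sum // => j _.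
rewrite mul_mpolyC rpredZ // mxE; case: ifP => // _.
by case: (_ == _); rewrite ?mulr1 ?mulr0 ?rpred0.
Qed.

Section Germ.
Variables (vars : seq V) (R : idomainType) (iota : {rmorphism k -> R}) (al : {rmorphism R -> k}).
Variable h : bool -> 'M[R]_d.
Hypothesis G : normal_germ vars iota al h.
Local Notation locus := (point_locus iota (fpv (J := J) h)).
Local Notation ev := (mmap iota (fpv (J := J) h)).

Lemma germ_unit s : h s \in unitmx.
Proof. by apply: (aug_unitmx (ng_aug G)); rewrite (ng_h G). Qed.

Lemma germ_fp (c' : flag_index J) : al (fp h c') = fp h0 c'.
Proof. by rewrite fp_map; apply: eq_fp => s; rewrite (ng_h G). Qed.

Lemma germ_base : fpv h (enum_rank (cbase J pi)) = 1.
Proof. by rewrite /fpv enum_rankK fp_norm //; apply: (ng_norm G). Qed.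

Let alK a : al (iota a) = a. Proof. exact: (aug_K (ng_aug G)). Qed.

Lemma locus_z : locus z.
Proof.
split=> [|f [e fh] f0]; first by case: Xz => _ [].
have -> : z = kap *: \row_i fpv (J := J) h0 i.
  by apply/rowP => i; rewrite !mxE -zE /zpt enum_valK.
rewrite (meval_scale _ _ fh); have := congr1 al f0; rewrite rmorph0.
rewrite -[mmap iota _ f]/(ev f) rmorph_mmap => E.
suff <- : mmap (al \o iota) (al \o fpv h) f = f.@[(\row_i fpv h0 i) ord0] by rewrite E mulr0.
by apply: eq_mmap => [a|i] /=; rewrite ?mxE ?germ_fp.
Qed.

Lemma locus_irr : proj_irreducible locus.
Proof.
have g0 : fpv h (enum_rank (cbase J pi)) != 0 by rewrite germ_base oner_neq0.
exact: point_locus_irr g0.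
Qed.

(** A nonzero value on the germ would specialize to frames over [k], that is, to a point of [X]. *)
Lemma ev_X f : (forall z', X z' -> f.@[z' ord0] = 0) -> ev f = 0.
Proof.
move=> fX; apply/eqP/negPn/negP => f0.
pose n0 := #|frame_index d|.
have /(@specialize k q d S D kq Su R iota h)  : mmap iota (frame_coords h (fun s => invmx (h s)))
    (mmap (@mpolyC n0 k) (fpv (XM k d true)) f) != 0.
  set phi := mmap iota _.
  rewrite -[phi _]/((phi : {rmorphism _ -> _}) _) (@eval_fpv k d J R iota _ h) //.
  - by move=> a; rewrite /phi /= mmapC.
  - by move=> e; rewrite /phi /= mmapX mmap1U.
case; [exact: germ_unit | exact: (ng_Z G) |].
move=> h1 [h1u h1Z /eqP[]].
rewrite -[meval _ _]/((meval (frame_coords h1 (fun s => invmx (h1 s))) : {rmorphism _ -> _}) _).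
rewrite (@eval_fpv k d J k idfun _ h1) //=; first last.
- by move=> e; rewrite /= mevalXU.
- by move=> a; rewrite /= mevalC.
have := fX (\row_i fpv h1 i) _ => <-; first by apply: eq_mmap => // i; rewrite mxE.
apply: FX; exists 1, h1; split=> //; first exact: oner_neq0.
by move=> i; rewrite mxE mul1r.
Qed.

Lemma locus_X z' : locus z' -> X z'.
Proof.
have [T Th XT] := X_closed q S J b1u b2u l H.
move=> [z'0 Hz]; apply/XT; split=> // f Tf; apply: Hz; first exact: Th.
by apply: ev_X => y /XT[_]; apply.
Qed.

Lemma ev_fv v : ev (fv v) = lamz iota (tagged v) (h (tag v)) - iota (lamz idfun (tagged v) (h0 (tag v))).
Proof.
pose g : {rmorphism A -> R} := ev.
rewrite -[ev _]/(g _) rmorphB rmorphM; congr (_ - _).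
  rewrite lam_map Hm_map.
  have -> : Hm (g \o @zX k d J) pi (tag v) = h (tag v).
    rewrite -(Hm_norm (J := J) (tag v) (ng_norm G)); apply: eq_Hm => c'.
    by rewrite /= /zX mmapX mmap1U /fpv enum_rankK.
  by apply: eq_lam => a; apply: mmapC.
rewrite [g _%:MP]mmapC; rewrite -[RHS]mulr1; congr (_ * _).
by rewrite -[RHS]germ_base /g /zX /= mmapX mmap1U.
Qed.

Lemma tangent_of_germ v : v \in vars -> exists t, [/\ cone_tangent X z t, zpt t (cbase J pi) = 0 &
  forall s (f : 'I_(dim s)), lamz idfun f (Hm (zpt t) pi s) = kap * (existT _ s f == v)%:R].
Proof.
case/(ng_der G) => del [dl dk] delE.
(* The factor [kap] makes the germ reduce to the vector [z] itself and not to a multiple of it. *)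
pose ga i := iota kap * fpv (J := J) h i.
pose Dl x := al (del x).
have DlP : dlin al Dl by split=> x y; rewrite /Dl ?dl.1 ?dl.2 ?rmorphD ?rmorphM.
have DlC a : Dl (iota a) = 0 by rewrite /Dl dk rmorph0.
have Dl0 := dlin0 DlP.
exists (\row_i Dl (ga i)).
have zptE c' : zpt (\row_i Dl (ga i)) c' = Dl (iota kap * fp h c').
  by rewrite /zpt mxE /ga /fpv enum_rankK.
have DlM a x : Dl (iota a * x) = a * Dl x by rewrite DlP.2 DlC mul0r addr0 alK.
split=> [f [[e fh] fX]||s f].
- have := germ_tder ga alK DlP DlC f.
  rewrite (mmap_scale _ _ _ fh) -[mmap _ _ _]/(ev f) ev_X // mulr0 Dl0 => /esym E.
  rewrite -[RHS]E /tder; apply: eq_bigr => i _; congr (_ * _); apply: meval_eq => j.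
  by rewrite !mxE rmorphM alK germ_fp -zE /zpt enum_valK.
- by rewrite zptE DlM fp_norm ?(dlin1 DlP) ?mulr0 //; apply: (ng_norm G).
have HmE i j : Hm (zpt (\row_i Dl (ga i))) pi s i j = kap * Dl (h s i j).
  have -> : Hm (zpt (\row_i Dl (ga i))) pi s = Hm (Dl \o (fun c' : flag_index J => iota kap * fp h c')) pi s.
    by apply: eq_Hm => c'; rewrite zptE.
  by rewrite -Hm_fun // Hm_scale mxE Hm_norm ?DlM //; apply: (ng_norm G).
have := congr1 al (delE s f); rewrite rmorph_nat => <-; rewrite /lam (big_morph del dl.1 (dlin0 dl)) rmorph_sum mulr_sumr.
apply: eq_bigr => i _; rewrite (big_morph del dl.1 (dlin0 dl)) rmorph_sum mulr_sumr.
apply: eq_bigr => j _; rewrite HmE mulrCA -[del _]/(del _); congr (_ * _).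
by rewrite -/(Dl _) DlM.
Qed.

End Germ.

(** Freeing one coordinate enlarges the closure of the germ strictly: [fv v] vanishes on the old
    closure and not on the new one. *)
Lemma germ_chain vars : uniq vars -> exists (ch : nat -> 'rV[k]_N -> Prop) (R : idomainType)
    (iota : {rmorphism k -> R}) (al : {rmorphism R -> k}) (h : bool -> 'M[R]_d),
  [/\ normal_germ vars iota al h, closed_chain X (size vars) ch, ch 0%N z &
      ch (size vars) = point_locus iota (fpv (J := J) h)].
Proof.
elim: vars => [_|v vars IH /= /andP[nv /IH[ch [R [iota [al [h [G [Hc Hs] chz chE]]]]]]]].
  exists (fun _ => point_locus idfun (fpv (J := J) h0)), k, idfun, idfun, h0.
  split=> //; first exact: germ_nil; last exact: (locus_z germ_nil).
  split=> // i _; split; last exact: (locus_irr germ_nil).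
  exists (point_locus idfun (fpv (J := J) h0)); first exact: point_locus_closed.
  by move=> z'; split=> [Lz|[]//]; split=> //; apply: (locus_X germ_nil).
have [h' G' hh'] := germ_cons G nv.
set iota' := [the {rmorphism k -> pser R} of @ps_const R \o iota] in G'.
set al' := [the {rmorphism pser R -> k} of al \o @ps_coef0 R] in G'.
pose L' := point_locus iota' (fpv (J := J) h').
pose ch' i := if (i <= size vars)%N then ch i else L'.
exists ch', (pser R), iota', al', h'; split=> //; last first.
- by rewrite /ch' ltnn.
have fp_h' (f : {mpoly k[N]}) : mmap iota' (fpv h') f = 0 -> mmap iota (fpv h) f = 0.
  move=> /(congr1 (@ps_coef0 R)); rewrite rmorph0 -[mmap iota' _ f]/((mmap iota' (fpv h') : {rmorphism _ -> _}) f) rmorph_mmap => E.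
  rewrite -[RHS]E; apply: eq_mmap => [a|i] /=; first by rewrite ps_constK.
  by rewrite /fpv fp_map; apply: eq_fp => s; rewrite hh'.
split=> i; rewrite /ch'.
  rewrite leq_eqVlt => /orP[/eqP->|]; last by rewrite ltnS => ile; rewrite ile; apply: Hc.
  rewrite ltnn; split; last exact: (locus_irr G').
  exists L'; first exact: point_locus_closed.
  by move=> z'; split=> [Lz|[]//]; split=> //; apply: (locus_X G').
rewrite ltnS => ile; have [ilt|ige] := ltnP i (size vars); first by rewrite ile; apply: Hs.
have -> : i = size vars by apply/eqP; rewrite eqn_leq ile.
rewrite leqnn chE; split=> [z' [z'0 Hz]|sub].
  by split=> // f fh /fp_h'; apply: Hz.
have nz : mmap iota' (fpv h') (fv v) != 0.
  have [|del [dl dk] delE] := ng_der G' (v := v); first exact: mem_head.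
  rewrite (ev_fv G'); apply/eqP => /(congr1 del); rewrite (dlin0 dl).
  have -> x y : del (x - iota' y) = del x.
    by rewrite -rmorphN dl.1 dk addr0.
  by rewrite delE; case: (v) => s f; rewrite eqxx => /eqP; rewrite oner_eq0.
have g0 : fpv h' (enum_rank (cbase J pi)) != 0 by rewrite (germ_base G') oner_neq0.
have [z' Lz'] := point_locus_ex g0 nz; case/eqP.
have [_ Hz] := sub z' Lz'; apply: Hz; first exact: fv_homog.
by rewrite (ev_fv G) (ng_lam G) -?surjective_tagged ?subrr //; case: (v) nv.
Qed.

(** Euler's relation, obtained from the germ of the line through [z] at the scalar 1. *)
Lemma tangent_self : cone_tangent X z z.
Proof.
move=> f [[e fh] fX].
pose ga i : {poly k} := 'X * (z ord0 i)%:P.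
pose al : {rmorphism {poly k} -> k} := horner_eval (1 : k).
pose Dl (p : {poly k}) := p^`().[1].
have alE p : al p = p.[1] by [].
have DlP : dlin al Dl.
  split=> p1 p2; rewrite /Dl ?derivD ?derivM !hornerE ?alE //.
  by rewrite addrC.
have := @germ_tder k N {poly k} (@polyC k) al Dl ga _ DlP _ f.
rewrite (mmap_scale _ (fun i => (z ord0 i)%:P) _ fh) => E.
have zf : mmap (@polyC k) (fun i => (z ord0 i)%:P) f = 0.
  have := fX z Xz; rewrite /zero_at => /(congr1 (@polyC k)); rewrite polyC0 => <-.
  by rewrite -[RHS]/((@polyC k : {rmorphism _ -> _}) _) rmorph_mmap.
transitivity (tder (\row_i al (ga i)) (\row_i Dl (ga i)) f); last first.
  rewrite -E ?zf ?mulr0 ?(dlin0 DlP) // => a; first by rewrite alE hornerC.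
  by rewrite /Dl derivC horner0.
rewrite /tder; apply: eq_bigr => i _; congr (_ * _).
  by rewrite mxE /Dl /ga derivM derivC derivX mulr0 addr0 mul1r hornerC.
by apply: meval_eq => j; rewrite mxE alE hornerM hornerX hornerC mul1r.
Qed.

Local Notation SA := (fun s => map_mx (@mpolyC N k) (invmx (Sf s)^T)).

Lemma eval_E2 (z' : 'rV[k]_N) s : map_mx (meval (z' ord0)) (E2 q SA (@zX k d J) pi s) =
  E2 q (fun s => invmx (Sf s)^T) (zpt z') pi s.
Proof.
rewrite E2_map /E2; congr (_ *: _); first exact: zpt_zX.
have HX s' : Hm (meval (z' ord0) \o @zX k d J) pi s' = Hm (zpt z') pi s'.
  by apply: eq_Hm => c'; apply: zpt_zX.
rewrite !HX; suff -> : map_mx (meval (z' ord0)) (SA s) = invmx (Sf s)^T by [].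
by apply/matrixP => u v; rewrite [LHS]mxE [SA s u v]mxE; apply: mevalC.
Qed.

Section TangentZero.
Variable t : 'rV[k]_N.
Hypothesis (tX : cone_tangent X z t) (t0 : zpt t (cbase J pi) = 0).
Local Notation Dt := (tder z t).
Let ez : {rmorphism A -> k} := meval (z ord0).
Local Notation HX s := (Hm (@zX k d J) pi s).
Local Notation Mt s := (Hm (zpt t) pi s).

Let XD f : (forall z', X z' -> f.@[z' ord0] = 0) -> Dt f = 0.
Proof. exact: (cone_tangentP (@X_cone _ _ _ _ _ _ _ _) tX). Qed.
Let DP : dlin ez Dt := tder_dlin z t.
Let D1 : Dt 1 = 0. Proof. exact: dlin1 DP. Qed.
Let DzX c' : Dt (zX k c') = zpt t c'. Proof. exact: tderX. Qed.
Let ezX c' : ez (zX k c') = zpt z c'. Proof. exact: zpt_zX. Qed.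

Let DH s : map_mx Dt (HX s) = Mt s.
Proof.
apply/matrixP => i j; rewrite mxE Hm_fun ?(dlin0 DP) //.
by congr (fun_of_matrix _ i j); apply: eq_Hm => c'; apply: DzX.
Qed.

Let eH s : map_mx ez (HX s) = kap *: h0 s.
Proof. by rewrite Hm_map -HE; apply: eq_Hm => c'; apply: ezX. Qed.

Lemma tangent_normalized s (i j : 'I_d) : ~~ nz (D s) i j -> Mt s (pi s i) j = 0.
Proof.
move=> nij; pose f : A := zX k (cbase J pi) * (HX s (pi s i) j + (- (i == j)%:R)%:MP * zX k (cbase J pi)).
have /XD : forall z', X z' -> f.@[z' ord0] = 0.
  move=> z' Xz'; have [a [h [a0 hu z'E]]] := X_is_flag b1u b2u Xz'.
  have -> : f.@[z' ord0] = zpt z' (cbase J pi) * (Hm (zpt z') pi s (pi s i) j - (i == j)%:R * zpt z' (cbase J pi)).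
    rewrite /f mevalM mevalD mevalM mevalC mulNr -!zpt_zX; congr (_ * (_ - _)).
    transitivity (map_mx (meval (z' ord0)) (HX s) (pi s i) j); first by rewrite [RHS]mxE.
    by rewrite Hm_map; congr (fun_of_matrix _ _ j); apply: eq_Hm => c'; apply: zpt_zX.
  have [->|nz0] := eqVneq (zpt z' (cbase J pi)) 0; first by rewrite mul0r.
  have [p [pu pP pn _ HE']] := chart_point hu z'E nz0.
  by rewrite HE' mxE pn // [_ * (_ == _)%:R]mulrC subrr mulr0.
rewrite DP.2 DzX t0 mul0r addr0 DP.1 DP.2 DzX t0 tderC mulr0 mul0r !addr0.
have /matrixP/(_ (pi s i) j) := DH s; rewrite mxE => ->; rewrite ezX.
by move/eqP; rewrite mulf_eq0 (negPf z0) => /eqP.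
Qed.

Let nu s := invmx (h0 s) *m Mt s.
Let nuN s : inN (D s) (nu s).
Proof. by apply: normalized_ldiv => //; apply: tangent_normalized. Qed.
Let ME s : h0 s *m nu s = Mt s. Proof. by rewrite mulKVmx. Qed.

(** The equation [E2] is differentiated. The twisted factor consists of [q]-th powers and is
    constant, so only the adjugate contributes; it gives [nu] times [Nk], up to a multiple of [Nk],
    which is in [inZ]. *)
Lemma tangent_commutant s : inZ (D s) (nu s *m Nk q S h0 s).
Proof.
pose KX : 'M[A]_d := SA s *m (fmx q (\adj (HX (~~ s))))^T *m w0 A d.
have DK : map_mx Dt KX = 0.
  have D0 := dlin0 DP.
  have e1 : map_mx Dt (SA s) = 0 by apply/matrixP => u v; rewrite !mxE tderC.
  have e2 : map_mx Dt (fmx q (\adj (HX (~~ s))))^T = 0.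
    by apply/matrixP => u v; rewrite [LHS]mxE [_^T u v]mxE [fmx _ _ _ _]mxE [RHS]mxE (dlin_expq _ DP kq q1).
  have e3 : map_mx Dt (w0 A d) = 0.
    by apply/matrixP => u v; rewrite [LHS]mxE [w0 A d u v]mxE [RHS]mxE; case: (_ == _).
  by rewrite /KX !(dlin_mulmx _ _ DP) e1 e2 e3 !(mulmx0, mul0mx, addr0).
have [e1 e10 adjE] := adj_scale z0 (h0u s).
have [e2 e20 adjE'] := adj_scale z0 (h0u (~~ s)).
have KE : map_mx ez KX = e2 ^+ q *: Cm q (Sf s) (h0 (~~ s)).
  rewrite /KX !map_mxM w0_map -map_trmx fmx_map map_mx_adj eH adjE'.
  have -> : map_mx ez (SA s) = invmx (Sf s)^T.
    by apply/matrixP => u v; rewrite [LHS]mxE [SA s u v]mxE; apply: mevalC.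
  have -> : (fmx q (e2 *: invmx (h0 (~~ s))))^T = e2 ^+ q *: (fmx q (invmx (h0 (~~ s))))^T.
    by apply/matrixP => u v; rewrite !mxE exprMn.
  by rewrite -scalemxAr -scalemxAl.
have DA : map_mx Dt (\adj (HX s)) *m (kap *: h0 s) = (Dt (\det (HX s)))%:M - e1 *: nu s.
  have := dlin_mulmx (\adj (HX s)) (HX s) DP; rewrite mul_adj_mx DH eH map_mx_adj eH adjE.
  have -> : map_mx Dt (\det (HX s))%:M = (Dt (\det (HX s)))%:M :> 'M_d.
    apply/matrixP => u v; rewrite !mxE; case: (u == v) => //.
    by rewrite !mulr0n (dlin0 DP).
  by move=> ->; rewrite -scalemxAl addrC addKr.
set A1 := map_mx Dt (\adj (HX s)) in DA; set e := Dt (\det (HX s)) in DA.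
have A1E : A1 *m Cm q (Sf s) (h0 (~~ s)) = kap^-1 *: (e *: Nk q S h0 s - e1 *: (nu s *m Nk q S h0 s)).
  have -> : A1 = kap^-1 *: ((e%:M - e1 *: nu s) *m invmx (h0 s)).
    by rewrite -DA -scalemxAr -scalemxAl scalerA mulVf // scale1r mulmxK.
  rewrite -scalemxAl -mulmxA -/(Nk q S h0 s) mulmxBl mul_scalar_mx.
  by rewrite -scalemxAl.
move=> i j nij.
have /XD : forall z', X z' -> (E2 q SA (@zX k d J) pi s i j).@[z' ord0] = 0.
  move=> z' /XF fz'; have /matrixP/(_ i j) := eval_E2 z' s; rewrite mxE => ->.
  exact: (frame_E2 kq q1 Su b1u b2u l_gt0 lHd Om_bd Om_min D1P D2P).
have -> : E2 q SA (@zX k d J) pi s = zX k (cbase J pi) *: (\adj (HX s) *m KX).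
  by rewrite /E2 /KX !mulmxA.
rewrite [X in Dt X]mxE DP.2 DzX t0 mul0r addr0 ezX.
have -> : Dt ((\adj (HX s) *m KX) i j) = (A1 *m map_mx ez KX) i j.
  transitivity (map_mx Dt (\adj (HX s) *m KX) i j); first by rewrite [RHS]mxE.
  by rewrite (dlin_mulmx _ _ DP) DK mulmx0 add0r.
rewrite KE -scalemxAr A1E scalerA mxE mulrA => /eqP.
rewrite mulf_eq0 !mulf_eq0 invr_eq0 expf_eq0 (negPf z0) (negPf e20) andbF /=.
rewrite mxE mxE (h0Z nij) mulr0 add0r mxE oppr_eq0 mxE mulf_eq0 (negPf e10) /=.
by move/eqP.
Qed.

Hypothesis tlam : forall s (f : 'I_(dim s)), lamz idfun f (Mt s) = 0.

(** The coordinates determine [nu], so [Mt] vanishes. Every other coordinate is expressed through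
    [Hm] by [E1], whose derivative then forces [t = 0]. *)
Lemma tangent_zero : t = 0.
Proof.
have M0 s : Mt s = 0.
  rewrite -ME (c_span (@nuN s) (tangent_commutant (s := s))) big1 ?mulmx0 // => f _.
  by rewrite ME tlam scale0r.
have D0 := dlin0 DP.
apply/rowP => i; rewrite mxE -[i]enum_valK -[t ord0 _]/(zpt t (enum_val i)).
move: (enum_val i) => c'.
have /XD : forall z', X z' -> (E1 (@zX k d J) pi c').@[z' ord0] = 0.
  move=> z' Xz'; have fz' := X_is_flag b1u b2u Xz'.
  rewrite -[meval _ _]/((meval (z' ord0) : {rmorphism A -> k}) _) E1_map.
  rewrite -[RHS](E1_flag pi c' fz'); congr (E1 _ pi c'); apply: funext; exact: zpt_zX.
rewrite /E1 DP.2 DzX t0 mul0r addr0 ezX => /eqP; rewrite mulf_eq0 (negPf z0) /=.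
have DM f g : Dt f = 0 -> Dt g = 0 -> Dt (f * g) = 0.
  by move=> f0 g0; rewrite DP.2 f0 g0 mulr0 mul0r addr0.
have -> f g : Dt (f - g) = Dt f - Dt g.
  by have := DP.1 (f - g) g; rewrite subrK => ->; rewrite addrK.
rewrite [Dt (zX k (cbase J pi) * _)]DM ?subr0; last 2 first.
- by rewrite DzX.
- apply: dlin_kills_fp DP D1 _ => s u v.
  by have /matrixP/(_ u v) := DH s; rewrite M0 !mxE.
rewrite DP.2 DzX (dlin_exp_eq0 _ DP D1) ?mulr0 ?add0r; last by rewrite DzX.
rewrite rmorphXn /= ezX mulf_eq0 expf_eq0 (negPf z0) andbF orbF.
by move/eqP.
Qed.

End TangentZero.

(** This is [(d - l) + (d - l0)] with [l0 = d + 1 - (l + H)]. *)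
Lemma card_V : #|{: V}| = (d.-1 + H)%N.
Proof.
rewrite card_tagged sumnE big_map big_enum /= big_bool /= !card_ord.
by rewrite (nxt_min true) (nxt_min false) /=; lia.
Qed.

(** Germs in one coordinate give tangent vectors dual to the coordinates, and [z] adds the direction
    of the cone. Subtracting their combination from any tangent vector leaves one to which
    [tangent_zero] applies. *)
Lemma X_smooth_at : local_dim X z (d.-1 + H) /\
  exists2 T : 'M[k]_N, \rank T = (d.-1 + H).+1 & forall t, (t <= T)%MS <-> cone_tangent X z t.
Proof.
split.
  split.
    have [ch [R [iota [al [h [_ Hch chz _]]]]]] := germ_chain (enum_uniq {: V}).
    by exists ch => //; move: Hch; rewrite -cardE card_V.
  move=> r' ch Hch _; apply: (X_chain_le kq q1 Su SS b1u b2u bb orth l_gt0 lHd Om_bd Om_min Om_max D1P D2P Hch).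
have /choice[tv tvP] : forall v : V, exists t, [/\ cone_tangent X z t, zpt t (cbase J pi) = 0 &
    forall s (f : 'I_(dim s)), lamz idfun f (Hm (zpt t) pi s) = kap * (existT _ s f == v)%:R].
  move=> v; have [h' G' _] := germ_cons germ_nil (isT : v \notin [::]).
  exact: (tangent_of_germ (iota := [the {rmorphism k -> pser k} of @ps_const k \o idfun])
    (al := [the {rmorphism pser k -> k} of idfun \o @ps_coef0 k]) G' (mem_head _ _)).
pose T0 : 'M[k]_(1 + #|{: V}|, N) := col_mx z (\matrix_i tv (enum_val i)).
have mulT0 (u : 'rV_(1 + #|{: V}|)) : u *m T0 = lsubmx u ord0 ord0 *: z + \sum_i rsubmx u ord0 i *: tv (enum_val i).
  rewrite -[u in LHS]hsubmxK mul_row_col; congr (_ + _).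
    by rewrite [lsubmx u in LHS]mx11_scalar mul_scalar_mx.
  by rewrite mulmx_sum_row; apply: eq_bigr => i _; rewrite rowK.
have zptD (t1 t2 : 'rV[k]_N) c' : zpt (t1 + t2) c' = zpt t1 c' + zpt t2 c' by rewrite /zpt mxE.
have zptZ a (t1 : 'rV[k]_N) c' : zpt (a *: t1) c' = a * zpt t1 c' by rewrite /zpt mxE.
have zpt0 c' : zpt (0 : 'rV[k]_N) c' = 0 by rewrite /zpt mxE.
have lamE s (f : 'I_(dim s)) : linear (fun t : 'rV[k]_N => lamz idfun f (Hm (zpt t) pi s) : k^o).
  move=> a t1 t2; rewrite /lam scaler_sumr -big_split; apply: eq_bigr => i _ /=.
  rewrite scaler_sumr -big_split; apply: eq_bigr => j _ /=; rewrite !mxE !zptD !zptZ -!/(_ * _).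
  by case: ifP => _; rewrite /GRing.scale /=; ring.
have [lf lfE] : exists lf : forall s, 'I_(dim s) -> {linear 'rV[k]_N -> k^o},
    forall s f t, lf s f t = lamz idfun f (Hm (zpt t) pi s).
  pose lf s f : {linear 'rV[k]_N -> k^o} := HB.pack (fun t : 'rV[k]_N => lamz idfun f (Hm (zpt t) pi s) : k^o)
    (GRing.isLinear.Build _ _ _ _ _ (lamE s f)).
  by exists lf.
have sum_c0 (u : 'I_#|{: V}| -> k) : zpt (\sum_i u i *: tv (enum_val i)) (cbase J pi) = 0.
  rewrite /zpt summxE big1 // => i _; rewrite mxE -[tv _ _ _]/(zpt _ (cbase J pi)).
  by have [_ -> _] := tvP (enum_val i); rewrite mulr0.
have sum_lf (u : 'I_#|{: V}| -> k) s f : lf s f (\sum_i u i *: tv (enum_val i)) = kap * u (enum_rank (existT _ s f)).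
  rewrite linear_sum (bigD1 (enum_rank (existT _ s f))) //= big1 ?addr0 => [|i ni].
    by rewrite linearZ /= lfE enum_rankK; have [_ _ ->] := tvP (existT _ s f); rewrite eqxx mulr1 [_ *: _]mulrC.
  rewrite linearZ /= lfE; have [_ _ ->] := tvP (enum_val i).
  rewrite -[existT _ s f]enum_rankK (inj_eq enum_val_inj) eq_sym (negPf ni).
  by rewrite mulr0 scaler0.
have T0f : row_free T0.
  apply: inj_row_free => u; rewrite mulT0 => E.
  have u0 : lsubmx u ord0 ord0 = 0.
    have := congr1 (fun t => zpt t (cbase J pi)) E; rewrite zptD zptZ sum_c0 zpt0 addr0.
    by move/eqP; rewrite mulf_eq0 (negPf z0) orbF => /eqP.
  rewrite u0 scale0r add0r in E.
  rewrite -[u]hsubmxK [lsubmx u]mx11_scalar u0; suff -> : rsubmx u = 0.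
    by rewrite -scalemx1 scale0r row_mx0.
  apply/rowP => i; rewrite [RHS]mxE; have := sum_lf (fun i => rsubmx u ord0 i) (tag (enum_val i)) (tagged (enum_val i)).
  rewrite E linear0 -[existT _ _ _]/(Tagged _ _) taggedK enum_valK => /esym/eqP.
  by rewrite mulf_eq0 (negPf z0) => /eqP.
exists <<T0>>%MS; first by rewrite genmxE (eqP T0f) card_V.
move=> t; rewrite genmxE; split=> [/submxP[u ->]|tX].
  rewrite mulT0 => f fX.
  have E (t' : 'rV[k]_N) : \sum_(i < N) t' ord0 i * (f^`M(i)).@[z ord0] = (t' *m \col_i (f^`M(i)).@[z ord0]) ord0 ord0.
    by rewrite mxE; apply: eq_bigr => i _; rewrite mxE.
  have E0 (t' : 'rV[k]_N) : cone_tangent X z t' -> t' *m \col_i (f^`M(i)).@[z ord0] = 0.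
    by move=> /(_ f fX); rewrite E => E0; apply/matrixP => a a'; rewrite !ord1 E0 mxE.
  rewrite E mulmxDl -scalemxAl (E0 _ tangent_self) mulmx_suml big1 ?scaler0 ?addr0 ?mxE // => i _.
  by rewrite -scalemxAl E0 ?scaler0 //; have [] := tvP (enum_val i).
pose a := zpt t (cbase J pi) / kap.
pose u (i : 'I_#|{: V}|) := lf (tag (enum_val i)) (tagged (enum_val i)) (t - a *: z) / kap.
have tE : t = a *: z + \sum_i u i *: tv (enum_val i).
  apply/eqP; rewrite -subr_eq0; apply/eqP; apply: tangent_zero.
  - move=> f fX; have := tX f fX.
    have E (t' : 'rV[k]_N) : \sum_(i < N) t' ord0 i * (f^`M(i)).@[z ord0] = (t' *m \col_i (f^`M(i)).@[z ord0]) ord0 ord0.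
      by rewrite mxE; apply: eq_bigr => i _; rewrite mxE.
    have E0 (t' : 'rV[k]_N) : cone_tangent X z t' -> t' *m \col_i (f^`M(i)).@[z ord0] = 0.
      by move=> /(_ f fX); rewrite E => E0; apply/matrixP => i i'; rewrite !ord1 E0 mxE.
    rewrite !E mulmxBl mulmxDl -scalemxAl (E0 _ tangent_self) (E0 _ tX) mulmx_suml big1 ?scaler0 ?addr0 ?subr0 ?mxE // => i _.
    by rewrite -scalemxAl E0 ?scaler0 //; have [] := tvP (enum_val i).
  - by rewrite -scaleN1r zptD zptZ zptD zptZ sum_c0 addr0 /a divfK // mulN1r subrr.
  - move=> s f; rewrite -lfE opprD addrA linearB sum_lf /= /u enum_rankK /=.
    by rewrite mulrC divfK // subrr.
apply/submxP; exists (row_mx a%:M (\row_i u i)).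
rewrite mulT0 row_mxKl row_mxKr [a%:M _ _]mxE mulr1n [LHS]tE; congr (_ + _).
by apply: eq_bigr => i _; rewrite [(\row_i u i) _ _]mxE.
Qed.

End AtPoint.

Theorem X_local z : X z -> local_dim X z (d.-1 + H) /\
  exists2 T : 'M[k]_N, \rank T = (d.-1 + H).+1 & forall t, (t <= T)%MS <-> cone_tangent X z t.
Proof.
move=> Xz; have [pi [g [z0 [gu gZ] gn zE HE]]] := X_chart kq q1 Su b1u b2u bb orth l_gt0 lHd Om_bd Om_min D1P D2P Xz.
have Dd s x : x \in D s -> (x < d)%N by move=> /dseq_lt/andP[].
have Nu s : Nk q S g s \in unitmx.
  by rewrite /Nk unitmx_mul unitmx_inv gu Cm_unit // Sf_unit.
have CB s := commutant_basis d0 (@Dd s) (Nu s) (gZ s) (gu s).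
pose c s := projT1 (cid (CB s)); have cP s := projT2 (cid (CB s)).
pose Lam s := projT1 (cid (cP s)); have LamP s := projT2 (cid (cP s)).
apply: (@X_smooth_at z pi g Xz z0 gu gZ gn zE HE c Lam).
- by move=> s e; have [cN _ _ _] := LamP s; apply: cN.
- by move=> s e; have [_ cZ _ _] := LamP s; apply: cZ.
- by move=> s f e; have [_ _ cL _] := LamP s; apply: cL.
- by move=> s nu nuN nuZ; have [_ _ _ cS] := LamP s; apply: cS.
Qed.

Theorem X_smooth : proj_smooth X.
Proof. by move=> z /X_local[Xd XT]; exists (d.-1 + H)%N. Qed.

Theorem X_dim : krull_dim X (d.-1 + H).
Proof.
split=> [|r' ch]; last exact: (X_chain_le kq q1 Su SS b1u b2u bb orth l_gt0 lHd Om_bd Om_min Om_max D1P D2P).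
have [[z Xz] _] := X_irreducible kq q1 Su SS b1u b2u bb orth l_gt0 lHd Om_bd Om_min Om_max D1P D2P.
by have [[[ch Hch _] _] _] := X_local Xz; exists ch.
Qed.

End Smoothness.

(** A matrix of maximal rank among those with row space inside [W] has [W] as row space. *)
Lemma subspace_mx (k : fieldType) m (W : 'rV[k]_m -> Prop) :
  W 0 -> (forall u v, W u -> W v -> W (u + v)) -> (forall a u, W u -> W (a *: u)) ->
  exists A : 'M[k]_m, forall v, W v <-> (v <= A)%MS.
Proof.
move=> W0 WD WZ; pose P r := `[< exists2 A : 'M[k]_m, \rank A = r & forall v, (v <= A)%MS -> W v >].
have P0 : exists r, P r.
  exists 0%N; apply/asboolP; exists 0; first exact: mxrank0.
  by move=> v; rewrite submx0 => /eqP->.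
have Pm r : P r -> (r <= m)%N by move/asboolP => [A <- _]; apply: rank_leq_row.
have [r /asboolP[A rA AW] rmax] := ex_maxnP P0 Pm.
exists A => v; split=> [Wv|/AW//]; apply: contraT => nv.
have : P (\rank (A + v)%MS).
  apply/asboolP; exists (A + v)%MS => // u /sub_addsmxP[[u1 u2] /= ->].
  apply: WD; first by apply: AW; apply: submxMl.
  by rewrite [u2]mx11_scalar mul_scalar_mx; apply: WZ.
move/rmax; rewrite leqNgt -rA => /negP[]; apply: rank_ltmx; rewrite /ltmx addsmxSl.
by rewrite addsmx_sub submx_refl.
Qed.

(** * Vertex lattices *)

Section LatticeQuotients.
Variables (E : fieldType) (v : E -> int) (C : vectType E) (k : fieldType) (r : E -> k).
Hypothesis (dv : discrete_valuation v) (rm : residue_map v r).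
Implicit Types (L M P : C -> Prop) (x y : C).

Lemma dv_mulE (a b : E) : a != 0 -> b != 0 -> v (a * b) = v a + v b.
Proof. exact: (dv_mul dv). Qed.

Lemma dv_one : v 1 = 0.
Proof. by have := dv_mulE (oner_neq0 E) (oner_neq0 E); rewrite mulr1 => e; apply: (addrI (v 1)); rewrite addr0. Qed.

Lemma dv_opp1 : v (-1) = 0.
Proof.
have n1 : (-1 : E) != 0 by rewrite oppr_eq0 oner_neq0.
by have := dv_mulE n1 n1; rewrite mulrNN mulr1 dv_one; move: (v _) => w; lia.
Qed.

Lemma val_ge0 m : val_ge v m 0. Proof. by rewrite /val_ge eqxx. Qed.

Lemma val_geM m n (a b : E) : val_ge v m a -> val_ge v n b -> val_ge v (m + n) (a * b).
Proof.
rewrite /val_ge mulf_eq0; have [->|a0] := eqVneq a 0; have [->|b0] := eqVneq b 0 => //=.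
by rewrite dv_mulE //; lia.
Qed.

Lemma val_geD m (a b : E) : val_ge v m a -> val_ge v m b -> val_ge v m (a + b).
Proof.
rewrite /val_ge; have [->|a0] := eqVneq a 0; first by rewrite add0r.
have [->|b0] := eqVneq b 0; first by rewrite addr0 (negPf a0).
have [//|ab0] := eqVneq (a + b) 0; have := dv_add dv a0 b0 ab0.
by move=> H /= Ha Hb; apply: le_trans H; rewrite le_min Ha Hb.
Qed.

Lemma val_geN m (a : E) : val_ge v m a -> val_ge v m (- a).
Proof.
move=> am; rewrite -mulN1r -[m]add0r; apply: val_geM am.
by rewrite /val_ge dv_opp1 lexx orbT.
Qed.

Lemma val_ge_sum m (I : Type) (s : seq I) (F : I -> E) :
  (forall i, val_ge v m (F i)) -> val_ge v m (\sum_(i <- s) F i).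
Proof.
move=> H; apply: (big_ind (val_ge v m)) => //; first exact: val_ge0.
by move=> a b; apply: val_geD.
Qed.

Lemma integral1 : integral v 1. Proof. by rewrite /integral /val_ge dv_one lexx orbT. Qed.

Lemma val_ge_weak m n (a : E) : (n <= m) -> val_ge v m a -> val_ge v n a.
Proof. by rewrite /val_ge; case: (a == 0) => //=; lia. Qed.

Lemma integralM (a b : E) : integral v a -> integral v b -> integral v (a * b).
Proof. by rewrite -[integral v (a * b)]/(val_ge v (0 + 0) _); apply: val_geM. Qed.

Lemma rm0 : r 0 = 0.
Proof. by apply: (addrI (r 0)); rewrite -(rm_add rm) ?addr0 //; apply: val_ge0. Qed.

Lemma rm_sum (I : Type) (s : seq I) (F : I -> E) : (forall i, integral v (F i)) ->
  r (\sum_(i <- s) F i) = \sum_(i <- s) r (F i).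
Proof.
move=> H; elim: s => [|i s IH]; first by rewrite !big_nil rm0.
by rewrite !big_cons (rm_add rm) ?IH //; apply: val_ge_sum.
Qed.

Lemma rm_nat n : r n%:R = n%:R.
Proof.
have nI i : integral v i%:R.
  elim: i => [|i IH]; first exact: val_ge0.
  by rewrite -natr1; apply: val_geD => //; apply: integral1.
elim: n => [|n IH]; first exact: rm0.
by rewrite -!natr1 (rm_add rm) ?(rm_one rm) ?IH //; apply: integral1.
Qed.

Lemma rm_exp (a : E) n : integral v a -> integral v (a ^+ n) /\ r (a ^+ n) = r a ^+ n.
Proof.
move=> aI; elim: n => [|n [I1 I2]]; first by rewrite !expr0 (rm_one rm); split=> //; apply: integral1.
by rewrite !exprS (rm_mul rm) // I2; split=> //; apply: integralM.
Qed.

Lemma rm_lift (a : k) : {b : E | integral v b & r b = a}.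
Proof. by have /cid2 := rm_surj rm a. Qed.

Definition has_dim M L m := exists rho : C -> 'cV[k]_m, quot_map v r M L rho.

Lemma submodule_sum L (I : Type) (s : seq I) (F : I -> C) : submodule v L ->
  (forall i, L (F i)) -> L (\sum_(i <- s) F i).
Proof. by move=> [L0 LD _] H; apply: (big_ind L). Qed.

Section QuotMap.
Variables (M L : C -> Prop) (m : nat) (rho : C -> 'cV[k]_m).
Hypothesis (q : quot_map v r M L rho) (Lsub : submodule v L).

Let L0 : L 0. Proof. by case: Lsub. Qed.

Lemma quot_map0 : rho 0 = 0.
Proof. by apply: (addrI (rho 0)); rewrite -(qm_add q) ?addr0. Qed.

Lemma quot_map_comb n (a : 'I_n -> E) (x : 'I_n -> C) : (forall i, integral v (a i)) ->
  (forall i, L (x i)) -> L (\sum_i a i *: x i) /\ rho (\sum_i a i *: x i) = \sum_i r (a i) *: rho (x i).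
Proof.
move=> aI xL; have [_ LD LZ] := Lsub.
have axL i : L (a i *: x i) by apply: LZ.
split; first exact: submodule_sum.
have H (s : seq 'I_n) : rho (\sum_(i <- s) a i *: x i) = \sum_(i <- s) r (a i) *: rho (x i).
  elim: s => [|i s IH]; first by rewrite !big_nil quot_map0.
  by rewrite !big_cons (qm_add q) ?IH ?(qm_scale q) //; apply: submodule_sum.
exact: H.
Qed.

Lemma quot_map_frame : {e : 'I_m -> C | (forall i, L (e i)) & forall i, rho (e i) = delta_mx i ord0}.
Proof.
have /choice[e eP] : forall i : 'I_m, exists x, L x /\ rho x = delta_mx i ord0.
  by move=> i; have [x Lx xE] := qm_surj q (delta_mx i ord0); exists x.
by exists e => i; have [] := eP i.
Qed.

End QuotMap.

Lemma kernel_vector a b (Pm : 'M[k]_(a, b)) : (b < a)%N -> exists2 u : 'rV[k]_a, u != 0 & u *m Pm = 0.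
Proof.
move=> ba; have K0 : kermx Pm != 0.
  by rewrite -mxrank_eq0 mxrank_ker subn_eq0 -ltnNge; apply: leq_ltn_trans (rank_leq_col _) ba.
have /rowV0Pn[u uK u0] := K0.
by exists u => //; apply/sub_kermxP.
Qed.

Lemma has_dim_le M L a b : submodule v L -> has_dim M L a -> has_dim M L b -> (a <= b)%N.
Proof.
move=> Ls [f qf] [g qg]; rewrite leqNgt; apply/negP => ba.
have [e eL eE] := quot_map_frame qf.
have [u u0 uE] := kernel_vector (\matrix_(i < a) (g (e i))^T) ba.
pose c i := s2val (rm_lift (u ord0 i)).
have cI i : integral v (c i) := s2valP (rm_lift (u ord0 i)).
have cE i : r (c i) = u ord0 i := s2valP' (rm_lift (u ord0 i)).
have [xL fx] := quot_map_comb qf Ls cI eL; have [_ gx] := quot_map_comb qg Ls cI eL.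
case/negP: u0; apply/eqP; have g0 : g (\sum_i c i *: e i) = 0.
  rewrite gx; apply: trmx_inj; rewrite trmx0 -[RHS]uE mulmx_sum_row linear_sum /=.
  by apply: eq_bigr => i _; rewrite linearZ /= cE rowK.
have /(qm_ker qf xL) := (qm_ker qg xL).1 g0; rewrite fx => /matrixP f0.
apply/rowP => i; have := f0 i ord0; rewrite summxE (bigD1 i) //= big1 => [|j ji].
  by rewrite cE eE !mxE !eqxx mulr1 addr0.
by rewrite eE !mxE eq_sym (negPf ji) mulr0.
Qed.

Lemma has_dim_uniq M L a b : submodule v L -> has_dim M L a -> has_dim M L b -> a = b.
Proof. by move=> Ls A B; apply/eqP; rewrite eqn_leq !(@has_dim_le M L). Qed.

Lemma has_dim_same M M' L L' m : same M M' -> same L L' -> has_dim M L m -> has_dim M' L' m.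
Proof.
move=> MM LL [f [H1 H2 H3 H4 H5]]; exists f; split.
- by move=> x /MM /H1 /LL.
- by move=> x y /LL Lx /LL Ly; apply: H2.
- by move=> a x aI /LL Lx; apply: H3.
- by move=> y; have [x /LL Lx xE] := H4 y; exists x.
- by move=> x /LL Lx; split=> [/H5-/(_ Lx)/MM|/MM/H5] //; apply.
Qed.

(** The image of [P] in [k^m] is the row space of some [A]; the two quotients are read through a row
    basis of [A] and through its cokernel. *)
Lemma has_dim_split M P L m : submodule v L -> submodule v P -> incl M P -> incl P L -> has_dim M L m ->
  exists a b, [/\ (a + b = m)%N, has_dim M P a & has_dim P L b].
Proof.
move=> Ls Ps MP PL [f q].
pose W (u : 'rV[k]_m) := exists2 x, P x & (f x)^T = u.
have [P0 PD PZ] := Ps; have [_ LD LZ] := Ls.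
have [|||A AW] := @subspace_mx k m W.
- by exists 0 => //; rewrite (quot_map0 q Ls) trmx0.
- move=> _ _ [x Px <-] [y Py <-]; exists (x + y); first exact: PD.
  by rewrite (qm_add q) ?linearD //; apply: PL.
- move=> a u [x Px <-]; have [c cI <-] := rm_surj rm a; exists (c *: x); first exact: PZ.
  by rewrite (qm_scale q) ?linearZ //; apply: PL.
exists (\rank A), (\rank (cokermx A)); split.
- by rewrite mxrank_coker addnC subnK // rank_leq_row.
- exists (fun x => ((f x)^T *m pinvmx (row_base A))^T); split=> //.
  + by move=> x y Px Py; rewrite (qm_add q) ?linearD /= ?mulmxDl ?linearD //; apply: PL.
  + by move=> a x aI Px; rewrite (qm_scale q) ?linearZ /= -?scalemxAl ?linearZ //; apply: PL.
  + move=> y; have /AW[x Px xE] : (y^T *m row_base A <= A)%MS.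
      by rewrite (submx_trans (submxMl _ _)) // eq_row_base.
    exists x => //; rewrite xE -mulmxA mulmxVp ?row_base_free // mulmx1 trmxK.
    by [].
  + move=> x Px; split=> [/(congr1 trmx)|/(qm_ker q (PL x Px))->]; last by rewrite trmx0 mul0mx trmx0.
    rewrite trmxK trmx0 => E0; apply/(qm_ker q (PL x Px)); apply: trmx_inj; rewrite trmx0.
    have xA : ((f x)^T <= row_base A)%MS by rewrite eq_row_base; apply/AW; exists x.
    by rewrite -(mulmxKpV xA) E0 mul0mx.
exists (fun x => ((f x)^T *m col_base (cokermx A))^T); split=> //.
- by move=> x y Lx Ly; rewrite (qm_add q) ?linearD /= ?mulmxDl ?linearD.
- by move=> a x aI Lx; rewrite (qm_scale q) ?linearZ /= -?scalemxAl ?linearZ.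
- move=> y; have /submxP[w wE] : (y^T <= col_base (cokermx A))%MS by rewrite submx_full ?col_base_full.
  by have [x Lx xE] := qm_surj q w^T; exists x => //; rewrite xE trmxK -wE trmxK.
move=> x Lx; have H : P x <-> (f x)^T *m cokermx A = 0.
  split=> [Px|/eqP]; first by apply/eqP; rewrite -submxE; apply/AW; exists x.
  rewrite -submxE => /AW[y Py yE]; have Ly := PL y Py.
  have xyL : L (x - y) by rewrite -scaleN1r; apply: LD => //; apply: LZ => //; apply: val_geN; apply: integral1.
  have : M (x - y).
    apply/(qm_ker q xyL); have := qm_add q xyL Ly; rewrite subrK (trmx_inj yE) => h.
    by apply: (addIr (f x)); rewrite add0r -h.
  by move/MP => /PD/(_ Py); rewrite subrK.
have HM : (f x)^T *m cokermx A = (f x)^T *m col_base (cokermx A) *m row_base (cokermx A).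
  by rewrite -mulmxA mulmx_base.
rewrite H HM; split=> [/(congr1 trmx)|E0].
  by rewrite trmxK trmx0 => ->; rewrite mul0mx.
have /row_freeP[X XE] := row_base_free (cokermx A).
by rewrite -[_ *m col_base _]mulmx1 -XE mulmxA E0 mul0mx trmx0.
Qed.

Lemma has_dim_scale c M L m : c != 0 -> has_dim M L m -> has_dim (scale c M) (scale c L) m.
Proof.
move=> c0 [f q]; exists (fun x => f (c^-1 *: x)); have cK y : c^-1 *: (c *: y) = y.
  by rewrite scalerA mulVf // scale1r.
split.
- by move=> _ [y My ->]; exists y => //; apply: (qm_incl q).
- by move=> _ _ [x Lx ->] [y Ly ->]; rewrite scalerDr !cK (qm_add q).
- by move=> a _ aI [x Lx ->]; rewrite scalerA mulrC -scalerA !cK (qm_scale q).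
- by move=> y; have [x Lx xE] := qm_surj q y; exists (c *: x); [exists x | rewrite cK].
move=> _ [x Lx ->]; rewrite cK (qm_ker q Lx); split=> [Mx|[y My /(congr1 (fun z => c^-1 *: z))]].
  by exists x.
by rewrite !cK => ->.
Qed.

(** Each simple step has dimension one: with two coordinates, the vanishing of the first would
    define a submodule strictly between. *)
Lemma has_dim_length M L m t : submodule v L -> has_dim M L m -> quot_length v M L t -> t = m.
Proof.
move=> Ls Lm [c [c0 ct cs cstep]].
have cinc i j : (i <= j)%N -> (j <= t)%N -> incl (c i) (c j).
  elim: j => [|j IH]; first by rewrite leqn0 => /eqP-> _ x.
  rewrite leq_eqVlt => /orP[/eqP->|ij] jt x cx; first by [].
  by have [H _ _] := cstep j jt; apply: H; apply: IH cx => //; apply: ltnW.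
have [f q] := Lm.
have Mc i : (i <= t)%N -> incl M (c i).
  by move=> it x /c0 cx; apply: cinc cx.
have cL i : (i <= t)%N -> incl (c i) L by move=> it x cx; apply/ct; apply: cinc cx.
have ind i : (i <= t)%N -> has_dim M (c i) i.
  elim: i => [_|i IH it].
    exists (fun=> 0); split=> //; first by move=> x; apply: Mc.
    - by move=> x y _ _; rewrite addr0.
    - by move=> a x _ _; rewrite scaler0.
    - by move=> y; exists 0; [have [] := cs 0%N isT | apply/matrixP => -[]].
    - by move=> x /c0.
  have IHi := IH (ltnW it).
  have [m' [_ [_ Hm' _]]] := has_dim_split Ls (cs i.+1 it) (Mc i.+1 it) (cL i.+1 it) Lm.
  have [inc ninc simp] := cstep i it.
  have [a [e [ae Ha [g qg]]]] := has_dim_split (cs i.+1 it) (cs i (ltnW it)) (Mc i (ltnW it)) inc Hm'.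
  have ia := has_dim_uniq (cs i (ltnW it)) IHi Ha.
  suff e1 : e = 1%N by move: Hm'; rewrite -ae -ia e1 addn1.
  clear ia.
  case: e g qg ae => [|[|e]] g qg ae //.
    case: ninc => x cx; apply/(qm_ker qg cx); by apply/matrixP => -[].
  pose P x := c i.+1 x /\ g x ord0 ord0 = 0.
  have [cD0 cDD cDZ] := cs i.+1 it.
  have Ps : submodule v P.
    split; first by split=> //; rewrite (quot_map0 qg (cs i.+1 it)) mxE.
    - by move=> x y [cx gx] [cy gy]; split; [exact: cDD | rewrite (qm_add qg) // mxE gx gy addr0].
    - by move=> b x bI [cx gx]; split; [exact: cDZ | rewrite (qm_scale qg) // mxE gx mulr0].
  have [||S|S] := simp P Ps.
  - by move=> x cx; split; [exact: inc | have -> := (qm_ker qg (inc x cx)).2 cx; rewrite mxE].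
  - by move=> x [].
  - have [x cx xE] := qm_surj qg (delta_mx (lift ord0 ord0) ord0).
    have /S/(qm_ker qg cx) : P x by split=> //; rewrite xE mxE.
    by rewrite xE => /matrixP/(_ (lift ord0 ord0) ord0); rewrite !mxE !eqxx => /eqP; rewrite oner_eq0.
  have [x cx xE] := qm_surj qg (delta_mx ord0 ord0).
  have [_] := (S x).2 cx; rewrite xE mxE !eqxx => /eqP; by rewrite oner_eq0.
have Lt : has_dim M L t by apply: has_dim_same ct (ind t (leqnn t)).
exact: has_dim_uniq Ls Lt Lm.
Qed.

End LatticeQuotients.

Section HermitianLattices.
Variables (E : fieldType) (v : E -> int) (conj : {rmorphism E -> E}) (C : vectType E).
Variables (form : C -> C -> E) (k : fieldType) (r : E -> k) (pi : E).
Hypothesis (dv : discrete_valuation v) (rm : residue_map v r).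
Hypothesis (conj_v : forall a, a != 0 -> v (conj a) = v a) (conjK : involutive conj).
Hypothesis hf : hermitian_form conj form.
Hypothesis (pi0 : pi != 0) (vpi : v pi = 1) (conj_pi : conj pi = pi).
Local Notation has_dim := (@has_dim E v C k r).
Local Notation dl := (dual v form).
Implicit Types (L M : C -> Prop) (x y : C).

Lemma formDl x y z : form (x + y) z = form x z + form y z.
Proof. by rewrite -[x]scale1r (hf_linear hf) mul1r scale1r. Qed.

Lemma form0l z : form 0 z = 0.
Proof. by apply: (addrI (form 0 z)); rewrite -formDl !addr0. Qed.

Lemma formZl a x z : form (a *: x) z = a * form x z.
Proof. by rewrite -[a *: x]addr0 (hf_linear hf) form0l addr0. Qed.

Lemma formDr x y z : form z (x + y) = form z x + form z y.
Proof. by rewrite (hf_conj hf) formDl rmorphD -!(hf_conj hf). Qed.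

Lemma formZr a x z : form z (a *: x) = conj a * form z x.
Proof. by rewrite (hf_conj hf) formZl rmorphM -(hf_conj hf). Qed.

Lemma form0r z : form z 0 = 0.
Proof. by rewrite (hf_conj hf) form0l rmorph0. Qed.

Lemma form_suml (I : Type) (s : seq I) (F : I -> C) z : form (\sum_(i <- s) F i) z = \sum_(i <- s) form (F i) z.
Proof. exact: (big_morph (fun x => form x z) (fun x y => formDl x y z) (form0l z)). Qed.

Lemma form_sumr (I : Type) (s : seq I) (F : I -> C) z : form z (\sum_(i <- s) F i) = \sum_(i <- s) form z (F i).
Proof. exact: (big_morph (form z) (fun x y => formDr x y z) (form0r z)). Qed.

Lemma val_ge_conj m a : val_ge v m (conj a) = val_ge v m a.
Proof. by rewrite /val_ge fmorph_eq0; have [//|a0] := eqVneq a 0; rewrite conj_v. Qed.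

Lemma val_ge_form m x y : val_ge v m (form y x) = val_ge v m (form x y).
Proof. by rewrite (hf_conj hf) val_ge_conj. Qed.

Lemma val_ge_pi : val_ge v 1 pi. Proof. by rewrite /val_ge vpi lexx orbT. Qed.

Lemma val_ge_piV : val_ge v (-1) pi^-1.
Proof.
rewrite /val_ge invr_eq0 (negPf pi0) /=.
have := dv_mulE dv pi0 (invr_neq0 pi0); rewrite mulfV // (dv_one dv) vpi.
by move: (v pi^-1) => w; lia.
Qed.

Lemma scaleP c L x : c != 0 -> scale c L x <-> L (c^-1 *: x).
Proof.
move=> c0; split=> [[y Ly ->]|Lx]; first by rewrite scalerA mulVf // scale1r.
by exists (c^-1 *: x) => //; rewrite scalerA mulfV // scale1r.
Qed.

Lemma lattice_submodule L : lattice v L -> submodule v L.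
Proof.
move=> [b _ LP]; split.
- by apply/LP => i; rewrite linear0; apply: val_ge0.
- by move=> x y /LP Lx /LP Ly; apply/LP => i; rewrite linearD; apply: (val_geD dv); [exact: Lx | exact: Ly].
- by move=> a x aI /LP Lx; apply/LP => i; rewrite linearZ; apply: (integralM dv) => //; apply: Lx.
Qed.

Lemma dual_submodule L : submodule v (dl L).
Proof.
split.
- by move=> y _; rewrite form0l; apply: val_ge0.
- by move=> x y Lx Ly z Lz; rewrite formDl; apply: val_geD; [|exact: Lx|exact: Ly].
- by move=> a x aI Lx z Lz; rewrite formZl; apply: integralM => //; apply: Lx.
Qed.

Lemma scale_submodule c L : submodule v L -> submodule v (scale c L).
Proof.
move=> [L0 LD LZ]; split.
- by exists 0; rewrite ?scaler0.
- by move=> _ _ [x Lx ->] [y Ly ->]; exists (x + y); [exact: LD | rewrite scalerDr].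
- by move=> a _ aI [x Lx ->]; exists (a *: x); [exact: LZ | rewrite !scalerA mulrC].
Qed.

Lemma has_dim_lattice L : lattice v L -> has_dim (scale pi L) L (\dim {:C}).
Proof.
move=> Ll; have [b bP LP] := Ll; have [_ LD LZ] := lattice_submodule Ll.
have bf := basis_free bP.
have xE x : x = \sum_i coord b i x *: b`_i by apply: coord_basis bP (memvf x).
exists (fun x => \col_i r (coord b i x)); split.
- by move=> _ [x Lx ->]; apply: LZ => //; apply: val_ge_weak val_ge_pi.
- by move=> x y /LP Lx /LP Ly; apply/colP => i; rewrite !mxE linearD; apply: (rm_add rm); [exact: Lx | exact: Ly].
- by move=> a x aI /LP Lx; apply/colP => i; rewrite !mxE linearZ; apply: (rm_mul rm) => //; apply: Lx.
- move=> y; pose c i := s2val (rm_lift rm (y i ord0)).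
  have cE i : coord b i (\sum_j c j *: b`_j) = c i by rewrite coord_sum_free.
  exists (\sum_j c j *: b`_j); last by apply/colP => i; rewrite mxE cE; apply: (s2valP' (rm_lift rm (y i ord0))).
  by apply/LP => i; rewrite cE; apply: (s2valP (rm_lift rm (y i ord0))).
move=> x Lx; have xI := (LP x).1 Lx; rewrite scaleP //; split=> [/colP H|/LP H].
  apply/LP => i; have := H i; rewrite !mxE => /eqP; rewrite (rm_ker rm) // => h.
  by rewrite linearZ /integral -[0]/(-1 + 1 : int); apply: val_geM => //; apply: val_ge_piV.
apply/colP => i; rewrite !mxE; apply/eqP; rewrite (rm_ker rm) //.
have := H i; rewrite linearZ => h; have := val_geM dv val_ge_pi h.
by rewrite addr0 [pi * _]mulVKf.
Qed.

(** The [i]-th coordinate is the pairing with a vector of the dual basis, given by the inverse Gram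
    matrix; that vector lies in the dual lattice. *)
Lemma double_dual L x : lattice v L -> (forall y, dl L y -> integral v (form x y)) -> L x.
Proof.
move=> Ll xI; have [b bP LP] := Ll; apply/LP => i.
have bE z : z = \sum_j coord b j z *: b`_j by apply: coord_basis bP (memvf z).
pose G := \matrix_(l < \dim {:C}, j < \dim {:C}) form b`_l b`_j.
have Gu : G \in unitmx.
  rewrite -row_free_unit; apply: inj_row_free => u uG.
  have u0 : \sum_l u ord0 l *: b`_l = 0.
    apply: (hf_nondeg hf) => y; rewrite [y]bE form_sumr big1 // => j _; rewrite formZr.
    suff -> : form (\sum_l u ord0 l *: b`_l) b`_j = 0 by rewrite mulr0.
    have /rowP/(_ j) := uG; rewrite !mxE => <-; rewrite form_suml.
    by apply: eq_bigr => l _; rewrite formZl mxE.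
  by apply/rowP => l; rewrite mxE -(coord_sum_free (fun l => u ord0 l) l (basis_free bP)) u0 linear0.
pose f := \sum_j conj (invmx G j i) *: b`_j.
have fE (l : 'I_(\dim {:C})) : form b`_l f = (l == i)%:R.
  rewrite form_sumr; have /matrixP/(_ l i) := mulmxV Gu; rewrite !mxE => <-.
  by apply: eq_bigr => j _; rewrite formZr conjK mulrC !mxE.
have xf z : form z f = coord b i z.
  rewrite {1}[z]bE form_suml (bigD1 i) //= big1 => [|l li]; rewrite formZl fE ?eqxx ?mulr1 ?addr0 //.
  by rewrite (negPf li) mulr0.
rewrite -xf; apply: xI => y Ly.
by rewrite -[integral v _]/(val_ge v 0 _) val_ge_form xf; apply: (LP y).1.
Qed.

(** The form induces a pairing of the two quotients whose left kernel is trivial. *)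
Lemma pairing_dim L L' a b : submodule v L -> submodule v L' ->
  (forall x y, L x -> L' y -> integral v (form x y)) ->
  has_dim (scale pi (dl L')) L a -> has_dim (scale pi (dl L)) L' b -> (a <= b)%N.
Proof.
move=> Ls Ls' LL [f qf] [g qg]; rewrite leqNgt; apply/negP => ba.
have [e eL eE] := quot_map_frame qf; have [e' eL' eE'] := quot_map_frame qg.
have [u u0 uE] := kernel_vector (\matrix_(i < a, j < b) r (form (e i) (e' j))) ba.
pose c i := s2val (rm_lift rm (u ord0 i)).
have cI i : integral v (c i) := s2valP (rm_lift rm (u ord0 i)).
have cE i : r (c i) = u ord0 i := s2valP' (rm_lift rm (u ord0 i)).
have [xL fx] := quot_map_comb qf Ls cI eL; set x := \sum_i c i *: e i in xL fx.
have xe' j : val_ge v 1 (form x (e' j)).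
  rewrite -(rm_ker rm); last exact: LL.
  apply/eqP; have /rowP/(_ j) := uE; rewrite !mxE => <-; rewrite form_suml (rm_sum dv rm) => [|i].
    by apply: eq_bigr => i _; rewrite formZl (rm_mul rm) ?cE ?mxE //; apply: LL.
  by rewrite formZl; apply: integralM => //; apply: LL.
have [L0' LD' LZ'] := Ls'.
have xL' y : L' y -> val_ge v 1 (form x y).
  move=> Ly; pose c' j := s2val (rm_lift rm (g y j ord0)).
  have cI' j : integral v (c' j) := s2valP (rm_lift rm (g y j ord0)).
  have cE' j : r (c' j) = g y j ord0 := s2valP' (rm_lift rm (g y j ord0)).
  have [yL gy] := quot_map_comb qg Ls' cI' eL'; set y' := \sum_j c' j *: e' j in yL gy.
  have gE : g y' = g y.
    rewrite gy; apply/colP => i; rewrite summxE (bigD1 i) //= big1 => [|j ji].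
      by rewrite cE' eE' !mxE !eqxx mulr1 addr0.
    by rewrite eE' !mxE eq_sym (negPf ji) mulr0.
  have wL : L' (y - y').
    by rewrite -scaleN1r; apply: LD' => //; apply: LZ' => //; apply: val_geN => //; apply: integral1.
  have [w Lw wE] : scale pi (dl L) (y - y').
    apply/(qm_ker qg wL); apply: (addIr (g y')); rewrite -(qm_add qg) // subrK gE.
    by rewrite add0r.
  rewrite -[y](subrK y') wE formDr formZr conj_pi; apply: val_geD => //.
    by rewrite -[1]addr0; apply: val_geM val_ge_pi _ => //; rewrite val_ge_form; apply: Lw.
  rewrite form_sumr; apply: val_ge_sum => // j; rewrite formZr -[1]add0r; apply: val_geM => //.
  by rewrite val_ge_conj; apply: cI'.
have /(qm_ker qf xL) : scale pi (dl L') x.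
  apply/scaleP => // y /xL' xy; rewrite formZl -[integral v _]/(val_ge v (-1 + 1) _).
  by apply: val_geM => //; apply: val_ge_piV.
rewrite fx => /colP f0; case/negP: u0; apply/eqP/rowP => i; have := f0 i.
rewrite summxE (bigD1 i) //= big1 => [|j ji]; first by rewrite cE eE !mxE !eqxx mulr1 addr0.
by rewrite eE !mxE eq_sym (negPf ji) mulr0.
Qed.

Section VertexPair.
Variables (L0 L1 : C -> Prop) (t0 t1 : nat).
Hypothesis (v0 : vertex_lattice v form pi 0 L0) (v1 : vertex_lattice v form pi 1 L1).
Hypothesis (L10 : incl (scale pi (dl L1)) L0).
Hypothesis (T0 : vertex_type v form pi 0 L0 t0) (T1 : vertex_type v form pi 1 L1 t1).

Lemma vertex_integral x y : L0 x -> L1 y -> integral v (form x y).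
Proof.
have [_ _ L00] := v0; have [_ _ L11] := v1 => Lx /L11; rewrite expr1 => /L10 Ly.
by have [w Lw ->] := L00 x Lx; rewrite expr0 scale1r; apply: Lw.
Qed.

(** With [a], [e], [d] the successive dimensions in the chain, [a + e + d = t0]. Multiplying the
    middle step by [pi] gives [e + t1 = dim C], and duality gives [a = d]. *)
Lemma vertex_quotients : exists2 d, (2 * d + \dim {:C} = t0 + t1)%N &
  has_dim (scale pi (dl L1)) L0 d /\ has_dim (scale pi (dl L0)) L1 d.
Proof.
have [l0 L01 L00] := v0; have [l1 L12 L11] := v1.
rewrite expr1 in L01 L11; have T0' := T0; rewrite /vertex_type expr1 in T0'.
have {}L00 : incl L0 (dl L0) by move=> x /L00[y Ly ->]; rewrite expr0 scale1r.
have s0 := lattice_submodule l0; have s1 := lattice_submodule l1.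
have sd0 := scale_submodule pi (dual_submodule L0); have sd1 := scale_submodule pi (dual_submodule L1).
have sdd1 := scale_submodule (pi ^+ 2) (dual_submodule L1).
have I01 : incl (scale pi (dl L0)) L1.
  move=> _ [y Ly ->]; apply: double_dual => // w Lw; rewrite formZl -[pi in pi * _]conj_pi -formZr.
  by apply: Ly; apply: L10; exists w.
have I10 : incl L1 L0 by move=> x /L11 /L10.
have I00 : incl (scale pi L0) (scale pi (dl L0)) by move=> _ [x /L00 Lx ->]; exists x.
have I11 : incl (scale pi L1) (scale (pi ^+ 2) (dl L1)).
  by move=> _ [x /L11[y Ly ->] ->]; exists y => //; rewrite scalerA expr2.
have [_ [b [_ _ Hb]]] := has_dim_split dv rm s0 sd0 I00 L01 (has_dim_lattice l0).
have tb : t0 = b := has_dim_length dv rm s0 Hb T0'.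
have [a [b' [ab Ha Hb']]] := has_dim_split dv rm s0 s1 I01 I10 Hb.
have [e [d [ed He Hd]]] := has_dim_split dv rm s0 sd1 L11 L10 Hb'.
have [e' [b1 [eb He' Hb1]]] := has_dim_split dv rm s1 sdd1 I11 L12 (has_dim_lattice l1).
have tb1 : t1 = b1 := has_dim_length dv rm s1 Hb1 T1.
have ee : e = e'.
  apply: (has_dim_uniq rm sdd1 _ He').
  apply: has_dim_same (has_dim_scale pi0 He) => //.
  by move=> x; rewrite !scaleP ?expf_neq0 // scalerA expr2 invfM.
have ad : a = d.
  apply/eqP; rewrite eqn_leq; apply/andP; split.
    by apply: (pairing_dim s1 s0 _ Ha Hd) => x y Lx Ly; rewrite -[integral v _]/(val_ge v 0 _) val_ge_form; apply: vertex_integral.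
  by apply: (pairing_dim s0 s1 _ Hd Ha) => x y; apply: vertex_integral.
exists d; first by rewrite tb tb1 -ab -eb -ed ee ad; lia.
by split=> //; rewrite -ad.
Qed.

(** A vector in the left kernel of [S] lifts to an element of [pi L0] whose pairings with [L1] have
    valuation at least 2, so it lies in [pi ^+ 2] times the dual of [L1]. *)
Lemma pairing_unit d (rho1 rho2 : C -> 'cV[k]_d) (fr : k -> k) (S : 'M[k]_d) :
  quot_map v r (scale (pi ^+ 2) (dl L1)) (scale pi L0) rho1 ->
  (forall x y, scale pi L0 x -> L1 y ->
     r (pi^-1 * form x y) = ((rho1 x)^T *m S *m map_mx fr (rho2 y)) ord0 ord0) ->
  S \in unitmx.
Proof.
move=> q SE; rewrite -row_free_unit; apply: inj_row_free => u uS.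
have [x Lx xE] := qm_surj q u^T.
suff /(qm_ker q Lx) : scale (pi ^+ 2) (dl L1) x by rewrite xE => /(congr1 trmx); rewrite trmxK trmx0.
apply/scaleP => [|y Ly]; first by rewrite expf_neq0.
have := SE x y Lx Ly; rewrite xE trmxK uS mul0mx mxE => /eqP; rewrite (rm_ker rm) => [h|].
  rewrite formZl expr2 invfM -mulrA -[integral v _]/(val_ge v (-1 + 1) _).
  by apply: val_geM => //; apply: val_ge_piV.
have [x' Lx' ->] := Lx; rewrite formZl mulKf //.
exact: vertex_integral.
Qed.

End VertexPair.

End HermitianLattices.

(** * Residue fields and their Frobenius *)

Section ResidueFields.
Variables (Qp : fieldType) (vp : Qp -> int) (F : fieldExtType Qp) (vF : F -> int) (kF : finFieldType).
Variables (rF : F -> kF) (pi : F) (hF : finite_ext_Qp vp vF rF pi) (q : nat) (hq : #|kF| = q).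
Variables (E : fieldExtType F) (vE : E -> int) (kE : finFieldType) (rE : E -> kE).
Variables (conj : {rmorphism E -> E}) (hE : unramified_quadratic vF vE rE conj).

Lemma residue_card_gt1 : (1 < q)%N. Proof. by rewrite -hq card_finNzRing_gt1. Qed.

Lemma residue_nat_eq0 n : n%:R = 0 :> kF -> n%:R = 0 :> kE.
Proof.
move=> n0; have rmF := fe_residue hF; have rmE := uq_residue hE.
have : rE n%:R == 0.
  have nI (T : fieldType) (w : T -> int) : discrete_valuation w -> integral w n%:R.
    move=> dv; elim: (n) => [|i IH]; first exact: val_ge0.
    by rewrite -natr1; apply: (val_geD dv) => //; apply: integral1.
  rewrite (rm_ker rmE); last exact: nI (uq_dv hE).
  have : val_ge vF 1 n%:R.
    rewrite -(rm_ker rmF); last exact: nI (fe_dv hF).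
    by rewrite (rm_nat (fe_dv hF) rmF) n0.
  have <- : (n%:R : F)%:A = n%:R :> E by rewrite scaler_nat.
  rewrite /val_ge.
  have [->|a0] := eqVneq (n%:R : F) 0; first by rewrite scale0r eqxx.
  by rewrite (uq_unramified hE) // => /= ->; rewrite orbT.
by rewrite (rm_nat (uq_dv hE) rmE) => /eqP.
Qed.

Lemma residue_pchar (kbar : fieldType) (jk : {rmorphism kE -> kbar}) : [pchar kbar].-nat q.
Proof.
have [l lp lF] := finPcharP kF; rewrite -hq (card_pprimeChar lF) pnatX pnatE //.
apply/orP; left; rewrite inE lp /=; have := residue_nat_eq0 (pcharf0 lF).
by move=> /(congr1 jk); rewrite rmorph_nat rmorph0 => ->.
Qed.

Variables (K : fieldType) (vK : K -> int) (k : closedFieldType) (rK : K -> k).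
Variables (emb : {rmorphism E -> K}) (sigma : {rmorphism K -> K}).
Variable hK : witt_field q vE conj vK rK emb sigma.

(** Both sides are compared in [K], where [sigma] extends [conj] and preserves the valuation. *)
Lemma conj_val a : a != 0 -> vE (conj a) = vE a.
Proof.
move=> a0; have ca0 : conj a != 0 by rewrite fmorph_eq0.
rewrite -(wf_iota hK ca0) -(wf_sigma_iota hK) (wf_sigma_val hK) ?fmorph_eq0 //.
exact: (wf_iota hK).
Qed.

(** On residues [sigma] is the [q]-th power, and it restricts to [conj], whose square is the
    identity. *)
Lemma residue_frob (conjK : involutive conj) (x : kE) : x ^+ (q * q) = x.
Proof.
have rmE := uq_residue hE; have dE := uq_dv hE; have rmK := wf_residue hK; have dK := wf_dv hK.
have [a aI <-] := rm_surj rmE x.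
have embI m y : val_ge vK m (emb y) = val_ge vE m y.
  by rewrite /val_ge fmorph_eq0; have [//|y0] := eqVneq y 0; rewrite (wf_iota hK).
have fr y : integral vE y -> rK (emb (conj y)) = rK (emb y) ^+ q.
  by move=> yI; rewrite -(wf_sigma_iota hK) (wf_sigma_frob hK) // /integral embI.
have caI : integral vE (conj a).
  by move: aI; rewrite /integral /val_ge fmorph_eq0; have [//|a0] := eqVneq a 0; rewrite conj_val.
have aK : rK (emb a) ^+ (q * q) = rK (emb a) by rewrite exprM -fr // -fr // conjK.
have [aqI aqE] := rm_exp dE rmE (q * q) aI.
have dI : integral vE (a ^+ (q * q) - a) by apply: (val_geD dE) => //; apply: (val_geN dE).
apply/eqP; rewrite -subr_eq0 -aqE.
have sE : rE (a ^+ (q * q) - a) = rE (a ^+ (q * q)) - rE a.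
  by apply: (addIr (rE a)); rewrite -(rm_add rmE) // !subrK.
rewrite -sE (rm_ker rmE) // -embI -(rm_ker rmK); last by rewrite /integral embI.
have eI : integral vK (emb a) by rewrite /integral embI.
have [eqI eqE] := rm_exp dK rmK (q * q) eI.
have s0 : rK (emb (a ^+ (q * q) - a)) + rK (emb a) = rK (emb a).
  by rewrite -(rm_add rmK) ?/integral ?embI // -rmorphD subrK rmorphXn /= eqE aK.
by apply/eqP; apply: (addIr (rK (emb a))); rewrite s0 add0r.
Qed.

End ResidueFields.

(** By hermitian symmetry applied twice, the square of [conj] fixes all values of the form, and
    every scalar is such a value. *)
Lemma hermitian_conjK (E : fieldType) (conj : {rmorphism E -> E}) (C : vectType E) (form : C -> C -> E) :
  hermitian_form conj form -> (0 < \dim {:C})%N -> involutive conj.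
Proof.
move=> hf C0 a.
have /existsNP[x /existsNP[y xy]] : ~ forall x y : C, form x y = 0.
  move=> f0; have : \dim {:C} = 0%N.
    apply/eqP; rewrite dimv_eq0; apply/eqP/vspaceP => x; rewrite memvf memv0; apply/esym/eqP.
    by apply: (hf_nondeg hf) => y.
  by move=> e; rewrite e in C0.
have fK u w : conj (conj (form u w)) = form u w by rewrite -!(hf_conj hf).
have := fK (a / form x y *: x) y; rewrite (formZl hf) divfK //; exact/eqP.
Qed.

Lemma ith_lt m (I : {set 'I_m.+1}) j : (1 <= j <= #|I|.-1)%N ->
  [/\ (ith I j < ith I j.+1)%N, exists2 i : 'I_m.+1, i \in I & ith I j = i &
      exists2 i : 'I_m.+1, i \in I & ith I j.+1 = i].
Proof.
move=> /andP[j1 jI]; rewrite /ith /=.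
have sz : size [seq val i | i <- enum I] = #|I| by rewrite size_map -cardE.
have jlt : (j < #|I|)%N by lia.
have jlt' : (j.-1 < #|I|)%N by lia.
have so : sorted ltn [seq val i | i <- enum I].
  apply: (@subseq_sorted _ ltn ltn_trans _ (iota 0 m.+1)); last exact: iota_ltn_sorted.
  have -> : enum I = [seq i <- enum 'I_m.+1 | i \in I] by rewrite enumT.
  by rewrite -val_enum_ord map_subseq // filter_subseq.
have mem i : (i < #|I|)%N -> exists2 i' : 'I_m.+1, i' \in I & nth 0%N [seq val i | i <- enum I] i = i'.
  move=> iI; have : nth 0%N [seq val i | i <- enum I] i \in [seq val i | i <- enum I].
    by rewrite mem_nth // sz.
  by case/mapP => i'; rewrite mem_enum => i'I ->; exists i'.
split; [|exact: mem | exact: mem].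
by apply: (sorted_ltn_nth ltn_trans) => //; rewrite ?inE ?sz //; lia.
Qed.

Lemma mem_refl_avoiding D (dims : seq nat) x : (x \in dseq (refl_avoiding D dims)) = [&& (0 < x)%N, (x < D)%N & x \in dims].
Proof.
have [xD|Dx] := ltnP x D; last first.
  by rewrite andbF; apply/negbTE/negP => /dseq_lt; lia.
rewrite -[x]/(val (Ordinal xD)) mem_dseq !inE /=; case: (0 < x)%N => //=.
by rewrite negbK.
Qed.

(** * Dimensions of the flag members *)

Section FlagDimensions.
Variables (m : nat) (h : nat -> nat) (n : nat) (ij ij' l0 l1 : nat).
Hypothesis (hh : parahoric_datum n m h) (ijm : (ij < ij' <= m)%N).
Local Notation H := ((h ij' - h ij.+1)./2).
Local Notation d := (l0 + l1 - 1 + H)%N.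
Local Notation dimW := [seq (l1 + (h (ij + i) - h ij.+1)./2)%N | i <- iota 1 (ij' - ij)].
Local Notation dimU := [seq (l0 + (h ij' - h (ij + i))./2)%N | i <- iota 1 (ij' - ij)].

(** The [h] have the same parity, so halving their differences loses nothing. *)
Lemma h_double i i' : (ij < i)%N -> (i <= i' <= ij')%N -> h i' = (h i + (h i' - h i)./2.*2)%N.
Proof.
move=> ii /andP[i'i i'j]; have le : (h i <= h i')%N.
  move: i'i; rewrite leq_eqVlt => /orP[/eqP->//|lt]; apply: ltnW; apply: (pd_lt hh) => //; lia.
have par : odd (h i) = odd (h i') by apply: (pd_parity hh); lia.
rewrite -[LHS](subnKC le); congr (_ + _)%N.
by rewrite -[LHS]odd_double_half oddB // par addbb.
Qed.

Lemma h_half_lt i i' : (ij < i)%N -> (i < i')%N -> (i' <= ij')%N ->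
  ((h i - h ij.+1)./2 < (h i' - h ij.+1)./2)%N.
Proof.
move=> i1 ii i'j; have lt : (h i < h i')%N by apply: (pd_lt hh); lia.
have e1 := @h_double ij.+1 i (ltnSn _) (introT andP (conj i1 (ltnW (leq_trans ii i'j)))).
have e2 := @h_double ij.+1 i' (ltnSn _) (introT andP (conj (ltn_trans i1 ii) i'j)).
by rewrite -ltn_double -(ltn_add2l (h ij.+1)) -e1 -e2.
Qed.

Lemma dimW_sorted : sorted ltn dimW.
Proof.
have H0 : {in [pred i | (0 < i <= ij' - ij)%N] &,
    {homo (fun i => l1 + (h (ij + i) - h ij.+1)./2)%N : x y / (x < y)%N}}.
  by move=> x y; rewrite !inE => x1 y1 xy /=; rewrite ltn_add2l h_half_lt //; lia.
apply: (homo_sorted_in H0); last exact: iota_ltn_sorted.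
by apply/allP => x; rewrite mem_iota inE; lia.
Qed.

Lemma dimW_bd w : w \in dimW -> (l1 <= w <= l1 + H)%N.
Proof.
case/mapP => i; rewrite mem_iota => i1 ->; rewrite leq_addr leq_add2l.
have [lt|ge] := ltnP (ij + i) ij'; last first.
  by have -> /= : (ij + i)%N = ij' by lia.
by apply: ltnW; apply: h_half_lt; lia.
Qed.

Lemma dimW_min : l1 \in dimW.
Proof. by apply/mapP; exists 1%N; rewrite ?mem_iota ?addn1 ?subnn ?addn0 //; lia. Qed.

Lemma dimW_max : exists2 s, rev dimW = (l1 + H)%N :: s & path (fun w' w => (w < w')%N) (l1 + H)%N s.
Proof.
have : sorted (fun w' w => (w < w')%N) (rev dimW) by rewrite rev_sorted; exact: dimW_sorted.
have -> : rev dimW = (l1 + H)%N :: rev [seq (l1 + (h (ij + i) - h ij.+1)./2)%N | i <- iota 1 (ij' - ij).-1].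
  have {1}-> : (ij' - ij = (ij' - ij).-1 + 1)%N by lia.
  rewrite iotaD map_cat rev_cat /= /rev /=; congr (_ :: _); congr (_ + (h _ - _)./2)%N; lia.
by move=> /= P; exists (rev [seq (l1 + (h (ij + i) - h ij.+1)./2)%N | i <- iota 1 (ij' - ij).-1]).
Qed.

Lemma dimU_dimW x : (0 < l0)%N -> (0 < l1)%N -> (0 < x < d)%N -> (x \in dimU) = ((d.+1 - x)%N \in dimW).
Proof.
move=> l0_gt0 l1_gt0 xd; have dE i : (1 <= i <= ij' - ij)%N ->
    (l0 + (h ij' - h (ij + i))./2 + (l1 + (h (ij + i) - h ij.+1)./2) = d.+1)%N.
  move=> i1; have e1 := @h_double (ij + i) ij'; have e2 := @h_double ij.+1 (ij + i); have e3 := @h_double ij.+1 ij'.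
  have {}e1 := e1 ltac:(lia) ltac:(lia); have {}e2 := e2 ltac:(lia) ltac:(lia); have {}e3 := e3 ltac:(lia) ltac:(lia).
  move: e1 e2 e3; move: (_./2) (_./2) (_./2) => u v w; rewrite -!muln2; lia.
apply/mapP/mapP => -[i]; rewrite mem_iota => i1 xE; exists i; rewrite ?mem_iota //.
  have := dE i; lia.
have := dE i; lia.
Qed.

End FlagDimensions.

(** * From the lattices of a Bruhat-Tits index to the geometry of the variety *)

Theorem proposition3p25
  (p : nat) (p_prime : prime p) (p_odd : odd p)
  (Qp : fieldType) (vp : Qp -> int) (hQp : is_Qp p vp)
  (F : fieldExtType Qp) (vF : F -> int) (kF : finFieldType) (rF : F -> kF) (pi : F)
  (hF : finite_ext_Qp vp vF rF pi)
  (q : nat) (hq : #|kF| = q)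
  (E : fieldExtType F) (vE : E -> int) (kE : finFieldType) (rE : E -> kE)
  (conj : {rmorphism E -> E}) (hE : unramified_quadratic vF vE rE conj)
  (n m : nat) (n_ge1 : (1 <= n)%N) (m_ge1 : (1 <= m)%N)
  (h : nat -> nat) (hh : parahoric_datum n m h)
  (N : vectType E) (Fr Ve : N -> N) (act : E -> N -> N) (pairing : N -> N -> E)
  (M : N -> Prop)
  (hN : unitary_dieudonne n (h 1%N) vE rE conj pi Fr Ve act pairing M)
  (K : fieldType) (vK : K -> int) (k : closedFieldType) (rK : K -> k)
  (emb : {rmorphism E -> K}) (sigma : {rmorphism K -> K})
  (hK : witt_field q vE conj vK rK emb sigma)
  (Nk : vectType K) (bc : N -> Nk) (Frk Vek : Nk -> Nk) (pairingk : Nk -> Nk -> K)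
  (hNk : isocrystal_base_change Fr Ve pairing emb sigma bc Frk Vek pairingk)
  (delta : E) (delta_neq0 : delta != 0) (delta_unit : vE delta = 0)
  (delta_conj : conj delta = - delta)
  (C : vectType E) (jC : C -> Nk) (form : C -> C -> E)
  (hC : tau_invariants pi%:A delta act emb bc Frk Vek pairingk jC form)
  (C_dim : \dim {:C} = n) (C_form : hermitian_form conj form)
  (I : {set 'I_m.+1}) (L0 L1 : nat -> C -> Prop)
  (hI : bruhat_tits_index vE form pi%:A n h I L0 L1)
  (j : nat) (j_bounds : (1 <= j <= #|I|.-1)%N)
  (l0 l1 : nat) (l0_ge1 : (1 <= l0)%N) (l1_ge1 : (1 <= l1)%N)
  (type1 : vertex_type vE form pi%:A 1 (L1 (ith I j))
     (2 * (l1 - 1) + (n - h (ith I j).+1) + 1))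
  (type0 : vertex_type vE form pi%:A 0 (L0 (ith I j.+1))
     (2 * (l0 - 1) + h (ith I j.+1) + 1))
  (kbar : closedFieldType) (jk : {rmorphism kE -> kbar})
  (kbar_alg : forall x : kbar, exists2 P : {poly kE}, P != 0 & root (map_poly jk P) x) :
  let ij := ith I j in
  let ij' := ith I j.+1 in
  let Lambda1 := L1 ij in
  let Lambda0 := L0 ij' in
  let top1 := scale pi%:A Lambda0 in
  let bot1 := scale (pi%:A ^+ 2) (dual vE form Lambda1) in
  let top2 := Lambda1 in
  let bot2 := scale pi%:A (dual vE form Lambda0) in
  let d := ((l0 + l1 - 1) + (h ij' - h ij.+1)./2)%N in
  let dimW := [seq (l1 + (h (ij + i) - h ij.+1)./2)%N | i <- iota 1 (ij' - ij)] in
  let dimU := [seq (l0 + (h ij' - h (ij + i))./2)%N | i <- iota 1 (ij' - ij)] in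
  let J := (refl_avoiding d dimW, refl_avoiding d dimU) in
  let w := (coxeter_word d l1, coxeter_word d l0) in
  [/\ exists rho1 : C -> 'cV[kE]_d, quot_map vE rE bot1 top1 rho1,
      exists rho2 : C -> 'cV[kE]_d, quot_map vE rE bot2 top2 rho2 &
      forall (rho1 rho2 : C -> 'cV[kE]_d) (S b1 b2 : 'M[kE]_d),
        quot_map vE rE bot1 top1 rho1 ->
        quot_map vE rE bot2 top2 rho2 ->
        (forall x y, top1 x -> top2 y ->
           rE ((pi%:A)^-1 * form x y) =
           ((rho1 x)^T *m S *m map_mx (fun a => a ^+ q) (rho2 y)) ord0 ord0) ->
        adapted_frames q S b1 b2 ->
        let X := @fine_DL_closure kbar q d (map_mx jk S)
                   (map_mx jk b1, map_mx jk b2) J w in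
        [/\ proj_closed X, proj_smooth X, proj_irreducible X &
            krull_dim X (l0 + l1 + (h ij' - h ij.+1) - 2)%N]].
Proof.
move=> ij ij' Lambda1 Lambda0 top1 bot1 top2 bot2 d dimW dimU J w.
have [ijlt [i iI iE] [i' i'I i'E]] := ith_lt j_bounds.
have ijm : (ij < ij' <= m)%N by rewrite ijlt /ij' i'E -ltnS ltn_ord.
have v1 : vertex_lattice vE form pi%:A 1 Lambda1.
  have im : i != m :> nat by rewrite -iE; move: ijm; rewrite /ij; lia.
  by have [] := bt_L1 hI iI im; rewrite /Lambda1 /ij iE.
have v0 : vertex_lattice vE form pi%:A 0 Lambda0.
  have i0 : i' != 0%N :> nat by rewrite -i'E; move: ijm; rewrite /ij'; lia.
  by have [] := bt_L0 hI i'I i0; rewrite /Lambda0 /ij' i'E.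
have L10 : incl (scale pi%:A (dual vE form Lambda1)) Lambda0 := bt_incl10 hI j_bounds.
have dE := uq_dv hE; have rmE := uq_residue hE.
have pi0 : pi%:A != 0 :> E by rewrite scaler_eq0 oner_eq0 orbF (fe_pi_neq0 hF).
have vpi : vE pi%:A = 1 by rewrite (uq_unramified hE) ?(fe_pi_neq0 hF) // (fe_pi hF).
have conj_pi := uq_conj_fix hE pi.
have conjK : involutive conj by apply: (hermitian_conjK C_form); rewrite C_dim.
have cv := conj_val hK.
have [D' DE [Hd1 Hd2]] := vertex_quotients dE rmE cv conjK C_form pi0 vpi conj_pi v0 v1 L10 type0 type1.
pose H := ((h ij' - h ij.+1)./2)%N.
have dH : d = ((l0 + l1 - 1) + H)%N by [].
have ijb : (ij.+1 <= ij' <= ij')%N by rewrite ijlt leqnn.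
have hE' : h ij' = (h ij.+1 + H.*2)%N := h_double hh ijm (ltnSn ij) ijb.
have hn : (h ij.+1 <= n)%N by apply: (pd_le hh); case/andP: ijm => lt le; apply: leq_trans lt le.
(* The two types are substituted in [2 D' + n = t0 + t1]; the terms [h] combine to [2 H]. *)
have Dd : D' = d.
  move: DE; rewrite C_dim -/ij -/ij' hE' dH -muln2; move: hn l0_ge1 l1_ge1; clear.
  move: (h ij.+1) H D' => u v w; lia.
subst D'.
split.
- have S2 : same (scale pi%:A (scale pi%:A (dual vE form Lambda1))) bot1.
    by move=> x; rewrite /bot1 !scaleP ?expf_neq0 // scalerA expr2 invfM.
  exact: has_dim_same S2 (fun x => iff_refl _) (has_dim_scale pi0 Hd1).
- exact: Hd2.
move=> rho1 rho2 S b1 b2 rho1P rho2P SE [b1u b2u borth] X.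
have q1 := residue_card_gt1 hq.
have kq := residue_pchar hF hq hE jk.
have fr := residue_frob hE hK conjK.
have Su : S \in unitmx := pairing_unit dE rmE C_form pi0 vpi v0 v1 L10 rho1P SE.
have fmxK (M0 : 'M[kE]_d) : fmx q (fmx q (map_mx jk M0)) = map_mx jk M0.
  by apply/matrixP => u v; rewrite !mxE -exprM -rmorphXn fr.
have Su' : map_mx jk S \in unitmx by rewrite map_unitmx.
have b1u' : (map_mx jk b1, map_mx jk b2).1 \in unitmx by rewrite map_unitmx.
have b2u' : (map_mx jk b1, map_mx jk b2).2 \in unitmx by rewrite map_unitmx.
have orth (a c : 'I_d) : (a + c + 2 <= d)%N ->
    ((map_mx jk b1, map_mx jk b2).1^T *m map_mx jk S *m fmx q (map_mx jk b1, map_mx jk b2).2) a c = 0.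
  move=> /borth ac; have := congr1 jk ac; rewrite rmorph0 => <-.
  transitivity (map_mx jk (b1^T *m S *m map_mx (fun x => x ^+ q) b2) a c); last by rewrite [LHS]mxE.
  rewrite !map_mxM map_trmx; congr ((_ *m _) a c); apply/matrixP => u v.
  by rewrite !mxE rmorphXn.
have lHd : (l1 + H <= d)%N by rewrite dH; move: l0_ge1 l1_ge1; move: (H) => u; clear; lia.
(* The dimensions are listed from the largest down, the order in which the cyclic vectors are
   obtained. *)
pose Om := rev dimW.
have mOm x : (x \in Om) = (x \in dimW) by rewrite mem_rev.
have Om_bd x : x \in Om -> (l1 <= x <= l1 + H)%N by rewrite mOm; apply: (dimW_bd hh ijm).
have Om_min : l1 \in Om by rewrite mOm; apply: (dimW_min _ _ ijm).
have Om_max := dimW_max l1 hh ijm.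
have D1P x : (x \in dseq (Js J true)) = (x \in Om) && (x < d)%N.
  rewrite mem_refl_avoiding mOm; have [/(dimW_bd hh ijm) xl|] := boolP (x \in dimW); last by rewrite !andbF.
  by rewrite andbT (leq_trans l1_ge1) //; case/andP: xl.
have D2P x : (x \in dseq (Js J false)) = [&& (0 < x)%N, (x < d)%N & (d.+1 - x)%N \in Om].
  rewrite mem_refl_avoiding mOm; have [xd|] := boolP ((0 < x < d)%N); last by rewrite !andbA => /negPf->.
  by rewrite (dimU_dimW hh ijm l0_ge1 l1_ge1 xd).
(* The second Coxeter word is indexed by [l0 = d + 1 - (l1 + H)], dual to the largest dimension in
   [dimW]. *)
have wE : w = (coxeter_word d l1, coxeter_word d (d.+1 - (l1 + H))).
  by rewrite /w; congr (_, coxeter_word _ _); rewrite dH; move: l0_ge1 l1_ge1; move: (H) => u; clear; lia.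
(* Both sides are [l0 + l1 + 2 H - 2]. *)
have rE' : (l0 + l1 + (h ij' - h ij.+1) - 2 = d.-1 + H)%N.
  by rewrite hE' addKn -muln2 dH; move: l0_ge1 l1_ge1; move: (H) => u; clear; lia.
have bb := fmxK b2.
rewrite /X wE rE'; split.
- exact: (X_closed q (map_mx jk S) J b1u' b2u' l1 H).
- exact: (X_smooth kq q1 Su' (fmxK S) b1u' b2u' bb orth l1_ge1 lHd Om_bd Om_min Om_max D1P D2P).
- exact: (X_irreducible kq q1 Su' (fmxK S) b1u' b2u' bb orth l1_ge1 lHd Om_bd Om_min Om_max D1P D2P).
- exact: (X_dim kq q1 Su' (fmxK S) b1u' b2u' bb orth l1_ge1 lHd Om_bd Om_min Om_max D1P D2P).
Qed.
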